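(* Let $r\in[0,1]$, and let $\mathcal A_{\mathcal H_r}:\mathcal H^1_{in}\times H^0(S^1,\mathbb R^2)\to\mathbb R$ be the Hamiltonian action obtained by applying the nonlocal Legendre transform to the regularized action functional $\mathcal B_r:\mathcal H^1_{in}\to\mathbb R$, $$\mathcal A_{\mathcal H_r}(z,\eta)=\langle\eta_1,z_1'\rangle+\langle\eta_2,z_2'\rangle-\mathcal H_r(z,\eta),\qquad \mathcal H_r(z,\eta)=\sum_{i=1}^2\Bigl(\frac{\|\eta_i\|^2}{8\|z_i\|^2}-\frac2{\|z_i\|^2}\Bigr)-r\,\mathcal I(z_1,z_2)-(1-r)\,\mathcal A(z_1,z_2).$$ Then the corresponding Hamiltonian delay equation reproduces frozen planet orbits. Precisely: $(z,\eta)$ is a critical point of $\mathcal A_{\mathcal H_r}$ if and only if $\eta\in H^1(S^1,\mathbb R^2)$ and the Hamilton equations $z_i'=\nabla_{\eta_i}\mathcal H_r(z,\eta)=\frac{\eta_i}{4\|z_i\|^2}$, $\eta_i'=-\nabla_{z_i}\mathcal H_r(z,\eta)$, $i=1,2$, hold. The assignments $(z,\eta)\mapsto z$ and $z\mapsto(z,\eta)$ with $\eta_i=4\|z_i\|^2z_i'$ define a one-to-one correspondence between critical points of $\mathcal A_{\mathcal H_r}$ and critical points of $\mathcal B_r$. Consequently, under the Levi-Civita transformations $q_i(t)=z_i(\tau_{z_i}(t))^2$, $i=1,2$, solutions $(z,\eta)$ of the Hamilton equations are in 4-to-1 correspondence with generalized solutions $(q_1,q_2)$ of $$\ddot q_1=-\frac{2}{q_1^2}+\frac{r}{(q_1-q_2)^2}+\frac{1-r}{(\bar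 q_1-\bar q_2)^2},\qquad \ddot q_2=-\frac{2}{q_2^2}-\frac{r}{(q_1-q_2)^2}-\frac{1-r}{(\bar q_1-\bar q_2)^2}.$$
   Context: Notation: $S^1=\mathbb R/\mathbb Z$; $\langle f,g\rangle=\int_0^1fg\,d\tau$, $\|\cdot\|$ the $L^2$-norm (so $\|z^2\|^2=\int_0^1z^4d\tau$); $H^k=W^{k,2}$, $H^0=L^2$; $\bar q=\int_0^1q\,dt$. For $z\in C^0(S^1,\mathbb R)$ with finite zero set, $t_z:S^1\to S^1$, $t_z(\tau)=\|z\|^{-2}\int_0^\tau z(\sigma)^2d\sigma$, is a homeomorphism, and $\tau_z:=t_z^{-1}$. $\mathcal H^1_{in}=\{(z_1,z_2)\in H^1(S^1,\mathbb R^2):\|z_1\|>0,\ \|z_2\|>0,\ z_1^2(\tau)-z_2^2(\tau_{z_2}(t_{z_1}(\tau)))>0\text{ for all }\tau\in S^1\}$, open in $H^1(S^1,\mathbb R^2)$. On it: $\mathcal Q(z_i)=2\|z_i\|^2\|z_i'\|^2+\frac2{\|z_i\|^2}$, $\mathcal I(z_1,z_2)=-\frac1{\|z_1\|^2}\int_0^1\frac{z_1(\tau)^2}{z_1^2(\tau)-z_2^2(\tau_{z_2}(t_{z_1}(\tau)))}d\tau$, $\mathcal A(z_1,z_2)=-\frac{\|z_1\|^2\|z_2\|^2}{\|z_1^2\|^2\|z_2\|^2-\|z_2^2\|^2\|z_1\|^2}$, and $\mathcal B_r(z)=\mathcal Q(z_1)+\mathcal Q(z_2)+r\,\mathcal I(z)+(1-r)\,\mathcal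 A(z)$, i.e. $\mathcal B_r=r\mathcal B_{in}+(1-r)\mathcal B_{av}$ with $\mathcal B_{in}=\mathcal Q(z_1)+\mathcal Q(z_2)+\mathcal I$ and $\mathcal B_{av}=\mathcal Q(z_1)+\mathcal Q(z_2)+\mathcal A$. $\nabla_{z_i},\nabla_{\eta_i}$ denote components of the $L^2$-gradient: $\langle\nabla_{z_i}\mathcal H_r(z,\eta),w\rangle=D_{z_i}\mathcal H_r(z,\eta)w$ for all $w\in H^1(S^1,\mathbb R)$, and similarly for $\eta_i$. The Hamiltonian $\mathcal H_r$ is the fibrewise Legendre transform of the Lagrange function $\mathcal L_r(z,w)=\sum_{i=1}^2\bigl(2\|z_i\|^2\|w_i\|^2+\frac{2}{\|z_i\|^2}\bigr)+r\,\mathcal I(z)+(1-r)\,\mathcal A(z)$ on $\mathcal H^1_{in}\times H^0(S^1,\mathbb R^2)$, for which $\mathcal B_r(z)=\mathcal L_r(z,z')$: that is, $\mathcal H_r(z,\eta)=\langle\eta_1,w_1\rangle+\langle\eta_2,w_2\rangle-\mathcal L_r(z,w)$ with $w_i=\frac{\eta_i}{4\|z_i\|^2}$, the solution of $\eta_i=\nabla_{w_i}\mathcal L_r(z,w)=4\|z_i\|^2w_i$. A generalized solution of the system is a pair $(q_1,q_2)\in H^1(S^1,\mathbb R_{\ge0}\times\mathbb R_{\ge0})$ such that for $i=1,2$: $q_1(t)>q_2(t)$ for all $t\in S^1$; the zero sets $Z_i=q_i^{-1}(0)$ are finite and each have an even number of elements; the restricted maps $q_i:S^1\setminus Z_i\to\mathbb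 R_{\ge0}$ are smooth and satisfy the system; the energies $E_i=\frac{\dot q_i^2}{2}-\frac2{q_i}$ on $S^1\setminus Z_i$ extend to continuous functions $S^1\to\mathbb R$.
   Formalization: In the definition of generalized solution, ''smooth'' on the complement of Z_i is read as C² there and C^∞ off both Z_1 and Z_2, because for r>0 the function q_1 is only C² at collisions of q_2 and no literally smooth generalized solutions exist. *)

(* Defs.v *)
From HB Require Import structures.
From mathcomp Require Import all_boot all_order all_algebra.
From mathcomp Require Import all_classical all_reals all_analysis.

Set Implicit Arguments.
Unset Strict Implicit.
Unset Printing Implicit Defensive.

Import Order.TTheory GRing.Theory Num.Theory.
Import numFieldNormedType.Exports.

Local Open Scope classical_set_scope.
Local Open Scope ring_scope.

Section frozen_planet.
Variable R : realType.

Local Notation mu := (@lebesgue_measure R).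
Local Notation F := (R -> R).
Local Notation F2 := (F * F)%type.
Local Notation I01 := (`[(0 : R), 1]%classic).

(* Functions on the circle [S^1 = R/Z] are functions on [R]. Continuous ones (in
   particular elements of [H^1]) are required to be 1-periodic on [R]. An
   element of [L^2] is only looked at on the fundamental domain [[0, 1]], where
   it is identified with any function equal to it almost everywhere. *)

Definition ip (f g : F) : R := \int[mu]_(x in I01) (f x * g x).
Definition nsq (f : F) : R := ip f f.
Definition nrm (f : F) : R := Num.sqrt (nsq f).
Definition avg (f : F) : R := \int[mu]_(x in I01) f x.

Definition L2 (f : F) : Prop :=
  measurable_fun I01 f /\
  mu.-integrable I01 (fun x => (f x ^+ 2)%:E).

Definition aeeq (f g : F) : Prop := ae_eq mu I01 f g.

(* [W^{1,2}] in one dimension: the continuous representative is the absolutely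
   continuous function with the [L^2] weak derivative [w]. *)
Definition is_wderiv (z w : F) : Prop :=
  L2 w /\
  forall t, 0 <= t <= 1 -> z t = z 0 + \int[mu]_(x in `[(0 : R), t]) w x.

Definition H1 (z : F) : Prop := periodic z 1 /\ exists w, is_wderiv z w.

(* A representative of the weak derivative, which is unique only up to
   equality almost everywhere on [[0, 1]]. *)
Definition wderiv (z : F) : F := xget (fun=> 0) [set w | is_wderiv z w].

Definition L2sq (w : F2) : Prop := L2 w.1 /\ L2 w.2.
Definition H1sq (z : F2) : Prop := H1 z.1 /\ H1 z.2.
Definition H1L2 (x : F2 * F2) : Prop := H1sq x.1 /\ L2sq x.2.

Definition ip2 (f g : F2) : R := ip f.1 g.1 + ip f.2 g.2.
Definition aeeq2 (f g : F2) : Prop := aeeq f.1 g.1 /\ aeeq f.2 g.2.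
Definition wderiv2 (z : F2) : F2 := (wderiv z.1, wderiv z.2).

Definition normL2 (w : F2) : R := Num.sqrt (ip2 w w).
Definition normH1 (z : F2) : R :=
  Num.sqrt (ip2 z z + ip2 (wderiv2 z) (wderiv2 z)).
Definition normH1L2 (x : F2 * F2) : R :=
  Num.sqrt (normH1 x.1 ^+ 2 + normL2 x.2 ^+ 2).

(* [E] is an ambient space of functions, [V] the linear subspace carrying the
   Hilbert norm [N] (a norm up to almost everywhere equality). Functionals are
   total on [E] but meant on an open subset of [V]; increments range over
   [V] only. *)
Definition is_frechet (E : lmodType R) (V : set E) (N : E -> R)
    (f : E -> R) (x : E) (L : E -> R) : Prop :=
  [/\ forall a h k, V h -> V k -> L (a *: h + k) = a * L h + L k,
      exists C, forall h, V h -> `|L h| <= C * N h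
    & forall e, 0 < e -> exists2 d, 0 < d &
        forall h, V h -> N h < d -> `|f (x + h) - f x - L h| <= e * N h].

Definition critical (E : lmodType R) (V : set E) (N : E -> R) (U : set E)
    (f : E -> R) (x : E) : Prop :=
  U x /\ is_frechet V N f x (fun=> 0).

Definition is_grad (f : F2 -> R) (w g : F2) : Prop :=
  L2sq g /\ is_frechet L2sq normL2 f w (fun h => ip2 g h).

(* [(g.1, g.2)] is the [L^2]-gradient at [x = (z, eta)] of a functional on
   [H^1(S^1, R^2) x L^2(S^1, R^2)]: [g.1] has the components
   [nabla_{z_i}] and [g.2] the components [nabla_{eta_i}]. *)
Definition is_gradH (f : F2 * F2 -> R) (x g : F2 * F2) : Prop :=
  [/\ L2sq g.1, L2sq g.2 &
      is_frechet H1L2 normH1L2 f x (fun h => ip2 g.1 h.1 + ip2 g.2 h.2)].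

Definition tmap (z : F) (tau : R) : R :=
  (nsq z)^-1 * \int[mu]_(s in `[(0 : R), tau]) (z s ^+ 2).

(* Inverse of [t_z] on [[0, 1]]. If [t_z] is not injective, which happens only
   if [z] vanishes on an interval, this chooses a preimage; [z] vanishes on the
   whole fibre in that case, so [z \o taumap z] does not depend on the choice. *)
Definition taumap (z : F) : R -> R := 'pinv_(fun=> 0) I01 (tmap z).

Definition levi_civita1 (z : F) (t : R) : R :=
  z (taumap z (t - (Num.floor t)%:~R)) ^+ 2.

Definition levi_civita (z : F2) : F2 :=
  (levi_civita1 z.1, levi_civita1 z.2).

Definition gap (z : F2) (tau : R) : R :=
  z.1 tau ^+ 2 - z.2 (taumap z.2 (tmap z.1 tau)) ^+ 2.

Definition H1in (z : F2) : Prop :=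
  [/\ H1sq z, 0 < nrm z.1, 0 < nrm z.2 &
      forall tau, 0 <= tau <= 1 -> 0 < gap z tau].

Definition H1inL2 (x : F2 * F2) : Prop := H1in x.1 /\ L2sq x.2.

Definition Qfun (z : F) : R :=
  2 * nrm z ^+ 2 * nrm (wderiv z) ^+ 2 + 2 / nrm z ^+ 2.

Definition Ifun (z : F2) : R :=
  - ((nrm z.1 ^+ 2)^-1 *
     \int[mu]_(tau in I01) (z.1 tau ^+ 2 / gap z tau)).

Definition sqr (z : F) : F := fun tau => z tau ^+ 2.

Definition Afun (z : F2) : R :=
  - (nrm z.1 ^+ 2 * nrm z.2 ^+ 2 /
     (nrm (sqr z.1) ^+ 2 * nrm z.2 ^+ 2 - nrm (sqr z.2) ^+ 2 * nrm z.1 ^+ 2)).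

Definition Bfun (r : R) (z : F2) : R :=
  Qfun z.1 + Qfun z.2 + r * Ifun z + (1 - r) * Afun z.

Definition Lfun1 (z w : F) : R :=
  2 * nrm z ^+ 2 * nrm w ^+ 2 + 2 / nrm z ^+ 2.

Definition Lagr (r : R) (z w : F2) : R :=
  Lfun1 z.1 w.1 + Lfun1 z.2 w.2 + r * Ifun z + (1 - r) * Afun z.

Definition scl (c : R) (f : F) : F := fun tau => c * f tau.

(* The fibre derivative of the Lagrangian is [w |-> momentum z w], with inverse
   [velocity z]; [Ham] is the fibrewise Legendre transform. *)
Definition velocity (z eta : F2) : F2 :=
  (scl (4 * nrm z.1 ^+ 2)^-1 eta.1, scl (4 * nrm z.2 ^+ 2)^-1 eta.2).
Definition momentum (z w : F2) : F2 :=
  (scl (4 * nrm z.1 ^+ 2) w.1, scl (4 * nrm z.2 ^+ 2) w.2).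

Definition Ham (r : R) (x : F2 * F2) : R :=
  let w := velocity x.1 x.2 in ip2 x.2 w - Lagr r x.1 w.

Definition action (r : R) (x : F2 * F2) : R :=
  ip2 x.2 (wderiv2 x.1) - Ham r x.

Definition crit_action (r : R) : set (F2 * F2) :=
  critical H1L2 normH1L2 H1inL2 (action r).

Definition crit_B (r : R) : set F2 :=
  critical H1sq normH1 H1in (Bfun r).

Definition hamilton_solution (r : R) (x : F2 * F2) : Prop :=
  [/\ H1in x.1, H1sq x.2 &
      exists g, [/\ is_gradH (Ham r) x g,
                    aeeq2 (wderiv2 x.1) g.2
                  & aeeq2 (wderiv2 x.2) (- g.1)]].

Definition zeros (q : F) : set R := [set t | 0 <= t < 1 /\ q t = 0].

Definition even_zeros (q : F) : Prop := exists n : nat, (zeros q #= `I_n.*2)%card.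

Definition smooth_on (U : set R) (q : F) : Prop :=
  forall (n : nat) t, U t -> derivable (derive1n n q) t 1.

Definition C2_on (U : set R) (q : F) : Prop :=
  forall t, U t ->
    [/\ derivable q t 1, derivable (derive1 q) t 1
      & {for t, continuous (derive1n 2 q)}].

Definition energy (q : F) (t : R) : R := derive1 q t ^+ 2 / 2 - 2 / q t.

Definition energy_extends (q : F) : Prop :=
  exists e : F, [/\ continuous e, periodic e 1 &
    forall t, q t != 0 -> e t = energy q t].

(* At a zero of [q_2] the right-hand side of the equation for [q_1] is
   continuous but, if [r > 0], not differentiable (there [q_2] behaves like
   [|t - t0|^(2/3)]), so [q_1] is [C^2] but not [C^3] at such a point. Each
   [q_i] is therefore asked to be [C^2] off its own zeros and [C^oo] off the
   zeros of both. *)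
Definition generalized_solution (r : R) (q : F2) : Prop :=
  [/\ H1sq q /\ (forall t, 0 <= q.1 t /\ 0 <= q.2 t),
      forall t, q.2 t < q.1 t,
      even_zeros q.1 /\ even_zeros q.2,
      [/\ C2_on [set t | q.1 t != 0] q.1,
          C2_on [set t | q.2 t != 0] q.2,
          smooth_on [set t | q.1 t != 0 /\ q.2 t != 0] q.1,
          smooth_on [set t | q.1 t != 0 /\ q.2 t != 0] q.2 &
          (forall t, q.1 t != 0 ->
             derive1n 2 q.1 t = - (2 / q.1 t ^+ 2) + r / (q.1 t - q.2 t) ^+ 2
                          + (1 - r) / (avg q.1 - avg q.2) ^+ 2) /\
          (forall t, q.2 t != 0 ->
             derive1n 2 q.2 t = - (2 / q.2 t ^+ 2) - r / (q.1 t - q.2 t) ^+ 2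
                          - (1 - r) / (avg q.1 - avg q.2) ^+ 2)]
    & energy_extends q.1 /\ energy_extends q.2].

End frozen_planet.

(* Main.v *)
Require Import Defs.
From mathcomp Require Import all_boot all_order all_algebra.
From mathcomp Require Import all_classical all_reals all_analysis.
From mathcomp Require Import measurable_realfun.
From mathcomp Require Import ring lra.

Set Implicit Arguments.
Unset Strict Implicit.
Unset Printing Implicit Defensive.

Import Order.TTheory GRing.Theory Num.Theory.
Import numFieldNormedType.Exports.

Local Open Scope classical_set_scope.
Local Open Scope ring_scope.

(** Why the theorem holds. Put [N_i = nsq z_i], [q_i (t_{z_i}) = z_i^2] and let
    [F = r / (q_1 - q_2)^2 + (1 - r) / (avg q_1 - avg q_2)^2] be the force between the particles.

    The Legendre transform. Completing the square in the momenta ([actionE]), the action is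
    [Bfun r z] minus the squares of [eta_i - 4 N_i z_i'], divided by [8 N_i]. Hence a point is
    critical exactly if these defects vanish almost everywhere and [z] is critical for [Bfun r]
    ([crit_actionE]). For momenta in [H^1], integration by parts identifies criticality with
    Hamilton's equations ([hamilton_critE]). So everything is reduced to critical points of
    [Bfun r], together with their regularity.

    Regularity. In the time variable the interaction is the mean of [- 1 / (q_1 - q_2)], but
    [q_1] at a perturbed time change need not be differentiable in [z] unless [z_1] is
    C^1. What holds without regularity is that an increment [eps h] of the outer particle
    changes the interaction by at most a constant times [eps] times the [L^1]-norm of [h]
    ([interaction_L1]): a shift of the argument of a function of bounded variation costs, in
    the mean, the size of the shift. At a critical point this bounds [<z_1', h'>] by the
    [L^1]-norm of [h], and testing with trapezoids shows that [z_1'] is Lipschitz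
    ([crit_outer_C1]).

    The Euler-Lagrange equations. Once [z_1] is C^1, the functional is differentiable with
    derivative [sum_i 4 N_i <z_i', h_i'> + <K_i z_i, h_i>] ([Bfun_frechet]), where [K_i] is a
    nonlocal but continuous function. In terms of the energy [e_i] the equation becomes the
    Levi-Civita regularization [2 N^2 z'' = (e + s F (t_z) z^2) z], [e' = s F (t_z) (z^2)'],
    [2 N^2 z'^2 - 2 = z^2 e] of [q'' = - 2 / q^2 + s F], with [s = 1] for the outer and [s = -1]
    for the inner particle ([kepler], [regular]). The last equation, the definition of the
    energy, is a first integral of the other two, and its mean is right because of the
    dependence of the functional on [N]. Thus [z] is critical if and only if it is regular in
    this sense ([regular_crit], [crit_regular]).

    Collision orbits. The zeros of a solution [z] of the regularized equation are simple, so
    [z] changes its sign there, and a periodic function does so an even number of times; the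
    square, in the time [t], is a solution with collisions ([regular_generalized]). Conversely,
    [T = q q' / 2 - int (e + s F q / 2)] has the derivative [1 / q] off the collisions; it gives
    back the parameter [tau], and the square root of [q] with a sign alternating at every
    collision is periodic as the number of collisions is even ([levi_civita_inverse]). Two
    regularized orbits over the same solution have the same time change, hence the same
    squares, energies and products [z z'], and differ by a sign ([kepler_uniq]); the signs for
    the two particles give four orbits ([four_orbits]). *)

(** The integral vanishes if [b < a], so it is not oriented; [prim] below is. *)
Notation itg a b f := (Rintegral (@lebesgue_measure _) `[a, b]%classic f).
Notation L1 a b f :=
  ((@lebesgue_measure _).-integrable `[a, b]%classic (EFin \o f)).
Notation der f x l := (is_derive (x : _) (1 : _) (f : _ -> _) (l : _)).

(** * Calculus on the line *)

Section continuity.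
Variable R : realType.
Implicit Types (f g : R -> R) (c : R).

Lemma cont_id : continuous (fun x : R => x).
Proof. by move=> x; exact: cvg_id. Qed.

Lemma cont_cst c : continuous (fun _ : R => c).
Proof. by move=> x; exact: cvg_cst. Qed.

Lemma contD f g : continuous f -> continuous g -> continuous (fun x => f x + g x).
Proof. by move=> cf cg x; apply: continuousD; [exact: cf|exact: cg]. Qed.

Lemma contN f : continuous f -> continuous (fun x => - f x).
Proof. by move=> cf x; apply: continuousN; exact: cf. Qed.

Lemma contM f g : continuous f -> continuous g -> continuous (fun x => f x * g x).
Proof. by move=> cf cg x; apply: continuousM; [exact: cf|exact: cg]. Qed.

Lemma contX f n : continuous f -> continuous (fun x => f x ^+ n).
Proof.
move=> cf; elim: n => [|n IH].
  by under eq_fun do rewrite expr0; exact: cont_cst.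
by under eq_fun do rewrite exprS; exact: contM.
Qed.

Lemma contV f : (forall x, f x != 0) -> continuous f -> continuous (fun x => (f x)^-1).
Proof. by move=> f0 cf x; apply: continuousV => //; exact: cf. Qed.

Lemma cont_comp f g : continuous f -> continuous g -> continuous (fun x => f (g x)).
Proof. by move=> cf cg x; apply: continuous_comp; [exact: cg|exact: cf]. Qed.

End continuity.

(** Continuity by the shape of the function, with continuous hypotheses as atoms; an inverse
    leaves the goal that its argument has no zero. *)
Ltac cont := repeat (match goal with
  | |- continuous (fun x => x) => exact (@cont_id _)
  | |- continuous (fun x => ?c) => exact (@cont_cst _ c)
  | |- continuous (fun x => @?f x + @?g x) => refine (@contD _ f g _ _)
  | |- continuous (fun x => - @?f x) => refine (@contN _ f _)
  | |- continuous (fun x => @?f x * @?g x) => refine (@contM _ f g _ _)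
  | |- continuous (fun x => @?f x ^+ ?n) => refine (@contX _ f n _)
  | |- continuous (fun x => (@?f x)^-1) => refine (@contV _ f _ _)
  | H : continuous ?f |- continuous ?f => exact H
  | |- continuous (fun x => ?f (@?g x)) => refine (@cont_comp _ f g _ _)
  end).

Section integrals.
Variable R : realType.
Local Notation mu := (@lebesgue_measure R).
Implicit Types (f g h z w : R -> R) (a b c d x y s t : R).

Lemma near_gt a x : a < x -> \forall y \near x, a < y.
Proof.
move=> ax; exists (x - a) => /=; first by rewrite subr_gt0.
by move=> y /=; rewrite ltr_norml => /andP[_ ?]; lra.
Qed.

Lemma near_lt b x : x < b -> \forall y \near x, y < b.
Proof. exact: lt_nbhsl. Qed.

Lemma addfE f g x : (f + g) x = f x + g x. Proof. by []. Qed.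
Lemma oppfE f x : (- f) x = - f x. Proof. by []. Qed.
Lemma scalefE k f x : (k *: f) x = k * f x. Proof. by []. Qed.

Lemma continuous_L1 f a b : continuous f -> L1 a b f.
Proof.
move=> cf; apply: continuous_compact_integrable; first exact: segment_compact.
exact: continuous_subspaceT.
Qed.

Lemma L1_sub f a b c d : a <= c -> d <= b -> L1 a b f -> L1 c d f.
Proof.
move=> ac db; apply: integrableS => //; apply: subset_itv; rewrite bnd_simp //.
Qed.

Lemma L1D f g a b : L1 a b f -> L1 a b g -> L1 a b (fun x => f x + g x).
Proof. by move=> Lf Lg; exact: (integrableD _ Lf Lg). Qed.

Lemma L1Z k f a b : L1 a b f -> L1 a b (fun x => k * f x).
Proof. by move=> Lf; exact: (integrableZl _ k Lf). Qed.

Lemma L1B f g a b : L1 a b f -> L1 a b g -> L1 a b (fun x => f x - g x).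
Proof. by move=> Lf Lg; exact: (integrableB _ Lf Lg). Qed.

Lemma L1_norm f a b : L1 a b f -> L1 a b (fun x => `|f x|).
Proof. by move=> Lf; exact: (integrable_norm Lf). Qed.

Lemma itgD f g a b : L1 a b f -> L1 a b g ->
  itg a b (fun x => f x + g x) = itg a b f + itg a b g.
Proof. by move=> Lf Lg; rewrite RintegralD. Qed.

Lemma itgZ k f a b : L1 a b f -> itg a b (fun x => k * f x) = k * itg a b f.
Proof. by move=> Lf; rewrite RintegralZl. Qed.

Lemma itgB f g a b : L1 a b f -> L1 a b g ->
  itg a b (fun x => f x - g x) = itg a b f - itg a b g.
Proof. by move=> Lf Lg; rewrite RintegralB. Qed.

Lemma itg_cst k a b : a <= b -> itg a b (fun=> k) = k * (b - a).
Proof.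
move=> ab; rewrite Rintegral_cst //= lebesgue_measure_itv /= lte_fin.
by case: ltgtP ab => //= -> _; rewrite subrr.
Qed.

Lemma itg_eq f g a b : (forall x, a <= x <= b -> f x = g x) ->
  itg a b f = itg a b g.
Proof. by move=> fg; apply: eq_Rintegral => x; rewrite inE /= in_itv /= => /fg. Qed.

Lemma itg_le f g a b : L1 a b f -> L1 a b g ->
  (forall x, a <= x <= b -> f x <= g x) -> itg a b f <= itg a b g.
Proof. by move=> Lf Lg fg; apply: le_Rintegral => // x; rewrite /= in_itv /= => /fg. Qed.

Lemma itg_ge0 f a b : (forall x, a <= x <= b -> 0 <= f x) -> 0 <= itg a b f.
Proof. by move=> f0; apply: Rintegral_ge0 => x; rewrite /= in_itv /= => /f0. Qed.

Lemma norm_itg f a b : L1 a b f -> `|itg a b f| <= itg a b (fun x => `|f x|).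
Proof. by move=> Lf; apply: le_normr_Rintegral. Qed.

Lemma norm_itg_le f a b C : a <= b -> L1 a b f ->
  (forall x, a <= x <= b -> `|f x| <= C) -> `|itg a b f| <= C * (b - a).
Proof.
move=> ab Lf fC; rewrite (le_trans (norm_itg Lf)) // -itg_cst //.
apply: itg_le => //; first exact: L1_norm.
by apply: continuous_L1; exact: cst_continuous.
Qed.

Lemma itg_aa f a : itg a a f = 0.
Proof. by rewrite set_itv1 Rintegral_set1. Qed.

Lemma itg_gt f a b : b < a -> itg a b f = 0.
Proof. by move=> ba; rewrite set_itv_ge ?Rintegral_set0 // bnd_simp -ltNge. Qed.

Lemma itg_split f a b c : a <= b -> b <= c -> L1 a c f ->
  itg a c f = itg a b f + itg b c f.
Proof.
move=> ab bc Lf; apply/eqP; rewrite addrC -subr_eq; apply/eqP.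
rewrite Rintegral_itvB ?bnd_simp //.
by rewrite Rintegral_itv_obnd_cbnd //; apply: integrableS Lf => //;
  apply: subset_itv; rewrite bnd_simp.
Qed.

Lemma ae_int f g a b : ae_eq mu `[a, b]%classic f g -> L1 a b f -> L1 a b g ->
  itg a b f = itg a b g.
Proof.
move=> fg Lf Lg; congr fine; apply: ae_eq_integral => //.
- exact: (measurable_int mu).
- exact: (measurable_int mu).
- by move: fg; apply: filterS => x /= fgx Dx; rewrite fgx.
Qed.

Lemma L2_mul f g : L2 f -> L2 g -> L1 0 1 (fun x => f x * g x).
Proof.
move=> [mf Lf] [mg Lg].
apply: (@le_integrable _ _ _ mu _ _ _ (EFin \o (fun x => f x ^+ 2 + g x ^+ 2))) => //.
- by apply/measurable_EFinP; exact: measurable_funM.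
- move=> x _ /=; rewrite lee_fin [leRHS]ger0_norm ?addr_ge0 ?sqr_ge0 //.
  rewrite ler_norml; have := sqr_ge0 (f x + g x); have := sqr_ge0 (f x - g x).
  have := sqr_ge0 (f x); have := sqr_ge0 (g x).
  by move=> ? ? ? ?; apply/andP; split; nra.
- exact: (L1D Lf Lg).
Qed.

Lemma continuous_L2 f : continuous f -> L2 f.
Proof.
move=> cf; split.
  by apply: measurable_funTS; exact: continuous_measurable_fun.
by apply: continuous_L1 => x; apply: continuousM; exact: cf.
Qed.

Lemma L2_L1 f : L2 f -> L1 0 1 f.
Proof.
move=> Lf; have L21 : L2 (fun=> 1 : R) by apply: continuous_L2; exact: cst_continuous.
by have := L2_mul Lf L21; apply: eq_integrable => // x _ /=; rewrite mulr1.
Qed.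

Lemma L2D f g : L2 f -> L2 g -> L2 (f + g).
Proof.
move=> Lf Lg; case: (Lf) (Lg) => mf Lf2 [mg Lg2]; split; first exact: measurable_funD.
have := L1D (L1D Lf2 Lg2) (L1Z 2 (L2_mul Lf Lg)).
by apply: eq_integrable => // x _ /=; congr EFin; rewrite addfE; ring.
Qed.

Lemma L2Z k f : L2 f -> L2 (k *: f).
Proof.
move=> [mf Lf]; split; first exact: measurable_funM.
have := L1Z (k ^+ 2) Lf.
by apply: eq_integrable => // x _ /=; congr EFin; rewrite scalefE; ring.
Qed.

Lemma L20 : L2 (0 : R -> R).
Proof. by apply: continuous_L2 => x; exact: cst_continuous. Qed.

Lemma L2N f : L2 f -> L2 (- f).
Proof. by move=> /(L2Z (-1)); rewrite scaleN1r. Qed.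

Lemma L2B f g : L2 f -> L2 g -> L2 (f - g).
Proof. by move=> Lf /L2N; exact: L2D. Qed.

Lemma ipC f g : ip f g = ip g f.
Proof. by apply: itg_eq => x _; rewrite mulrC. Qed.

Lemma ipDl f g h : L2 f -> L2 g -> L2 h -> ip (f + g) h = ip f h + ip g h.
Proof.
move=> Lf Lg Lh; rewrite /ip -itgD; [|exact: L2_mul..].
by apply: itg_eq => x _; rewrite addfE mulrDl.
Qed.

Lemma ipZl k f h : L2 f -> L2 h -> ip (k *: f) h = k * ip f h.
Proof.
move=> Lf Lh; rewrite /ip -itgZ; last exact: L2_mul.
by apply: itg_eq => x _; rewrite scalefE mulrA.
Qed.

Lemma ipDr f g h : L2 f -> L2 g -> L2 h -> ip h (f + g) = ip h f + ip h g.
Proof. by move=> *; rewrite ![ip h _]ipC ipDl. Qed.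

Lemma ipZr k f h : L2 f -> L2 h -> ip h (k *: f) = k * ip h f.
Proof. by move=> *; rewrite ![ip h _]ipC ipZl. Qed.

Lemma ipNl f h : L2 f -> L2 h -> ip (- f) h = - ip f h.
Proof. by move=> *; rewrite -scaleN1r ipZl // mulN1r. Qed.

Lemma ipBl f g h : L2 f -> L2 g -> L2 h -> ip (f - g) h = ip f h - ip g h.
Proof. by move=> *; rewrite ipDl ?ipNl //; exact: L2N. Qed.

Lemma ip0l f : ip 0 f = 0.
Proof.
by rewrite /ip (itg_eq (g := fun=> 0)) ?itg_cst ?mul0r // => x _; rewrite mul0r.
Qed.

Lemma nsq_ge0 f : 0 <= nsq f.
Proof. by apply: itg_ge0 => x _; rewrite -expr2 sqr_ge0. Qed.

Lemma nsqD f g : L2 f -> L2 g -> nsq (f + g) = nsq f + 2 * ip f g + nsq g.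
Proof.
move=> Lf Lg; rewrite /nsq ipDl ?ipDr //; last exact: L2D.
by rewrite (ipC g f); ring.
Qed.

Lemma nsqZ k f : L2 f -> nsq (k *: f) = k ^+ 2 * nsq f.
Proof. by move=> Lf; rewrite /nsq ipZl ?ipZr //; [ring|exact: L2Z]. Qed.

Lemma nrm_sq f : nrm f ^+ 2 = nsq f.
Proof. by rewrite sqr_sqrtr // nsq_ge0. Qed.

Lemma nrm_ge0 f : 0 <= nrm f. Proof. exact: sqrtr_ge0. Qed.

Lemma nrm_gt0 f : (0 < nrm f) = (0 < nsq f).
Proof. by rewrite sqrtr_gt0. Qed.

Lemma cauchy_schwarz f g : L2 f -> L2 g -> `|ip f g| <= nrm f * nrm g.
Proof.
move=> Lf Lg; rewrite -[leLHS]sqrtr_sqr /nrm -sqrtrM ?nsq_ge0 //.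
rewrite ler_sqrt ?mulr_ge0 ?nsq_ge0 //.
have H x : 0 <= nsq f + 2 * x * ip f g + x ^+ 2 * nsq g.
  by have := nsq_ge0 (f + x *: g); rewrite nsqD ?nsqZ ?ipZr //; [lra|exact: L2Z].
have [g0|g0] := eqVneq (nsq g) 0.
  rewrite g0 mulr0; have [->|i0] := eqVneq (ip f g) 0; first by rewrite expr0n.
  have := H (- (nsq f + 1) / (2 * ip f g)); rewrite g0 mulr0 addr0.
  suff -> : 2 * (- (nsq f + 1) / (2 * ip f g)) * ip f g = - (nsq f + 1) by lra.
  by field.
have gp : 0 < nsq g by rewrite lt_def g0 nsq_ge0.
have := H (- ip f g / nsq g).
have -> : nsq f + 2 * (- ip f g / nsq g) * ip f g + (- ip f g / nsq g) ^+ 2 * nsq g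
  = (nsq f * nsq g - ip f g ^+ 2) / nsq g by field.
by rewrite pmulr_lge0 ?invr_gt0 // subr_ge0.
Qed.

Lemma ae_ip f g h : aeeq f g -> L2 f -> L2 g -> L2 h -> ip f h = ip g h.
Proof.
move=> fg Lf Lg Lh; apply: ae_int; [|exact: L2_mul..].
by move: fg; apply: filterS => x /= fgx Dx; rewrite fgx.
Qed.

Lemma aeeq_sym f g : aeeq f g -> aeeq g f.
Proof. by apply: filterS => x /= fg Dx; rewrite fg. Qed.

Lemma aeeq_trans f g h : aeeq f g -> aeeq g h -> aeeq f h.
Proof. by apply: filterS2 => x /= fg gh Dx; rewrite fg ?gh. Qed.

Lemma aeeq_refl f : aeeq f f.
Proof. exact: aeW. Qed.

Lemma aeeq_eq f g : (forall x, 0 <= x <= 1 -> f x = g x) -> aeeq f g.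
Proof. by move=> fg; apply: aeW => x; rewrite /= in_itv /= => /fg. Qed.

Lemma ae_nsq f g : aeeq f g -> L2 f -> L2 g -> nsq f = nsq g.
Proof. by move=> fg Lf Lg; rewrite /nsq (ae_ip fg) // ipC (ae_ip fg). Qed.

Lemma nsq_eq0 f : L2 f -> nsq f = 0 -> aeeq f 0.
Proof.
move=> Lf f0.
have : (\int[mu]_(x in `[(0%R:R), 1%R]) `|(f x ^+ 2)%:E|)%E = 0%E.
  rewrite (_ : integral _ _ _ = \int[mu]_(x in `[0%R, 1%R]) (f x ^+ 2)%:E)%E; last first.
    by apply: eq_integral => x _ /=; rewrite ger0_norm // sqr_ge0.
  have fin := integrable_fin_num (mu := mu) (measurable_itv `[0%R, 1%R]) Lf.2.
  rewrite -(fineK fin); congr EFin.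
  by rewrite -[RHS]f0; apply: itg_eq => x _; rewrite expr2.
move/(ae_eq_integral_abs mu (measurable_itv _)).
have mf2 : measurable_fun `[(0:R), 1]%classic (fun x => (f x ^+ 2)%:E).
  exact: (measurable_int mu Lf.2).
move=> /(_ mf2); apply: filterS => x /= H Dx.
by move: (H Dx) => [] /eqP; rewrite sqrf_eq0 => /eqP.
Qed.

Lemma aeeq_nsqB f g : L2 f -> L2 g -> aeeq f g <-> nsq (f - g) = 0.
Proof.
move=> Lf Lg; split=> [fg|].
  have /ae_nsq -> // : aeeq (f - g) 0.
  - by move: fg; apply: filterS => x /= fg Dx; rewrite addfE oppfE fg // subrr.
  - by rewrite /nsq ip0l.
  - exact: L2B.
  - exact: L20.
move=> /(nsq_eq0 (L2B Lf Lg)); apply: filterS => x /= H Dx; apply/eqP.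
by rewrite -subr_eq0; apply/eqP; exact: H.
Qed.

(** One of the two integrals is over an empty or degenerate interval, which gives the usual
    sign for negative [x]. *)
Definition prim f x := itg 0 x f - itg x 0 f.

Lemma der_eq f x l l' : der f x l -> l = l' -> der f x l'.
Proof. by move=> d <-. Qed.

Lemma der_ext f g x l : (forall y, g y = f y) -> der f x l -> der g x l.
Proof. by move=> /funext ->. Qed.

Lemma derD f g x l m : der f x l -> der g x m -> der (fun y => f y + g y) x (l + m).
Proof. exact: is_deriveD. Qed.

Lemma derB f g x l m : der f x l -> der g x m -> der (fun y => f y - g y) x (l - m).
Proof. exact: is_deriveB. Qed.

Lemma derM f g x l m : der f x l -> der g x m ->
  der (fun y => f y * g y) x (l * g x + f x * m).
Proof.
move=> df dg; apply: (@der_eq _ _ _ _ (is_deriveM df dg)).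
by rewrite /GRing.scale /=; ring.
Qed.

Lemma derZ c f x l : der f x l -> der (fun y => c * f y) x (c * l).
Proof. by move=> df; exact: (is_deriveZ c df). Qed.

Lemma der_cst c x : der (fun=> c) x 0.
Proof. exact: is_derive_cst. Qed.

Lemma der_sq f x l : der f x l -> der (fun y => f y ^+ 2) x (2 * f x * l).
Proof.
move=> df; apply: (@der_ext (fun y => f y * f y)) => [y|]; first by rewrite expr2.
by apply: (der_eq (derM df df)); ring.
Qed.

Lemma der_comp f g x l m : der f (g x) l -> der g x m -> der (fun y => f (g y)) x (l * m).
Proof. by move=> df dg; exact: is_derive1_comp. Qed.

Lemma der_recip f x l : f x != 0 -> der f x l ->
  der (fun y => (f y)^-1) x (- l / f x ^+ 2).
Proof.
move=> f0 df; apply: (der_eq (is_deriveV f0 df)).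
by rewrite /GRing.scale /= mulNr mulrC mulNr.
Qed.

Lemma derivable_continuous f x l : der f x l -> {for x, continuous f}.
Proof. by move=> [d _]; apply/differentiable_continuous/derivable1_diffP. Qed.

Lemma prim_split f a x : continuous f -> a <= 0 -> a <= x ->
  prim f x = itg a x f - itg a 0 f.
Proof.
move=> cf a0 ax; rewrite /prim; have [x0|x0] := leP 0 x.
  rewrite (@itg_split f a 0 x) //; last exact: continuous_L1.
  have -> : itg x 0 f = 0.
    by move: x0; rewrite le_eqVlt => /predU1P[<-|/itg_gt ->//]; rewrite itg_aa.
  by ring.
rewrite (itg_gt _ x0) (@itg_split f a x 0) // ?ltW //; last exact: continuous_L1.
by ring.
Qed.

Lemma prim_der f x : continuous f -> der (prim f) x (f x).
Proof.
move=> cf; pose a : R := Num.min 0 x - 1.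
have m0 : Num.min 0 x <= 0 by rewrite ge_min lexx.
have mx : Num.min 0 x <= x by rewrite ge_min lexx orbT.
have a0 : a < 0 by rewrite /a; lra.
have ax : a < x by rewrite /a; lra.
have x1 : x < x + 1 by rewrite ltrDl.
pose F y := itg a y f.
have dF : der F x (f x).
  have [d e] := continuous_FTC1_closed x1 (continuous_L1 a (x + 1) cf) ax (cf x).
  by rewrite -e derive1E; exact: DeriveDef.
apply: (@near_eq_is_derive _ _ _ (fun y => F y - itg a 0 f)).
  near=> y; rewrite (@prim_split f a) ?(ltW a0) ?ltW //.
  by near: y; exact: near_gt.
rewrite -[f x]subr0; exact: is_deriveB.
Unshelve. all: by end_near. Qed.
End integrals.

(** * Sobolev functions of one variable *)

Section sobolev.
Variable R : realType.
Local Notation mu := (@lebesgue_measure R).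
Implicit Types (f g h z w u v : R -> R) (a b c e x t : R).

Lemma cst_of_der0 f a b : a <= b -> {within `[a, b], continuous f} ->
  (forall x, a < x < b -> der f x 0) -> f b = f a.
Proof.
move=> ab cf df.
have df' x : x \in `]a, b[ -> der f x 0 by rewrite in_itv /= => /df.
have [c _ /eqP] := @MVT_segment _ f (fun=> 0) a b ab df' cf.
by rewrite mul0r subr_eq0 => /eqP.
Qed.

Lemma itg_der f F a b : a <= b -> continuous f ->
  {within `[a, b], continuous F} -> (forall x, a < x < b -> der F x (f x)) ->
  itg a b f = F b - F a.
Proof.
move=> ab cf cF dF.
have cP : continuous (prim f) by move=> x; exact: derivable_continuous (prim_der x cf).
have key G : {within `[a, b], continuous G} ->
    (forall x, a < x < b -> der G x (f x)) -> G b - G a = prim f b - prim f a.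
  move=> cG dG; suff : G b - prim f b = G a - prim f a by lra.
  apply: (@cst_of_der0 (fun x => G x - prim f x)) => //.
    move=> x; apply: continuousB; first exact: cG.
    exact: continuous_subspaceT.
  by move=> x xab; rewrite -(subrr (f x)); apply: is_deriveB; [exact: dG|exact: prim_der].
rewrite key //.
have -> : itg a b f = itg a b f - itg a a f by rewrite itg_aa subr0.
pose c := Num.min a 0 - 1.
have ca : c <= a by rewrite /c; have : Num.min a 0 <= a by [rewrite ge_min lexx]; lra.
have c0 : c <= 0.
  by rewrite /c; have : Num.min a 0 <= 0 by [rewrite ge_min lexx orbT]; lra.
rewrite itg_aa !(@prim_split _ _ c) ?(le_trans ca ab) ?ca ?c0 //.
rewrite (@itg_split _ f c a b) //; last exact: continuous_L1.
by ring.
Qed.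

Lemma itg_prim f a b : a <= b -> continuous f -> itg a b f = prim f b - prim f a.
Proof.
move=> ab cf; apply: itg_der => //; last by move=> x _; exact: prim_der.
by apply: continuous_subspaceT => x; exact: derivable_continuous (prim_der x cf).
Qed.

Lemma prim_continuous f : continuous f -> continuous (prim f).
Proof. by move=> cf x; exact: derivable_continuous (prim_der x cf). Qed.

Definition fpart x : R := x - (Num.floor x)%:~R.

Lemma fpart_ge0 x : 0 <= fpart x.
Proof. by rewrite subr_ge0 ge_floor. Qed.

Lemma fpart_lt1 x : fpart x < 1.
Proof. by rewrite ltrBlDl; have := lt_succ_floor x; rewrite intrD. Qed.

Lemma periodic_nat f n x : periodic f 1 -> f (x + n%:R) = f x.
Proof. by move=> pf; exact: (periodicn pf). Qed.

Lemma periodic_int f (n : int) x : periodic f 1 -> f (x + n%:~R) = f x.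
Proof.
move=> pf; case: n => n; first by rewrite -pmulrn; exact: periodic_nat.
rewrite NegzE mulrNz -pmulrn -[in RHS](subrK n.+1%:R x).
by rewrite periodic_nat.
Qed.

Lemma periodic_fpart f x : periodic f 1 -> f (fpart x) = f x.
Proof. by move=> pf; rewrite /fpart -mulrNz periodic_int. Qed.

(** Composing with [clip] extends a function from [[0, 1]] by its end values; it turns
    continuity on the interval into continuity on the line. *)
Definition clip x : R := Num.max 0 (Num.min 1 x).

Lemma clip_itv x : 0 <= clip x /\ clip x <= 1.
Proof. by rewrite le_max lexx ge_max ler01 ge_min lexx. Qed.

Lemma clip_id x : 0 <= x <= 1 -> clip x = x.
Proof. by case/andP => x0 x1; rewrite /clip (min_r x1) (max_r x0). Qed.

Lemma clip_le0 x : x <= 0 -> clip x = 0.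
Proof. by move=> x0; rewrite /clip max_l // ge_min x0 orbT. Qed.

Lemma clip_ge1 x : 1 <= x -> clip x = 1.
Proof. by move=> x1; rewrite /clip min_l // max_r. Qed.

Lemma clip_lip x y : `|clip x - clip y| <= `|x - y|.
Proof.
have h3 := ler_norm (x - y); have h4 := ler_norm (y - x); rewrite (distrC y) in h4.
move: (`|x - y|) h3 h4 => r h3 h4; rewrite /clip /Num.max /Num.min.
by case: (ltP 1 x) => hx; case: (ltP 1 y) => hy; rewrite ?ltr01;
  try case: (ltP 0 x) => h1; try case: (ltP 0 y) => h2;
  apply/ler_normlP; split; lra.
Qed.

Lemma near_dist_lt x e : 0 < e -> \forall y \near x, `|x - y| < e.
Proof. by move=> e0; exists e. Qed.

Lemma near_dist_le x e : 0 < e -> \forall y \near x, `|x - y| <= e.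
Proof. by move=> e0; apply: filterS (near_dist_lt x e0) => y /ltW. Qed.

Lemma continuous_atP f x : (forall e, 0 < e -> exists2 d, 0 < d &
  forall y, `|x - y| < d -> `|f x - f y| <= e) -> {for x, continuous f}.
Proof.
move=> H; apply/cvgrPdist_le => e e0; have [d d0 fd] := H e e0.
by apply: filterS (near_dist_lt x d0) => y /fd.
Qed.

Lemma continuous_at_dist f x e : {for x, continuous f} -> 0 < e ->
  exists2 d, 0 < d & forall y, `|x - y| < d -> `|f x - f y| < e.
Proof.
move=> /cvgrPdist_lt cf e0; have [d d0 fd] := cf e e0.
by exists d.
Qed.

Lemma clip_continuous : continuous clip.
Proof.
move=> x; apply/cvgrPdist_le => e e0; near=> y.
rewrite (le_trans (clip_lip _ _)) //; near: y; exact: near_dist_le.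
Unshelve. all: by end_near. Qed.

Lemma near_continuous_eq f g x : (\forall y \near x, g y = f y) ->
  {for x, continuous f} -> {for x, continuous g}.
Proof.
move=> fg cf; have fgx := nbhs_singleton fg; rewrite /prop_for /continuous_at fgx.
by apply: cvg_trans cf; apply: near_eq_cvg; apply: filterS fg => y ->.
Qed.

Lemma L1_01 w s t : L2 w -> 0 <= s -> t <= 1 -> L1 s t w.
Proof. by move=> Lw s0 t1; apply: L1_sub (L2_L1 Lw). Qed.

Lemma itg_holder w (s t : R) : L2 w -> 0 <= s -> s <= t -> t <= 1 ->
  `|itg s t w| <= Num.sqrt (t - s) * nrm w.
Proof.
move=> Lw s0 st t1.
have L1i a b : L1 a b (\1_(`[s, t] : set R)).
  apply: (@integrableS _ _ _ mu setT) => //.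
  have /= := @integrable_indic_itv R s t true false.
  by [].
have Li : L2 (\1_(`[s, t] : set R) : R -> R).
  split; first exact: measurable_indic.
  have := L1i 0 1; apply: eq_integrable => // x _ /=; congr EFin.
  by rewrite indicE; case: (_ \in _); rewrite ?expr1n ?expr0n.
have sub : `[s, t]%classic `&` `[0, 1]%classic = `[s, t]%classic :> set R.
  apply/seteqP; split => x /=; first by case.
  by move=> xst; split => //; move: xst; rewrite !in_itv /= => /andP[? ?]; apply/andP; split; lra.
have E f : itg s t f = ip f (\1_(`[s, t] : set R)).
  rewrite /ip -[in LHS]sub Rintegral_mkcondl; apply: itg_eq => x _.
  by rewrite patchE indicE; case: (_ \in _); rewrite ?mulr1 ?mulr0.
rewrite E mulrC; have := cauchy_schwarz Lw Li.
suff -> : nrm (\1_(`[s, t] : set R)) = Num.sqrt (t - s) by [].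
congr Num.sqrt; rewrite /nsq -E -[RHS]mul1r -itg_cst //.
by apply: itg_eq => x xst; rewrite indicE mem_set.
Qed.

Lemma wderiv_holder z w (s t : R) : is_wderiv z w -> 0 <= s -> s <= t -> t <= 1 ->
  `|z t - z s| <= Num.sqrt (t - s) * nrm w.
Proof.
move=> [Lw zE] s0 st t1; have [s1 t0] : s <= 1 /\ 0 <= t by split; lra.
rewrite (zE s) ?s0 ?s1 // (zE t) ?t0 ?t1 //.
rewrite (@itg_split _ w 0 s t) //; last exact: L1_01.
rewrite (_ : _ - _ = itg s t w); first exact: itg_holder.
by ring.
Qed.

Lemma H1_wderiv z : H1 z -> is_wderiv z (wderiv z).
Proof. by move=> [_ [w zw]]; exact: (@xgetI _ (fun=> 0) [set w | is_wderiv z w] w). Qed.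

(** Hoelder continuity with exponent 1/2 takes care of the open fundamental domain. Near an
    integer the two one-sided pieces are glued: their sum, clipped, minus the common value [z
    0] is a continuous function that agrees with [z]. *)
Lemma H1_continuous z : H1 z -> continuous z.
Proof.
move=> Hz; have zw := H1_wderiv Hz; have pz := Hz.1.
set w := wderiv z in zw; set C := nrm w.
have C0 : 0 <= C := nrm_ge0 _.
have half (x y : R) : 0 <= x -> x <= 1 -> 0 <= y -> y <= 1 ->
    `|z x - z y| <= Num.sqrt `|x - y| * C.
  move=> x0 x1 y0 y1; have [xy|yx] := leP x y.
    by rewrite distrC [X in Num.sqrt X]distrC [X in Num.sqrt X]ger0_norm ?subr_ge0 //
      wderiv_holder.
  by rewrite [X in Num.sqrt X]ger0_norm ?subr_ge0 ?wderiv_holder // ltW.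
have z01 : z 1 = z 0 by rewrite -[in LHS](add0r 1) pz.
have cc : continuous (z \o clip).
  move=> x; apply: continuous_atP => e e0.
  have C1 : 0 < C + 1 by lra.
  have ee : 0 < e / (C + 1) by rewrite divr_gt0.
  exists ((e / (C + 1)) ^+ 2); first by rewrite exprn_gt0.
  move=> y xy; have [x0 x1] := clip_itv x; have [y0 y1] := clip_itv y.
  rewrite /= (le_trans (half _ _ x0 x1 y0 y1)) //.
  have H : Num.sqrt `|clip x - clip y| <= e / (C + 1).
    rewrite -[X in _ <= X](ger0_norm (ltW ee)) -(sqrtr_sqr (e / _)) ler_wsqrtr //.
    by rewrite (le_trans (clip_lip _ _)) // ltW.
  rewrite (le_trans (ler_wpM2r C0 H)) // mulrAC ler_pdivrMr //.
  by rewrite ler_wpM2l ?(ltW e0) // lerDl.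
move=> x; pose n := Num.floor x.
have xn0 : 0 <= x - n%:~R := fpart_ge0 x.
have xn1 : x - n%:~R < 1 := fpart_lt1 x.
apply: (@near_continuous_eq (fun y => (z \o clip) (y - n%:~R) +
    (z \o clip) (y - n%:~R + 1) - z 0)); last first.
  have cc' : continuous (fun y => (z \o clip) y) := cc.
  suff H : continuous (fun y : R => (z \o clip) (y - n%:~R) +
    (z \o clip) (y - n%:~R + 1) - z 0) by exact: H.
  by cont.
near=> y.
have yn1 : n%:~R - 1 < y by near: y; apply: near_gt; lra.
have yn2 : y < n%:~R + 1 by near: y; apply: near_lt; lra.
rewrite /= (_ : z y = z (y - n%:~R)); last by rewrite -mulrNz periodic_int.
have u1 : -1 < y - n%:~R by lra.
have u2 : y - n%:~R < 1 by lra.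
move: (y - n%:~R) u1 u2 => u u1 u2; case: (leP 0 u) => u0.
  by rewrite [clip (u + 1)]clip_ge1 ?clip_id ?z01 ?addrK //; lra.
rewrite [clip u]clip_le0 ?clip_id ?pz ?[_ + z u]addrC ?addrK //; lra.
Unshelve. all: by end_near. Qed.

(** The oscillation of [z] is at most [nrm w] by Cauchy-Schwarz, and the mean of [`|z|] is at
    most [nrm z]. *)
Lemma H1_sup z w t : is_wderiv z w -> L2 z -> 0 <= t <= 1 -> `|z t| <= nrm z + nrm w.
Proof.
move=> zw Lz t01; have [Lw zE] := zw.
have L21 : L2 (fun=> 1 : R) by apply: continuous_L2; exact: cst_continuous.
have n1 : nrm (fun=> 1 : R) = 1.
  rewrite /nrm (_ : nsq _ = 1) ?sqrtr1 // /nsq /ip.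
  by rewrite (itg_eq (g := fun=> 1)) ?itg_cst ?subr0 ?mul1r // => x _; rewrite mul1r.
have Lc k : L1 0 1 (fun=> k : R) by apply: continuous_L1; exact: cst_continuous.
have Lzn : L1 0 1 (fun x => `|z x|) := L1_norm (L2_L1 Lz).
have half s : 0 <= s <= 1 -> `|z t| <= `|z s| + nrm w.
  move=> s01; have hol a b : 0 <= a -> a <= b -> b <= 1 -> `|z b - z a| <= nrm w.
    move=> a0 ab b1; rewrite (le_trans (wderiv_holder zw a0 ab b1)) //.
    rewrite ler_piMl ?nrm_ge0 // -[X in _ <= X]sqrtr1 ler_wsqrtr //; lra.
  have : `|z t - z s| <= nrm w.
    have [st|ts] := leP s t; [|rewrite distrC]; apply: hol; lra.
  by have := ler_normD (z s) (z t - z s); rewrite subrKC; lra.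
have -> : `|z t| = itg 0 1 (fun=> `|z t|) by rewrite itg_cst // subr0 mulr1.
apply: (@le_trans _ _ (itg 0 1 (fun s => `|z s| + nrm w))).
  by apply: itg_le => //; exact: L1D.
rewrite itgD // itg_cst // subr0 mulr1 lerD2r.
have Ln : L2 (fun x => `|z x|).
  split; first by apply: measurableT_comp => //; exact: Lz.1.
  by have := Lz.2; apply: eq_integrable => // x _ /=; rewrite real_normK // num_real.
have := cauchy_schwarz Ln L21; rewrite n1 mulr1.
have -> : nrm (fun x => `|z x|) = nrm z.
  by congr Num.sqrt; apply: itg_eq => x _; rewrite -normrM ger0_norm // -expr2 sqr_ge0.
apply: le_trans; rewrite (_ : ip _ _ = itg 0 1 (fun s => `|z s|)) ?ler_norm //.
by apply: itg_eq => x _; rewrite mulr1.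
Qed.

(** Lebesgue differentiation of the primitive of [w]. It makes the weak derivative unique
    almost everywhere. *)
Lemma wderiv_ae z w : is_wderiv z w ->
  {ae mu, forall x, 0 < x < 1 -> der z x (w x)}.
Proof.
move=> [Lw zE].
have Lw1 := L2_L1 Lw.
have := lebesgue_differentiation (integrable_locally (measurable_itv _) Lw1).
apply: filterS; first exact: (ae_filter_ringOfSetsType mu).
move=> x wx /andP[x0 x1].
pose v := w \_ `[0, 1]; pose F y := itg 0 y v.
have Lv : L1 0 1 v.
  by apply: eq_integrable Lw1 => // y; rewrite /v /= patchE => ->.
have [d e] := @FTC1_lebesgue_pt R v (BLeft 0) x 1 x1 Lv x0 wx.
have dF : der F x (w x).
  have <- : v x = w x by rewrite /v patchE mem_set //= in_itv /= !ltW.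
  by rewrite -e derive1E; exact: DeriveDef.
apply: (@near_eq_is_derive _ _ _ (fun y => z 0 + F y)).
  near=> y; have y0 : 0 < y by near: y; exact: near_gt.
  have y1 : y < 1 by near: y; exact: near_lt.
  rewrite /= (zE y) ?ltW // /F; congr (_ + _); apply: itg_eq => s /andP[s0 sy].
  by rewrite /v patchE mem_set //= in_itv /= s0 (le_trans sy) ?ltW.
rewrite -[w x]add0r; apply: is_deriveD.
Unshelve. all: by end_near. Qed.

Lemma aeeq_oo u v : {ae mu, forall x, 0 < x < 1 -> u x = v x} -> aeeq u v.
Proof.
move=> uv; have ne (a : R) : {ae mu, forall x, x != a}.
  exists [set a]; split; rewrite ?lebesgue_measure_set1 //.
  by move=> x /= /negP; rewrite negbK => /eqP.
apply: (@filterS3 _ _ (ae_filter_ringOfSetsType mu) _ _ _ _ _ uv (ne 0) (ne 1)) => x /= uvx x0 x1; rewrite in_itv /= => /andP[h0 h1].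
by apply: uvx; rewrite !lt_def x0 h0 eq_sym x1 h1.
Qed.

Lemma wderiv_uniq z w w' : is_wderiv z w -> is_wderiv z w' -> aeeq w w'.
Proof.
move=> /wderiv_ae zw /wderiv_ae zw'; apply: aeeq_oo.
apply: (@filterS2 _ _ (ae_filter_ringOfSetsType mu) _ _ _ _ zw zw') => x h1 h2 x01;
by have [_ <-] := h1 x01; have [_ <-] := h2 x01.
Qed.

Lemma is_wderivD z1 w1 z2 w2 : is_wderiv z1 w1 -> is_wderiv z2 w2 ->
  is_wderiv (z1 + z2) (w1 + w2).
Proof.
move=> [L1w e1] [L2w e2]; split; first exact: L2D.
move=> t t01; have [t0 t1] := andP t01.
rewrite !addfE e1 // e2 //.
have -> : itg 0 t (w1 + w2) = itg 0 t w1 + itg 0 t w2.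
  by rewrite -itgD //; exact: L1_01.
by ring.
Qed.

Lemma is_wderivZ k z w : is_wderiv z w -> is_wderiv (k *: z) (k *: w).
Proof.
move=> [Lw e]; split; first exact: L2Z.
move=> t t01; have [t0 t1] := andP t01.
have -> : itg 0 t (k *: w) = k * itg 0 t w by rewrite -itgZ //; exact: L1_01.
by rewrite !scalefE e // mulrDr.
Qed.

Lemma H1D z1 z2 : H1 z1 -> H1 z2 -> H1 (z1 + z2).
Proof.
move=> [p1 [w1 h1]] [p2 [w2 h2]]; split; last by exists (w1 + w2); exact: is_wderivD.
by move=> u; rewrite !addfE p1 p2.
Qed.

Lemma H1Z k z : H1 z -> H1 (k *: z).
Proof.
move=> [p1 [w1 h1]]; split; last by exists (k *: w1); exact: is_wderivZ.
by move=> u; rewrite !scalefE p1.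
Qed.

Lemma H1_L2 z : H1 z -> L2 z.
Proof. by move=> /H1_continuous; exact: continuous_L2. Qed.

Lemma wderivD z1 z2 : H1 z1 -> H1 z2 ->
  aeeq (wderiv (z1 + z2)) (wderiv z1 + wderiv z2).
Proof.
move=> h1 h2; apply: (@wderiv_uniq (z1 + z2)); first exact/H1_wderiv/H1D.
by apply: is_wderivD; exact: H1_wderiv.
Qed.

Lemma wderivZ k z : H1 z -> aeeq (wderiv (k *: z)) (k *: wderiv z).
Proof.
move=> h1; apply: (@wderiv_uniq (k *: z)); first exact/H1_wderiv/H1Z.
by apply: is_wderivZ; exact: H1_wderiv.
Qed.

Lemma C1_wderiv z v : (forall x, der z x (v x)) -> continuous v -> is_wderiv z v.
Proof.
move=> zv cv; split; first exact: continuous_L2.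
move=> t /andP[t0 t1]; rewrite (@itg_der v z) //; first by ring.
by apply: continuous_subspaceT => x; exact: derivable_continuous (zv x).
Qed.

(** The function [u v - int (u v' + u' v)] changes on an interval of length [d] by at most
    [sqrt d] times an integral over that interval, because [u] and [v] are Hoelder continuous
    with exponent 1/2. Adding over the intervals of a partition of mesh [1/n] bounds its total
    change by a constant times [n^(-1/2)]. *)
Lemma wderiv_parts u u' v v' : is_wderiv u u' -> is_wderiv v v' ->
  continuous u -> continuous v ->
  ip u v' + ip u' v = u 1 * v 1 - u 0 * v 0.
Proof.
move=> uu' vv' cu cv; have [Lu uE] := uu'; have [Lv vE] := vv'.
pose p x := u x * v' x + u' x * v x; pose m x := `|u' x| + `|v' x|.
have Lp : L1 0 1 p by apply: L1D; apply: L2_mul => //; exact: continuous_L2.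
have Lm : L1 0 1 m by apply: L1D; apply: L1_norm; exact: L2_L1.
have Lcst k a b : L1 a b (fun=> k : R) by apply: continuous_L1; exact: cst_continuous.
pose C := nrm u' + nrm v'.
have C0 : 0 <= C by rewrite addr_ge0 // nrm_ge0.
have step a b : 0 <= a -> a <= b -> b <= 1 ->
    `|u b * v b - u a * v a - itg a b p| <= Num.sqrt (b - a) * C * itg a b m.
  move=> a0 ab b1.
  have La f : L1 0 1 f -> L1 a b f by exact: L1_sub.
  have Lu1 : L1 a b u' by apply/La/L2_L1.
  have Lv1 : L1 a b v' by apply/La/L2_L1.
  have Lr : L1 a b (fun x => u b * v' x + v a * u' x) by apply: L1D; exact: L1Z.
  have -> : u b * v b - u a * v a = itg a b (fun x => u b * v' x + v a * u' x).
    rewrite itgD ?itgZ //; try exact: L1Z.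
    have E (z w : R -> R) : is_wderiv z w -> itg a b w = z b - z a.
      move=> [Lw zE]; have [a1 b0] : a <= 1 /\ 0 <= b by split; lra.
      rewrite (zE b) ?b0 // (zE a) ?a0 // (@itg_split _ w 0 a b) //; last exact: L1_01.
      by ring.
    by rewrite (E _ _ uu') (E _ _ vv'); ring.
  rewrite -itgB //; last exact: La.
  apply: (le_trans (norm_itg _)); first by apply: L1B => //; exact: La.
  rewrite -itgZ; last exact: La.
  apply: itg_le.
  - by apply: L1_norm; apply: L1B => //; exact: La.
  - by apply: L1Z; exact: La.
  move=> x /andP[ax xb]; rewrite /p /m.
  have -> : u b * v' x + v a * u' x - (u x * v' x + u' x * v x) =
     (u b - u x) * v' x - (v x - v a) * u' x by ring.
  rewrite (le_trans (ler_normB _ _)) // !normrM.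
  have hol (z w : R -> R) s t : is_wderiv z w -> a <= s -> s <= t -> t <= b ->
      `|z t - z s| <= Num.sqrt (b - a) * nrm w.
    move=> zw s0 st t1; rewrite (le_trans (wderiv_holder zw _ _ _)) //; try lra.
    rewrite ler_wpM2r ?nrm_ge0 // ler_wsqrtr //; lra.
  have h1 := hol _ _ x b uu' ax xb (lexx _).
  have h2 := hol _ _ a x vv' (lexx _) ax xb.
  have n1 := normr_ge0 (u' x); have n2 := normr_ge0 (v' x).
  have S0 := sqrtr_ge0 (b - a).
  have nu := nrm_ge0 u'; have nv := nrm_ge0 v'.
  rewrite mulrDr addrC; apply: lerD.
    apply: (le_trans (ler_wpM2r n1 h2)).
    by rewrite ler_wpM2r // ler_wpM2l // /C lerDr.
  apply: (le_trans (ler_wpM2r n2 h1)).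
  by rewrite ler_wpM2r // ler_wpM2l // /C lerDl.
clearbody C.
pose M := itg 0 1 m.
have M0 : 0 <= M by apply: itg_ge0 => x _; rewrite addr_ge0.
have bound n : `|u 1 * v 1 - u 0 * v 0 - itg 0 1 p| <=
    Num.sqrt (n.+1%:R^-1) * C * M.
  pose x k : R := k%:R / n.+1%:R.
  have n0 : 0 < n.+1%:R :> R by rewrite ltr0n.
  have x0 k : 0 <= x k by rewrite divr_ge0 // ltW.
  have xn : x n.+1 = 1 by rewrite /x divff // gt_eqF.
  have xS k : x k.+1 = x k + n.+1%:R^-1 by rewrite /x -(natr1 k) mulrDl mul1r.
  have xle k : x k <= x k.+1 by rewrite xS lerDl invr_ge0 ltW.
  (* the errors of the subintervals add up, their integral factors being additive *)
  have ind k : (k <= n.+1)%N -> `|u (x k) * v (x k) - u 0 * v 0 - itg 0 (x k) p| <=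
      Num.sqrt (n.+1%:R^-1) * C * itg 0 (x k) m.
    elim: k => [_|k IH kn].
      by rewrite /x mul0r !itg_aa subrr subr0 normr0 mulr0.
    have x1 : x k.+1 <= 1 by rewrite -xn ler_pM2r ?invr_gt0 // ler_nat.
    have := IH (ltnW kn); have := step (x k) (x k.+1) (x0 k) (xle k) x1.
    rewrite [in Num.sqrt (x k.+1 - x k)]xS [in x k + _ - _]addrAC subrr add0r.
    have sp f : L1 0 1 f -> itg 0 (x k.+1) f = itg 0 (x k) f + itg (x k) (x k.+1) f.
      by move=> Lf; apply: itg_split => //; apply: L1_sub Lf.
    rewrite !sp // mulrDr => h1 h2.
    apply: (le_trans _ (lerD h2 h1)).
    apply: (le_trans _ (ler_normD _ _)); rewrite le_eqVlt; apply/orP; left; apply/eqP.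
    by congr `| _ |; ring.
  by have := ind n.+1 (leqnn _); rewrite xn.
have -> : ip u v' + ip u' v = itg 0 1 p.
  by rewrite itgD //; apply: L2_mul => //; exact: continuous_L2.
apply/eqP; rewrite eq_sym -subr_eq0 -normr_eq0 eq_le normr_ge0 andbT.
rewrite leNgt; apply/negP; set D := `| _ | in bound * => D0.
set K := C * M; have D2 : 0 < D ^+ 2 by rewrite exprn_gt0.
pose n := Num.bound (K ^+ 2 / D ^+ 2).
have Kn : K ^+ 2 < n%:R * D ^+ 2.
  by rewrite -ltr_pdivrMr // archi_boundP // divr_ge0 // sqr_ge0.
have n0 : 0 < n.+1%:R :> R by rewrite ltr0n.
have := bound n; rewrite -/D -mulrA -/K => DK.
have : D ^+ 2 * n.+1%:R <= K ^+ 2.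
  have s2 : Num.sqrt (n.+1%:R^-1) ^+ 2 * n.+1%:R = 1 :> R.
    by rewrite sqr_sqrtr ?invr_ge0 ?mulVf ?gt_eqF // ltW.
  have DK2 : D ^+ 2 <= (Num.sqrt (n.+1%:R^-1) * K) ^+ 2.
    by rewrite ler_sqr ?nnegrE ?(ltW D0) // (le_trans _ DK) // ltW.
  have := ler_wpM2r (ltW n0) DK2.
  by rewrite exprMn [leRHS]mulrAC s2 mul1r.
by rewrite -natr1 mulrDr mulr1; lra.
Qed.

Lemma H1_parts u u' h : is_wderiv u u' -> continuous u -> u 1 = u 0 -> H1 h ->
  ip u (wderiv h) + ip u' h = 0.
Proof.
move=> uu' cu u01 Hh; have h01 : h 1 = h 0 by rewrite -[in LHS](add0r 1) Hh.1.
rewrite (wderiv_parts uu' (H1_wderiv Hh)) ?u01 ?h01 ?subrr //.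
exact: H1_continuous.
Qed.

Lemma L2_cst c : L2 (fun=> c : R).
Proof. by apply: continuous_L2; cont. Qed.

Lemma ip_cstl c f : L2 f -> ip (fun=> c) f = c * itg 0 1 f.
Proof. by move=> Lf; rewrite /ip itgZ //; exact: L2_L1. Qed.

Lemma prim_wderiv g : L2 g -> is_wderiv (fun t => itg 0 t g) g.
Proof. by move=> Lg; split=> // t _; rewrite itg_aa add0r. Qed.

Lemma periodic_of_fpart f : periodic (fun x => f (fpart x)) 1.
Proof.
move=> x; congr f; rewrite /fpart floorDrz ?rpred1 // floor1 intrD.
by rewrite opprD addrACA subrr addr0.
Qed.

Lemma fpart_id x : 0 <= x < 1 -> fpart x = x.
Proof.
by move=> x01; rewrite /fpart (_ : Num.floor x = 0) ?subr0 //; apply/floor_def; rewrite add0r.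
Qed.

Lemma fpart_extend f t : f 1 = f 0 -> 0 <= t <= 1 -> f (fpart t) = f t.
Proof.
move=> f01 /andP[t0]; rewrite le_eqVlt => /predU1P[->|t1]; last by rewrite fpart_id ?t0.
by rewrite /fpart floor1 subrr f01.
Qed.

Lemma H1_periodize f w : is_wderiv f w -> f 1 = f 0 -> H1 (fun x => f (fpart x)) /\
  is_wderiv (fun x => f (fpart x)) w.
Proof.
move=> [Lw fE] f01; have W : is_wderiv (fun x => f (fpart x)) w.
  split => // t t01; rewrite fpart_extend // fE // (@fpart_extend f 0) //.
  by rewrite lexx ler01.
by split => //; split; [exact: periodic_of_fpart|exists w].
Qed.

(** Testing against the constant 1 gives the mean of [g]. The primitive [G] of [g] is then
    periodic, and integration by parts turns the hypothesis into orthogonality of [w - G] to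
    all derivatives of periodic functions, that is to everything of mean zero; its own
    deviation from its mean is such a function. *)
Lemma du_bois_reymond w g : L2 w -> L2 g ->
  (forall h, H1 h -> ip w (wderiv h) + ip g h = 0) ->
  itg 0 1 g = 0 /\ exists c, aeeq w (fun t => c + itg 0 t g).
Proof.
move=> Lw Lg H.
have H1c c : is_wderiv (fun=> c : R) (0 : R -> R).
  by apply: C1_wderiv; exact: (@cont_cst _ 0).
have Lcst := L2_cst.
have g0 : itg 0 1 g = 0.
  have h1 : H1 (fun=> 1 : R) by split=> //; exists 0.
  have := H _ h1; rewrite (ipC w) (ae_ip (wderiv_uniq (H1_wderiv h1) (H1c 1))) //.
  - by rewrite ip0l add0r ipC ip_cstl // mul1r.
  - by case: (H1_wderiv h1).
  - exact: L20.
split=> //; pose G t := itg 0 t g.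
have WG : is_wderiv G g := prim_wderiv Lg.
have G01 : G 1 = G 0 by rewrite /G g0 itg_aa.
have [HG WG'] := H1_periodize WG G01.
pose G' x := G (fpart x).
have LG : L2 G' := H1_L2 HG.
pose c := itg 0 1 (fun t => w t - G' t); pose phi := w - G' - (fun=> c).
have Lphi : L2 phi by apply: L2B => //; exact: L2B.
have phi0 : itg 0 1 phi = 0.
  have -> : itg 0 1 phi = c - itg 0 1 (fun=> c).
    rewrite /c -itgB //; first exact: (L2_L1 (L2B Lw LG)).
    exact: L2_L1.
  by rewrite itg_cst // subr0 mulr1 subrr.
have [Hh Wh] := H1_periodize (prim_wderiv Lphi) (etrans phi0 (esym (itg_aa phi 0))).
have [LwD _] := H1_wderiv Hh.
have E := wderiv_uniq (H1_wderiv Hh) Wh.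
have : ip phi phi = 0.
  rewrite {1}/phi ipBl // ?ipBl // ?ip_cstl // ?phi0 ?mulr0 ?subr0; last exact: L2B.
  rewrite (ipC w) (ipC G') -!(ae_ip E) // -(ipC w) -(ipC G').
  have := H _ Hh.
  have G'01 : G' 1 = G' 0 by have := HG.1 0; rewrite add0r.
  have := H1_parts WG' (H1_continuous HG) G'01 Hh.
  by lra.
move=> /(nsq_eq0 Lphi) phiE; exists c.
have G'E : aeeq G' G by apply: aeeq_eq => t t01; exact: fpart_extend.
apply: (@filterS2 _ _ (ae_filter_ringOfSetsType mu) _ _ _ _ phiE G'E).
move=> t /= h1 h2 tI; have := h1 tI; rewrite /phi !addfE !oppfE (h2 tI).
by move=> /eqP; rewrite subr_eq0 => /eqP <-; rewrite subrK.
Qed.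
End sobolev.

Opaque wderiv.

(** * The Hamiltonian action and its Legendre transform *)

Section legendre.
Variable R : realType.
Local Notation mu := (@lebesgue_measure R).
Local Notation F := (R -> R).
Local Notation F2 := (F * F)%type.
Implicit Types (f g h z w u v : R -> R) (a b c e x t r : R).

Lemma frechet_of_quadratic (E : lmodType R) (V : set E) (N : E -> R) (f : E -> R)
    (x : E) (L : E -> R) (C0 C d0 : R) :
  (forall (a : R) (h k : E), V h -> V k -> L (a *: h + k) = a * L h + L k) ->
  (forall h : E, V h -> `|L h| <= C0 * N h) -> 0 < d0 -> (forall h : E, 0 <= N h) ->
  (forall h : E, V h -> N h < d0 -> `|f (x + h) - f x - L h| <= C * N h ^+ 2) ->
  is_frechet V N f x L.
Proof.
move=> Llin Lb d00 N0 H; split=> //; first by exists C0.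
move=> e e0; exists (Num.min d0 (e / (`|C| + 1))).
  by rewrite lt_min d00 divr_gt0 // ltr_wpDl.
move=> h Vh; rewrite lt_min => /andP[hd0]; rewrite ltr_pdivlMr ?ltr_wpDl // => he.
rewrite (le_trans (H h Vh hd0)) // expr2 mulrA ler_wpM2r ?N0 //.
have := ler_norm C; have := N0 h; nra.
Qed.

(** Both remainders are small compared with [t] along the ray [t h], so the two linear maps
    agree on [h]. *)
Lemma frechet_uniq (E : lmodType R) (V : set E) (N : E -> R) (f : E -> R)
    (x : E) (L L' : E -> R) :
  (forall h : E, 0 <= N h) ->
  (forall (t : R) (h : E), V h -> V (t *: h) /\ N (t *: h) = `|t| * N h) ->
  is_frechet V N f x L -> is_frechet V N f x L' -> forall h : E, V h -> L h = L' h.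
Proof.
move=> N0 hom [Llin _ Le] [Llin' _ Le'] h Vh.
have V0 : V 0 by have [] := hom 0 h Vh; rewrite scale0r.
have scal (M : E -> R) (t : R) : (forall (a : R) (h k : E), V h -> V k -> M (a *: h + k) = a * M h + M k) ->
    M (t *: h) = t * M h.
  move=> Ml; have := Ml 1 0 0 V0 V0; rewrite scale1r addr0 mul1r => M0.
  by rewrite -[t *: h]addr0 Ml //; lra.
apply/eqP; rewrite -subr_eq0 -normr_le0.
apply/ler_addgt0Pl => e e0; rewrite addr0.
have Nh1 : 0 < N h + 1 by rewrite ltr_wpDl.
have e2 : 0 < e / (2 * (N h + 1)) by rewrite divr_gt0 // mulr_gt0.
have [d d0 H] := Le _ e2; have [d' d0' H'] := Le' _ e2.
pose t := Num.min d d' / (2 * (N h + 1)).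
have m0 : 0 < Num.min d d' by rewrite lt_min d0.
have t0 : 0 < t by rewrite divr_gt0 // mulr_gt0.
have [Vt Nt] := hom t h Vh; rewrite (gtr0_norm t0) in Nt.
have : N (t *: h) < Num.min d d'.
  rewrite Nt /t mulrAC ltr_pdivrMr ?mulr_gt0 // ltr_pM2l //.
  by have := N0 h; lra.
rewrite lt_min => /andP[/(H _ Vt) h1 /(H' _ Vt) h2].
rewrite (scal L t Llin) Nt in h1; rewrite (scal L' t Llin') Nt in h2.
set D := f (x + t *: h) - f x in h1 h2.
have : t * `|L h - L' h| <= t * e.
  rewrite -{1}(gtr0_norm t0) -normrM.
  have -> : t * (L h - L' h) = (D - t * L' h) - (D - t * L h) by ring.
  rewrite (le_trans (ler_normB _ _)) // (le_trans (lerD h2 h1)) //.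
  have -> : e / (2 * (N h + 1)) * (t * N h) + e / (2 * (N h + 1)) * (t * N h)
    = t * (e * (N h / (N h + 1))) by field; rewrite gt_eqF.
  rewrite ler_pM2l // ler_piMr ?(ltW e0) // ler_pdivrMr // mul1r; lra.
by rewrite ler_pM2l.
Qed.

Implicit Types (Z H W K eta : F2).

Lemma pairDE (A B : nmodType) (p q : A * B) : ((p + q).1 = p.1 + q.1) * ((p + q).2 = p.2 + q.2).
Proof. by []. Qed.

Lemma pairZE (p : F2) t : ((t *: p).1 = t *: p.1) * ((t *: p).2 = t *: p.2).
Proof. by []. Qed.

Lemma normL2_sq W : normL2 W ^+ 2 = nsq W.1 + nsq W.2.
Proof. by rewrite sqr_sqrtr // addr_ge0 // nsq_ge0. Qed.

Lemma normH1_sq Z : normH1 Z ^+ 2 =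
  nsq Z.1 + nsq Z.2 + nsq (wderiv Z.1) + nsq (wderiv Z.2).
Proof.
rewrite sqr_sqrtr; first by rewrite /ip2 addrA.
by rewrite !addr_ge0 // nsq_ge0.
Qed.

Lemma normL2_ge0 W : 0 <= normL2 W. Proof. exact: sqrtr_ge0. Qed.
Lemma normH1_ge0 Z : 0 <= normH1 Z. Proof. exact: sqrtr_ge0. Qed.
Lemma normH1L2_ge0 (X : F2 * F2) : 0 <= normH1L2 X. Proof. exact: sqrtr_ge0. Qed.

Lemma normH1L2_sq (X : F2 * F2) : normH1L2 X ^+ 2 = normH1 X.1 ^+ 2 + normL2 X.2 ^+ 2.
Proof. by rewrite sqr_sqrtr // addr_ge0 // sqr_ge0. Qed.

Lemma le_of_sq a b : 0 <= b -> a ^+ 2 <= b ^+ 2 -> a <= b.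
Proof.
by move=> b0 ab; have [/ltW //|ba] := ltP a b; move: ab; rewrite ler_sqr // nnegrE // (le_trans b0).
Qed.

Lemma nrm_normL2 W : nrm W.1 <= normL2 W /\ nrm W.2 <= normL2 W.
Proof.
by split; apply: le_of_sq; rewrite ?normL2_ge0 // nrm_sq normL2_sq;
  have := nsq_ge0 W.1; have := nsq_ge0 W.2; lra.
Qed.

Lemma nrm_normH1 Z : [/\ nrm Z.1 <= normH1 Z, nrm Z.2 <= normH1 Z,
  nrm (wderiv Z.1) <= normH1 Z & nrm (wderiv Z.2) <= normH1 Z].
Proof.
by split; apply: le_of_sq; rewrite ?normH1_ge0 // nrm_sq normH1_sq;
  move: (nsq_ge0 Z.1) (nsq_ge0 Z.2) (nsq_ge0 (wderiv Z.1)) (nsq_ge0 (wderiv Z.2));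
  clear; lra.
Qed.

Lemma norm_normH1L2 (X : F2 * F2) : normH1 X.1 <= normH1L2 X /\ normL2 X.2 <= normH1L2 X.
Proof.
by split; apply: le_of_sq; rewrite ?normH1L2_ge0 // normH1L2_sq;
  have := sqr_ge0 (normH1 X.1); have := sqr_ge0 (normL2 X.2); lra.
Qed.

Lemma normH1_sup Z t : H1sq Z -> 0 <= t <= 1 ->
  `|Z.1 t| <= 2 * normH1 Z /\ `|Z.2 t| <= 2 * normH1 Z.
Proof.
move=> [H1 H2] t01; have [a1 a2 a3 a4] := nrm_normH1 Z.
have := H1_sup (H1_wderiv H1) (H1_L2 H1) t01.
have := H1_sup (H1_wderiv H2) (H1_L2 H2) t01.
move=> h1 h2; move: a1 a2 a3 a4 h1 h2; move: (nrm _) (nrm _) (nrm _) (nrm _) (normH1 Z) (`|_|) (`|_|).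
by clear; move=> *; split; lra.
Qed.

Lemma L2sq_scale t W : L2sq W -> L2sq (t *: W) /\ normL2 (t *: W) = `|t| * normL2 W.
Proof.
move=> [L1w L2w]; split; first by split; exact: L2Z.
rewrite -sqrtr_sqr -sqrtrM ?sqr_ge0 //; congr Num.sqrt.
by rewrite /ip2 -!/(nsq _) !nsqZ //; ring.
Qed.

Lemma nsq_wderivZ t h : H1 h -> nsq (wderiv (t *: h)) = t ^+ 2 * nsq (wderiv h).
Proof.
move=> Hh; have [Lw _] := H1_wderiv Hh.
rewrite (ae_nsq (wderivZ t Hh)) ?nsqZ //; last exact: L2Z.
by case: (H1_wderiv (H1Z t Hh)).
Qed.

Lemma H1sq_scale t Z : H1sq Z -> H1sq (t *: Z) /\ normH1 (t *: Z) = `|t| * normH1 Z.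
Proof.
move=> [L1w L2w]; split; first by split; exact: H1Z.
rewrite -sqrtr_sqr -sqrtrM ?sqr_ge0 //; congr Num.sqrt.
have -> : ip2 (t *: Z) (t *: Z) = nsq (t *: Z.1) + nsq (t *: Z.2) by [].
have -> : ip2 (wderiv2 (t *: Z)) (wderiv2 (t *: Z)) =
  nsq (wderiv (t *: Z.1)) + nsq (wderiv (t *: Z.2)) by [].
rewrite (nsq_wderivZ t L1w) (nsq_wderivZ t L2w).
rewrite (nsqZ t (H1_L2 L1w)) (nsqZ t (H1_L2 L2w)) /ip2 /= /nsq.
by ring.
Qed.

Lemma H1L2_scale t (X : F2 * F2) : H1L2 X ->
  H1L2 (t *: X) /\ normH1L2 (t *: X) = `|t| * normH1L2 X.
Proof.
move=> [h1 h2]; have [a1 a2] := H1sq_scale t h1; have [b1 b2] := L2sq_scale t h2.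
split; first by split.
rewrite -sqrtr_sqr -sqrtrM ?sqr_ge0 //; congr Num.sqrt.
by rewrite a2 b2 !exprMn real_normK ?num_real //; ring.
Qed.

Lemma L2sqD W K : L2sq W -> L2sq K -> L2sq (W + K).
Proof. by move=> [a b] [c d]; split; exact: L2D. Qed.

Lemma H1sqD W K : H1sq W -> H1sq K -> H1sq (W + K).
Proof. by move=> [a b] [c d]; split; exact: H1D. Qed.

Lemma L2sq_wderiv Z : H1sq Z -> L2sq (wderiv2 Z).
Proof. by move=> [a b]; split; [case: (H1_wderiv a)|case: (H1_wderiv b)]. Qed.

Lemma H1sq_L2sq Z : H1sq Z -> L2sq Z.
Proof. by move=> [a b]; split; exact: H1_L2. Qed.

Lemma ip2_lin W : L2sq W -> forall a H K, L2sq H -> L2sq K ->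
  ip2 W (a *: H + K) = a * ip2 W H + ip2 W K.
Proof.
move=> [a b] t H K [c d] [p q]; rewrite /ip2 !pairDE !pairZE.
by rewrite !ipDr ?ipZr //; [ring|exact: L2Z..].
Qed.

Lemma ip2_bound W H : L2sq W -> L2sq H -> `|ip2 W H| <= 2 * normL2 W * normL2 H.
Proof.
move=> [a b] [c d]; rewrite /ip2 (le_trans (ler_normD _ _)) //.
have := cauchy_schwarz a c; have := cauchy_schwarz b d.
have [w1 w2] := nrm_normL2 W; have [h1 h2] := nrm_normL2 H.
have := nrm_ge0 W.1; have := nrm_ge0 W.2; have := nrm_ge0 H.1; have := nrm_ge0 H.2.
move=> p1 p2 p3 p4 e1 e2.
have := ler_pM p4 p2 w1 h1; have := ler_pM p3 p1 w2 h2; lra.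
Qed.

Lemma aeeq2_ip2 W W' K : aeeq2 W W' -> L2sq W -> L2sq W' -> L2sq K ->
  ip2 W K = ip2 W' K.
Proof. by move=> [a b] [c d] [p q] [s t]; rewrite /ip2 (ae_ip a) ?(ae_ip b). Qed.

Lemma ip2_eq_ae W W' : L2sq W -> L2sq W' -> (forall K, L2sq K -> ip2 W K = ip2 W' K) ->
  aeeq2 W W'.
Proof.
move=> [a b] [c d] E.
have D1 : L2 (W.1 - W'.1) by exact: L2B.
have D2 : L2 (W.2 - W'.2) by exact: L2B.
have := E (W.1 - W'.1, W.2 - W'.2) (conj D1 D2).
rewrite /ip2 /= => {}E.
have : nsq (W.1 - W'.1) + nsq (W.2 - W'.2) = 0.
  by rewrite /nsq ipBl // (ipBl b) //; lra.
have := nsq_ge0 (W.1 - W'.1); have := nsq_ge0 (W.2 - W'.2) => h1 h2 h.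
by split; apply/aeeq_nsqB => //; lra.
Qed.

Lemma L2_scl c f : L2 f -> L2 (scl c f).
Proof. exact: L2Z. Qed.

Lemma ip_scll c f g : L2 f -> L2 g -> ip (scl c f) g = c * ip f g.
Proof. exact: ipZl. Qed.

Lemma nsq_scl c f : L2 f -> nsq (scl c f) = c ^+ 2 * nsq f.
Proof. exact: nsqZ. Qed.

Lemma L2sq_momentum Z W : L2sq W -> L2sq (momentum Z W).
Proof. by move=> [a b]; split; exact: L2_scl. Qed.

Lemma L2sq_velocity Z W : L2sq W -> L2sq (velocity Z W).
Proof. by move=> [a b]; split; exact: L2_scl. Qed.

Lemma HamE r Z eta : 0 < nsq Z.1 -> 0 < nsq Z.2 -> L2sq eta ->
  Ham r (Z, eta) =
    (nsq eta.1 / (8 * nsq Z.1) - 2 / nsq Z.1) + (nsq eta.2 / (8 * nsq Z.2) - 2 / nsq Z.2)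
    - r * Ifun Z - (1 - r) * Afun Z.
Proof.
move=> N1 N2 [L1e L2e]; rewrite /Ham /Lagr /Lfun1 /ip2 /velocity /= !nrm_sq.
rewrite ![ip _ (scl _ _)]ipC !ip_scll // !nsq_scl // -!/(nsq _).
by field; rewrite !gt_eqF.
Qed.

(** The Lagrangian is quadratic in the velocity, so its gradient is read off from the square;
    uniqueness of gradients gives the converse. *)
Lemma Lagr_grad r Z W eta : 0 < nsq Z.1 -> 0 < nsq Z.2 -> L2sq eta -> L2sq W ->
  is_grad (Lagr r Z) W eta <-> aeeq2 W (velocity Z eta).
Proof.
move=> N1 N2 Le Lw; have [Le1 Le2] := Le; have [Lw1 Lw2] := Lw.
have LM := L2sq_momentum Z Lw.
have G : is_frechet (@L2sq R) (@normL2 R) (Lagr r Z) W (ip2 (momentum Z W)).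
  apply: (@frechet_of_quadratic _ _ _ _ _ _ (2 * normL2 (momentum Z W))
    (2 * (nsq Z.1 + nsq Z.2)) 1).
  - exact: ip2_lin.
  - by move=> h Lh; exact: ip2_bound.
  - exact: ltr01.
  - exact: normL2_ge0.
  - move=> h [Lh1 Lh2] _; rewrite /Lagr /Lfun1 /ip2 /momentum /= !nrm_sq.
    rewrite !nsqD // !ip_scll // normL2_sq.
    rewrite [X in `|X|](_ : _ = 2 * nsq Z.1 * nsq h.1 + 2 * nsq Z.2 * nsq h.2);
      last by ring.
    have h1 := nsq_ge0 h.1; have h2 := nsq_ge0 h.2.
    rewrite ger0_norm; last by rewrite addr_ge0 // mulr_ge0 // mulr_ge0 // ltW.
    by have := mulr_ge0 (ltW N1) h2; have := mulr_ge0 (ltW N2) h1; lra.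
have N10 : nsq Z.1 != 0 by rewrite gt_eqF.
have N20 : nsq Z.2 != 0 by rewrite gt_eqF.
have scK (c : R) f g : c != 0 -> aeeq f (scl c^-1 g) <-> aeeq g (scl c f).
  move=> c0; split; apply: filterS => x /= fg Dx; rewrite /scl fg //.
    by rewrite /scl mulrA divff // mul1r.
  by rewrite /scl mulrA mulVf // mul1r.
have vm : aeeq2 W (velocity Z eta) <-> aeeq2 eta (momentum Z W).
  rewrite /aeeq2 /velocity /momentum /= !nrm_sq.
  by split=> -[a b]; split; apply/scK => //; rewrite mulf_neq0.
rewrite vm; split=> [[_ G']|E].
  apply: ip2_eq_ae => // K LK.
  by apply: (frechet_uniq _ _ G' G LK); [exact: normL2_ge0|exact: L2sq_scale].
split=> //; case: G => G1 G2 G3.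
have EE (h : F2) : L2sq h -> ip2 eta h = ip2 (momentum Z W) h by move=> Lh; exact: aeeq2_ip2.
split; first exact: ip2_lin.
  by have [C GC] := G2; exists C => h Lh; rewrite EE ?GC.
by move=> e e0; have [d d0 Gd] := G3 e e0; exists d => // h Lh; rewrite EE //; exact: Gd.
Qed.

Lemma Ham_grad r Z eta : 0 < nsq Z.1 -> 0 < nsq Z.2 -> L2sq eta ->
  is_grad (fun eta' => Ham r (Z, eta')) eta (velocity Z eta).
Proof.
move=> N1 N2 Le; have [Le1 Le2] := Le.
have Lv := L2sq_velocity Z Le.
split=> //; apply: (@frechet_of_quadratic _ _ _ _ _ _ (2 * normL2 (velocity Z eta))
    ((8 * nsq Z.1)^-1 + (8 * nsq Z.2)^-1) 1).
- exact: ip2_lin.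
- by move=> h Lh; exact: ip2_bound.
- exact: ltr01.
- exact: normL2_ge0.
move=> h Lh _; have [Lh1 Lh2] := Lh; rewrite !HamE //; last exact: L2sqD.
rewrite /ip2 /velocity /= !nrm_sq !nsqD // !ip_scll // normL2_sq.
rewrite [X in `|X|](_ : _ = (8 * nsq Z.1)^-1 * nsq h.1 + (8 * nsq Z.2)^-1 * nsq h.2);
  last by field; rewrite !gt_eqF.
have h1 := nsq_ge0 h.1; have h2 := nsq_ge0 h.2.
have i1 : 0 <= (8 * nsq Z.1)^-1 by rewrite invr_ge0 mulr_ge0 // ltW.
have i2 : 0 <= (8 * nsq Z.2)^-1 by rewrite invr_ge0 mulr_ge0 // ltW.
rewrite ger0_norm; last by rewrite addr_ge0 // mulr_ge0.
by have := mulr_ge0 i1 h2; have := mulr_ge0 i2 h1; lra.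
Qed.

Lemma nsq_add_le f g : L2 f -> L2 g -> nsq (f + g) <= 2 * nsq f + 2 * nsq g.
Proof.
move=> Lf Lg; have := nsq_ge0 (f - g); rewrite !nsqD //; last exact: L2N.
have := ipZr (-1) Lg Lf; rewrite scaleN1r => ->.
by have := nsqZ (-1) Lg; rewrite scaleN1r => ->; lra.
Qed.

Lemma H1in_nsq Z : H1in Z -> 0 < nsq Z.1 /\ 0 < nsq Z.2.
Proof. by case=> _ n1 n2 _; rewrite -!nrm_gt0. Qed.

(** Deviation of a momentum from the one belonging to the velocity of [z]. *)
Definition defect z f := f - scl (4 * nsq z) (wderiv z).

(** Completing the square in the momenta: the action is [Bfun] minus weighted squares of the
    defects. All of the correspondence between the two critical point problems comes from this
    identity. *)
Lemma actionE r Z eta : H1sq Z -> 0 < nsq Z.1 -> 0 < nsq Z.2 -> L2sq eta ->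
  action r (Z, eta) = Bfun r Z - nsq (defect Z.1 eta.1) / (8 * nsq Z.1)
                               - nsq (defect Z.2 eta.2) / (8 * nsq Z.2).
Proof.
move=> [h1 h2] N1 N2 Le; have [e1 e2] := Le.
have [w1 _] := H1_wderiv h1; have [w2 _] := H1_wderiv h2.
have D z f : L2 f -> L2 (wderiv z) -> nsq (defect z f) =
    nsq f - 2 * (4 * nsq z) * ip f (wderiv z) + (4 * nsq z) ^+ 2 * nsq (wderiv z).
  move=> Lf Lz; rewrite /defect nsqD ?nsq_scl //; last exact/L2N/L2_scl.
  have Ls := L2_scl (4 * nsq z) Lz.
  rewrite ipC ipNl // ip_scll // (ipC _ f).
  by have := nsqZ (-1) Ls; rewrite scaleN1r nsq_scl // => ->; ring.
rewrite !D // /action HamE // /Bfun /Qfun !nrm_sq /ip2 /=.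
by field; rewrite !gt_eqF.
Qed.

Lemma defect0 z f : nsq (defect z (f - defect z f)) = 0.
Proof.
rewrite (_ : f - _ = scl (4 * nsq z) (wderiv z)); last first.
  by rewrite /defect opprB addrC subrK.
by rewrite /defect subrr /nsq ip0l.
Qed.

Lemma aeeq_defect z f : L2 f -> L2 (wderiv z) ->
  aeeq f (scl (4 * nsq z) (wderiv z)) <-> nsq (defect z f) = 0.
Proof. by move=> Lf Lz; apply: aeeq_nsqB => //; exact: L2_scl. Qed.

Lemma nsq_perturb z h : L2 z -> L2 h -> nrm h <= 1 ->
  `|nsq (z + h) - nsq z| <= (2 * nrm z + 1) * nrm h.
Proof.
move=> Lz Lh h1; rewrite nsqD //.
rewrite (_ : _ - _ = 2 * ip z h + nsq h); last by ring.
rewrite (le_trans (ler_normD _ _)) // normrM ger0_norm // (ger0_norm (nsq_ge0 _)).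
have := cauchy_schwarz Lz Lh; rewrite -(nrm_sq h) expr2.
by have := nrm_ge0 h; move: (nrm z) (nrm h) (`|_|) h1 => a b c *; nra.
Qed.

Lemma nsq_lower z h : L2 z -> L2 h -> 0 < nsq z -> exists2 d, 0 < d &
  forall h, L2 h -> nrm h < d -> nrm h <= 1 /\ nsq z / 2 <= nsq (z + h).
Proof.
move=> Lz _ Nz; pose M := 2 * nrm z + 1.
have M0 : 0 < M by rewrite /M; have := nrm_ge0 z; lra.
exists (Num.min 1 (nsq z / (2 * M))).
  by rewrite lt_min ltr01 divr_gt0 // mulr_gt0.
move=> k Lk; rewrite lt_min => /andP[/ltW k1]; rewrite ltr_pdivlMr ?mulr_gt0 // => kM.
split=> //; have := nsq_perturb Lz Lk k1; rewrite -/M.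
by move=> /ler_normlP[]; move: (nsq (z + k)) => a; nra.
Qed.

(** A vanishing defect stays of first order under a perturbation, so its square is of second
    order and does not contribute to the derivative of the action. *)
Lemma defect_perturb z f : H1 z -> L2 f -> 0 < nsq z -> nsq (defect z f) = 0 ->
  exists2 C, 0 < C & exists2 d, 0 < d & forall h k, H1 h -> L2 k -> nrm h < d ->
    nsq z / 2 <= nsq (z + h) /\
    nsq (defect (z + h) (f + k)) <= C * (nsq k + nsq h + nsq (wderiv h)).
Proof.
move=> Hz Lf Nz D0; have Lz := H1_L2 Hz; have [Lw _] := H1_wderiv Hz.
have fE := (aeeq_defect Lf Lw).2 D0.
have [d d0 Hd] := nsq_lower Lz Lz Nz.
pose N := nsq z; pose M := 2 * nrm z + 1.
have M0 : 0 < M by rewrite /M; have := nrm_ge0 z; lra.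
have w0 := nsq_ge0 (wderiv z).
pose a := (N + M) ^+ 2; pose b := M ^+ 2 * nsq (wderiv z).
have a0 : 0 <= a by exact: sqr_ge0.
have b0 : 0 <= b by rewrite mulr_ge0 // sqr_ge0.
exists (2 + 64 * a + 64 * b); first by lra.
exists d => // h k Hh Lk hd; have Lh := H1_L2 Hh; have [Lv _] := H1_wderiv Hh.
have [h1 lo] := Hd h Lh hd; split=> //.
have per := nsq_perturb Lz Lh h1.
set N' := nsq (z + h) in lo per *; rewrite -/N -/M in per lo.
pose A := scl (4 * N') (wderiv h); pose B := scl (4 * (N' - N)) (wderiv z).
have LA : L2 A by exact: L2_scl.
have LB : L2 B by exact: L2_scl.
have [Lwh _] := H1_wderiv (H1D Hz Hh).
have -> : nsq (defect (z + h) (f + k)) = nsq (k - (A + B)).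
  apply: ae_nsq.
  - apply: (@filterS2 _ _ (ae_filter_ringOfSetsType mu) _ _ _ _ fE (wderivD Hz Hh)).
    move=> x /= e1 e2 xI; rewrite /defect !addfE !oppfE !addfE (e1 xI) /scl (e2 xI).
    by rewrite addfE /A /B /scl -/N -/N'; ring.
  - by apply: L2B; [exact: L2D|exact: L2_scl].
  - by apply: L2B => //; exact: L2D.
have q1 : nsq (k - (A + B)) <= 2 * nsq k + 2 * nsq (A + B).
  have := nsq_add_le Lk (L2N (L2D LA LB)).
  by have := nsqZ (-1) (L2D LA LB); rewrite scaleN1r => ->; lra.
have q2 := nsq_add_le LA LB.
rewrite (nsq_scl _ Lv) (nsq_scl _ Lw) in q2.
have q3 : (N' - N) ^+ 2 <= M ^+ 2 * nsq h.
  by rewrite -nrm_sq -exprMn -real_normK ?num_real // ler_sqr ?nnegrE // mulr_ge0 ?nrm_ge0 // ltW.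
have q4 : N' ^+ 2 <= a.
  rewrite /a ler_sqr ?nnegrE ?nsq_ge0 //; last by rewrite addr_ge0 ?nsq_ge0 ?ltW.
  move/ler_normlP: per => [_]; have := ler_wpM2l (ltW M0) h1; lra.
have q5 := ler_wpM2r (nsq_ge0 (wderiv h)) q4.
have q6 : (N' - N) ^+ 2 * nsq (wderiv z) <= b * nsq h.
  by rewrite /b [leRHS]mulrAC ler_wpM2r.
have := nsq_ge0 k; have := nsq_ge0 h; have := nsq_ge0 (wderiv h).
move: q1 q2 q5 q6; rewrite !exprMn.
move: (nsq (k - _)) (nsq (A + B)) (N' ^+ 2) (nsq k) (nsq h) (nsq (wderiv h)) ((N' - N) ^+ 2) (nsq (wderiv z)).
move: b0; move: b => b; move: a0 {q4}; move: a => a; clear.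
move=> a0 b0 p q n k h w m v q1 q2 q5 q6 w0 h0 k0.
have := mulr_ge0 a0 h0; have := mulr_ge0 a0 k0; have := mulr_ge0 b0 w0.
have := mulr_ge0 b0 k0; move=> *; nra.
Qed.

(** Scaling the momentum along its own defect decreases the action at the rate given by the
    squared defects, so these vanish at a critical point. *)
Lemma crit_action_defect r Z eta : crit_action r (Z, eta) -> L2sq eta ->
  nsq (defect Z.1 eta.1) = 0 /\ nsq (defect Z.2 eta.2) = 0.
Proof.
move=> [[HZ _] [_ _ Fr]] Le; have [hz _ _ _] := HZ; have [N1 N2] := H1in_nsq HZ.
have Lw := L2sq_wderiv hz.
have [e1 e2] := Le; have [w1 w2] := Lw.
pose S := nsq (defect Z.1 eta.1) / (8 * nsq Z.1) + nsq (defect Z.2 eta.2) / (8 * nsq Z.2).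
have s1 : 0 <= nsq (defect Z.1 eta.1) / (8 * nsq Z.1).
  by rewrite divr_ge0 ?nsq_ge0 // mulr_ge0 // ltW.
have s2 : 0 <= nsq (defect Z.2 eta.2) / (8 * nsq Z.2).
  by rewrite divr_ge0 ?nsq_ge0 // mulr_ge0 // ltW.
have LD z f : L2 f -> L2 (wderiv z) -> L2 (defect z f).
  by move=> Lf Lz; apply: L2B => //; exact: L2_scl.
pose k : F2 := (defect Z.1 eta.1, defect Z.2 eta.2).
have Lk : L2sq k by split; exact: LD.
have VX : H1L2 (0 : F2, k).
  split=> //; have [//] := H1sq_scale 0 hz.
  by rewrite scale0r.
suff S0 : S <= 0.
  have [p1 p2] : nsq (defect Z.1 eta.1) / (8 * nsq Z.1) = 0 /\
     nsq (defect Z.2 eta.2) / (8 * nsq Z.2) = 0 by rewrite /S in S0; split; lra.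
  by split; [move/eqP: p1|move/eqP: p2]; rewrite mulf_eq0 invr_eq0 mulf_eq0 ?pnatr_eq0 /= ?(gt_eqF N1)
   ?(gt_eqF N2) ?orbF => /eqP.
have NX0 := normH1L2_ge0 (0 : F2, k); set n := normH1L2 _ in NX0.
apply/ler_addgt0Pl => e e0; rewrite addr0.
have en : 0 < e / (n + 1) by rewrite divr_gt0 // ltr_wpDl.
have [d d0 H] := Fr _ en.
(* the defect grows by the factor [1 + t] along [t k], hence its square by [2 t + t^2] *)
pose t := Num.min 1 (d / (n + 1)) / 2.
have m1 : Num.min 1 (d / (n + 1)) <= 1 by rewrite ge_min lexx.
have m2 : Num.min 1 (d / (n + 1)) <= d / (n + 1) by rewrite ge_min lexx orbT.
have m0 : 0 < Num.min 1 (d / (n + 1)) by rewrite lt_min ltr01 divr_gt0 // ltr_wpDl.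
have t0 : 0 < t by rewrite /t divr_gt0.
have [Vt Nt] := H1L2_scale t VX; rewrite -/n (gtr0_norm t0) in Nt.
have := H _ Vt; rewrite Nt.
have tn : t * n < d.
  have : t * (n + 1) < d by rewrite -ltr_pdivlMr ?ltr_wpDl // /t; lra.
  by move: t0; nra.
move=> /(_ tn); rewrite subr0.
have -> : (Z, eta) + t *: (0, k) = (Z, eta + t *: k).
  by rewrite -[LHS]/(Z + t *: 0, eta + t *: k) scaler0 addr0.
have Lek : L2sq (eta + t *: k) by apply: L2sqD => //; have [] := L2sq_scale t Lk.
rewrite !actionE //=.
have Dt z f : L2 f -> L2 (wderiv z) ->
    nsq (defect z (f + t *: defect z f)) = (1 + t) ^+ 2 * nsq (defect z f).
  move=> Lf Lz; rewrite -nsqZ; last exact: LD.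
  congr nsq; rewrite /defect scalerDl scale1r -!addrA; congr (_ + _); exact: addrC.
rewrite !Dt // => hh.
have : t * S <= t * e.
  have : e / (n + 1) * (t * n) <= t * e.
    have -> : e / (n + 1) * (t * n) = t * (e * (n / (n + 1))) by ring.
    rewrite ler_pM2l // ler_piMr ?(ltW e0) // ler_pdivrMr ?ltr_wpDl // mul1r; lra.
  apply: le_trans; apply: le_trans hh.
  rewrite -normrN; apply: le_trans (ler_norm _).
  rewrite [leRHS](_ : _ = (2 * t + t ^+ 2) * S); last by rewrite /S; ring.
  have S0 : 0 <= S by exact: addr_ge0.
  by rewrite ler_wpM2r //; have := sqr_ge0 t; lra.
by rewrite ler_pM2l.
Qed.

Lemma div_halved a b n m : 0 <= a -> a <= b -> 0 < n -> n / 2 <= m ->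
  0 <= a / (8 * m) <= b / (4 * n).
Proof.
move=> a0 ab n0 nm; have m0 : 0 < m by lra.
have m8 : 0 < 8 * m by lra.
have n4 : 0 < 4 * n by lra.
rewrite divr_ge0 ?(ltW m8) //=.
by rewrite ler_pM ?invr_ge0 ?(ltW m8) // lef_pV2 ?posrE //; lra.
Qed.

(** With zero defect the action and [Bfun] differ to second order. To pass from the action to
    [Bfun] an increment of [z] is accompanied by the increment of the momenta that keeps the
    defect zero; this increment is of the same order. *)
Lemma crit_actionE r Z eta : L2sq eta -> crit_action r (Z, eta) <->
  crit_B r Z /\ aeeq2 eta (momentum Z (wderiv2 Z)).
Proof.
move=> Le; have [e1 e2] := Le.
have aeD : H1in Z -> aeeq2 eta (momentum Z (wderiv2 Z)) <->
    nsq (defect Z.1 eta.1) = 0 /\ nsq (defect Z.2 eta.2) = 0.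
  case=> -[h1 h2] _ _ _; rewrite /aeeq2 /momentum /= !nrm_sq.
  have [w1 _] := H1_wderiv h1; have [w2 _] := H1_wderiv h2.
  by split=> -[a b]; split; apply/aeeq_defect.
have dec : H1in Z -> nsq (defect Z.1 eta.1) = 0 -> nsq (defect Z.2 eta.2) = 0 ->
   exists2 C, 0 < C & exists2 d, 0 < d & forall H K, H1sq H -> L2sq K -> normH1 H < d ->
    [/\ 0 < nsq (Z + H).1, 0 < nsq (Z + H).2,
     0 <= nsq (defect (Z + H).1 (eta + K).1) / (8 * nsq (Z + H).1)
      + nsq (defect (Z + H).2 (eta + K).2) / (8 * nsq (Z + H).2)
        <= C * (normH1 H ^+ 2 + normL2 K ^+ 2) &
     nsq (defect (Z + H).1 (eta + K).1) + nsq (defect (Z + H).2 (eta + K).2)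
        <= C * (normH1 H ^+ 2 + normL2 K ^+ 2)].
  move=> HZ D1 D2; have [[h1 h2] _ _ _] := HZ; have [N1 N2] := H1in_nsq HZ.
  have [C1 C10 [d1 d10 P1]] := defect_perturb h1 e1 N1 D1.
  have [C2 C20 [d2 d20 P2]] := defect_perturb h2 e2 N2 D2.
  pose c1 := C1 / (4 * nsq Z.1); pose c2 := C2 / (4 * nsq Z.2).
  have c10 : 0 < c1 by rewrite divr_gt0 // mulr_gt0.
  have c20 : 0 < c2 by rewrite divr_gt0 // mulr_gt0.
  exists (C1 + C2 + c1 + c2); first by rewrite !addr_gt0.
  exists (Num.min d1 d2); first by rewrite lt_min d10.
  move=> H K [Hh1 Hh2] [k1 k2]; rewrite lt_min => /andP[n1 n2].
  have [a1 a2 _ _] := nrm_normH1 H.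
  have [lo1 b1] := P1 _ _ Hh1 k1 (le_lt_trans a1 n1).
  have [lo2 b2] := P2 _ _ Hh2 k2 (le_lt_trans a2 n2).
  rewrite normH1_sq normL2_sq !pairDE.
  have p1 : 0 < nsq (Z.1 + H.1) by apply: lt_le_trans lo1; rewrite divr_gt0.
  have p2 : 0 < nsq (Z.2 + H.2) by apply: lt_le_trans lo2; rewrite divr_gt0.
  have /andP[f1 g1] := div_halved (nsq_ge0 _) b1 N1 lo1.
  have /andP[f2 g2] := div_halved (nsq_ge0 _) b2 N2 lo2.
  rewrite (mulrAC C1) -/c1 in g1; rewrite (mulrAC C2) -/c2 in g2.
  have s1 := nsq_ge0 H.1; have s2 := nsq_ge0 H.2; have s3 := nsq_ge0 (wderiv H.1).
  have s4 := nsq_ge0 (wderiv H.2); have s5 := nsq_ge0 K.1; have s6 := nsq_ge0 K.2.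
  split=> //.
    rewrite addr_ge0 //=.
    move: g1 g2 s1 s2 s3 s4 s5 s6 C10 C20 c10 c20.
    move: (nsq (defect _ _) / _) (nsq (defect _ _) / _) => A1 A2.
    move: c1 c2 (nsq _) (nsq _) (nsq _) (nsq _) (nsq _) (nsq _).
    clear; move=> *; nra.
  clear f1 f2 g1 g2; move: b1 b2 s1 s2 s3 s4 s5 s6 C10 C20 c10 c20.
  move: (nsq (defect _ _)) (nsq (defect _ _)) => A1 A2.
  move: c1 c2 (nsq _) (nsq _) (nsq _) (nsq _) (nsq _) (nsq _).
  clear; move=> *; nra.
have actB : H1in Z -> nsq (defect Z.1 eta.1) = 0 -> nsq (defect Z.2 eta.2) = 0 ->
    action r (Z, eta) = Bfun r Z.
  move=> HZ D1 D2; have [hz _ _ _] := HZ; have [N1 N2] := H1in_nsq HZ.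
  by rewrite actionE // D1 D2 !mul0r !subr0.
split.
  move=> cA; have [D1 D2] := crit_action_defect cA Le.
  case: cA => -[HZ _] [_ _ Fr]; have [hz _ _ _] := HZ.
  split; last exact/aeD.
  split=> //; split; [by move=> *; rewrite mulr0 addr0|by exists 0 => *; rewrite normr0 mul0r|].
  have [C C0 [d d0 P]] := dec HZ D1 D2.
  move=> e e0; have C1 : 0 < 1 + C by rewrite addr_gt0.
  have [c c0 c2] : exists2 c : R, 0 < c & c ^+ 2 = 1 + C.
    by exists (Num.sqrt (1 + C)); rewrite ?sqrtr_gt0 // sqr_sqrtr // ltW.
  have ec : 0 < e / c by rewrite divr_gt0.
  have [d' d'0 Fd] := Fr _ ec.
  exists (Num.min d (d' / c)); first by rewrite lt_min d0 divr_gt0.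
  move=> H HH; rewrite lt_min => /andP[nd]; rewrite ltr_pdivlMr // => nd'.
  have L20' : L2sq (0 : F2) by split; exact: L20.
  have n00 : normL2 (0 : F2) = 0.
    by have [_] := L2sq_scale 0 L20'; rewrite scale0r normr0 mul0r.
  have [p1 p2 _ b] := P H 0 HH L20' nd.
  rewrite addr0 n00 expr0n addr0 in b.
  have HZH := H1sqD hz HH.
  have [w1 w2] := L2sq_wderiv HZH.
  (* moving the momenta to the ones belonging to [Z + H] *)
  pose K : F2 := (- defect (Z + H).1 eta.1, - defect (Z + H).2 eta.2).
  have LK : L2sq K by split; apply: L2N; apply: L2B => //; exact: L2_scl.
  have nN f : L2 f -> nsq (- f) = nsq f.
    by move=> Lf; have := nsqZ (-1) Lf; rewrite scaleN1r => ->; ring.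
  have nK : normL2 K ^+ 2 <= C * normH1 H ^+ 2.
    by rewrite normL2_sq !nN //; apply: L2B => //; exact: L2_scl.
  have nX : normH1L2 (H, K) <= c * normH1 H.
    apply: le_of_sq; first by rewrite mulr_ge0 ?normH1_ge0 // ltW.
    by rewrite normH1L2_sq /= exprMn c2 mulrDl mul1r lerD2l.
  have nXd : normH1L2 (H, K) < d' by apply: (le_lt_trans nX); rewrite mulrC.
  have := Fd (H, K) (conj HH LK) nXd.
  rewrite !subr0 (actB HZ D1 D2) -[(Z, eta) + (H, K)]/(Z + H, eta + K).
  have LeK : L2sq (eta + K) by exact: L2sqD.
  rewrite (actionE r HZH p1 p2 LeK).
  have z1 : nsq (defect (Z + H).1 (eta + K).1) = 0.
    by have := defect0 (Z + H).1 eta.1.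
  have z2 : nsq (defect (Z + H).2 (eta + K).2) = 0.
    by have := defect0 (Z + H).2 eta.2.
  rewrite z1 z2 !mul0r !subr0 => hh; apply: (le_trans hh).
  have := ler_wpM2l (ltW ec) nX.
  by rewrite mulrA divfK // gt_eqF.
move=> [[HZ [_ _ Fr]] ae]; have [hz _ _ _] := HZ.
have [D1 D2] := (aeD HZ).1 ae.
split; first by split.
split; [by move=> *; rewrite mulr0 addr0|by exists 0 => *; rewrite normr0 mul0r|].
have [C C0 [d d0 P]] := dec HZ D1 D2.
move=> e e0; have eh : 0 < e / 2 by lra.
have [d' d'0 Fd] := Fr _ eh.
exists (Num.min (Num.min d d') (e / (2 * C))).
  by rewrite !lt_min d0 d'0 divr_gt0 // mulr_gt0.
move=> [H K] [/= HH LK]; rewrite !lt_min ltr_pdivlMr ?mulr_gt0 // => /andP[/andP[n1 n2] n3].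
have [a1 a2] := norm_normH1L2 (H, K); rewrite /= in a1 a2.
have [p1 p2 /andP[q0 q] _] := P H K HH LK (le_lt_trans a1 n1).
have := Fd H HH (le_lt_trans a1 n2).
rewrite !subr0 (actB HZ D1 D2) -[(Z, eta) + (H, K)]/(Z + H, eta + K).
rewrite actionE //; [|exact: H1sqD|exact: L2sqD].
have := normH1L2_sq (H, K); rewrite /= => E; rewrite -E in q.
move: (normH1L2_ge0 (H, K)) q0 q a1 n3; rewrite /=.
move: (nsq (defect _ _) / _) (nsq (defect _ _) / _) (normH1L2 _) (normH1 H).
move: (Bfun r _) (Bfun r _) C0 e0; clear.
move=> b b' C0 e0 A1 A2 n m n0 q0 q mn n3 /ler_normlP[h1 h2].
by apply/ler_normlP; split; nra.
Qed.

(** The action is the bilinear pairing of [eta] with the velocity minus the Hamiltonian, and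
    for momenta in [H^1] the pairing can be integrated by parts: its derivative is [(- eta',
    z')]. So being critical means that the Hamiltonian has this gradient. *)
Lemma hamilton_critE r Z eta : H1sq eta ->
  hamilton_solution r (Z, eta) <-> crit_action r (Z, eta).
Proof.
move=> He; have Le := H1sq_L2sq He; have Lwe := L2sq_wderiv He.
have parts H : H1sq H -> ip2 eta (wderiv2 H) = - ip2 (wderiv2 eta) H.
  move=> [h1 h2]; case: (He) => k1 k2; rewrite /ip2 /=.
  have E f h : H1 f -> H1 h -> ip f (wderiv h) + ip (wderiv f) h = 0.
    move=> Hf Hh; apply: H1_parts => //; [exact: H1_wderiv|exact: H1_continuous|].
    by have := Hf.1 0; rewrite add0r.
  by have := E _ _ k1 h1; have := E _ _ k2 h2; lra.
have quad H K : H1sq Z -> H1sq H -> L2sq K ->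
    `|ip2 (eta + K) (wderiv2 (Z + H)) - ip2 eta (wderiv2 Z) -
      (ip2 eta (wderiv2 H) + ip2 K (wderiv2 Z))| <= 2 * normH1L2 (H, K) ^+ 2.
  move=> hz hh LK; have Lwz := L2sq_wderiv hz; have Lwh := L2sq_wderiv hh.
  have LeK := L2sqD Le LK.
  have DW : aeeq2 (wderiv2 (Z + H)) (wderiv2 Z + wderiv2 H).
    by case: hz => z1 z2; case: hh => h1 h2; split; exact: wderivD.
  have C (W W' : F2) : ip2 W W' = ip2 W' W by rewrite /ip2 !(ipC W.1) !(ipC W.2).
  rewrite C (aeeq2_ip2 DW) //; [|exact: L2sq_wderiv (H1sqD hz hh)|exact: L2sqD].
  have lin W V V' : L2sq W -> L2sq V -> L2sq V' -> ip2 W (V + V') = ip2 W V + ip2 W V'.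
    by move=> LW LV LV'; have := ip2_lin LW 1 LV LV'; rewrite scale1r mul1r.
  rewrite C lin // !(C (eta + K)) !lin // !(C _ eta) !(C _ K).
  rewrite [X in `|X|](_ : _ = ip2 K (wderiv2 H)); last by ring.
  rewrite (le_trans (ip2_bound LK Lwh)) //.
  have [a1 a2] := norm_normH1L2 (H, K); rewrite /= in a1 a2.
  have b1 : normL2 (wderiv2 H) <= normH1 H.
    apply: le_of_sq; rewrite ?normH1_ge0 // normL2_sq normH1_sq /=.
    by have := nsq_ge0 H.1; have := nsq_ge0 H.2; lra.
  have := normL2_ge0 K; have := normL2_ge0 (wderiv2 H).
  have := normH1_ge0 H.
  move: (normL2 K) (normL2 _) (normH1 H) (normH1L2 _) a1 a2 b1; clear; move=> *; nra.
have lin0 : forall (a : R) (h k : F2 * F2), H1L2 h -> H1L2 k -> (0:R) = a * 0 + 0.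
  by move=> *; rewrite mulr0 addr0.
split.
  move=> [HZ _ [G [[LG1 LG2 [_ _ Fr]] ae1 ae2]]]; rewrite /= in HZ ae1 ae2.
  have [hz _ _ _] := HZ; have Lwz := L2sq_wderiv hz.
  split; first by split.
  split => //; first by exists 0 => *; rewrite normr0 mul0r.
  move=> e e0; have e2 : 0 < e / 2 by lra.
  have [d d0 Fd] := Fr _ e2.
  exists (Num.min d (e / 4)); first by rewrite lt_min d0 /=; lra.
  move=> [H K] [/= HH LK]; rewrite lt_min => /andP[n1 n2].
  have := Fd (H, K) (conj HH LK) n1; have := quad H K hz HH LK.
  rewrite /action /= (parts H HH) !subr0.
  have -> : ip2 (wderiv2 eta) H = - ip2 G.1 H.
    rewrite (aeeq2_ip2 ae2) //; last exact: H1sq_L2sq.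
      rewrite /ip2 !ipNl //; try by [case: LG1|case: HH => *; exact: H1_L2].
      by rewrite opprD.
    by case: LG1 => *; split; exact: L2N.
  have -> : ip2 K (wderiv2 Z) = ip2 G.2 K.
    by rewrite -(aeeq2_ip2 ae1) //; rewrite /ip2 (ipC K.1) (ipC K.2).
  have := normH1L2_ge0 (H, K); move: (normH1L2 _) n2 => n n2 n0.
  rewrite opprK -[(Z, eta) + (H, K)]/(Z + H, eta + K).
  move: (ip2 G.1 H) (ip2 G.2 K) (ip2 eta _) (ip2 _ _) (Ham r _) (Ham r _).
  move: e0 n2 n0; clear; move=> e0 n2 n0 a b c d f g.
  by move=> /ler_normlP[h1 h2] /ler_normlP[h3 h4]; apply/ler_normlP; split; nra.
move=> [[HZ _] [_ _ Fr]]; rewrite /= in HZ.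
have [hz _ _ _] := HZ; have Lwz := L2sq_wderiv hz.
have LN : L2sq (- wderiv2 eta) by case: Lwe => *; split; exact: L2N.
split=> //; exists (- wderiv2 eta, wderiv2 Z); split; last 2 first.
- by split; exact: aeeq_refl.
- by rewrite /= opprK; split; exact: aeeq_refl.
split=> //=; split.
- move=> a [H K] [H' K'] [/= HH LK] [/= HH' LK'].
  by rewrite !ip2_lin //; try exact: H1sq_L2sq; ring.
- exists (2 * normL2 (- wderiv2 eta) + 2 * normL2 (wderiv2 Z)) => -[H K] [/= HH LK].
  have LH := H1sq_L2sq HH.
  have := ip2_bound LN LH; have := ip2_bound Lwz LK.
  have [a1 a2] := norm_normH1L2 (H, K); rewrite /= in a1 a2.
  have b1 : normL2 H <= normH1 H.
    apply: le_of_sq; rewrite ?normH1_ge0 // normL2_sq normH1_sq /=.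
    by have := nsq_ge0 (wderiv H.1); have := nsq_ge0 (wderiv H.2); lra.
  move=> h1 h2; rewrite (le_trans (ler_normD _ _)) //.
  have := normL2_ge0 (- wderiv2 eta); have := normL2_ge0 (wderiv2 Z).
  move: h1 h2 a1 a2 b1; move: (`|ip2 _ _|) (`|ip2 _ _|) (normL2 _) (normL2 _) (normL2 _) (normL2 _).
  by move: (normH1 _) (normH1L2 _); clear; move=> *; nra.
move=> e e0; have e2 : 0 < e / 2 by lra.
have [d d0 Fd] := Fr _ e2.
exists (Num.min d (e / 4)); first by rewrite lt_min d0 /=; lra.
move=> [H K] [/= HH LK]; rewrite lt_min => /andP[n1 n2].
have := Fd (H, K) (conj HH LK) n1; have := quad H K hz HH LK.
rewrite /action /= (parts H HH) !subr0.
have -> : ip2 (- wderiv2 eta) H = - ip2 (wderiv2 eta) H.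
  have [[h1 h2] [w1 w2]] := (HH, Lwe).
  by rewrite /ip2 !ipNl ?opprD //; exact: H1_L2.
have -> : ip2 K (wderiv2 Z) = ip2 (wderiv2 Z) K by rewrite /ip2 (ipC K.1) (ipC K.2).
have := normH1L2_ge0 (H, K); move: (normH1L2 _) n2 => n n2 n0.
rewrite -[(Z, eta) + (H, K)]/(Z + H, eta + K).
move: (ip2 _ H) (ip2 _ K) (ip2 eta _) (ip2 _ _) (Ham r _) (Ham r _).
move: e0 n2 n0; clear; move=> e0 n2 n0 a b c d f g.
by move=> /ler_normlP[h1 h2] /ler_normlP[h3 h4]; apply/ler_normlP; split; nra.
Qed.
End legendre.

(** * The time change of a periodic function *)

Section time_change.
Variable R : realType.
Local Notation mu := (@lebesgue_measure R).
Local Notation F := (R -> R).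
Local Notation F2 := (F * F)%type.
Implicit Types (f g h z w u v : R -> R) (a b c e x y s t tau : R) (Z : F2).

Lemma sqr_itg_nsq z : itg 0 1 (fun s => z s ^+ 2) = nsq z.
Proof. by apply: itg_eq => x _; rewrite expr2. Qed.

Lemma tmap0 z : tmap z 0 = 0.
Proof. by rewrite /tmap itg_aa mulr0. Qed.

Lemma tmap1 z : 0 < nsq z -> tmap z 1 = 1.
Proof. by move=> N0; rewrite /tmap sqr_itg_nsq mulVf // gt_eqF. Qed.

(** The time map, extended from [[0, 1]] to the line so that it can be differentiated
    everywhere. *)
Definition tline z tau := (nsq z)^-1 * prim (fun s => z s ^+ 2) tau.

Lemma tline_tmap z tau : 0 <= tau -> tline z tau = tmap z tau.
Proof.
rewrite /tline /tmap /prim le_eqVlt => /predU1P[<-|t0]; first by rewrite subrr itg_aa mulr0.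
by rewrite (itg_gt _ t0) subr0.
Qed.

Lemma tline_der z tau : continuous z -> der (tline z) tau (z tau ^+ 2 / nsq z).
Proof.
move=> cz; rewrite mulrC -[_^-1 * _]/(_^-1 *: _).
apply: is_deriveZ; apply: prim_der; cont.
Qed.

Lemma tline_continuous z : continuous z -> continuous (tline z).
Proof. by move=> cz x; exact: derivable_continuous (tline_der x cz). Qed.

Lemma tmapB z s t : continuous z -> 0 <= s -> s <= t ->
  tmap z t - tmap z s = (nsq z)^-1 * itg s t (fun x => z x ^+ 2).
Proof.
move=> cz s0 st; rewrite /tmap -mulrBr; congr (_ * _).
rewrite (@itg_split _ _ 0 s t) //; first by ring.
by apply: continuous_L1; cont.
Qed.

Lemma tmap_le z s t : continuous z -> 0 < nsq z -> 0 <= s -> s <= t ->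
  tmap z s <= tmap z t.
Proof.
move=> cz Nz s0 st; rewrite -subr_ge0 tmapB //; apply: mulr_ge0; first by rewrite invr_ge0 ltW.
by apply: itg_ge0 => x _; exact: sqr_ge0.
Qed.

Lemma tmap01 z t : continuous z -> 0 < nsq z -> 0 <= t <= 1 -> 0 <= tmap z t <= 1.
Proof.
move=> cz Nz /andP[t0 t1]; apply/andP; split.
  by rewrite -[X in X <= _](tmap0 z) tmap_le.
by rewrite -[X in _ <= X](tmap1 Nz) tmap_le.
Qed.

Lemma tmap_surj z t : continuous z -> 0 < nsq z -> 0 <= t <= 1 ->
  exists2 tau, 0 <= tau <= 1 & tmap z tau = t.
Proof.
move=> cz Nz t01.
have [|tau] := @IVT R (tline z) 0 1 t ler01 (continuous_subspaceT (tline_continuous cz)).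
  by rewrite !tline_tmap // tmap0 tmap1 // min_l // max_r.
rewrite in_itv /= => /andP[x0 x1] <-; exists tau; first by rewrite x0.
by rewrite tline_tmap.
Qed.

Lemma taumapP z t : continuous z -> 0 < nsq z -> 0 <= t <= 1 ->
  0 <= taumap z t <= 1 /\ tmap z (taumap z t) = t.
Proof.
move=> cz Nz t01.
have S : set_surj `[(0:R), 1]%classic `[(0:R), 1]%classic (tmap z).
  move=> s; rewrite /= in_itv /= => s01; have [tau h1 h2] := tmap_surj cz Nz s01.
  by exists tau => //; rewrite /= in_itv.
have tI : t \in `[(0:R), 1]%classic by rewrite inE /= in_itv.
split; last exact: (surjpK _ S tI).
have : `[(0:R), 1]%classic (taumap z t).
  have sub := @surjpinv_image_sub R R (fun=> 0) `[(0:R), 1]%classic `[(0:R), 1]%classic (tmap z) S.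
  by apply: sub; exists t => //; rewrite /= in_itv.
by rewrite /= in_itv.
Qed.

Lemma itg_gt0 f a b c : continuous f -> (forall x, a <= x <= b -> 0 <= f x) ->
  a <= c <= b -> a < b -> 0 < f c -> 0 < itg a b f.
Proof.
move=> cf f0 /andP[ac cb] ab fc.
have [d d0 fd] := continuous_at_dist (cf c) (divr_gt0 fc (ltr0n R 2)).
pose s := Num.max a (c - d / 2); pose t := Num.min b (c + d / 2).
have [sa s1] : a <= s /\ c - d / 2 <= s by rewrite !le_max !lexx orbT.
have [tb t1] : t <= b /\ t <= c + d / 2 by rewrite !ge_min !lexx orbT.
have sc : s <= c by rewrite /s ge_max ac /=; lra.
have ct : c <= t by rewrite /t le_min cb /=; lra.
have st : s < t.
  by rewrite /s /t lt_min !gt_max ab /=; apply/andP; split; [lra|apply/andP; split; lra].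
have L x y : L1 x y f by exact: continuous_L1.
rewrite (@itg_split _ f a s b) // ?(@itg_split _ f s t b) //; try lra.
have p1 : 0 <= itg a s f by apply: itg_ge0 => x /andP[? ?]; apply: f0; lra.
have p2 : 0 <= itg t b f by apply: itg_ge0 => x /andP[? ?]; apply: f0; lra.
have : f c / 2 * (t - s) <= itg s t f.
  rewrite -itg_cst ?(ltW st) //; apply: itg_le => //; first by apply: continuous_L1; cont.
  move=> x /andP[sx xt]; have : `|c - x| < d by apply/ltr_normlP; split; lra.
  by move=> /fd/ltr_normlP[]; lra.
have : 0 < f c / 2 * (t - s) by rewrite mulr_gt0 ?subr_gt0 ?divr_gt0.
lra.
Qed.

(** Where the time map is constant the integral of [z^2] vanishes, so [z] does. This is why the
    arbitrary choice in [taumap] is harmless. *)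
Lemma tmap_fibre z s t : continuous z -> 0 < nsq z -> 0 <= s <= 1 -> 0 <= t <= 1 ->
  tmap z s = tmap z t -> z s ^+ 2 = z t ^+ 2.
Proof.
move=> cz Nz; wlog st : s t / s <= t.
  move=> H s01 t01 E; have [st|/ltW ts] := leP s t; first exact: H.
  by apply/esym; apply: H.
move=> /andP[s0 s1] /andP[t0 t1] E.
have : itg s t (fun x => z x ^+ 2) = 0.
  apply/eqP; have := tmapB cz s0 st; rewrite E subrr => /esym/eqP.
  by rewrite mulf_eq0 invr_eq0 (gt_eqF Nz).
move: st; rewrite le_eqVlt => /predU1P[-> //|st] I0.
have c2 : continuous (fun x => z x ^+ 2) by cont.
have Z0 x : s <= x <= t -> z x ^+ 2 = 0.
  move=> xst; apply/eqP; rewrite eq_le sqr_ge0 andbT leNgt; apply/negP => zx.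
  have pos y : s <= y <= t -> 0 <= z y ^+ 2 by move=> _; exact: sqr_ge0.
  by have := itg_gt0 c2 pos xst st zx; rewrite I0 ltxx.
by rewrite !Z0 // ?lexx ?(ltW st).
Qed.

(** The Levi-Civita image of [z] on [[0, 1]]. *)
Definition qf z t := z (taumap z t) ^+ 2.

Lemma qf_tmap z tau : continuous z -> 0 < nsq z -> 0 <= tau <= 1 ->
  qf z (tmap z tau) = z tau ^+ 2.
Proof.
move=> cz Nz t01; have [h1 h2] := taumapP cz Nz (tmap01 cz Nz t01).
exact: tmap_fibre.
Qed.

Definition qclip z t := qf z (clip t).

Lemma qclip_id z t : 0 <= t <= 1 -> qclip z t = qf z t.
Proof. by move=> t01; rewrite /qclip clip_id. Qed.

(** The time map need not be injective, so continuity of the inverse is not available. Instead: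
    the points where [z^2] is far from its value on the fibre over [t] form a compact set,
    whose image under the time map is closed and misses [t]. *)
Lemma qclip_continuous z : continuous z -> 0 < nsq z -> continuous (qclip z).
Proof.
move=> cz Nz x; apply: continuous_atP => e e0.
have [c0 c1] := clip_itv x.
pose t0 := clip x; have t001 : 0 <= t0 <= 1 by rewrite c0.
pose A := `[(0:R), 1]%classic `&` [set tau | e <= `|qf z t0 - z tau ^+ 2|].
have cA : compact (tline z @` A).
  apply: continuous_compact; first exact/continuous_subspaceT/tline_continuous.
  apply: compact_closedI; first exact: segment_compact.
  have cg : continuous (fun tau => `|qf z t0 - z tau ^+ 2|).
    apply: (@cont_comp _ Num.norm); first by move=> y; exact: norm_continuous.
    by cont.
  exact: (closed_comp (fun y _ => cg y) (@closed_ge _ e)).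
have nA : ~ (tline z @` A) t0.
  move=> [tau [/=]]; rewrite in_itv /= => /andP[tau0 tau1] ge E.
  have : qf z t0 = z tau ^+ 2 by rewrite -E tline_tmap // qf_tmap // tau0.
  by move=> Eq; move: ge; rewrite Eq subrr normr0 leNgt e0.
have oC : open (~` (tline z @` A)).
  by apply: closed_openC; apply: compact_closed => //; exact: Rhausdorff.
have [d /= d0 dP] := (open_nbhs_nbhs (conj oC nA) : nbhs t0 _).
exists d => // y xy.
have [y0 y1] := clip_itv y; have yI : 0 <= clip y <= 1 by rewrite y0.
have : ball_ Num.norm t0 d (clip y).
  by rewrite /= (le_lt_trans (clip_lip _ _)).
move=> /dP /= nin; have [h1 h2] := taumapP cz Nz yI.
rewrite /qclip leNgt; apply/negP => lt; apply: nin; exists (taumap z (clip y)).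
  by split; rewrite /= ?in_itv //= ltW.
by case/andP: h1 => h1 _; rewrite tline_tmap.
Qed.

Lemma substitution z (Phi : R -> R) : continuous z -> 0 < nsq z -> continuous Phi ->
  itg 0 1 (fun tau => z tau ^+ 2 / nsq z * Phi (tmap z tau)) = itg 0 1 Phi.
Proof.
move=> cz Nz cP; have ct := tline_continuous cz.
rewrite (itg_eq (g := fun tau => Phi (tline z tau) * (z tau ^+ 2 / nsq z))); last first.
  by move=> x /andP[x0 _]; rewrite tline_tmap // mulrC.
have cg : continuous (fun tau => Phi (tline z tau) * (z tau ^+ 2 / nsq z)) by cont.
have cG : continuous (prim Phi \o tline z).
  by move=> x; apply: continuous_comp; [exact: ct|exact: prim_continuous].
have dG x : 0 < x < 1 ->
    der (prim Phi \o tline z) x (Phi (tline z x) * (z x ^+ 2 / nsq z)).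
  by move=> _; apply: is_derive1_comp; [exact: prim_der|exact: tline_der].
rewrite (itg_der ler01 cg (continuous_subspaceT cG) dG) /= !tline_tmap //.
by rewrite tmap0 tmap1 // itg_prim.
Qed.

Lemma gap_qf Z t : continuous Z.1 -> 0 < nsq Z.1 -> 0 <= t <= 1 ->
  gap Z (taumap Z.1 t) = qf Z.1 t - qf Z.2 t.
Proof.
by move=> cz Nz t01; have [h1 h2] := taumapP cz Nz t01; rewrite /gap h2.
Qed.

Lemma gap_tmap Z tau : continuous Z.1 -> 0 < nsq Z.1 -> 0 <= tau <= 1 ->
  gap Z tau = qf Z.1 (tmap Z.1 tau) - qf Z.2 (tmap Z.1 tau).
Proof. by move=> cz Nz t01; rewrite /gap qf_tmap. Qed.

(** The domain of the functionals, freed of the Sobolev condition; the two positions are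
    compared at equal times [t]. *)
Definition apart Z := [/\ continuous Z.1, continuous Z.2, 0 < nsq Z.1, 0 < nsq Z.2 &
  forall t, 0 <= t <= 1 -> qf Z.2 t < qf Z.1 t].

Lemma H1in_apart Z : H1in Z -> apart Z.
Proof.
case=> -[h1 h2] n1 n2 g; rewrite !nrm_gt0 in n1 n2.
have c1 := H1_continuous h1; have c2 := H1_continuous h2.
split=> // t t01; rewrite -subr_gt0 -gap_qf //; apply: g.
by have [] := taumapP c1 n1 t01.
Qed.

Lemma apart_H1in Z : H1sq Z -> apart Z -> H1in Z.
Proof.
move=> hz [c1 c2 n1 n2 g]; split; rewrite ?nrm_gt0 // => t t01.
by rewrite gap_tmap // subr_gt0; apply: g; exact: tmap01.
Qed.

(** The reciprocal distance of the two particles at time [t]. *)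
Definition Psi Z t := (qclip Z.1 t - qclip Z.2 t)^-1.

Lemma apart_clip Z t : apart Z -> 0 < qclip Z.1 t - qclip Z.2 t.
Proof.
case=> _ _ _ _ g; rewrite subr_gt0; apply: g.
by have [-> ->] := clip_itv t.
Qed.

Lemma Psi_continuous Z : apart Z -> continuous (Psi Z).
Proof.
move=> sZ; have [c1 c2 n1 n2 _] := sZ.
have q1 := qclip_continuous c1 n1; have q2 := qclip_continuous c2 n2.
rewrite /Psi; apply: contV; first by move=> x; rewrite gt_eqF // apart_clip.
by cont.
Qed.

Lemma Psi_tmap1 Z tau : apart Z -> 0 <= tau <= 1 ->
  Psi Z (tmap Z.1 tau) = (gap Z tau)^-1.
Proof.
move=> [c1 c2 n1 n2 _] t01; rewrite /Psi !qclip_id ?tmap01 //.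
by rewrite -gap_tmap.
Qed.

Lemma Psi_tmap2 Z tau : apart Z -> 0 <= tau <= 1 ->
  Psi Z (tmap Z.2 tau) = (qf Z.1 (tmap Z.2 tau) - Z.2 tau ^+ 2)^-1.
Proof.
move=> [c1 c2 n1 n2 _] t01; rewrite /Psi !qclip_id ?tmap01 //.
by rewrite (@qf_tmap Z.2).
Qed.

(** The weight [z_1^2 / nsq z_1] is the derivative of the time map, so the substitution [t =
    t_{z_1}] turns the integral into a mean over the time. *)
Lemma IfunE Z : apart Z -> Ifun Z = - itg 0 1 (Psi Z).
Proof.
move=> sZ; have [c1 c2 n1 n2 _] := sZ; rewrite /Ifun nrm_sq.
have cP := Psi_continuous sZ.
have ct := tline_continuous c1.
rewrite -(substitution c1 n1 cP) -itgZ.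
  congr (- _); apply: itg_eq => tau t01.
  by rewrite Psi_tmap1 // mulrA (mulrC (nsq _)^-1).
apply: (@eq_integrable _ _ _ mu `[0%R, 1%R]%classic (measurable_itv _)
  (EFin \o (fun tau => Z.1 tau ^+ 2 * Psi Z (tline Z.1 tau)))).
  move=> x; rewrite inE /= in_itv /= => x01; rewrite -Psi_tmap1 // tline_tmap //.
  by case/andP: x01.
by apply: continuous_L1; cont.
Qed.

Lemma avg_q z : continuous z -> 0 < nsq z ->
  itg 0 1 (qclip z) = nsq (sqr z) / nsq z.
Proof.
move=> cz Nz; have cq := qclip_continuous cz Nz; rewrite -(substitution cz Nz cq).
rewrite mulrC /nsq /ip -itgZ; last by apply: continuous_L1; rewrite /sqr; cont.
apply: itg_eq => tau t01; rewrite qclip_id ?tmap01 // qf_tmap // /sqr -/(nsq z).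
by rewrite /nsq /ip; ring.
Qed.

Lemma AfunE Z : apart Z -> 0 < itg 0 1 (qclip Z.1) - itg 0 1 (qclip Z.2) /\
  Afun Z = - (itg 0 1 (qclip Z.1) - itg 0 1 (qclip Z.2))^-1.
Proof.
move=> sZ; have [c1 c2 n1 n2 _] := sZ.
have p : 0 < itg 0 1 (qclip Z.1) - itg 0 1 (qclip Z.2).
  have q1 := qclip_continuous c1 n1; have q2 := qclip_continuous c2 n2.
  rewrite -itgB; [|exact: continuous_L1..].
  apply: (@itg_gt0 _ 0 1 0) => //; last exact: apart_clip.
  - by cont.
  - by move=> x _; rewrite ltW // apart_clip.
  - by rewrite lexx ler01.
split=> //; move: p; rewrite !avg_q // /Afun !nrm_sq => p.
congr (- _); rewrite -[RHS]div1r; apply/eqP.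
have E : nsq (sqr Z.1) / nsq Z.1 - nsq (sqr Z.2) / nsq Z.2 =
   (nsq (sqr Z.1) * nsq Z.2 - nsq (sqr Z.2) * nsq Z.1) / (nsq Z.1 * nsq Z.2).
  by field; rewrite !gt_eqF.
rewrite E in p *; apply/eqP; field; rewrite !gt_eqF //=.
by move: p; rewrite pmulr_lgt0 ?invr_gt0 ?mulr_gt0.
Qed.
End time_change.

(** * First-order expansions, uniform in a parameter *)

Section expansions.
Variable R : realType.
Local Notation F := (R -> R).
Local Notation F2 := (F * F)%type.
Implicit Types (f g h z w u v : R -> R) (a b c d e x y s t tau : R) (Z H : F2).

Lemma uniform_continuity g e : continuous g -> 0 < e -> exists2 d, 0 < d &
  forall x y, 0 <= x <= 1 -> `|x - y| < d -> `|g x - g y| <= e.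
Proof.
move=> cg e0.
have := (@compact_near_coveringP _ `[(0:R), 1]%classic).1 (@segment_compact R 0 1).
move=> /(_ _ (0^'+) (fun d x => forall y, `|x - y| < d -> `|g x - g y| <= e) _).
case=> [x _|d /= d0 Hd].
  have [d d0 gd] := continuous_at_dist (cg x) (divr_gt0 e0 (ltr0n R 2)).
  have d2 : 0 < d / 2 by lra.
  exists ([set x' | `|x - x'| < d / 2], [set d' | d' < d / 2]) => /=.
    split; first exact: near_dist_lt.
    by near=> i; near: i; apply: nbhs_right_lt.
  move=> [x' d'] [/= xx' dd'] y x'y.
  have h1 := gd x' (lt_trans xx' _).
  have : `|x - y| < d.
    have := ler_normD (x - x') (x' - y); rewrite addrA subrK; lra.
  move=> /gd h2; have {}h1 : `|g x - g x'| < e / 2 by apply: h1; lra.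
  have := ler_normB (g x - g y) (g x - g x').
  rewrite (_ : g x - g y - (g x - g x') = g x' - g y); last by ring.
  by lra.
have dd : 0 < d / 2 by lra.
exists (d / 2) => // x y x01; apply: (Hd (d / 2)) => //=.
by rewrite sub0r normrN gtr0_norm //; lra.
Unshelve. all: by end_near. Qed.

Lemma uniform_taylor g dg e1 : continuous dg -> (forall x y, 0 <= x -> x <= y ->
    y <= 1 -> g y - g x = itg x y dg) -> 0 < e1 -> exists2 d, 0 < d &
  forall x y, 0 <= x <= 1 -> 0 <= y <= 1 -> `|y - x| < d ->
    `|g y - g x - dg x * (y - x)| <= e1 * `|y - x|.
Proof.
move=> cdg gE e10; have [d2 d20 uc] := uniform_continuity cdg e10.
exists d2 => // x y.
  move=> /andP[x0 x1] /andP[y0 y1] xy.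
  have cst a b k : L1 a b (fun=> k : R) by apply: continuous_L1; cont.
  have Ld a b : L1 a b dg by exact: continuous_L1.
  have [xley|/ltW ylex] := leP x y.
    rewrite gE // -itg_cst // -itgB // (ger0_norm (_ : 0 <= y - x)) ?subr_ge0 //.
    apply: norm_itg_le => //; first exact: L1B.
    move=> s /andP[xs sy]; rewrite distrC; apply: uc; rewrite ?x0 // distrC.
    rewrite ger0_norm in xy; last by rewrite subr_ge0.
    by rewrite ger0_norm ?subr_ge0 //; lra.
  rewrite (_ : g y - g x - _ = - (g x - g y - dg x * (x - y))); last by ring.
  rewrite normrN (distrC y) (ger0_norm (_ : 0 <= x - y)) ?subr_ge0 //.
  rewrite gE // -itg_cst // -itgB //.
  apply: norm_itg_le => //; first exact: L1B.
  move=> s /andP[ys sx]; rewrite distrC; apply: uc; rewrite ?x0 //.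
  rewrite distrC ger0_norm in xy; last by rewrite subr_ge0.
  by rewrite ger0_norm ?subr_ge0 //; lra.
Qed.

Definition bounded_lin (dG : F2 -> R -> R) := exists2 C, 0 < C &
  forall H t, H1sq H -> 0 <= t <= 1 -> `|dG H t| <= C * normH1 H.

(** Frechet differentiability at [H = 0], uniform in the parameter [t] in [[0, 1]]. The
    functionals are composed of such families by sums, products, inverses, integrals and
    substitutions, each of which has its rule below; uniformity in [t] is what makes
    integration and substitution possible. *)
Definition expands (G dG : F2 -> R -> R) :=
  [/\ bounded_lin dG,
      exists2 C, 0 < C & forall t, 0 <= t <= 1 -> `|G 0 t| <= C
    & forall e, 0 < e -> exists2 d, 0 < d & forall H t, H1sq H -> normH1 H < d ->
        0 <= t <= 1 -> `|G H t - G 0 t - dG H t| <= e * normH1 H].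

Lemma bound_pos (P : R -> Prop) : (forall x y, x <= y -> P x -> P y) ->
  (exists C, P C) -> exists2 C, 0 < C & P C.
Proof.
move=> mon [C PC]; exists (`|C| + 1); first by rewrite ltr_wpDl.
by apply: mon PC; have := ler_norm C; lra.
Qed.

Lemma expands_lip G dG : expands G dG -> exists2 C, 0 < C & exists2 d, 0 < d &
  forall H t, H1sq H -> normH1 H < d -> 0 <= t <= 1 -> `|G H t - G 0 t| <= C * normH1 H.
Proof.
move=> [[C C0 b] _ /(_ 1 ltr01)[d d0 k]]; exists (C + 1); first by lra.
exists d => // H t HH Hd t01; have := k H t HH Hd t01; have := b H t HH t01.
have := ler_normD (G H t - G 0 t - dG H t) (dG H t); rewrite subrK; lra.
Qed.

Lemma expands_bound G dG : expands G dG -> exists2 C, 0 < C & exists2 d, 0 < d &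
  forall H t, H1sq H -> normH1 H < d -> 0 <= t <= 1 -> `|G H t| <= C /\ `|G 0 t| <= C.
Proof.
move=> E; have [K K0 [d d0 k]] := expands_lip E; have [_ [C C0 b] _] := E.
exists (C + K); first by lra.
exists (Num.min d 1); first by rewrite lt_min d0 ltr01.
move=> H t HH; rewrite lt_min => /andP[Hd H1] t01.
have := k H t HH Hd t01; have := b t t01.
have := ler_normD (G H t - G 0 t) (G 0 t); rewrite subrK.
have := normH1_ge0 H; move: (normH1 H) H1 (`|_|) (`|_|) (`|_|).
by move=> n n1 p q s; split; nra.
Qed.

Lemma zeroH1 : H1sq (0 : F2) /\ normH1 (0 : F2) = 0.
Proof.
have h : H1 (0 : F).
  split=> [x //|]; exists 0; split; first exact: L20.
  move=> t /andP[t0 _]; rewrite (_ : itg 0 t _ = itg 0 t (fun=> 0)) // itg_cst // mul0r.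
  by rewrite addr0.
have hz : H1sq (0 : F2) by split.
by split=> //; have [_] := H1sq_scale 0 hz; rewrite scale0r normr0 mul0r.
Qed.

Lemma expands_ext G dG G' dG' :
  (exists2 d, 0 < d & forall H t, H1sq H -> normH1 H < d -> 0 <= t <= 1 ->
     G H t = G' H t) ->
  (forall H t, H1sq H -> 0 <= t <= 1 -> dG H t = dG' H t) ->
  expands G dG -> expands G' dG'.
Proof.
move=> [d d0 GG'] dGG' [[C C0 b] [K K0 k] H]; have [h0 n0] := zeroH1.
have E0 t : 0 <= t <= 1 -> G 0 t = G' 0 t by move=> t01; apply: GG' => //; rewrite n0.
split.
- by exists C => // H' t HH t01; rewrite -dGG' // b.
- by exists K => // t t01; rewrite -E0 // k.
move=> e e0; have [d' d'0 P] := H e e0.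
exists (Num.min d d'); first by rewrite lt_min d0.
move=> H' t HH; rewrite lt_min => /andP[n1 n2] t01.
by rewrite -GG' // -E0 // -dGG' // P.
Qed.

Lemma expands_cst g C : (forall t, 0 <= t <= 1 -> `|g t| <= C) ->
  expands (fun _ t => g t) (fun _ _ => 0).
Proof.
move=> gC; split.
- by exists 1 => // H t _ _; rewrite normr0 mul1r normH1_ge0.
- apply: bound_pos; last by exists C.
  by move=> x y xy P t t01; rewrite (le_trans (P t t01)).
move=> e e0; exists 1 => // H t _ _ _; rewrite subrr subr0 normr0.
by rewrite mulr_ge0 ?normH1_ge0 // ltW.
Qed.

Lemma continuous_bounded g : continuous g -> exists C, forall t, 0 <= t <= 1 -> `|g t| <= C.
Proof.
move=> cg; have cn : continuous (fun t => `|g t|).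
  by apply: (@cont_comp _ Num.norm) => //; exact: norm_continuous.
have [c _ P] := EVT_max ler01 (continuous_subspaceT cn).
by exists (`|g c|) => t t01; apply: P; rewrite in_itv.
Qed.

Lemma expands_continuous g : continuous g -> expands (fun _ t => g t) (fun _ _ => 0).
Proof. by move=> /continuous_bounded[C gC]; exact: expands_cst gC. Qed.

Lemma expandsD G dG K dK : expands G dG -> expands K dK ->
  expands (fun H t => G H t + K H t) (fun H t => dG H t + dK H t).
Proof.
move=> [[C C0 c] [D D0 d] g] [[C' C'0 c'] [D' D'0 d'] g']; split.
- exists (C + C'); first exact: addr_gt0.
  move=> H t HH t01; rewrite mulrDl (le_trans (ler_normD _ _)) // lerD ?c ?c' //.
- exists (D + D'); first exact: addr_gt0.
  move=> t t01; rewrite (le_trans (ler_normD _ _)) // lerD ?d ?d' //.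
move=> e e0; have e2 : 0 < e / 2 by lra.
have [x x0 P] := g _ e2; have [y y0 Q] := g' _ e2.
exists (Num.min x y); first by rewrite lt_min x0.
move=> H t HH; rewrite lt_min => /andP[n1 n2] t01.
have := P H t HH n1 t01; have := Q H t HH n2 t01.
set p := _ - _ - dG H t; set q := _ - _ - dK H t.
rewrite [X in _ -> _ -> `|X| <= _](_ : _ = p + q); last by rewrite /p /q; ring.
have := ler_normD p q; have := normH1_ge0 H.
by move: (normH1 H) (`|p|) (`|q|) (`|p + q|) => n ? ? ?; clear; lra.
Qed.

Lemma expandsM G dG K dK : expands G dG -> expands K dK ->
  expands (fun H t => G H t * K H t) (fun H t => dG H t * K 0 t + G 0 t * dK H t).
Proof.
move=> EG EK; have [B1 B10 [d1 d10 b1]] := expands_bound EK.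
have [L1 L10 [d2 d20 l1]] := expands_lip EK.
have [[C C0 c] [D D0 d] g] := EG; have [[C' C'0 c'] [D' D'0 d'] g'] := EK; split.
- exists (C * D' + D * C'); first by rewrite addr_gt0 ?mulr_gt0.
  move=> H t HH t01; rewrite mulrDl (le_trans (ler_normD _ _)) // lerD // normrM.
    by rewrite mulrAC ler_pM // ?c ?d'.
  by rewrite -mulrA ler_pM // ?c' ?d.
- exists (D * D'); first exact: mulr_gt0.
  by move=> t t01; rewrite normrM ler_pM // ?d ?d'.
move=> e e0; pose M := B1 + C * L1 + D.
have M0 : 0 < M by rewrite !addr_gt0 // mulr_gt0.
have eM : 0 < e / M by rewrite divr_gt0.
have [x x0 P] := g _ eM; have [y y0 Q] := g' _ eM.
exists (Num.min (Num.min (Num.min x y) (Num.min d1 d2)) (e / M)).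
  by rewrite !lt_min x0 y0 d10 d20 eM.
move=> H t HH; rewrite !lt_min => /andP[/andP[/andP[n1 n2] /andP[n3 n4]] n5] t01.
have p1 := P H t HH n1 t01; have q1 := Q H t HH n2 t01.
have [k1 _] := b1 H t HH n3 t01; have k2 := l1 H t HH n4 t01.
have k3 := c H t HH t01; have k4 := d t t01.
set p := _ - _ - dG H t in p1; set q := _ - _ - dK H t in q1.
rewrite [X in `|X|](_ : _ = p * K H t + dG H t * (K H t - K 0 t) + G 0 t * q);
  last by rewrite /p /q; ring.
have n0 := normH1_ge0 H.
have e1 : `|p * K H t| <= e / M * normH1 H * B1 by rewrite normrM ler_pM.
have e2 : `|dG H t * (K H t - K 0 t)| <= e / M * normH1 H * (C * L1).
  rewrite normrM; apply: (le_trans (ler_pM (normr_ge0 _) (normr_ge0 _) k3 k2)).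
  have -> : C * normH1 H * (L1 * normH1 H) = normH1 H * normH1 H * (C * L1) by ring.
  by rewrite ler_wpM2r ?mulr_ge0 ?(ltW C0) ?(ltW L10) // ler_wpM2r // ltW.
have e3 : `|G 0 t * q| <= e / M * normH1 H * D.
  by rewrite normrM mulrC ler_pM.
apply: (le_trans (ler_normD _ _)); apply: (le_trans (lerD (ler_normD _ _) e3)).
apply: (le_trans (lerD (lerD e1 e2) (lexx _))).
rewrite -!mulrDr -/M mulrAC divfK ?gt_eqF //.
Qed.

Lemma expandsV G dG c : expands G dG -> 0 < c ->
  (forall t, 0 <= t <= 1 -> c <= `|G 0 t|) ->
  expands (fun H t => (G H t)^-1) (fun H t => - dG H t / G 0 t ^+ 2).
Proof.
move=> EG c0 Gc; have [L L0 [d1 d10 l]] := expands_lip EG.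
have [[C C0 b] [D D0 d] g] := EG.
have c2 : 0 < c ^+ 2 by rewrite exprn_gt0.
have Gc2 t : 0 <= t <= 1 -> c ^+ 2 <= `|G 0 t ^+ 2|.
  by move=> t01; rewrite normrX ler_sqr ?nnegrE ?(ltW c0) // Gc.
have iG t : 0 <= t <= 1 -> `|(G 0 t ^+ 2)^-1| <= (c ^+ 2)^-1.
  by move=> t01; rewrite normfV lef_pV2 ?posrE // ?Gc2 // (lt_le_trans c2) ?Gc2.
split.
- exists (C / c ^+ 2); first exact: divr_gt0.
  move=> H t HH t01; rewrite normrM normrN mulrAC ler_pM // ?b // iG //.
- exists c^-1; first by rewrite invr_gt0.
  by move=> t t01; rewrite normfV lef_pV2 ?posrE // ?Gc // (lt_le_trans c0) ?Gc.
move=> e e0; pose M := (D + C * L) * 2 / (c ^+ 2 * c).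
have cc : 0 < c ^+ 2 * c by rewrite mulr_gt0.
have M0 : 0 < M by rewrite /M divr_gt0 // mulr_gt0 // addr_gt0 // mulr_gt0.
have eM : 0 < e / M by rewrite divr_gt0.
have [x x0 P] := g _ eM.
exists (Num.min (Num.min x d1) (Num.min (e / M) (c / (2 * L)))).
  by rewrite !lt_min x0 d10 eM divr_gt0 // mulr_gt0.
move=> H t HH; rewrite !lt_min => /andP[/andP[n1 n2] /andP[n3 n4]] t01.
rewrite ltr_pdivlMr ?mulr_gt0 // in n4.
have p1 := P H t HH n1 t01; have l1 := l H t HH n2 t01.
have k := b H t HH t01; have k2 := d t t01; have k3 := Gc t t01.
have n0 := normH1_ge0 H.
set p := _ - _ - dG H t in p1.
have GH : c / 2 <= `|G H t|.
  have := ler_normB (G H t) (G H t - G 0 t); rewrite subKr.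
  by move: (`|_|) (`|_|) (`|_|) k3 l1 n4; move: (normH1 H); clear; move=> *; nra.
have GH0 : G H t != 0 by rewrite -normr_gt0 (lt_le_trans _ GH) // divr_gt0.
have G00 : G 0 t != 0 by rewrite -normr_gt0 (lt_le_trans _ k3).
rewrite [X in `|X|](_ : _ = (- G 0 t * p + dG H t * (G H t - G 0 t)) *
   ((G 0 t ^+ 2)^-1 * (G H t)^-1)); last by rewrite /p; field; rewrite GH0.
have e1 : `|- G 0 t * p| <= e / M * normH1 H * D by rewrite normrM normrN mulrC ler_pM.
have e2 : `|dG H t * (G H t - G 0 t)| <= e / M * normH1 H * (C * L).
  rewrite normrM; apply: (le_trans (ler_pM (normr_ge0 _) (normr_ge0 _) k l1)).
  have -> : C * normH1 H * (L * normH1 H) = normH1 H * normH1 H * (C * L) by ring.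
  by rewrite ler_wpM2r ?mulr_ge0 ?(ltW C0) ?(ltW L0) // ler_wpM2r // ltW.
have e3 : `|(G 0 t ^+ 2)^-1 * (G H t)^-1| <= (c ^+ 2)^-1 * (c / 2)^-1.
  have hc : 0 < c / 2 by rewrite divr_gt0.
  by rewrite normrM ler_pM // ?iG // normfV lef_pV2 ?posrE // (lt_le_trans hc).
rewrite normrM; apply: (le_trans (ler_pM (normr_ge0 _) (normr_ge0 _)
   (le_trans (ler_normD _ _) (lerD e1 e2)) e3)).
rewrite -mulrDr le_eqVlt; apply/orP; left; apply/eqP.
rewrite /M; field; rewrite !gt_eqF //=.
by rewrite addr_gt0 // mulr_gt0.
Qed.

Lemma expands_itg G dG u : expands G dG -> (forall t, 0 <= t <= 1 -> 0 <= u t <= 1) ->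
  (exists2 d, 0 < d & forall H, H1sq H -> normH1 H < d -> L1 0 1 (G H)) ->
  (forall H, H1sq H -> L1 0 1 (dG H)) ->
  expands (fun H t => itg 0 (u t) (G H)) (fun H t => itg 0 (u t) (dG H)).
Proof.
move=> [[C C0 c] [D D0 d] g] u01 [d1 d10 LG] LdG.
have [h0 n0] := zeroH1.
have LG0 : L1 0 1 (G 0) by apply: LG => //; rewrite n0.
have sub f t : 0 <= t <= 1 -> L1 0 1 f -> L1 0 (u t) f.
  by move=> t01; have /andP[_ ?] := u01 t t01; exact: L1_sub.
have bnd f t K : 0 <= t <= 1 -> L1 0 1 f -> 0 <= K ->
    (forall s, 0 <= s <= 1 -> `|f s| <= K) -> `|itg 0 (u t) f| <= K.
  move=> t01 Lf K0 fK; have /andP[u0 u1] := u01 t t01.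
  rewrite (le_trans (@norm_itg_le _ f 0 (u t) K u0 (sub _ _ t01 Lf) _)) //.
    by move=> s /andP[s0 s1]; rewrite fK // s0 (le_trans s1).
  by rewrite subr0 ler_piMr.
split.
- exists C => // H t HH t01; apply: bnd => //; first exact: LdG.
    by rewrite mulr_ge0 ?normH1_ge0 // ltW.
  by move=> s s01; exact: c.
- exists D => // t t01; apply: bnd => //; first exact: ltW.
move=> e e0; have [x x0 P] := g _ e0.
exists (Num.min x d1); first by rewrite lt_min x0.
move=> H t HH; rewrite lt_min => /andP[n1 n2] t01.
have LH := LG H HH n2.
rewrite -itgB ?sub // -itgB ?sub //; first last.
- exact: LdG.
- exact: L1B.
apply: bnd => //.
- by apply: L1B; [exact: L1B|exact: LdG].
- by rewrite mulr_ge0 ?normH1_ge0 // ltW.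
by move=> s s01; exact: P.
Qed.

(** The outer function is fixed and C^1, the point of evaluation moves; continuity of its
    derivative makes the first-order Taylor remainder uniform. *)
Lemma expands_subst g dg (S dS : F2 -> R -> R) : expands S dS ->
  (exists2 d, 0 < d & forall H t, H1sq H -> normH1 H < d -> 0 <= t <= 1 -> 0 <= S H t <= 1) ->
  continuous g -> continuous dg -> (forall x y, 0 <= x -> x <= y -> y <= 1 ->
     g y - g x = itg x y dg) ->
  expands (fun H t => g (S H t)) (fun H t => dg (S 0 t) * dS H t).
Proof.
move=> ES [d0 d00 S01] cg cdg gE.
have [L L0 [d1 d10 l]] := expands_lip ES.
have [[C C0 c] _ P] := ES; have [h0 n0] := zeroH1.
have S00 t : 0 <= t <= 1 -> 0 <= S 0 t <= 1 by apply: S01 => //; rewrite n0.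
have [D D0 bd] := bound_pos (P := fun D => forall t, 0 <= t <= 1 -> `|dg t| <= D)
   (fun x y xy k t t01 => le_trans (k t t01) xy) (continuous_bounded cdg).
have [B B0 bg] := bound_pos (P := fun D => forall t, 0 <= t <= 1 -> `|g t| <= D)
   (fun x y xy k t t01 => le_trans (k t t01) xy) (continuous_bounded cg).
split.
- exists (D * C); first exact: mulr_gt0.
  by move=> H t HH t01; rewrite normrM -mulrA ler_pM // ?bd ?S00 // c.
- by exists B => // t t01; rewrite bg ?S00.
move=> e e0; pose e1 := e / (L + D).
have LD : 0 < L + D by exact: addr_gt0.
have e10 : 0 < e1 by exact: divr_gt0.
have [d2 d20 uc] := uniform_taylor cdg gE e10.
have [d3 d30 Q] := P _ e10.
exists (Num.min (Num.min d0 d1) (Num.min (d2 / L) d3)).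
  by rewrite !lt_min d00 d10 d30 divr_gt0.
move=> H t HH; rewrite !lt_min ltr_pdivlMr // => /andP[/andP[m0 m1] /andP[m2 m3]] t01.
have q := Q H t HH m3 t01; have lS := l H t HH m1 t01.
have s1 := S01 H t HH m0 t01; have s0 := S00 t t01.
have n1 := normH1_ge0 H.
have key := uc.
have := key _ _ s0 s1 (le_lt_trans lS _) => k1.
have {}k1 := k1 ltac:(by rewrite mulrC).
rewrite [X in `|X|](_ : _ = (g (S H t) - g (S 0 t) - dg (S 0 t) * (S H t - S 0 t))
   + dg (S 0 t) * (S H t - S 0 t - dS H t)); last by ring.
rewrite (le_trans (ler_normD _ _)) //.
have k2 : `|dg (S 0 t) * (S H t - S 0 t - dS H t)| <= e1 * normH1 H * D.
  by rewrite normrM mulrC ler_pM // bd.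
have k3 := le_trans k1 (ler_wpM2l (ltW e10) lS).
rewrite (le_trans (lerD k3 k2)) // le_eqVlt; apply/orP; left; apply/eqP.
by rewrite /e1; field; rewrite gt_eqF.
Qed.

(** The increment is small itself, so moving its point of evaluation matters only to higher
    order. Elements of [H^1] are merely Hoelder continuous, and this is enough. *)
Lemma expands_eval (p : F2 -> F) (S dS : F2 -> R -> R) : (p = fst \/ p = snd) ->
  expands S dS ->
  (exists2 d, 0 < d & forall H t, H1sq H -> normH1 H < d -> 0 <= t <= 1 -> 0 <= S H t <= 1) ->
  expands (fun H t => p H (S H t)) (fun H t => p H (S 0 t)).
Proof.
move=> pE ES [d0 d00 S01].
have [L L0 [d1 d10 l]] := expands_lip ES; have [h0 n0] := zeroH1.
have S00 t : 0 <= t <= 1 -> 0 <= S 0 t <= 1 by apply: S01 => //; rewrite n0.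
have sup H t : H1sq H -> 0 <= t <= 1 -> `|p H t| <= 2 * normH1 H.
  by move=> HH t01; have [] := normH1_sup HH t01; case: pE => ->.
have hol H s t : H1sq H -> 0 <= s <= 1 -> 0 <= t <= 1 ->
    `|p H t - p H s| <= Num.sqrt `|t - s| * normH1 H.
  move=> HH; wlog st : s t / s <= t.
    move=> W s01 t01; have [st|/ltW ts] := leP s t; first exact: W.
    by rewrite distrC [`|t - s|]distrC; exact: W.
  move=> /andP[s0 s1] /andP[t0 t1].
  have [a1 a2 a3 a4] := nrm_normH1 H.
  have S0 := sqrtr_ge0 (t - s).
  rewrite (ger0_norm (_ : 0 <= t - s)) ?subr_ge0 //.
  case: HH => H1' H2'; case: pE => ->.
    by rewrite (le_trans (wderiv_holder (H1_wderiv H1') s0 st t1)) // ler_wpM2l.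
  by rewrite (le_trans (wderiv_holder (H1_wderiv H2') s0 st t1)) // ler_wpM2l.
split.
- by exists 2 => // H t HH t01; apply: sup => //; exact: S00.
- exists 1 => // t t01; rewrite (_ : p 0 (S 0 t) = 0) ?normr0 //.
  by case: pE => ->.
move=> e e0; exists (Num.min (Num.min d0 d1) (e ^+ 2 / L)).
  by rewrite !lt_min d00 d10 divr_gt0 // exprn_gt0.
move=> H t HH; rewrite !lt_min ltr_pdivlMr // => /andP[/andP[m0 m1] m2] t01.
have lS := l H t HH m1 t01.
rewrite (_ : p 0 (S 0 t) = 0); last by case: pE => ->.
rewrite subr0 (le_trans (hol H _ _ HH (S00 t t01) (S01 H t HH m0 t01))) //.
rewrite ler_wpM2r ?normH1_ge0 // -[X in _ <= X](ger0_norm (ltW e0)) -(sqrtr_sqr e).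
by rewrite ler_wsqrtr // (le_trans lS) // mulrC ltW.
Qed.
End expansions.

(** * First variation of the time maps *)

Section perturbation.
Variable R : realType.
Local Notation F := (R -> R).
Local Notation F2 := (F * F)%type.
Implicit Types (f g h z w u v : R -> R) (a b c d e x y s t tau : R) (H : F2).
Variable Z : F2.
Hypothesis hZ : H1in Z.

Let hH : H1sq Z. Proof. by case: hZ. Qed.
Let sZ : apart Z. Proof. exact: H1in_apart. Qed.

Definition component (p : F2 -> F) := p = fst \/ p = snd.

Lemma componentD p Y H : component p -> p (Y + H) = p Y + p H.
Proof. by case=> ->. Qed.

Lemma componentH1 p Y : component p -> H1sq Y -> H1 (p Y).
Proof. by case=> -> []. Qed.

Lemma component_nsq p : component p -> 0 < nsq (p Z).
Proof. by case: sZ => _ _ n1 n2 _ [] ->. Qed.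

Lemma component_cont p Y : component p -> H1sq Y -> continuous (p Y).
Proof. by move=> pE HY; apply: H1_continuous; exact: componentH1. Qed.

Lemma component_nsqH p : component p -> exists2 d, 0 < d &
  forall H, H1sq H -> normH1 H < d -> 0 < nsq (p (Z + H)).
Proof.
move=> pE; have L := H1_L2 (componentH1 pE hH).
have [d d0 P] := nsq_lower L L (component_nsq pE).
exists d => // H HH Hd; rewrite componentD //.
have [a1 a2 _ _] := nrm_normH1 H.
have hp : nrm (p H) < d by case: pE => ->; exact: le_lt_trans Hd.
have [_] := P _ (H1_L2 (componentH1 pE HH)) hp.
by apply: lt_le_trans; rewrite divr_gt0 // component_nsq.
Qed.

Lemma exp_component p : component p -> expands (fun H t => p (Z + H) t) (fun H t => p H t).
Proof.
move=> pE.
have e1 := expands_continuous (component_cont pE hH).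
have e2 := expands_eval pE (expands_continuous (@cont_id R)) (ex_intro2 _ _ 1 ltr01
  (fun H t _ _ t01 => t01)).
apply: expands_ext (expandsD e1 e2); last by move=> H t _ _; rewrite add0r.
by exists 1 => // H t _ _ _; rewrite componentD.
Qed.

Lemma exp_sq p : component p ->
  expands (fun H t => p (Z + H) t ^+ 2) (fun H t => 2 * p Z t * p H t).
Proof.
move=> pE; have e := exp_component pE.
apply: expands_ext (expandsM e e); first by exists 1 => // H t _ _ _; rewrite expr2.
by move=> H t _ _; rewrite addr0; ring.
Qed.

Lemma L1_coord p Y : component p -> H1sq Y -> L1 0 1 (fun t => p Y t ^+ 2).
Proof.
by move=> pE HY; have cp := component_cont pE HY; apply: continuous_L1; cont.
Qed.

Lemma L1_coordM p H : component p -> H1sq H -> L1 0 1 (fun t => 2 * p Z t * p H t).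
Proof.
move=> pE HH; have c1 := component_cont pE hH; have c2 := component_cont pE HH.
by apply: continuous_L1; cont.
Qed.

Lemma itg_coordM p H : component p -> H1sq H ->
  itg 0 1 (fun t => 2 * p Z t * p H t) = 2 * ip (p Z) (p H).
Proof.
move=> pE HH; have c1 := component_cont pE hH; have c2 := component_cont pE HH.
rewrite /ip -itgZ; first by apply: itg_eq => t _; rewrite mulrA.
by apply: continuous_L1; cont.
Qed.

Lemma exp_nsq p : component p ->
  expands (fun H _ => nsq (p (Z + H))) (fun H _ => 2 * ip (p Z) (p H)).
Proof.
move=> pE; have e := expands_itg (u := fun=> 1) (exp_sq pE).
apply: expands_ext (e _ _ _).
- by exists 1 => // H t _ _ _; rewrite sqr_itg_nsq.
- by move=> H t HH _; exact: itg_coordM.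
- by move=> t _; rewrite ler01 lexx.
- by exists 1 => // H HH _; apply: L1_coord => //; exact: H1sqD.
- by move=> H HH; exact: L1_coordM.
Qed.

Lemma exp_nsqV p : component p -> expands (fun H _ => (nsq (p (Z + H)))^-1)
  (fun H _ => - (2 * ip (p Z) (p H)) / nsq (p Z) ^+ 2).
Proof.
move=> pE; have := expandsV (exp_nsq pE) (component_nsq pE); rewrite addr0; apply.
by move=> t _; exact: ler_norm.
Qed.

(** First variation of the time density [z^2 / nsq z]. *)
Definition ddens p H t :=
  2 * p Z t * p H t / nsq (p Z) - p Z t ^+ 2 / nsq (p Z) * (2 * ip (p Z) (p H) / nsq (p Z)).
(** First variation of the time map, the primitive of that of the density. *)
Definition dtime p H t :=
  2 * prim (fun s => p Z s * p H s) t / nsq (p Z)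
  - tline (p Z) t * (2 * ip (p Z) (p H) / nsq (p Z)).

Lemma exp_dens p : component p -> expands
  (fun H t => p (Z + H) t ^+ 2 / nsq (p (Z + H))) (ddens p).
Proof.
move=> pE; apply: expands_ext (expandsM (exp_sq pE) (exp_nsqV pE)).
  by exists 1.
move=> H t HH _; rewrite !addr0 /ddens; field.
by rewrite gt_eqF // component_nsq.
Qed.

Lemma exp_time p : component p -> expands (fun H t => tmap (p (Z + H)) t) (dtime p).
Proof.
move=> pE; have e := expands_itg (u := fun t => t) (exp_sq pE).
apply: expands_ext (expandsM (exp_nsqV pE) (e _ _ _)).
- by exists 1 => // H t _ _ _; rewrite /tmap.
- move=> H t HH /andP[t0 t1]; rewrite !addr0 /dtime tline_tmap // /tmap.
  have c1 := component_cont pE hH; have c2 := component_cont pE HH.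
  have -> : itg 0 t (fun s => 2 * p Z s * p H s) = 2 * prim (fun s => p Z s * p H s) t.
    have -> : prim (fun s => p Z s * p H s) t = itg 0 t (fun s => p Z s * p H s).
      rewrite itg_prim //; last by cont.
      by rewrite /prim !itg_aa subrr subr0.
    rewrite -itgZ; first by apply: itg_eq => s _; rewrite mulrA.
    by apply: continuous_L1; cont.
  by field; rewrite gt_eqF // component_nsq.
- by [].
- by exists 1 => // H HH _; apply: L1_coord => //; exact: H1sqD.
- by move=> H HH; exact: L1_coordM.
Qed.

Lemma dtime_der p H t : component p -> H1sq H -> der (dtime p H) t (ddens p H t).
Proof.
move=> pE HH; have c1 := component_cont pE hH; have c2 := component_cont pE HH.
rewrite /dtime /ddens.
have d1 : der (prim (fun s => p Z s * p H s)) t (p Z t * p H t) by apply: prim_der; cont.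
have d2 := tline_der t c1.
apply: (der_eq (derB (derM (derZ 2 d1) (der_cst (nsq (p Z))^-1 t))
  (derM d2 (der_cst (2 * ip (p Z) (p H) / nsq (p Z)) t)))).
by ring.
Qed.

Lemma dtime_continuous p H : component p -> H1sq H -> continuous (dtime p H).
Proof. by move=> pE HH x; exact: derivable_continuous (dtime_der x pE HH). Qed.

Lemma ddens_continuous p H : component p -> H1sq H -> continuous (ddens p H).
Proof.
move=> pE HH; have c1 := component_cont pE hH; have c2 := component_cont pE HH.
by rewrite /ddens; cont.
Qed.

Lemma prim0 f : prim f 0 = 0.
Proof. by rewrite /prim subrr. Qed.

Lemma dtime01 p H : component p -> H1sq H -> dtime p H 0 = 0 /\ dtime p H 1 = 0.
Proof.
move=> pE HH; have c1 := component_cont pE hH; have c2 := component_cont pE HH.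
rewrite /dtime !tline_tmap // tmap0 tmap1 ?component_nsq // prim0.
split; first by ring.
have -> : prim (fun s => p Z s * p H s) 1 = ip (p Z) (p H).
  by rewrite /ip itg_prim ?ler01 // ?prim0 ?subr0 //; cont.
by ring.
Qed.

(** The first variation of the time map vanishes at both ends of the period and has the
    derivative [ddens], so integration by parts moves the derivative onto the other factor. *)
Lemma dtime_parts p H (Gam k : F) : component p -> H1sq H -> continuous k ->
  (forall t, der Gam t (k t)) ->
  itg 0 1 (fun t => k (tline (p Z) t) * (p Z t ^+ 2 / nsq (p Z)) * dtime p H t)
  = - itg 0 1 (fun t => Gam (tline (p Z) t) * ddens p H t).
Proof.
move=> pE HH ck dG; have c1 := component_cont pE hH.
have ct := tline_continuous c1; have cd := dtime_continuous pE HH.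
have cdd := ddens_continuous pE HH.
have cG : continuous Gam by move=> x; exact: derivable_continuous (dG x).
apply/eqP; rewrite -addr_eq0 -itgD; [|by apply: continuous_L1; cont..].
pose P t := Gam (tline (p Z) t) * dtime p H t.
have dP t : der P t (k (tline (p Z) t) * (p Z t ^+ 2 / nsq (p Z)) * dtime p H t
      + Gam (tline (p Z) t) * ddens p H t).
  by apply: (der_eq (derM (der_comp (dG _) (tline_der t c1)) (dtime_der t pE HH))).
rewrite (@itg_der _ _ P).
- by have [h0 h1] := dtime01 pE HH; rewrite /P h0 h1 !mulr0 subrr.
- exact: ler01.
- by cont.
- by apply: continuous_subspaceT => x; exact: derivable_continuous (dP x).
Qed.

(** A force [f] and a potential [Gam] acting in the time [t] contribute [K z] to the
    [L^2]-gradient, where [K] is this density: [f] acts through the value [z^2], [Gam] through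
    the change of the time density, and the mean of [Gam] comes from normalizing the total time
    to 1. *)
Definition gdens p (f Gam : F) tau := 2 / nsq (p Z) *
  (f (tline (p Z) tau) * p Z tau ^+ 2 + Gam (tline (p Z) tau) - itg 0 1 Gam).

Lemma gdens_ip p H f (Gam : F) : component p -> H1sq H -> continuous f -> continuous Gam ->
  itg 0 1 (fun t => 2 * (p Z t ^+ 2 / nsq (p Z)) * f (tline (p Z) t) * (p Z t * p H t)
            + Gam (tline (p Z) t) * ddens p H t)
  = ip (fun t => gdens p f Gam t * p Z t) (p H).
Proof.
move=> pE HH cf cG; have c1 := component_cont pE hH; have c2 := component_cont pE HH.
have ct := tline_continuous c1; have n0 := component_nsq pE.
have sub : itg 0 1 (fun t => p Z t ^+ 2 / nsq (p Z) * Gam (tline (p Z) t)) = itg 0 1 Gam.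
  rewrite -(substitution c1 n0 cG); apply: itg_eq => t /andP[t0 _].
  by rewrite tline_tmap.
pose m := 2 / nsq (p Z) * itg 0 1 (fun t => p Z t * p H t).
have cm : itg 0 1 (fun t => m * (p Z t ^+ 2 / nsq (p Z) * Gam (tline (p Z) t)))
   = itg 0 1 (fun t => 2 / nsq (p Z) * itg 0 1 Gam * (p Z t * p H t)).
  rewrite !itgZ; [|by apply: continuous_L1; cont..].
  by rewrite sub /m; ring.
apply/eqP; rewrite -subr_eq0 /ip -itgB; [|rewrite ?/gdens; apply: continuous_L1..];
  rewrite ?/gdens ?/ddens; last 2 first.
- by cont.
- by cont.
rewrite (itg_eq (g := fun t => 2 / nsq (p Z) * itg 0 1 Gam * (p Z t * p H t) -
    m * (p Z t ^+ 2 / nsq (p Z) * Gam (tline (p Z) t)))); last first.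
  move=> t _; rewrite /m /ip; field; rewrite gt_eqF //.
by rewrite itgB ?cm ?subrr //; apply: continuous_L1; cont.
Qed.
End perturbation.

(** * First variation of the instantaneous interaction *)

Section interaction.
Variable R : realType.
Local Notation mu := (@lebesgue_measure R).
Local Notation F := (R -> R).
Local Notation F2 := (F * F)%type.
Implicit Types (f g h z u v : R -> R) (a b c d e x y s t tau : R) (H : F2).
Variable Z : F2.
Hypothesis hZ : H1in Z.
Variable w1 : F.
Hypothesis cw1 : continuous w1.
Hypothesis zw1 : is_wderiv Z.1 w1.

Let hH : H1sq Z. Proof. by case: hZ. Qed.
Let sZ : apart Z. Proof. exact: H1in_apart. Qed.
Let c1 : continuous Z.1. Proof. by case: sZ. Qed.
Let c2 : continuous Z.2. Proof. by case: sZ. Qed.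
Let n1 : 0 < nsq Z.1. Proof. by case: sZ. Qed.
Let n2 : 0 < nsq Z.2. Proof. by case: sZ. Qed.
Let pf : component (@fst F F). Proof. by left. Qed.
Let ps : component (@snd F F). Proof. by right. Qed.

(** The outer particle stays strictly above the inner one, so it has no collision. Hence its
    time map is bi-Lipschitz. *)
Lemma outer_neq0 t : Z.1 t != 0.
Proof.
rewrite -(periodic_fpart t (proj1 (proj1 hH))); have := fpart_ge0 t; have := fpart_lt1 t.
move: (fpart t) => {}t t1 t0; have t01 : 0 <= t <= 1 by rewrite t0 ltW.
case: hZ => _ _ _ /(_ t t01); rewrite /gap => g.
by apply: contraTneq g => ->; rewrite expr0n sub0r oppr_gt0 -leNgt sqr_ge0.
Qed.

Lemma outer_speed : exists2 m, 0 < m & forall t, 0 <= t <= 1 -> m <= Z.1 t ^+ 2 / nsq Z.1.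
Proof.
have cb : continuous (fun t => Z.1 t ^+ 2 / nsq Z.1) by cont.
have [c _ P] := EVT_min ler01 (continuous_subspaceT cb).
exists (Z.1 c ^+ 2 / nsq Z.1); last by move=> t t01; apply: P; rewrite in_itv.
by rewrite divr_gt0 // exprn_even_gt0 //= outer_neq0.
Qed.

Lemma tmap_expand m x y : (forall t, 0 <= t <= 1 -> m <= Z.1 t ^+ 2 / nsq Z.1) ->
  0 <= x <= 1 -> 0 <= y <= 1 ->
  m * `|x - y| <= `|tmap Z.1 x - tmap Z.1 y|.
Proof.
move=> Hm; wlog yx : x y / y <= x.
  move=> W x01 y01; have [yx|/ltW xy] := leP y x; first exact: W.
  by rewrite distrC [X in _ <= X]distrC; exact: W.
move=> /andP[x0 x1] /andP[y0 y1].
rewrite ger0_norm ?subr_ge0 // tmapB // ger0_norm; last first.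
  rewrite mulr_ge0 ?invr_ge0 ?(ltW n1) //; apply: itg_ge0 => t _; exact: sqr_ge0.
rewrite -itgZ; last by apply: continuous_L1; cont.
rewrite -itg_cst //; apply: itg_le; [by apply: continuous_L1; cont..|].
by move=> t /andP[yt tx]; rewrite mulrC; apply: Hm; rewrite (le_trans y0 yt) (le_trans tx).
Qed.

Definition outer_tau t := taumap Z.1 (clip t).

Lemma outer_tauP t : 0 <= t <= 1 ->
  0 <= outer_tau t <= 1 /\ tmap Z.1 (outer_tau t) = t.
Proof. by move=> t01; rewrite /outer_tau clip_id //; exact: taumapP. Qed.

Lemma tmap_inj x y : 0 <= x <= 1 -> 0 <= y <= 1 -> tmap Z.1 x = tmap Z.1 y -> x = y.
Proof.
move=> x01 y01 E; have [m m0 Hm] := outer_speed.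
have := tmap_expand Hm x01 y01; rewrite E subrr normr0 pmulr_rle0 // normr_le0.
by rewrite subr_eq0 => /eqP.
Qed.

Lemma outer_tau_tmap t : 0 <= t <= 1 -> outer_tau (tmap Z.1 t) = t.
Proof.
move=> t01; have T := tmap01 c1 n1 t01.
by have [h1 h2] := outer_tauP T; exact: tmap_inj.
Qed.

Lemma outer_tau_continuous : continuous outer_tau.
Proof.
have [m m0 Hm] := outer_speed.
move=> x; apply: continuous_atP => e e0; exists (m * e); first exact: mulr_gt0.
move=> y xy; have [x0 x1] := clip_itv x; have [y0 y1] := clip_itv y.
have [h1 h2] := taumapP c1 n1 (introT andP (conj x0 x1)).
have [k1 k2] := taumapP c1 n1 (introT andP (conj y0 y1)).
have := tmap_expand Hm h1 k1; rewrite h2 k2 => T.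
rewrite -(ler_pM2l m0); apply: (le_trans T).
by rewrite ltW // (le_lt_trans (clip_lip _ _)).
Qed.

(** The parameter of the outer particle at the moment when the inner one is at [tau]. *)
Definition sync H tau := taumap (Z + H).1 (tmap (Z + H).2 tau).

Lemma sync0 tau : 0 <= tau <= 1 -> sync 0 tau = outer_tau (tline Z.2 tau).
Proof.
move=> t01; rewrite /sync addr0 /outer_tau clip_id ?tline_tmap //; try by case/andP: t01.
exact: tmap01.
Qed.

Lemma syncP : exists2 d, 0 < d & forall H tau, H1sq H -> normH1 H < d -> 0 <= tau <= 1 ->
  0 <= sync H tau <= 1 /\ tmap (Z + H).1 (sync H tau) = tmap (Z + H).2 tau.
Proof.
have [d d0 P] := component_nsqH hZ pf; have [d' d'0 P'] := component_nsqH hZ ps.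
exists (Num.min d d'); first by rewrite lt_min d0.
move=> H tau HH; rewrite lt_min => /andP[k1 k2] t01.
have HS := H1sqD hH HH.
by apply: taumapP; [exact: (component_cont pf)|exact: P|apply: tmap01 => //;
   [exact: (component_cont ps)|exact: P']].
Qed.

Lemma sync0P tau : 0 <= tau <= 1 ->
  0 <= sync 0 tau <= 1 /\ tmap Z.1 (sync 0 tau) = tmap Z.2 tau.
Proof.
move=> t01; rewrite sync0 // -(@tline_tmap _ Z.2); last by case/andP: t01.
apply: outer_tauP; rewrite tline_tmap; last by case/andP: t01.
exact: tmap01.
Qed.

Lemma norm_remainder (t1 t2 t d1 d1' d2 bd A B C D : R) :
  `|t1 - t2 - bd| <= A -> `|t - t1 - d1'| <= B -> `|t - t2 - d2| <= C ->
  `|d1' - d1| <= D -> `|bd - (d2 - d1)| <= A + B + C + D.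
Proof. by rewrite !ler_norml; lra. Qed.

Definition dsync H tau := (dtime Z snd H tau - dtime Z fst H (sync 0 tau)) /
  (Z.1 (sync 0 tau) ^+ 2 / nsq Z.1).

(** Implicit differentiation of [t_1 (sync tau) = t_2 tau]. The outer time map is steep
    everywhere, which turns the expansion of the two sides into an expansion of [sync] itself. *)
Lemma exp_sync : expands sync dsync.
Proof.
have [m m0 Hm] := outer_speed.
have E1 := exp_time hZ pf; have E2 := exp_time hZ ps.
have [[K1 K10 k1] _ T1] := E1; have [[K2 K20 k2] _ T2] := E2.
have [L1 L10 [r1 r10 l1]] := expands_lip E1.
have [L2 L20 [r2 r20 l2]] := expands_lip E2.
have [[D D0 bD] _ _] := exp_dens hZ pf.
have [r3 r30 SP] := syncP.
have sp tau : 0 <= tau <= 1 -> 0 < Z.1 (sync 0 tau) ^+ 2 / nsq Z.1.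
  by move=> t01; rewrite divr_gt0 // exprn_even_gt0 //= outer_neq0.
have iv tau : 0 <= tau <= 1 -> `|(Z.1 (sync 0 tau) ^+ 2 / nsq Z.1)^-1| <= m^-1.
  move=> t01; rewrite normfV gtr0_norm ?sp // lef_pV2 ?posrE ?sp //.
  by apply: Hm; have [] := sync0P t01.
split.
- exists ((K2 + K1) / m); first by rewrite divr_gt0 // addr_gt0.
  move=> H tau HH t01; have [s01 _] := sync0P t01.
  rewrite normrM [leRHS]mulrAC ler_pM ?iv // mulrDl (le_trans (ler_normB _ _)) //.
  by apply: lerD; [exact: k2|exact: k1].
- by exists 1 => // tau t01; have [/andP[h0 h1] _] := sync0P t01; rewrite ger0_norm.
move=> e e0; pose L := (L1 + L2) / m.
have L0 : 0 < L by rewrite divr_gt0 // addr_gt0.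
pose e1 := e * m / (2 * (2 + L)).
have e10 : 0 < e1 by rewrite divr_gt0 ?mulr_gt0 // addr_gt0.
have tl x y : 0 <= x -> x <= y -> y <= 1 ->
    tline Z.1 y - tline Z.1 x = itg x y (fun t => Z.1 t ^+ 2 / nsq Z.1).
  move=> x0 xy y1; apply/esym; apply: itg_der => //; first by cont.
    exact/continuous_subspaceT/tline_continuous.
  by move=> t _; exact: tline_der.
have cb : continuous (fun t => Z.1 t ^+ 2 / nsq Z.1) by cont.
have [r4 r40 UT] := uniform_taylor cb tl e10.
have [r5 r50 P1] := T1 _ e10; have [r6 r60 P2] := T2 _ e10.
pose r7 := e * m / 2 / (D * L).
have DL : 0 < D * L by exact: mulr_gt0.
have r70 : 0 < r7 by rewrite !divr_gt0 ?(mulr_gt0 e0 m0).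
exists (Num.min (Num.min (Num.min r1 r2) (Num.min r3 (r4 / L)))
        (Num.min (Num.min r5 r6) r7)).
  have r4L : 0 < r4 / L by exact: divr_gt0.
  by rewrite !lt_min r10 r20 r30 r4L r50 r60 r70.
move=> H tau HH; rewrite !lt_min => /andP[/andP[/andP[a1 a2] /andP[a3 a4]] /andP[/andP[a5 a6] a7]] t01.
rewrite ltr_pdivlMr // in a4.
have [s01 sE] := SP H tau HH a3 t01; have [s'01 s'E] := sync0P t01.
have n0 := normH1_ge0 H.
have q1 := P1 H _ HH a5 s01; have q2 := P2 H _ HH a6 t01.
have u1 := l1 H _ HH a1 s01; have u2 := l2 H _ HH a2 t01.
rewrite addr0 in q1 q2 u1 u2.
have X : `|tmap Z.1 (sync H tau) - tmap Z.1 (sync 0 tau)| <= (L1 + L2) * normH1 H.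
  rewrite s'E (_ : _ - _ = (tmap (Z + H).2 tau - tmap Z.2 tau) -
    (tmap (Z + H).1 (sync H tau) - tmap Z.1 (sync H tau))); last by rewrite sE; ring.
  by rewrite (le_trans (ler_normB _ _)) // mulrDl addrC lerD.
have S : `|sync H tau - sync 0 tau| <= L * normH1 H.
  have := le_trans (tmap_expand Hm s01 s'01) X.
  by rewrite /L mulrAC ler_pdivlMr // mulrC.
have Sr : `|sync H tau - sync 0 tau| < r4.
  by apply: (le_lt_trans S); rewrite mulrC.
have V := UT _ _ s'01 s01 Sr.
have V' : `|tline Z.1 (sync H tau) - tline Z.1 (sync 0 tau) -
   Z.1 (sync 0 tau) ^+ 2 / nsq Z.1 * (sync H tau - sync 0 tau)| <= e1 * (L * normH1 H).
  by apply: (le_trans V); rewrite ler_wpM2l // ltW.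
have [/andP[s0 _] /andP[s'0 _]] := (s01, s'01).
rewrite !tline_tmap // s'E in V'.
have W : `|dtime Z fst H (sync H tau) - dtime Z fst H (sync 0 tau)| <=
    D * normH1 H * (L * normH1 H).
  have lipd x y : 0 <= x -> x <= y -> y <= 1 ->
      `|dtime Z fst H y - dtime Z fst H x| <= D * normH1 H * (y - x).
    move=> x0 xy y1; have cdd := ddens_continuous hZ pf HH.
    have <- : itg x y (ddens Z fst H) = dtime Z fst H y - dtime Z fst H x.
      apply: itg_der => //; first exact/continuous_subspaceT/dtime_continuous.
      by move=> t _; exact: dtime_der.
    apply: norm_itg_le => //; first exact: continuous_L1.
    by move=> t /andP[xt ty]; apply: bD => //; rewrite (le_trans x0 xt) (le_trans ty).
  have DH : 0 <= D * normH1 H by rewrite mulr_ge0 // ltW.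
  apply: le_trans (ler_wpM2l DH S).
  have [/andP[? ?] /andP[? ?]] := (s01, s'01).
  have [ss|/ltW ss] := leP (sync 0 tau) (sync H tau).
    by rewrite (ger0_norm (_ : 0 <= sync H tau - _)) ?subr_ge0 // lipd.
  rewrite distrC (distrC (sync H tau)) (ger0_norm (_ : 0 <= sync 0 tau - _)) ?subr_ge0 //.
  by rewrite lipd.
set b := Z.1 (sync 0 tau) ^+ 2 / nsq Z.1 in V'.
have b0 : 0 < b := sp _ t01.
have bm : m <= b by exact: Hm.
set delta := sync H tau - sync 0 tau in V' *.
rewrite /dsync -/b.
rewrite [X in `|X|](_ : _ = (b * delta -
  (dtime Z snd H tau - dtime Z fst H (sync 0 tau))) / b); last by field; rewrite gt_eqF.
rewrite normrM normfV (gtr0_norm b0) ler_pdivrMr //.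
rewrite sE in q1; apply: (le_trans (norm_remainder V' q1 q2 W)).
have -> : e1 * (L * normH1 H) + e1 * normH1 H + e1 * normH1 H = e * m / 2 * normH1 H.
  by rewrite /e1; field; rewrite gt_eqF // addr_gt0.
have h7 : D * normH1 H * (L * normH1 H) <= e * m / 2 * normH1 H.
  rewrite mulrA ler_wpM2r //.
  by rewrite mulrAC mulrC -ler_pdivlMr //; exact: ltW.
apply: (le_trans (lerD (lexx _) h7)).
rewrite (_ : _ + _ = e * normH1 H * m); last by field.
by rewrite ler_wpM2l // mulr_ge0 // ltW.
Qed.

Lemma sync_range : exists2 d, 0 < d & forall H tau, H1sq H -> normH1 H < d ->
  0 <= tau <= 1 -> 0 <= sync H tau <= 1.
Proof.
by have [d d0 P] := syncP; exists d => // H tau HH Hd t01; have [] := P H tau HH Hd t01.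
Qed.

(** The evaluation of [z_1] at a moving point is differentiable only because [z_1] is C^1,
    which is why its regularity is established separately. *)
Lemma exp_outer : expands (fun H tau => (Z + H).1 (sync H tau))
  (fun H tau => w1 (sync 0 tau) * dsync H tau + H.1 (sync 0 tau)).
Proof.
have z1E x y : 0 <= x -> x <= y -> y <= 1 -> Z.1 y - Z.1 x = itg x y w1.
  move=> x0 xy y1; have [_ zE] := zw1.
  rewrite (zE x) ?x0 ?(le_trans xy) // (zE y) ?(le_trans x0 xy) //.
  rewrite (@itg_split _ w1 0 x y) //; first by ring.
  exact: continuous_L1.
apply: expands_ext (expandsD (expands_subst exp_sync sync_range c1 cw1 z1E)
   (expands_eval pf exp_sync sync_range)) => //.
by exists 1.
Qed.

Definition distance H tau := (Z + H).1 (sync H tau) ^+ 2 - (Z + H).2 tau ^+ 2.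

Lemma distance0 tau : 0 <= tau <= 1 -> distance 0 tau = (Psi Z (tline Z.2 tau))^-1.
Proof.
move=> t01; have /andP[t0 _] := t01; rewrite /distance tline_tmap // Psi_tmap2 // invrK.
by rewrite !addr0 /qf /sync addr0.
Qed.

Definition ddist H tau := 2 * Z.1 (sync 0 tau) *
  (w1 (sync 0 tau) * dsync H tau + H.1 (sync 0 tau)) - 2 * Z.2 tau * H.2 tau.

Lemma exp_distance : expands distance ddist.
Proof.
have e := exp_outer; have e2 := exp_sq hZ ps.
have em := expands_continuous (@cont_cst R (-1)).
apply: expands_ext (expandsD (expandsM e e) (expandsM em e2)).
  by exists 1 => // H t _ _ _; rewrite /distance; ring.
by move=> H t _ _; rewrite addr0 /ddist /=; ring.
Qed.

Lemma distance_lower : exists2 c, 0 < c & forall tau, 0 <= tau <= 1 -> c <= distance 0 tau.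
Proof.
have cP : continuous (fun t => qclip Z.1 t - qclip Z.2 t).
  by have q1 := qclip_continuous c1 n1; have q2 := qclip_continuous c2 n2; cont.
have [c _ P] := EVT_min ler01 (continuous_subspaceT cP).
exists (qclip Z.1 c - qclip Z.2 c); first exact: apart_clip.
move=> tau t01; have /andP[t0 _] := t01.
rewrite distance0 // /Psi invrK; apply: P; rewrite in_itv /= tline_tmap //.
exact: tmap01.
Qed.

Lemma apart_near : exists2 d, 0 < d & forall H, H1sq H -> normH1 H < d -> apart (Z + H).
Proof.
have [d1 d10 P1] := component_nsqH hZ pf; have [d2 d20 P2] := component_nsqH hZ ps.
have [c c0 Pc] := distance_lower; have [L L0 [d3 d30 P3]] := expands_lip exp_distance.
exists (Num.min (Num.min d1 d2) (Num.min d3 (c / L))).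
  by rewrite !lt_min d10 d20 d30 divr_gt0.
move=> H HH; rewrite !lt_min ltr_pdivlMr // => /andP[/andP[a1 a2] /andP[a3 a4]].
have HS := H1sqD hH HH.
have k1 := component_cont pf HS; have k2 := component_cont ps HS.
have m1 := P1 H HH a1; have m2 := P2 H HH a2.
split=> // t t01; have [tau tau01 tE] := tmap_surj k2 m2 t01.
have -> : qf (Z + H).2 t = (Z + H).2 tau ^+ 2 by rewrite -tE qf_tmap.
rewrite -subr_gt0 -tE -/(distance H tau).
have := P3 H tau HH a3 tau01; have := Pc tau tau01 => h1 /ler_normlP[h2 _].
by rewrite /qf -/(sync H tau) -/(distance H tau); lra.
Qed.

Definition fPsi t := Psi Z t ^+ 2.
Definition slope1 s := 2 * nsq Z.1 * w1 s / Z.1 s.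
(** With [f] the inverse square distance and [q_1, q_2] the Levi-Civita images, [Gam1] is the
    primitive of [f q_1'], and [Gam2] below is one of [f q_2']: their difference is the
    reciprocal distance [1 / (q_1 - q_2)], whose derivative is [- f (q_1' - q_2')]. In this
    form [q_2], which is not differentiable at its collisions, is not differentiated. *)
Definition Gam1 := prim (fun t => fPsi t * slope1 (outer_tau t)).
Definition Gam2 t := Gam1 t + Psi Z t.

Lemma fPsi_continuous : continuous fPsi.
Proof. by have := Psi_continuous sZ; rewrite /fPsi => cP; cont. Qed.

Lemma slope1_continuous : continuous slope1.
Proof. by have n0 := outer_neq0; rewrite /slope1; cont. Qed.

Let ck : continuous (fun t => fPsi t * slope1 (outer_tau t)).
Proof.
have cf := fPsi_continuous; have cs := slope1_continuous; have co := outer_tau_continuous.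
by cont.
Qed.

Lemma Gam1_der t : der Gam1 t (fPsi t * slope1 (outer_tau t)).
Proof. exact: prim_der. Qed.

Lemma Gam1_continuous : continuous Gam1.
Proof. by move=> x; exact: derivable_continuous (Gam1_der x). Qed.

Lemma Gam2_continuous : continuous Gam2.
Proof.
have cG := Gam1_continuous; have := Psi_continuous sZ => cP; rewrite /Gam2; cont.
Qed.

Definition dIfun H :=
  ip (fun t => gdens Z fst fPsi Gam1 t * Z.1 t) H.1
  - ip (fun t => gdens Z snd fPsi Gam2 t * Z.2 t) H.2.

(** The derivative of the integrand in [- Ifun], with the parameter of the outer particle
    written as a function of the time, continuous on the whole line. *)
Definition dintegrand H t := ddens Z snd H t * Psi Z (tline Z.2 t)
  - Z.2 t ^+ 2 / nsq Z.2 * fPsi (tline Z.2 t) *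
   (2 * Z.1 (outer_tau (tline Z.2 t)) * H.1 (outer_tau (tline Z.2 t))
    + slope1 (outer_tau (tline Z.2 t)) *
       (dtime Z snd H t - dtime Z fst H (outer_tau (tline Z.2 t)))
    - 2 * Z.2 t * H.2 t).

(** Pulling the integral over the parameter of the inner particle back to the time, and then to
    the parameter of the outer one, gives three terms: the values [h_i] against the force, and
    the variations of the two time maps, which are integrated by parts. *)
Lemma dintegrand_itg H : H1sq H -> - itg 0 1 (dintegrand H) = dIfun H.
Proof.
move=> HH; have h1 := component_cont pf HH; have h2 := component_cont ps HH.
have t2c := tline_continuous c2; have t1c := tline_continuous c1.
have cP := Psi_continuous sZ; have cf := fPsi_continuous; have cs := slope1_continuous.
have co := outer_tau_continuous; have cG1 := Gam1_continuous; have cG2 := Gam2_continuous.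
have d1c := dtime_continuous hZ pf HH; have d2c := dtime_continuous hZ ps HH.
have dd1 := ddens_continuous hZ pf HH; have dd2 := ddens_continuous hZ ps HH.
pose th t := fPsi t * (2 * Z.1 (outer_tau t) * H.1 (outer_tau t)
   - slope1 (outer_tau t) * dtime Z fst H (outer_tau t)).
have cth : continuous th by rewrite /th; cont.
pose A t := ddens Z snd H t * Psi Z (tline Z.2 t)
  + 2 * (Z.2 t ^+ 2 / nsq Z.2) * fPsi (tline Z.2 t) * (Z.2 t * H.2 t).
pose B t := (fun s => fPsi s * slope1 (outer_tau s)) (tline Z.2 t) *
   (Z.2 t ^+ 2 / nsq Z.2) * dtime Z snd H t.
pose C t := Z.2 t ^+ 2 / nsq Z.2 * th (tline Z.2 t).
have cA : continuous A by rewrite /A; cont.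
have cB : continuous B by rewrite /B; cont.
have cC : continuous C by apply: contM; [cont|exact: (cont_comp cth)].
have E t : 0 <= t <= 1 -> dintegrand H t = A t - B t - C t.
  by move=> _; rewrite /dintegrand /A /B /C /th /fPsi; ring.
rewrite (itg_eq E) !itgB; [|exact: continuous_L1..|by apply: continuous_L1; cont|exact: continuous_L1].
have EB : itg 0 1 B = - itg 0 1 (fun t => Gam1 (tline Z.2 t) * ddens Z snd H t).
  exact: (dtime_parts hZ ps HH ck Gam1_der).
have EC : itg 0 1 C = ip (fun t => gdens Z fst fPsi Gam1 t * Z.1 t) H.1.
  have -> : itg 0 1 C = itg 0 1 th.
    rewrite -(substitution c2 n2 cth); apply: itg_eq => t /andP[t0 _].
    by rewrite /C tline_tmap.
  rewrite -(substitution c1 n1 cth) -(gdens_ip hZ pf HH cf cG1).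
  pose B1 t := (fun s => fPsi s * slope1 (outer_tau s)) (tline Z.1 t) *
     (Z.1 t ^+ 2 / nsq Z.1) * dtime Z fst H t.
  have cB1 : continuous B1 by rewrite /B1; cont.
  have EB1 : itg 0 1 B1 = - itg 0 1 (fun t => Gam1 (tline Z.1 t) * ddens Z fst H t).
    exact: (dtime_parts hZ pf HH ck Gam1_der).
  have ca : continuous (fun t => 2 * (Z.1 t ^+ 2 / nsq Z.1) * fPsi (tline Z.1 t) * (Z.1 t * H.1 t)).
    by cont.
  have cb : continuous (fun t => Gam1 (tline Z.1 t) * ddens Z fst H t) by cont.
  rewrite itgD; [|exact: continuous_L1..].
  rewrite -[X in _ + X]opprK -EB1 -itgB; [|exact: continuous_L1..].
  apply: itg_eq => t t01; have /andP[t0 _] := t01.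
  by rewrite /th /B1 /= !tline_tmap // outer_tau_tmap //; ring.
have EA : itg 0 1 A - itg 0 1 B = ip (fun t => gdens Z snd fPsi Gam2 t * Z.2 t) H.2.
  rewrite EB opprK -itgD; [|exact: continuous_L1|by apply: continuous_L1; cont].
  rewrite -(gdens_ip hZ ps HH cf cG2); apply: itg_eq => t _.
  rewrite /A /Gam2.
  by ring.
by rewrite EA EC /dIfun; ring.
Qed.

(** Written as an integral over the parameter of the inner particle, [- Ifun] involves the
    outer particle only through its distance at the synchronized parameter. *)
Lemma exp_Ifun : expands (fun H _ => Ifun (Z + H)) (fun H _ => dIfun H).
Proof.
have [c c0 Pc] := distance_lower; have [d d0 ap] := apart_near.
have e0 := exp_dens hZ ps.
have e1 : expands (fun H t => (distance H t)^-1)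
    (fun H t => - ddist H t / distance 0 t ^+ 2).
  apply: (expandsV exp_distance c0) => t t01.
  by apply: le_trans (ler_norm _); exact: Pc.
have integrandE H t : H1sq H -> normH1 H < d -> 0 <= t <= 1 ->
    (Z + H).2 t ^+ 2 / nsq (Z + H).2 * (distance H t)^-1 =
    (Z + H).2 t ^+ 2 / nsq (Z + H).2 * Psi (Z + H) (tmap (Z + H).2 t).
  by move=> HH Hd t01; rewrite Psi_tmap2 //; exact: ap.
have dE H t : H1sq H -> 0 <= t <= 1 ->
    ddens Z snd H t * (distance 0 t)^-1 + (Z + 0).2 t ^+ 2 / nsq (Z + 0).2 *
      (- ddist H t / distance 0 t ^+ 2) = dintegrand H t.
  move=> HH t01; rewrite addr0 distance0 // /dintegrand /ddist /dsync sync0 //.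
  rewrite invrK /fPsi exprVn invrK.
  set s := outer_tau _; have s0 := outer_neq0 s; rewrite /slope1.
  by field; rewrite s0 ?(gt_eqF n1) ?(gt_eqF n2).
have e := expands_itg (u := fun=> 1) (expandsM e0 e1).
have e2 := expandsM (expands_continuous (@cont_cst R (-1))) (e _ _ _).
apply: expands_ext (e2 _ _ _).
- exists d => // H t HH Hd t01; rewrite IfunE; last exact: ap.
  rewrite mulN1r; congr (- _).
  have [k1 k2 m1 m2 _] := ap H HH Hd.
  rewrite -(substitution k2 m2 (Psi_continuous (ap H HH Hd))).
  by apply: itg_eq => s s01; rewrite integrandE.
- move=> H t HH t01; rewrite mul0r add0r mulN1r -dintegrand_itg //.
  by congr (- _); apply: itg_eq => s s01; exact: dE.
- by move=> t _; rewrite ler01 lexx.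
- exists d => // H HH Hd; have [k1 k2 m1 m2 _] := ap H HH Hd.
  apply: (@eq_integrable _ _ _ mu `[0%R, 1%R]%classic (measurable_itv _)
    (EFin \o (fun t => (Z + H).2 t ^+ 2 / nsq (Z + H).2 *
       Psi (Z + H) (tline (Z + H).2 t)))).
    move=> x; rewrite inE /= in_itv /= => x01; rewrite integrandE //.
    by rewrite tline_tmap //; case/andP: x01.
  have ct := tline_continuous k2; have cP := Psi_continuous (ap H HH Hd).
  by apply: continuous_L1; cont.
move=> H HH.
apply: (@eq_integrable _ _ _ mu `[0%R, 1%R]%classic (measurable_itv _)
    (EFin \o dintegrand H)).
  by move=> x; rewrite inE /= in_itv /= => x01; rewrite dE.
have h1 := component_cont pf HH; have h2 := component_cont ps HH.
have t2c := tline_continuous c2; have cP := Psi_continuous sZ.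
have cf := fPsi_continuous; have cs := slope1_continuous.
have co := outer_tau_continuous; have dd2 := ddens_continuous hZ ps HH.
have d1c := dtime_continuous hZ pf HH; have d2c := dtime_continuous hZ ps HH.
by apply: continuous_L1; rewrite /dintegrand; cont.
Qed.
End interaction.

(** * The derivative of the regularized functional *)

Section total_derivative.
Variable R : realType.
Local Notation F := (R -> R).
Local Notation F2 := (F * F)%type.
Implicit Types (f g h z u v : R -> R) (a b c d e x y s t tau : R) (H : F2).
Variables (r : R) (Z : F2).
Hypothesis hZ : H1in Z.

Let hH : H1sq Z. Proof. by case: hZ. Qed.
Let sZ : apart Z. Proof. exact: H1in_apart. Qed.
Let pf : component (@fst F F). Proof. by left. Qed.
Let ps : component (@snd F F). Proof. by right. Qed.

Definition qbar (p : F2 -> F) := nsq (sqr (p Z)) / nsq (p Z).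

Lemma exp_quart p : component p -> expands (fun H _ => nsq (sqr (p (Z + H))))
  (fun H _ => 4 * ip (fun t => p Z t ^+ 3) (p H)).
Proof.
move=> pE; have e := exp_sq hZ pE.
have e1 := expands_itg (u := fun=> 1) (expandsM e e).
apply: expands_ext (e1 _ _ _).
- by exists 1 => // H t _ _ _; apply: itg_eq => x _.
- move=> H t HH _; have k1 := component_cont pE hH; have k2 := component_cont pE HH.
  rewrite /ip -itgZ; last by apply: continuous_L1; cont.
  by apply: itg_eq => x _; rewrite addr0; ring.
- by move=> t _; rewrite ler01 lexx.
- exists 1 => // H HH _; have k1 := component_cont pE (H1sqD hH HH).
  by apply: continuous_L1; cont.
- move=> H HH; have k1 := component_cont pE hH; have k2 := component_cont pE HH.
  by rewrite !addr0; apply: continuous_L1; cont.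
Qed.

Lemma exp_qbar p : component p ->
  expands (fun H _ => nsq (sqr (p (Z + H))) / nsq (p (Z + H)))
    (fun H _ => ip (fun t => 2 / nsq (p Z) * (2 * p Z t ^+ 2 - qbar p) * p Z t) (p H)).
Proof.
move=> pE; apply: expands_ext (expandsM (exp_quart pE) (exp_nsqV hZ pE)).
  by exists 1.
move=> H t HH _; have k1 := component_cont pE hH; have k2 := component_cont pE HH.
have n0 := component_nsq hZ pE; rewrite !addr0.
have -> : ip (fun t => 2 / nsq (p Z) * (2 * p Z t ^+ 2 - qbar p) * p Z t) (p H)
  = 4 / nsq (p Z) * ip (fun t => p Z t ^+ 3) (p H)
    - 2 / nsq (p Z) * qbar p * ip (p Z) (p H).
  rewrite /ip -!itgZ -?itgB; [|by apply: continuous_L1; cont..].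
  by apply: itg_eq => x _; ring.
by rewrite /qbar; field; rewrite gt_eqF.
Qed.

Definition fA := (qbar fst - qbar snd)^-1 ^+ 2.

Lemma qbar_lt : 0 < qbar fst - qbar snd.
Proof. by have [] := AfunE sZ; case: sZ => *; rewrite /qbar -!avg_q. Qed.

Lemma gap_quotient (u v m n A B C D : R) : 0 < m -> 0 < n ->
  `|u / m + -1 * (v / n) - (A + -1 * B)| <= C * D -> D * C < A - B ->
  -1 / (u / m + -1 * (v / n)) = - (m * n / (u * n - v * m)).
Proof.
move=> m0 n0 /ler_normlP[k _] l; have p0 : 0 < u / m + -1 * (v / n) by lra.
have E : u / m + -1 * (v / n) = (u * n - v * m) / (m * n) by field; rewrite !gt_eqF.
by rewrite E in p0 *; rewrite invf_div mulN1r.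
Qed.

(** Each of the two mean positions is a quotient of integral norms, so no time change enters. *)
Lemma exp_Afun : expands (fun H _ => Afun (Z + H)) (fun H _ =>
  ip (fun t => fA * (2 / nsq Z.1 * (2 * Z.1 t ^+ 2 - qbar fst)) * Z.1 t) H.1
  - ip (fun t => fA * (2 / nsq Z.2 * (2 * Z.2 t ^+ 2 - qbar snd)) * Z.2 t) H.2).
Proof.
have em := expands_continuous (@cont_cst R (-1)).
have q0 := qbar_lt.
have eD := expandsD (exp_qbar pf) (expandsM em (exp_qbar ps)).
have eV := expandsV eD q0.
have eT : forall t, 0 <= t <= 1 -> qbar fst - qbar snd <=
    `|nsq (sqr (Z + 0).1) / nsq (Z + 0).1 + -1 * (nsq (sqr (Z + 0).2) / nsq (Z + 0).2)|.
  by move=> t _; rewrite !addr0 mulN1r ler_norm.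
have [d1 d10 P1] := component_nsqH hZ pf; have [d2 d20 P2] := component_nsqH hZ ps.
have [L L0 [d3 d30 P3]] := expands_lip eD.
apply: expands_ext (expandsM em (eV eT)).
  exists (Num.min (Num.min d1 d2) (Num.min d3 ((qbar fst - qbar snd) / L))).
    by rewrite !lt_min d10 d20 d30 divr_gt0.
  move=> H t HH; rewrite !lt_min ltr_pdivlMr // => /andP[/andP[a1 a2] /andP[a3 a4]] t01.
  have m1 := P1 H HH a1; have m2 := P2 H HH a2.
  have := P3 H t HH a3 t01; rewrite !addr0.
  rewrite /Afun !nrm_sq -/(qbar fst) -/(qbar snd) => k.
  exact: gap_quotient m1 m2 k a4.
move=> H t HH t01; have k1 := component_cont pf hH; have k2 := component_cont ps hH.
have h1 := component_cont pf HH; have h2 := component_cont ps HH.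
have sc (z h : F) c (q n : R) : continuous z -> continuous h ->
   ip (fun t => c * (2 / n * (2 * z t ^+ 2 - q)) * z t) h =
   c * ip (fun t => 2 / n * (2 * z t ^+ 2 - q) * z t) h.
  move=> cz ch; rewrite /ip -itgZ; last by apply: continuous_L1; cont.
  by apply: itg_eq => x _; rewrite !mulrA.
rewrite (sc _ _ _ _ _ k1 h1) (sc _ _ _ _ _ k2 h2) !addr0 !mul0r !add0r /fA /qbar.
rewrite -mulrBr !mulN1r exprVn mulNr opprK mulrC.
by [].
Qed.

Lemma exp_wnsq p : component p -> expands (fun H _ => nsq (wderiv (p (Z + H))))
  (fun H _ => 2 * ip (wderiv (p Z)) (wderiv (p H))).
Proof.
move=> pE; have Lw H : H1sq H -> L2 (wderiv (p H)).
  by move=> HH; case: (H1_wderiv (componentH1 pE HH)).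
have nw H : H1sq H -> nrm (wderiv (p H)) <= normH1 H.
  by move=> HH; have [] := nrm_normH1 H; case: pE => ->.
have sumE H : H1sq H -> nsq (wderiv (p (Z + H))) =
    nsq (wderiv (p Z)) + 2 * ip (wderiv (p Z)) (wderiv (p H)) + nsq (wderiv (p H)).
  move=> HH; rewrite componentD // (ae_nsq (wderivD _ _)) ?nsqD //;
    try exact: componentH1; try exact: Lw.
    by rewrite -componentD //; apply: Lw; exact: H1sqD.
  by apply: L2D; exact: Lw.
have W0 := nrm_ge0 (wderiv (p Z)).
split.
- exists (2 * nrm (wderiv (p Z)) + 1); first by rewrite ltr_wpDl // mulr_ge0.
  move=> H t HH _; rewrite normrM ger0_norm // mulrDl mul1r.
  have := cauchy_schwarz (Lw _ hH) (Lw _ HH).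
  have := ler_wpM2l W0 (nw H HH); have := normH1_ge0 H; lra.
- exists (nsq (wderiv (p Z)) + 1); first by rewrite ltr_wpDl // nsq_ge0.
  by move=> t _; rewrite addr0 ger0_norm ?nsq_ge0 //; lra.
move=> e e0; exists e => // H t HH He _.
rewrite sumE // addr0.
rewrite [X in `|X|](_ : _ = nsq (wderiv (p H))); last by ring.
rewrite ger0_norm ?nsq_ge0 // -nrm_sq expr2.
by apply: ler_pM; rewrite ?nrm_ge0 ?nw // (le_trans (nw H HH)) // ltW.
Qed.

Lemma exp_Qfun p : component p -> expands (fun H _ => Qfun (p (Z + H)))
  (fun H _ => 4 * nsq (p Z) * ip (wderiv (p Z)) (wderiv (p H))
   + ip (fun t => (4 * nsq (wderiv (p Z)) - 4 / nsq (p Z) ^+ 2) * p Z t) (p H)).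
Proof.
move=> pE; have ec := expands_continuous (@cont_cst R 2).
apply: expands_ext (expandsD (expandsM (expandsM ec (exp_nsq hZ pE)) (exp_wnsq pE))
   (expandsM ec (exp_nsqV hZ pE))).
  by exists 1 => // H t _ _ _; rewrite /Qfun !nrm_sq.
move=> H t HH _; have k1 := component_cont pE hH; have k2 := component_cont pE HH.
have -> : ip (fun t => (4 * nsq (wderiv (p Z)) - 4 / nsq (p Z) ^+ 2) * p Z t) (p H)
   = (4 * nsq (wderiv (p Z)) - 4 / nsq (p Z) ^+ 2) * ip (p Z) (p H).
  move: (_ - _) => c; rewrite /ip -itgZ; last by apply: continuous_L1; cont.
  by apply: itg_eq => x _; rewrite mulrA.
rewrite !addr0; field.
by rewrite gt_eqF // (component_nsq hZ pE).
Qed.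

Variable w1 : F.
Hypothesis cw1 : continuous w1.
Hypothesis zw1 : is_wderiv Z.1 w1.

(** The force [F (t)] which the particles exert on each other. The primitives [work1] and
    [work2] below are those of [F q_1'] and [F q_2']. *)
Definition force t := r * fPsi Z t + (1 - r) * fA.
Definition work1 t := r * Gam1 Z w1 t + (1 - r) * fA * qclip Z.1 t.
Definition work2 t := r * Gam2 Z w1 t + (1 - r) * fA * qclip Z.2 t.

Lemma force_continuous : continuous force.
Proof. by have cf := fPsi_continuous hZ; rewrite /force; cont. Qed.

Lemma work1_continuous : continuous work1.
Proof.
have cf := Gam1_continuous hZ cw1; have [k1 _ m1 _ _] := sZ.
by have cq := qclip_continuous k1 m1; rewrite /work1; cont.
Qed.

Lemma work2_continuous : continuous work2.
Proof.
have cf := Gam2_continuous hZ cw1; have [_ k2 _ m2 _] := sZ.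
by have cq := qclip_continuous k2 m2; rewrite /work2; cont.
Qed.

(** The derivative of [Bfun r] at [Z] is [H |-> sum_i 4 nsq z_i <z_i', h_i'> + <K_i z_i, h_i>],
    with [K_1], [K_2] these two functions. *)
Definition kernel1 t := 4 * nsq (wderiv Z.1) - 4 / nsq Z.1 ^+ 2 + gdens Z fst force work1 t.
Definition kernel2 t := 4 * nsq (wderiv Z.2) - 4 / nsq Z.2 ^+ 2 - gdens Z snd force work2 t.

Lemma gdens_continuous p f (G : F) : component p -> continuous f -> continuous G ->
  continuous (gdens Z p f G).
Proof.
move=> pE cf cG; have k1 := component_cont pE hH; have ct := tline_continuous k1.
by rewrite /gdens; cont.
Qed.

Lemma kernel1_continuous : continuous kernel1.
Proof.
by have cg := gdens_continuous pf force_continuous work1_continuous; rewrite /kernel1; cont.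
Qed.

Lemma kernel2_continuous : continuous kernel2.
Proof.
by have cg := gdens_continuous ps force_continuous work2_continuous; rewrite /kernel2; cont.
Qed.

Definition dBfun H :=
  (4 * nsq Z.1 * ip (wderiv Z.1) (wderiv H.1) + ip (fun t => kernel1 t * Z.1 t) H.1)
  + (4 * nsq Z.2 * ip (wderiv Z.2) (wderiv H.2) + ip (fun t => kernel2 t * Z.2 t) H.2).

Lemma gdens_total p t (G : F) : component p -> 0 <= t <= 1 -> continuous G ->
  gdens Z p force (fun t => r * G t + (1 - r) * fA * qclip (p Z) t) t =
  r * gdens Z p (fPsi Z) G t
  + (1 - r) * (fA * (2 / nsq (p Z) * (2 * p Z t ^+ 2 - qbar p))).
Proof.
move=> pE t01 cG; have k1 := component_cont pE hH; have m1 := component_nsq hZ pE.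
have cq := qclip_continuous k1 m1.
rewrite /gdens /force itgD; [|by apply: continuous_L1; cont..].
rewrite !itgZ; [|by apply: continuous_L1; cont..].
rewrite avg_q // tline_tmap; last by case/andP: t01.
rewrite qclip_id ?tmap01 // qf_tmap // -/(qbar p).
by ring.
Qed.

Lemma ip_split (K f g z h : F) (a b c : R) : continuous f -> continuous g ->
  continuous z -> continuous h ->
  (forall t, 0 <= t <= 1 -> K t = c + a * f t + b * g t) ->
  ip (fun t => K t * z t) h =
  ip (fun t => c * z t) h + a * ip (fun t => f t * z t) h + b * ip (fun t => g t * z t) h.
Proof.
move=> cf cg cz ch KE; rewrite /ip -!itgZ -?itgD; [|by apply: continuous_L1; cont..].
by apply: itg_eq => s s01; rewrite KE //; ring.
Qed.

Lemma exp_Bfun : expands (fun H _ => Bfun r (Z + H)) (fun H _ => dBfun H).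
Proof.
have er c := expands_continuous (@cont_cst R c).
apply: expands_ext (expandsD (expandsD (expandsD (exp_Qfun pf) (exp_Qfun ps))
   (expandsM (er r) (exp_Ifun hZ cw1 zw1))) (expandsM (er (1 - r)) exp_Afun)).
  by exists 1 => // H t _ _ _; rewrite /Bfun.
move=> H t HH _; rewrite !mul0r !add0r /dIfun /dBfun.
have k1 := component_cont pf hH; have k2 := component_cont ps hH.
have h1 := component_cont pf HH; have h2 := component_cont ps HH.
have cf := fPsi_continuous hZ; have cG1 := Gam1_continuous hZ cw1.
have cG2 := Gam2_continuous hZ cw1.
have g1 := gdens_continuous pf cf cG1; have g2 := gdens_continuous ps cf cG2.
have q1 : continuous (fun t => fA * (2 / nsq Z.1 * (2 * Z.1 t ^+ 2 - qbar fst))) by cont.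
have q2 : continuous (fun t => fA * (2 / nsq Z.2 * (2 * Z.2 t ^+ 2 - qbar snd))) by cont.
have E1 := ip_split (c := 4 * nsq (wderiv Z.1) - 4 / nsq Z.1 ^+ 2) (a := r) (b := 1 - r)
  (K := kernel1) g1 q1 k1 h1.
have E2 := ip_split (c := 4 * nsq (wderiv Z.2) - 4 / nsq Z.2 ^+ 2) (a := - r) (b := - (1 - r))
  (K := kernel2) g2 q2 k2 h2.
rewrite E1 ?E2.
- by ring.
- by move=> s s01; rewrite /kernel2 /work2 (gdens_total ps s01 cG2); ring.
- by move=> s s01; rewrite /kernel1 /work1 (gdens_total pf s01 cG1); ring.
Qed.

Lemma Bfun_frechet : is_frechet (@H1sq R) (@normH1 R) (Bfun r) Z dBfun.
Proof.
have [[C C0 b] _ Fr] := exp_Bfun.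
have I0 : 0 <= (0:R) <= 1 by rewrite lexx ler01.
split.
- move=> a H K HH HK; rewrite /dBfun !pairDE !pairZE.
  have [[h1 h2] [k1 k2]] := (HH, HK).
  have [W1 _] := H1_wderiv hH.1; have [W2 _] := H1_wderiv hH.2.
  have lw (z h k : F) : L2 z -> H1 h -> H1 k -> ip z (wderiv (a *: h + k)) =
      a * ip z (wderiv h) + ip z (wderiv k).
    move=> Lz Hh Hk; have [wh _] := H1_wderiv Hh; have [wk _] := H1_wderiv Hk.
    have Hah := H1Z a Hh.
    have E : aeeq (wderiv (a *: h + k)) (a *: wderiv h + wderiv k).
      apply: (@wderiv_uniq _ (a *: h + k)); first exact/H1_wderiv/H1D.
      by apply: is_wderivD; [apply: is_wderivZ|]; exact: H1_wderiv.
    rewrite ipC (ae_ip E) //.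
    - by rewrite ipC ipDr ?ipZr //; exact: L2Z.
    - by case: (H1_wderiv (H1D Hah Hk)).
    - by apply: L2D => //; exact: L2Z.
  have lz (z h k : F) : L2 z -> H1 h -> H1 k -> ip z (a *: h + k) = a * ip z h + ip z k.
    move=> Lz /H1_L2 Lh /H1_L2 Lk; rewrite ipDr ?ipZr //; exact: L2Z.
  have m1 := component_cont pf hH; have m2 := component_cont ps hH.
  have q1 := kernel1_continuous; have q2 := kernel2_continuous.
  rewrite !lw // !lz //; try (by apply: continuous_L2; cont).
  by ring.
- by exists C => H HH; apply: (b H 0 HH I0).
move=> e e0; have [d d0 P] := Fr e e0; exists d => // H HH Hd.
by have := P H 0 HH Hd I0; rewrite addr0.
Qed.
End total_derivative.

(** * Regularity of the outer particle at a critical point *)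

Section variation.
Variable R : realType.
Local Notation F := (R -> R).
Local Notation F2 := (F * F)%type.
Implicit Types (f g h z u v w : R -> R) (a b c d e x y s t tau C : R) (H : F2).

Lemma L2_norm w : L2 w -> L2 (fun x => `|w x|).
Proof.
case=> mw Iw; split; first exact: measurableT_comp.
rewrite (_ : (fun _ => _) = (fun x => (w x ^+ 2)%:E)) //.
by apply: funext => x; rewrite real_normK ?num_real.
Qed.

(** Total variation on [[0, t]] of a function with weak derivative [w]. *)
Definition variation w t := itg 0 (clip t) (fun x => `|w x|).

Lemma variation_le w x y : L2 w -> x <= y -> variation w x <= variation w y.
Proof.
move=> Lw xy; have [x0 x1] := clip_itv x; have [y0 y1] := clip_itv y.
have cxy : clip x <= clip y.
  rewrite /clip ge_max le_max lexx /= le_max; apply/orP; right.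
  by rewrite le_min !ge_min lexx xy orbT.
rewrite /variation (@itg_split _ _ 0 (clip x) (clip y)) ?lerDl ?itg_ge0 //.
by apply: L1_01 => //; exact: L2_norm.
Qed.

Lemma variation_continuous w : L2 w -> continuous (variation w).
Proof.
move=> /L2_norm Lw x; apply: continuous_atP => e e0; set C := nrm (fun x => `|w x|).
have C0 : 0 <= C := nrm_ge0 _.
have C1 : 0 < C + 1 by lra.
have ee : 0 < e / (C + 1) by rewrite divr_gt0.
have half s t : 0 <= s -> s <= t -> t <= 1 ->
    `|itg 0 t (fun x => `|w x|) - itg 0 s (fun x => `|w x|)| <= Num.sqrt (t - s) * C.
  by move=> s0 st t1; exact: (wderiv_holder (prim_wderiv Lw) s0 st t1).
exists ((e / (C + 1)) ^+ 2); first by rewrite exprn_gt0.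
move=> y xy; have [x0 x1] := clip_itv x; have [y0 y1] := clip_itv y.
have key : `|variation w x - variation w y| <= Num.sqrt `|clip x - clip y| * C.
  rewrite /variation; have [l|/ltW l] := leP (clip x) (clip y).
    by rewrite distrC [in leRHS]distrC [X in Num.sqrt X]ger0_norm ?subr_ge0 // half.
  by rewrite [X in Num.sqrt X]ger0_norm ?subr_ge0 // half.
apply: (le_trans key).
have Hs : Num.sqrt `|clip x - clip y| <= e / (C + 1).
  rewrite -[X in _ <= X](ger0_norm (ltW ee)) -(sqrtr_sqr (e / _)) ler_wsqrtr //.
  by rewrite (le_trans (clip_lip _ _)) // ltW.
rewrite (le_trans (ler_wpM2r C0 Hs)) // mulrAC ler_pdivrMr //.
by rewrite ler_wpM2l ?(ltW e0) // lerDl.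
Qed.

Lemma variation_bound z w x y r : is_wderiv z w -> 0 <= x <= 1 -> 0 <= y <= 1 ->
  `|x - y| <= r -> `|z x - z y| <= variation w (y + r) - variation w (y - r).
Proof.
move=> [Lw zE] x01 y01 /ler_normlP[xy yx].
have key s t : 0 <= s -> s <= t -> t <= 1 -> `|z t - z s| <= variation w t - variation w s.
  move=> s0 st t1; rewrite (zE t) ?(le_trans s0) // (zE s) ?s0 ?(le_trans st) //.
  rewrite /variation !clip_id ?s0 ?(le_trans st t1) ?(le_trans s0 st) //.
  rewrite (@itg_split _ w 0 s t) ?(@itg_split _ _ 0 s t) //;
    try by [apply: L1_01 => //; exact: L2_norm|exact: L1_01].
  rewrite (_ : _ - _ = itg s t w); last by ring.
  rewrite addrAC subrr add0r; apply: norm_itg; exact: L1_01.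
have [/andP[x0 x1] /andP[y0 y1]] := (x01, y01).
have [l|/ltW l] := leP y x.
  apply: (le_trans (key _ _ y0 l x1)); apply: lerB; apply: variation_le => //; lra.
rewrite distrC; apply: (le_trans (key _ _ x0 l y1)).
by apply: lerB; apply: variation_le => //; lra.
Qed.

Lemma variation_ge0 w x : 0 <= variation w x.
Proof. by apply: itg_ge0. Qed.

Lemma variation_le1 w x : L2 w -> variation w x <= variation w 1.
Proof.
move=> Lw; have [l|/ltW l] := leP x 1; first exact: variation_le.
by rewrite /variation !(@clip_ge1 _ x) // clip_ge1.
Qed.

(** The integral of [V (y + r) - V (y - r)] over a period telescopes to two integrals of [V]
    over intervals of length [2 r]. It is the replacement for a Lipschitz bound when the
    derivative is only integrable: moving the argument of [z] by [r] costs [O(r)] in the mean. *)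
Lemma itg_variation w r : L2 w -> 0 <= r ->
  itg 0 1 (fun y => variation w (y + r) - variation w (y - r)) <= 2 * r * variation w 1.
Proof.
move=> Lw r0; have cV := variation_continuous Lw; set V := variation w in cV *.
have cP := prim_continuous cV.
have shift c : continuous (fun y => V (y + c)) /\
    itg 0 1 (fun y => V (y + c)) = prim V (1 + c) - prim V c.
  have cc : continuous (fun y => V (y + c)) by cont.
  split=> //; rewrite -[in prim V c](add0r c).
  apply: (itg_der (F := fun y => prim V (y + c)) ler01 cc).
    by apply: continuous_subspaceT; cont.
  move=> x _; have d1 : der (fun y => y + c) x 1.
    by apply: (der_eq (derD (is_derive_id _ _) (der_cst c x))); rewrite addr0.
  have d2 := der_comp (f := prim V) (g := fun y => y + c) (prim_der (x + c) cV) d1.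
  by apply: (der_eq d2); rewrite mulr1.
have [c1 E1] := shift r; have [c2 E2] := shift (- r).
rewrite (itgB (continuous_L1 0 1 c1) (continuous_L1 0 1 c2)) E1 E2.
clear E1 E2 shift.
have -> : prim V (1 + r) - prim V r - (prim V (1 - r) - prim V (- r)) =
    itg (1 - r) (1 + r) V - itg (- r) r V.
  have l1 : 1 - r <= 1 + r by lra.
  have l2 : - r <= r by lra.
  rewrite (itg_prim l1 cV) (itg_prim l2 cV).
  by move: (prim V _) (prim V _) (prim V _) (prim V _) => p1 p2 p3 p4; ring.
have u : itg (1 - r) (1 + r) V <= V 1 * (1 + r - (1 - r)).
  rewrite -itg_cst; last by lra.
  apply: (itg_le (continuous_L1 _ _ cV) (continuous_L1 _ _ (@cont_cst R (V 1)))) => x _.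
  exact: variation_le1.
have l : 0 <= itg (- r) r V by apply: itg_ge0 => x _; exact: variation_ge0.
by move: u l; move: (itg _ _ _) (itg _ _ _) => p q u l; lra.
Qed.

(** Bounds the displacement at [s] of a function with weak derivative [w] whose argument is
    moved by at most [rho] and which has [eps h] added, [wh] being the weak derivative of [h]. *)
Definition displacement w wh h (eps rho : R) s := variation w (s + rho) - variation w (s - rho)
  + `|eps| * (`|h s| + (variation wh (s + rho) - variation wh (s - rho))).

Lemma displacement_continuous w wh h (eps rho : R) : L2 w -> L2 wh -> continuous h ->
  continuous (displacement w wh h eps rho).
Proof.
move=> /variation_continuous v1 /variation_continuous v2 ch; rewrite /displacement.
have nh : continuous (fun x => `|h x|).
  by apply: (@cont_comp _ Num.norm) => //; exact: norm_continuous.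
have l1 : continuous (fun s => variation w (s + rho) - variation w (s - rho)) by cont.
have l2 : continuous (fun s => variation wh (s + rho) - variation wh (s - rho)) by cont.
by apply: contD => //; apply: contM; [exact: cont_cst|exact: contD].
Qed.

Lemma itg_displacement w wh h (eps rho : R) : L2 w -> L2 wh -> continuous h -> 0 <= rho ->
  itg 0 1 (displacement w wh h eps rho) <=
  2 * rho * variation w 1 + `|eps| * (itg 0 1 (fun x => `|h x|) + 2 * rho * variation wh 1).
Proof.
move=> Lw Lwh ch rho0.
have i1 := itg_variation Lw rho0; have i2 := itg_variation Lwh rho0.
have v1 := variation_continuous Lw; have v2 := variation_continuous Lwh.
have nh : continuous (fun x => `|h x|).
  by apply: (@cont_comp _ Num.norm) => //; exact: norm_continuous.
have l1 : continuous (fun s => variation w (s + rho) - variation w (s - rho)).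
  by cont.
have l2 : continuous (fun s => variation wh (s + rho) - variation wh (s - rho)).
  by cont.
have l3 : continuous (fun s => `|h s| + (variation wh (s + rho) - variation wh (s - rho))).
  exact: contD.
have l4 := contM (@cont_cst R `|eps|) l3.
rewrite /displacement (itgD (continuous_L1 _ _ l1) (continuous_L1 _ _ l4)).
rewrite (itgZ _ (continuous_L1 _ _ l3)) (itgD (continuous_L1 _ _ nh) (continuous_L1 _ _ l2)).
by rewrite lerD // ler_wpM2l // lerD2l.
Qed.
End variation.

Section trapezoid.
Variable R : realType.
Local Notation mu := (@lebesgue_measure R).
Local Notation F := (R -> R).
Implicit Types (f g h z u v w : R -> R) (a b c d e x y s t tau C : R).

Definition window a c : F := \1_`[a, c]%classic.

Lemma window_L2 a c : L2 (window a c).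
Proof.
split; first by apply: measurable_funTS; exact: measurable_indic.
have -> : (fun x => (window a c x ^+ 2)%:E) = EFin \o window a c.
  by apply: funext => x; rewrite /window /= indicE; case: (_ \in _); rewrite ?expr1n ?expr0n.
by apply: integrableS (integrable_indic_itv a c true false) => //; exact: measurable_itv.
Qed.

Lemma itg_window f a c s t : itg s t (fun x => f x * window a c x) =
  \int[mu]_(x in `[s, t]%classic `&` `[a, c]%classic) f x.
Proof.
rewrite Rintegral_mkcondr; apply: eq_Rintegral => x _.
by rewrite /window indicE patchE; case: (_ \in _); rewrite ?mulr1 ?mulr0.
Qed.

Lemma setI_itv s t a c : s <= a -> c <= t ->
  `[s, t]%classic `&` `[a, c]%classic = `[a, c]%classic :> set R.
Proof.
move=> sa ct; apply/seteqP; split=> x /=; rewrite !in_itv /=; first by case.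
move=> /andP[u v]; by rewrite u v (le_trans sa u) (le_trans v ct).
Qed.

Definition ramp a c t := itg 0 t (window a c).

Lemma ramp_setI a c t : ramp a c t = \int[mu]_(x in `[0, t]%classic `&` `[a, c]%classic) 1.
Proof. by rewrite -itg_window; apply: itg_eq => x _; rewrite mul1r. Qed.

Lemma rampE a c t : 0 <= a -> a <= c -> c <= t -> ramp a c t = c - a.
Proof. by move=> a0 ac ct; rewrite ramp_setI setI_itv // itg_cst // mul1r. Qed.

Lemma ramp_ge0 a c t : 0 <= ramp a c t.
Proof. by apply: itg_ge0 => x _; rewrite /window indicE. Qed.

Lemma ramp_le a c s t : 0 <= s -> s <= t -> t <= 1 -> ramp a c s <= ramp a c t.
Proof.
move=> s0 st t1; rewrite /ramp (@itg_split _ _ 0 s t) ?lerDl //.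
  by apply: itg_ge0 => x _; rewrite /window indicE.
by apply: L1_01 => //; exact: window_L2.
Qed.

Lemma ramp0 a c t : 0 <= t -> t <= a -> a <= 1 -> ramp a c t = 0.
Proof.
move=> t0 ta a1; apply/eqP; rewrite eq_le ramp_ge0 andbT.
apply: (le_trans (@ramp_le a c t a t0 ta a1)); rewrite ramp_setI.
have [ca|ac] := ltP c a.
  rewrite (_ : _ `&` _ = set0) ?Rintegral_set0 //.
  by apply/seteqP; split=> x //= []; rewrite !in_itv /= => /andP[? ?] /andP[? ?]; lra.
rewrite (_ : _ `&` _ = [set a]) ?Rintegral_set1 //.
apply/seteqP; split=> x /=; rewrite !in_itv /=.
  by move=> [/andP[? ?] /andP[? ?]]; apply/eqP; rewrite eq_le; apply/andP.
by move=> ->; rewrite !lexx ac (le_trans t0).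
Qed.

(** The test function rises linearly from 0 to 1 on [[a, a + d]] and falls back on [[b, b +
    d]]. Its derivative picks the two difference quotients, its integral is at most [b + d -
    a]. *)
Lemma trapezoid_test z w C a b d : is_wderiv z w ->
  (forall h, H1 h -> `|ip w (wderiv h)| <= C * itg 0 1 (fun x => `|h x|)) ->
  0 <= C -> 0 < d -> 0 <= a -> a + d <= b -> b + d <= 1 ->
  `|(z (a + d) - z a) / d - (z (b + d) - z b) / d| <= C * (b + d - a).
Proof.
move=> zw hC C0 d0 a0 adb bd1; have [Lw zE] := zw.
have [a1 b0 ab b1] : [/\ a <= 1, 0 <= b, a <= b & b <= 1] by split; lra.
(* the derivative of the trapezoid *)
pose k : F := d^-1 *: (window a (a + d) - window b (b + d)).
have Lk : L2 k by apply: L2Z; apply: L2B; exact: window_L2.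
pose h t := itg 0 t k; have hk : is_wderiv h k := prim_wderiv Lk.
have hE t : 0 <= t <= 1 -> h t = d^-1 * (ramp a (a + d) t - ramp b (b + d) t).
  move=> /andP[t0 t1]; rewrite /h /ramp -itgB ?itgZ //; try exact: (L1_01 (window_L2 _ _)).
  by apply: L1B; exact: (L1_01 (window_L2 _ _)).
have h0 t : 0 <= t <= a -> h t = 0.
  move=> /andP[t0 ta]; rewrite hE ?t0 ?(le_trans ta) // !ramp0 ?subrr ?mulr0 //.
  exact: le_trans ta ab.
have h1 t : b + d <= t <= 1 -> h t = 0.
  move=> /andP[tb t1].
  have r1 : ramp a (a + d) t = d by rewrite rampE //; [ring|lra|lra].
  have r2 : ramp b (b + d) t = d by rewrite rampE //; [ring|lra].
  by rewrite hE ?t1 ?andbT ?r1 ?r2 ?subrr ?mulr0 //; lra.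
have hle t : 0 <= t <= 1 -> `|h t| <= 1.
  move=> t01; have /andP[t0 t1] := t01; rewrite hE // normrM gtr0_norm ?invr_gt0 // mulrC.
  rewrite ler_pdivrMr // mul1r.
  have r1 : ramp a (a + d) 1 = d by rewrite rampE //; [ring|lra|lra].
  have r2 : ramp b (b + d) 1 = d by rewrite rampE //; [ring|lra].
  have := ramp_ge0 a (a + d) t; have := ramp_ge0 b (b + d) t.
  have := @ramp_le a (a + d) t 1 t0 t1 (lexx _); have := @ramp_le b (b + d) t 1 t0 t1 (lexx _).
  rewrite r1 r2 ler_norml; move: (ramp _ _ _) (ramp _ _ _) => p q *.
  by apply/andP; split; lra.
have hp : h 1 = h 0 by rewrite (h0 0) ?(h1 1) ?lexx ?andbT.
have [Hh whk] := H1_periodize hk hp.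
have := hC _ Hh; set hh := fun x => h (fpart x) in Hh whk *.
have ae := wderiv_uniq (H1_wderiv Hh) whk.
have -> : ip w (wderiv hh) = (z (a + d) - z a) / d - (z (b + d) - z b) / d.
  rewrite ipC (ae_ip ae) //; last by case: (H1_wderiv Hh).
  rewrite ipC /k ipZr //; last by apply: L2B; exact: window_L2.
  have ipw s t : 0 <= s -> s <= t -> t <= 1 -> ip w (window s t) = z t - z s.
    move=> s0 st t1; rewrite /ip itg_window setI_itv //.
    rewrite (zE t) ?(zE s) ?s0 ?t1 ?(le_trans s0) ?(le_trans st) //.
    by rewrite (@itg_split _ w 0 s t) ?(L1_01 Lw) //; ring.
  have -> : ip w (window a (a + d) - window b (b + d)) =
     ip w (window a (a + d)) - ip w (window b (b + d)).
    by rewrite ipC ipBl ?(ipC _ w) //; exact: window_L2.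
  by rewrite !ipw //; [ring|lra|lra|lra].
move=> le1; apply: (le_trans le1); rewrite ler_wpM2l //.
have ch : continuous (fun x => `|hh x|).
  apply: (@cont_comp _ Num.norm); first by move=> y; exact: norm_continuous.
  exact: H1_continuous.
have Lh s t : L1 s t (fun x => `|hh x|) by exact: continuous_L1.
have hhE t : 0 <= t <= 1 -> hh t = h t by move=> t01; rewrite /hh fpart_extend.
rewrite (@itg_split _ _ 0 a 1) // (@itg_split _ _ a (b + d) 1) //; last lra.
have -> : itg 0 a (fun x => `|hh x|) = 0.
  rewrite (itg_eq (g := fun=> 0)) ?itg_cst ?mul0r // => x /andP[x0 xa].
  by rewrite hhE ?h0 ?normr0 ?x0 ?(le_trans xa).
have -> : itg (b + d) 1 (fun x => `|hh x|) = 0.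
  rewrite (itg_eq (g := fun=> 0)) ?itg_cst ?mul0r // => x /andP[xb x1].
  by rewrite hhE ?h1 ?normr0 ?x1 ?andbT ?xb //; lra.
rewrite add0r addr0 -[leRHS]mul1r -itg_cst; last lra.
apply: itg_le => //; first by apply: continuous_L1; cont.
move=> x /andP[xa xb]; have x01 : 0 <= x <= 1 by apply/andP; split; lra.
by rewrite -[h (fpart x)]/(hh x) hhE ?hle.
Qed.

(** McShane: the infimum of the cones [w y + C |x - y|] over [y] in [E]. *)
Lemma lipschitz_extension (E : set R) w C : 0 <= C -> (exists x, E x) ->
  (forall x y, E x -> E y -> `|w x - w y| <= C * `|x - y|) ->
  exists2 w1 : F, continuous w1 & forall x, E x -> w1 x = w x.
Proof.
move=> C0 [x0 Ex0] lip; pose S x := [set w y + C * `|x - y| | y in E].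
have S0 x : S x !=set0 by exists (w x0 + C * `|x - x0|), x0.
have Sb x : lbound (S x) (w x0 - C * `|x - x0|).
  move=> _ [y Ey <-]; have /ler_normlP[_] := lip _ _ Ex0 Ey.
  have := ler_wpM2l C0 (ler_distD x x0 y); rewrite mulrDr (distrC x0 x).
  by move: (C * _) (C * _) (C * _) => p q m; lra.
have Sl x : has_lbound (S x) by exists (w x0 - C * `|x - x0|).
pose w1 x := inf (S x); exists w1; last first.
  move=> x Ex; apply/eqP; rewrite eq_le; apply/andP; split.
    by apply: ge_inf => //; exists x => //; rewrite subrr normr0 mulr0 addr0.
  apply: lb_le_inf => // _ [y Ey <-]; have /ler_normlP[_] := lip _ _ Ex Ey.
  lra.
have w1l x y : w1 x <= w1 y + C * `|x - y|.
  rewrite -lerBlDr; apply: lb_le_inf => // _ [t Et <-].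
  have : w1 x <= w t + C * `|x - t| by apply: ge_inf => //; exists t.
  have := ler_wpM2l C0 (ler_distD y x t); rewrite mulrDr.
  by move: (C * _) (C * _) (C * _) => p q m; lra.
move=> x; apply: continuous_atP => e e0; have C1 : 0 < C + 1 by lra.
exists (e / (C + 1)); first exact: divr_gt0.
move=> y; rewrite ltr_pdivlMr // => xy.
have := w1l x y; have := w1l y x; rewrite (distrC y x).
have := normr_ge0 (x - y); move: (`|x - y|) xy => t xy t0.
rewrite ler_norml => h1 h2; have : C * t <= e by rewrite mulrC; lra.
by move=> h3; apply/andP; split; lra.
Qed.

(** Trapezoids show that [z'] is Lipschitz on the set of full measure where it is the limit of
    its difference quotients; the Lipschitz extension of this restriction is a continuous weak
    derivative. *)
Lemma C1_of_L1_bound z C : H1 z -> 0 <= C ->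
  (forall h, H1 h -> `|ip (wderiv z) (wderiv h)| <= C * itg 0 1 (fun x => `|h x|)) ->
  exists2 w1, continuous w1 & is_wderiv z w1.
Proof.
move=> Hz C0 hC; have zw := H1_wderiv Hz; set w := wderiv z in zw hC.
have [Lw zE] := zw.
pose E := [set x : R | 0 < x < 1 /\ der z x (w x)].
have quot x e : E x -> 0 < e -> exists2 d, 0 < d & forall t, 0 < t -> t < d ->
    `|(z (x + t) - z x) / t - w x| <= e.
  move=> [_ dz] e0; have [dv <-] := dz.
  move/cvgrPdist_le : dv => /(_ _ e0) [d /= d0 P]; exists d => // t t0 td.
  have := P t; rewrite /= sub0r normrN (gtr0_norm t0) => /(_ td (lt0r_neq0 t0)).
  by rewrite distrC /= [t%:A]mulr1 [_^-1 *: _]mulrC (addrC t).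
have lip x y : E x -> E y -> `|w x - w y| <= C * `|x - y|.
  wlog xy : x y / x < y.
    move=> W Ex Ey; have [xy|yx|->] := ltgtP x y; first exact: W.
      by rewrite distrC (distrC x) W.
    by rewrite !subrr normr0 mulr0.
  move=> Ex Ey; apply/ler_addgt0Pr => e e0.
  pose e1 := e / 3 / (C + 1); have e10 : 0 < e1 by rewrite !divr_gt0 //; lra.
  have e3 : 0 < e / 3 by lra.
  have [d1 d10 P1] := quot x _ Ex e3; have [d2 d20 P2] := quot y _ Ey e3.
  have [/andP[x0 x1] _] := Ex; have [/andP[y0 y1] _] := Ey.
  pose m := Num.min (Num.min d1 d2) (Num.min e1 (Num.min (y - x) (1 - y))).
  have m0 : 0 < m by rewrite !lt_min d10 d20 e10 !subr_gt0 xy.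
  pose t := m / 2; have t0 : 0 < t by rewrite /t; lra.
  have : t < m by rewrite /t; lra.
  rewrite !lt_min => /andP[/andP[q1 q2] /andP[q3 /andP[q4 q5]]].
  have := P1 t t0 q1; have := P2 t t0 q2.
  have := @trapezoid_test z w C x y t zw hC C0 t0 (ltW x0) _ _.
  move=> /(_ ltac:(lra) ltac:(lra)).
  rewrite (ltr0_norm (_ : x - y < 0)) ?subr_lt0 // !ler_norml.
  have Ct : C * t <= e / 3.
    apply: (le_trans (ler_wpM2l C0 (ltW q3))); rewrite /e1 mulrA ler_pdivrMr; last lra.
    by rewrite mulrC ler_wpM2l //; lra.
  rewrite (_ : C * (y + t - x) = C * - (x - y) + C * t); last by ring.
  move: (_ / t) (_ / t) (C * - _) (C * t) Ct => p q l m' Ct.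
  by move=> /andP[? ?] /andP[? ?] /andP[? ?]; apply/andP; split; lra.
have aeE : {ae mu, forall x, 0 < x < 1 -> E x}.
  by apply: filterS (wderiv_ae zw); first exact: (ae_filter_ringOfSetsType mu); move=> x h x01; split=> //; exact: h.
have [x0 Ex0] : exists x, E x.
  apply: contrapT => nE; move: aeE => [N [mN N0 sN]].
  have sub : `]0, 1[%classic `<=` N.
    by move=> x /=; rewrite in_itv /= => x01; apply: sN => /= h; apply: nE; exists x; exact: h.
  have : (mu `]0%R, 1%R[%classic <= mu N)%E by apply: le_measure; rewrite ?inE //; exact: measurable_itv.
  by rewrite [X in (_ <= X)%E]N0 lebesgue_measure_itv /= lte_fin ltr01 -EFinD subr0 lee_fin ler10.
have [w1 c1 w1E] := lipschitz_extension C0 (ex_intro _ x0 Ex0) lip.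
exists w1 => //; have ae1 : aeeq w w1.
  apply: aeeq_oo; apply: filterS aeE; first exact: (ae_filter_ringOfSetsType mu).
  by move=> x h x01; rewrite w1E //; exact: h.
split; first exact: continuous_L2.
move=> t /andP[t0 t1]; rewrite (zE t) ?t0 //; congr (_ + _).
apply: ae_int; [|exact: L1_01|exact: continuous_L1].
apply: (@filterS _ _ (ae_filter_ringOfSetsType mu) _ _ _ ae1).
move=> x h /=; rewrite in_itv /= => /andP[x0' xt]; apply: h; rewrite /= in_itv /= x0' /=.
exact: le_trans xt t1.
Qed.
End trapezoid.

Section outer_regularity.
Variable R : realType.
Local Notation F := (R -> R).
Local Notation F2 := (F * F)%type.
Implicit Types (f g h u v w : R -> R) (a b c d e x y s t tau C : R) (H : F2).
Variables (Z : F2) (hZ : H1in Z).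

Let hH : H1sq Z. Proof. by case: hZ. Qed.
Let sZ : apart Z. Proof. exact: H1in_apart. Qed.
Let pf : component (@fst F F). Proof. by left. Qed.
Let ps : component (@snd F F). Proof. by right. Qed.
Let c1 : continuous Z.1. Proof. by case: sZ. Qed.
Let c2 : continuous Z.2. Proof. by case: sZ. Qed.
Let n1 : 0 < nsq Z.1. Proof. by case: sZ. Qed.

Definition outward h : F2 := (h, 0).

Lemma outward_H1 h : H1 h -> H1sq (outward h).
Proof. by move=> Hh; split=> //; have [[_ ?] _] := @zeroH1 R. Qed.

Lemma gap_min : exists2 m, 0 < m & forall t, m <= qclip Z.1 t - qclip Z.2 t.
Proof.
have [k1 k2 m1 m2 _] := sZ.
have cP : continuous (fun t => qclip Z.1 t - qclip Z.2 t).
  by have q1 := qclip_continuous k1 m1; have q2 := qclip_continuous k2 m2; cont.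
have [c _ P] := EVT_min ler01 (continuous_subspaceT cP).
exists (qclip Z.1 c - qclip Z.2 c); first exact: apart_clip.
move=> t; have [t0 t1] := clip_itv t; have := P (clip t).
by rewrite /qclip !(@clip_id _ (clip t)) ?t0 // in_itv /= t0 => /(_ t1).
Qed.

Lemma abs_itg_le z h M : continuous z -> continuous h ->
  (forall t, 0 <= t <= 1 -> `|z t| <= M) -> `|ip z h| <= M * itg 0 1 (fun x => `|h x|).
Proof.
move=> cz ch zM; have cn : continuous (fun x => `|h x|).
  by apply: (@cont_comp _ Num.norm) => //; exact: norm_continuous.
have cp : continuous (fun x => z x * h x) by cont.
have cm : continuous (fun x => M * `|h x|) by cont.
have ca : continuous (fun x => `|z x * h x|).
  by apply: (@cont_comp _ Num.norm) => //; exact: norm_continuous.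
apply: (le_trans (norm_itg (continuous_L1 _ _ cp))); rewrite -itgZ; last exact: continuous_L1.
apply: itg_le; [exact: continuous_L1..|move=> x x01].
by rewrite normrM ler_wpM2r // zM.
Qed.

(** The first variation of the time map is bounded by the L^1-norm of the increment, and the
    outer time map is steep. The remainder of second order is absorbed in [e], because only the
    limit [eps -> 0] matters. *)
Lemma lag_bound : exists2 C, 0 < C & forall h e, H1 h -> 0 < e ->
  exists2 d, 0 < d & forall eps, `|eps| < d -> 0 < nsq (Z.1 + eps *: h) /\
    forall s, 0 <= s <= 1 -> 
      `|taumap (Z.1 + eps *: h) (tmap Z.1 s) - s| <=
        `|eps| * (C * itg 0 1 (fun x => `|h x|) + e).
Proof.
have [m m0 Hm] := outer_speed hZ.
have [M ZM] := continuous_bounded c1.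
have M0 : 0 <= M by apply: le_trans (ZM 0 _); rewrite ?lexx ?ler01.
exists (4 * M / nsq Z.1 / m + 1); first by rewrite ltr_wpDl // !divr_ge0 ?mulr_ge0 // ltW.
move=> h e Hh e0; pose H := outward h; have HH : H1sq H := outward_H1 Hh.
have ch := H1_continuous Hh.
have N0 : 0 < normH1 H + 1 by rewrite ltr_wpDl // normH1_ge0.
have [_ _ T] := exp_time hZ pf.
have e10 : 0 < e * m / (normH1 H + 1) by rewrite divr_gt0 // mulr_gt0.
have [d1 d10 P1] := T _ e10; have [d2 d20 P2] := component_nsqH hZ pf.
exists (Num.min d1 d2 / (normH1 H + 1)); first by rewrite divr_gt0 // lt_min d10.
move=> eps; rewrite ltr_pdivlMr // => Heps.
have [Heh Neh] := H1sq_scale eps HH.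
have : normH1 (eps *: H) < Num.min d1 d2.
  by rewrite Neh (le_lt_trans _ Heps) // ler_wpM2l // lerDl.
rewrite lt_min => /andP[k1 k2]; have Ne := P2 _ Heh k2.
have nse : 0 < nsq (Z.1 + eps *: h) by exact: Ne.
split=> // s s01; have cze := component_cont pf (H1sqD hH Heh).
have [t01 tE] := taumapP cze nse (tmap01 c1 n1 s01).
set t := taumap _ _ in t01 tE *.
have := P1 _ t Heh k1 t01; rewrite addr0 Neh.
have dh : `|dtime Z fst (eps *: H) t| <= `|eps| * (4 * M / nsq Z.1 * itg 0 1 (fun x => `|h x|)).
  have ci : continuous (fun x => Z.1 x * h x) by cont.
  have Ip : `|ip Z.1 h| <= M * itg 0 1 (fun x => `|h x|) := abs_itg_le c1 ch ZM.
  have E : ip Z.1 (eps *: H).1 = eps * ip Z.1 h.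
    by rewrite ipZr //; apply: continuous_L2.
  have Pr : `|prim (fun x => Z.1 x * h x) t| <= M * itg 0 1 (fun x => `|h x|).
    have /andP[t0 t1] := t01.
    have -> : prim (fun x => Z.1 x * h x) t = itg 0 t (fun x => Z.1 x * h x).
      by rewrite itg_prim // prim0 subr0.
    have cn : continuous (fun x => `|h x|).
      by apply: (@cont_comp _ Num.norm) => //; exact: norm_continuous.
    have cm : continuous (fun x => M * `|h x|) by cont.
    apply: (le_trans (norm_itg (continuous_L1 _ _ ci))); rewrite -itgZ; last exact: continuous_L1.
    rewrite [leRHS](@itg_split _ _ 0 t 1) //; last exact: continuous_L1.
    apply: ler_wpDr; first by apply: itg_ge0 => x _; rewrite mulr_ge0.
    apply: itg_le; [|exact: continuous_L1|].
      by apply: L1_norm; exact: continuous_L1.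
    by move=> x /andP[x0 xt]; rewrite normrM ler_wpM2r // ZM // x0 (le_trans xt).
  have tl : `|tline Z.1 t| <= 1.
    have /andP[t0 t1] := t01; rewrite tline_tmap //; have /andP[u0 u1] := tmap01 c1 n1 t01.
    by rewrite ger0_norm.
  have -> : dtime Z fst (eps *: H) t = eps * ((2 / nsq Z.1) * (prim (fun x => Z.1 x * h x) t
       - tline Z.1 t * ip Z.1 h)).
    rewrite /dtime E.
    have -> : prim (fun s => Z.1 s * (eps *: H).1 s) t = eps * prim (fun x => Z.1 x * h x) t.
      have /andP[t0 t1] := t01.
      rewrite -[RHS]subr0 -(mulr0 eps) -(prim0 (fun x => Z.1 x * h x)) -mulrBr -itg_prim //.
      rewrite -itgZ; last exact: continuous_L1.
      rewrite [LHS](_ : _ = itg 0 t (fun s => Z.1 s * (eps *: H).1 s)).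
        by apply: itg_eq => x _; rewrite /= mulrCA.
      have ceh := component_cont pf Heh.
      by rewrite itg_prim // ?prim0 ?subr0 //; cont.
    by rewrite /=; field; rewrite gt_eqF.
  rewrite normrM ler_wpM2l // normrM ger0_norm ?divr_ge0 // ?(ltW n1) //.
  rewrite (_ : 4 * M / nsq Z.1 * _ = 2 / nsq Z.1 * (2 * (M * itg 0 1 (fun x => `|h x|)))).
    rewrite ler_wpM2l ?divr_ge0 ?(ltW n1) // (le_trans (ler_normB _ _)) // mulrDl mul1r lerD //.
    by rewrite normrM -[leRHS]mul1r ler_pM.
  by field; rewrite gt_eqF.
move=> h1; have X : `|tmap Z.1 t - tmap Z.1 s| <=
    `|eps| * (4 * M / nsq Z.1 * itg 0 1 (fun x => `|h x|) + e * m).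
  rewrite -tE distrC.
  rewrite -[(Z + eps *: H).1]/(Z.1 + eps *: h) in h1.
  set q := tmap (Z.1 + _) t in h1 *; set q' := tmap Z.1 t in h1 *; set dd := dtime _ _ _ _ in h1 dh *.
  rewrite (_ : _ - _ = dd + (q - q' - dd)); last by ring.
  rewrite (le_trans (ler_normD _ _)) // mulrDr lerD // (le_trans h1) //.
  rewrite [leLHS]mulrCA ler_wpM2l //.
  rewrite mulrAC ler_pdivrMr // ler_wpM2l ?mulr_ge0 ?(ltW e0) ?(ltW m0) //.
  by rewrite lerDl.
have := le_trans (tmap_expand hZ Hm t01 s01) X; rewrite mulrC -ler_pdivlMr // => /le_trans; apply.
rewrite -[leLHS]mulrA ler_wpM2l // mulrDl mulfK ?gt_eqF // lerD2r.
by rewrite [leLHS]mulrAC ler_wpM2r ?lerDl // itg_ge0.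
Qed.

Lemma square_diff (x y h M : R) (eps D : R) : `|x| <= M -> `|y| <= M -> `|eps * h| <= 1 ->
  `|x - y| + `|eps * h| <= D -> `|(x + eps * h) ^+ 2 - y ^+ 2| <= (2 * M + 1) * D.
Proof.
move=> xM yM h1 xD; rewrite subr_sqr normrM mulrC ler_pM //.
  by rewrite (le_trans (ler_normD _ _)) // (le_trans (lerD (ler_normD _ _) (lexx _))) //; lra.
by rewrite addrAC (le_trans (ler_normD _ _)).
Qed.

Lemma inv_diff (p q m : R) : 0 < m -> m <= p -> `|q - p| <= m / 2 ->
  `|q^-1 - p^-1| <= 2 / m ^+ 2 * `|q - p|.
Proof.
move=> m0 mp /ler_normlP[l1 l2]; have p0 : 0 < p by exact: lt_le_trans mp.
have q0 : m / 2 <= q by lra.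
have q1 : 0 < q by lra.
have -> : q^-1 - p^-1 = - (q - p) / (p * q) by field; rewrite !gt_eqF.
rewrite normrM normrN mulrC ler_wpM2r // gtr0_norm ?invr_gt0 ?mulr_gt0 //.
rewrite (_ : 2 / m ^+ 2 = (m * (m / 2))^-1); last by field; rewrite gt_eqF.
by rewrite lef_pV2 ?posrE ?mulr_gt0 ?ler_pM ?divr_ge0 // ltW.
Qed.

Lemma gap_survives (u v y m : R) : 0 < m -> - (u - y) <= m / 2 -> m <= y - v -> v < u.
Proof. lra. Qed.

(** The two halves of [e] absorb the error [e'] in the lag and the term quadratic in [eps]. *)
Lemma increment_budget (A C0 V Vh n e e' a eps : R) : 0 <= A -> 0 <= V -> 0 <= Vh -> 0 < e ->
  e' = e / 2 / (A * (2 * V) + 1) -> a = C0 * n + e' -> 0 < a -> 0 <= eps ->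
  eps <= e / 2 / (A * (2 * a * Vh) + 1) ->
  A * (2 * (eps * a) * V + eps * (n + 2 * (eps * a) * Vh)) <=
  eps * (A * (2 * C0 * V + 1) * n + e).
Proof.
move=> A0 V0 Vh0 e0 e'E aE a0 eps0 epsE.
have half (k : R) : 0 <= k -> k * (e / 2 / (k + 1)) <= e / 2.
  move=> k0; rewrite mulrCA ler_piMr ?divr_ge0 ?(ltW e0) // ler_pdivrMr ?mul1r ?lerDl //; lra.
have b1 : A * (2 * V) * e' <= e / 2 by rewrite e'E half // !mulr_ge0.
have AVh0 : 0 <= A * (2 * a * Vh) by rewrite !mulr_ge0 // ltW.
have b2 : A * (2 * a * Vh) * eps <= e / 2.
  exact: le_trans (ler_wpM2l AVh0 epsE) (half _ AVh0).
rewrite [leLHS](_ : _ = eps * (A * (2 * C0 * V + 1) * n +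
  (A * (2 * V) * e' + A * (2 * a * Vh) * eps))); last by rewrite aE; ring.
by rewrite ler_wpM2l // lerD2l (le_trans (lerD b1 b2)) // -splitr.
Qed.

(** With the outer particle only in [H^1] the interaction need not be differentiable, but it is
    Lipschitz with respect to the L^1-norm of [h] in the limit [eps -> 0]: the perturbed
    position at time [t] is that of the original one at a parameter shifted by the lag, plus
    [eps h]. The shift costs in the mean the lag times the total variation of [z_1]. *)
Lemma interaction_L1 : exists2 C, 0 <= C & forall h e, H1 h -> 0 < e ->
  exists2 d, 0 < d & forall eps, `|eps| < d ->
    `|Ifun (Z + eps *: outward h) - Ifun Z| <=
      `|eps| * (C * itg 0 1 (fun x => `|h x|) + e).
Proof.
have [C0 C00 lag] := lag_bound; have [m m0 Hm] := gap_min.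
have [M ZM] := continuous_bounded c1.
have M0 : 0 <= M by apply: le_trans (ZM 0 _); rewrite ?lexx ?ler01.
have zw := H1_wderiv hH.1; have [Lw _] := zw; set w := wderiv Z.1 in zw Lw.
have [A A0 AE] : exists2 A, 0 <= A & A = 2 / m ^+ 2 * (M ^+ 2 / nsq Z.1 * (2 * M + 1)).
  eexists; last by [].
  apply: mulr_ge0; first by rewrite divr_ge0 ?sqr_ge0.
  by apply: mulr_ge0; [rewrite divr_ge0 ?sqr_ge0 // ltW|lra].
have V0 : 0 <= variation w 1 := variation_ge0 _ _.
exists (A * (2 * C0 * variation w 1 + 1)).
  by rewrite mulr_ge0 // addr_ge0 // !mulr_ge0 // ltW.
move=> h e Hh e0; have hw := H1_wderiv Hh; have [Lwh _] := hw; set wh := wderiv h in hw Lwh.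
have ch := H1_continuous Hh; have Vh0 : 0 <= variation wh 1 := variation_ge0 _ _.
have [S hS] := continuous_bounded ch.
have S0 : 0 <= S by apply: le_trans (hS 0 _); rewrite ?lexx ?ler01.
have S1 : 0 < S + 1 by rewrite ltr_wpDl.
set n := itg 0 1 (fun x => `|h x|); have n0 : 0 <= n by apply: itg_ge0.
pose e' := e / 2 / (A * (2 * variation w 1) + 1).
have AV0 : 0 <= A * (2 * variation w 1) by rewrite !mulr_ge0.
have e'0 : 0 < e' by rewrite !divr_gt0 // ltr_wpDl.
pose a := C0 * n + e'; have a0 : 0 < a by rewrite ltr_wpDl // mulr_ge0 // ltW.
have AVh0 : 0 <= A * (2 * a * variation wh 1) by rewrite !mulr_ge0 // ltW.
have M1 : 0 < 2 * M + 1 by lra.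
have [d1 d10 P1] := lag h e' Hh e'0.
have m4 : 0 < m / 4 / (2 * M + 1) by rewrite !divr_gt0.
have [d2 d20 UC] := uniform_continuity c1 m4.
pose d3 := Num.min 1 (m / 4 / (2 * M + 1)) / (S + 1).
have d30 : 0 < d3 by rewrite divr_gt0 // lt_min ltr01 m4.
pose d4 := e / 2 / (A * (2 * a * variation wh 1) + 1).
have d40 : 0 < d4 by rewrite !divr_gt0 // ltr_wpDl.
exists (Num.min (Num.min d1 (d2 / a)) (Num.min d3 d4)).
  by rewrite !lt_min d10 d30 d40 divr_gt0.
move=> eps; rewrite !lt_min => /andP[/andP[k1 k2] /andP[k3 k4]].
have [nse Hlag] := P1 _ k1.
have cze : continuous (Z.1 + eps *: h).
  rewrite (_ : Z.1 + eps *: h = (fun x => Z.1 x + eps * h x)); first by cont.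
  by [].
set ze := Z.1 + eps *: h in nse Hlag cze.
have E2 : Z.2 + eps *: (0 : F) = Z.2 by rewrite scaler0 addr0.
pose rho := `|eps| * a.
have rho0 : 0 <= rho by rewrite mulr_ge0 // ltW.
pose D := displacement w wh h eps rho.
(* the displacement at one time: bounded by the variation over a window of the size of the
   lag, and in any case small compared with the gap *)
have point s : 0 <= s <= 1 -> `|qf ze (tmap Z.1 s) - Z.1 s ^+ 2| <= (2 * M + 1) * D s /\
    `|qf ze (tmap Z.1 s) - Z.1 s ^+ 2| <= m / 2.
  move=> s01; have [t01 _] := taumapP cze nse (tmap01 c1 n1 s01).
  have lg := Hlag s s01; rewrite /qf; set t := taumap _ _ in t01 lg *.
  have zeE : ze t = Z.1 t + eps * h t by [].
  have ehS : `|eps * h t| <= Num.min 1 (m / 4 / (2 * M + 1)).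
    rewrite normrM; move: k3; rewrite ltr_pdivlMr // => /ltW; apply: le_trans.
    by rewrite ler_wpM2l // (le_trans (hS _ t01)) // lerDl.
  rewrite le_min in ehS; have /andP[eh1 eh2] := ehS.
  have lg' : `|t - s| <= rho by [].
  rewrite zeE; split.
    apply: square_diff; rewrite ?ZM // /D /displacement lerD //; first exact: (variation_bound zw).
    rewrite normrM ler_wpM2l //.
    have := variation_bound hw t01 s01 lg'; have := ler_normD (h s) (h t - h s).
    by rewrite subrKC => h1 h2; apply: (le_trans h1); rewrite lerD2l.
  rewrite (_ : m / 2 = (2 * M + 1) * (m / 4 / (2 * M + 1) + m / 4 / (2 * M + 1))); last first.
    by field; rewrite gt_eqF.
  apply: square_diff; rewrite ?ZM // lerD // UC // (le_lt_trans lg') //.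
  by rewrite /rho -ltr_pdivlMr.
have gapE t : 0 <= t <= 1 -> qf Z.2 t < qf ze t.
  move=> t01; have [s s01 tE] := tmap_surj c1 n1 t01.
  have [_ /ler_normlP[k _]] := point s s01; have := Hm t.
  by rewrite !qclip_id // -tE (@qf_tmap R Z.1) //; exact: gap_survives k.
have sE : apart (Z + eps *: outward h).
  split=> //; rewrite ?pairDE /= ?E2 //.
  exact: (component_nsq hZ ps).
have cq1 := qclip_continuous c1 n1; have cq2 := qclip_continuous c2 (component_nsq hZ ps).
have cqe := qclip_continuous cze nse.
rewrite !IfunE // -opprD normrN; set Pe := Psi (Z + _).
have cPe : continuous Pe by exact: Psi_continuous.
have cP : continuous (Psi Z) by exact: Psi_continuous.
have nc := @norm_continuous R R.
have cd : continuous (fun t => `|qclip ze t - qclip Z.1 t|).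
  by apply: (@cont_comp _ Num.norm) => //; cont.
(* the reciprocal distance is Lipschitz as long as the gap stays above [m / 2] *)
have step1 : `|itg 0 1 Pe - itg 0 1 (Psi Z)| <=
    2 / m ^+ 2 * itg 0 1 (fun t => `|qclip ze t - qclip Z.1 t|).
  rewrite -itgB; [|exact: continuous_L1..].
  have cb : continuous (fun t => Pe t - Psi Z t) by cont.
  have cb' : continuous (fun t => `|Pe t - Psi Z t|).
    by apply: (@cont_comp _ Num.norm) => //; cont.
  have cb'' : continuous (fun t => 2 / m ^+ 2 * `|qclip ze t - qclip Z.1 t|).
    by apply: contM => //; exact: cont_cst.
  apply: (le_trans (norm_itg (continuous_L1 _ _ cb))).
  rewrite -itgZ; last exact: continuous_L1.
  apply: itg_le; [exact: continuous_L1..|move=> t t01].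
  have [s s01 ts] := tmap_surj c1 n1 t01; have [_ k] := point s s01.
  rewrite /Pe /Psi /= E2 -/ze.
  have -> : qclip ze t - qclip Z.1 t = (qclip ze t - qclip Z.2 t) - (qclip Z.1 t - qclip Z.2 t).
    by rewrite opprB addrA subrK.
  apply: inv_diff => //; rewrite opprB addrA subrK.
  by rewrite !qclip_id // -ts (@qf_tmap R Z.1).
have cD : continuous D by exact: displacement_continuous.
(* back from the time to the parameter *)
have step2 : itg 0 1 (fun t => `|qclip ze t - qclip Z.1 t|) <=
    M ^+ 2 / nsq Z.1 * (2 * M + 1) * itg 0 1 D.
  rewrite -(substitution c1 n1 cd) -itgZ; last exact: continuous_L1.
  have cl : continuous (fun x => M ^+ 2 / nsq Z.1 * (2 * M + 1) * D x).
    by apply: contM => //; exact: cont_cst.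
  have ct := tline_continuous c1.
  have cr : continuous (fun x => Z.1 x ^+ 2 / nsq Z.1 *
      (fun t => `|qclip ze t - qclip Z.1 t|) (tline Z.1 x)).
    by apply: contM; [cont|exact: (cont_comp cd)].
  rewrite [leLHS](itg_eq (g := fun x => Z.1 x ^+ 2 / nsq Z.1 *
      (fun t => `|qclip ze t - qclip Z.1 t|) (tline Z.1 x))); last first.
    by move=> x /andP[x0 _]; rewrite tline_tmap.
  apply: itg_le; [exact: continuous_L1..|move=> s s01].
  have [k _] := point s s01; have /andP[s0 _] := s01.
  rewrite tline_tmap // !qclip_id ?tmap01 // (@qf_tmap R Z.1) // -[leRHS]mulrA ler_pM //.
    by rewrite divr_ge0 ?sqr_ge0 // ltW.
  rewrite ler_wpM2r ?invr_ge0 ?(ltW n1) //.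
  by rewrite -real_normK ?num_real // lerXn2r ?nnegrE // ZM.
have step3 := itg_displacement eps Lw Lwh ch rho0; rewrite -/D -/n in step3.
have m2 : 0 <= 2 / m ^+ 2 by rewrite divr_ge0 ?sqr_ge0.
apply: (le_trans step1); apply: (le_trans (ler_wpM2l m2 step2)).
rewrite mulrA -AE; apply: (le_trans (ler_wpM2l A0 step3)).
exact: increment_budget A0 V0 Vh0 e0 erefl erefl a0 (normr_ge0 eps) (ltW k4).
Qed.

Lemma split_increment (q1 q2 q0 i1 i0 a1 a0 w kz kk r A1 A2 A3 A4 A5 A6 : R) :
  `|q1 + q2 + r * i1 + (1 - r) * a1 - (q0 + q2 + r * i0 + (1 - r) * a0)| <= A1 ->
  `|q1 - q0 - (w + kz)| <= A2 -> `|i1 - i0| <= A3 -> `|a1 - a0 - kk| <= A4 ->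
  `|kk| <= A5 -> `|kz| <= A6 ->
  `|w| <= A1 + A2 + `|r| * A3 + `|1 - r| * (A4 + A5) + A6.
Proof.
move=> b1 b2 b3 b4 b5 b6.
have b3' : `|r * (i1 - i0)| <= `|r| * A3 by rewrite normrM ler_wpM2l.
have b45 : `|(1 - r) * (a1 - a0)| <= `|1 - r| * (A4 + A5).
  rewrite normrM ler_wpM2l // -(subrK kk (a1 - a0)).
  by rewrite (le_trans (ler_normD _ _)) // lerD.
move: b1 b2 b3' b45 b6; rewrite mulrBr (mulrBr (1 - r)) !ler_norml.
move: (r * i1) (r * i0) ((1 - r) * a1) ((1 - r) * a0) (`|r| * _) (`|1 - r| * _) => *; lra.
Qed.

(** At a critical point the kinetic term [<z_1', h'>] is balanced by terms which are all
    bounded by the L^1-norm of [h]; [C1_of_L1_bound] applies. The inner particle is not regular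
    at this stage, and the derivative of the interaction need not exist. *)
Lemma crit_outer_C1 r : crit_B r Z -> exists2 w1, continuous w1 & is_wderiv Z.1 w1.
Proof.
move=> [_ [_ _ crit]]; have [C C0 IC] := interaction_L1.
have [M ZM] := continuous_bounded c1.
pose k := 4 * nsq (wderiv Z.1) - 4 / nsq Z.1 ^+ 2.
pose ka t := fA Z * (2 / nsq Z.1 * (2 * Z.1 t ^+ 2 - qbar Z fst)) * Z.1 t.
have cka : continuous ka by rewrite /ka; cont.
have ck : continuous (fun t => k * Z.1 t) by cont.
have [Ma kaM] := continuous_bounded cka; have [Mk kM] := continuous_bounded ck.
have I0 : 0 <= (0:R) <= 1 by rewrite lexx ler01.
have Ma0 : 0 <= Ma by apply: le_trans (kaM 0 I0).
have Mk0 : 0 <= Mk by apply: le_trans (kM 0 I0).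
pose C1 := (Mk + `|r| * C + `|1 - r| * Ma) / (4 * nsq Z.1).
have N4 : 0 < 4 * nsq Z.1 by rewrite mulr_gt0.
apply: (@C1_of_L1_bound _ Z.1 C1 hH.1).
  by rewrite divr_ge0 ?(ltW N4) // !addr_ge0 // mulr_ge0.
move=> h Hh; set n := itg 0 1 _; have ch := H1_continuous Hh.
rewrite mulrAC ler_pdivlMr // mulrC.
rewrite -[X in X * `|_|](gtr0_norm N4) -normrM.
apply/ler_addgt0Pr => e e0.
pose H := outward h; have HH : H1sq H := outward_H1 Hh.
have n0 := normH1_ge0 H; have n1' : 0 < normH1 H + 1 by lra.
pose L := 1 + `|r| + 1 + `|1 - r|.
have L0 : 0 < L by have := normr_ge0 r; have := normr_ge0 (1 - r); rewrite /L; lra.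
have e1 : 0 < e / L by rewrite divr_gt0.
have e2 : 0 < e / L / (normH1 H + 1) by rewrite divr_gt0.
have [d1 d10 P1] := crit _ e2.
have [_ _ /(_ _ e2) [d2 d20 P2]] := exp_Qfun hZ pf.
have [_ _ /(_ _ e2) [d3 d30 P3]] := exp_Afun hZ.
have [d4 d40 P4] := IC h _ Hh e1.
pose d := Num.min (Num.min d1 d2) d3 / (normH1 H + 1).
have d0 : 0 < d by rewrite divr_gt0 // !lt_min d10 d20.
pose eps := Num.min d d4 / 2.
have eps0 : 0 < eps by rewrite divr_gt0 // lt_min d0.
have epsE : `|eps| = eps by rewrite gtr0_norm.
have epsd : eps < Num.min d d4 by rewrite ltr_pdivrMr // ltr_pMr ?lt_min ?d0 // ltr1n.
move: epsd; rewrite lt_min => /andP[ed ed4].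
have [Heh Neh] := H1sq_scale eps HH.
have : normH1 (eps *: H) < Num.min (Num.min d1 d2) d3.
  rewrite Neh epsE; apply: le_lt_trans (_ : eps * (normH1 H + 1) < _); last by rewrite -ltr_pdivlMr.
  by rewrite ler_wpM2l ?lerDl // ltW.
rewrite !lt_min => /andP[/andP[q1 q2] q3].
have bnd : e / L / (normH1 H + 1) * normH1 (eps *: H) <= eps * (e / L).
  rewrite Neh epsE mulrCA ler_wpM2l ?(ltW eps0) // mulrAC ler_pdivrMr //.
  by rewrite ler_wpM2l ?lerDl // ltW.
have := P4 eps; rewrite epsE => /(_ ed4) b4.
have := le_trans (P1 _ Heh q1) bnd; rewrite subr0 => b1.
have := le_trans (P2 _ 0 Heh q2 I0) bnd; rewrite addr0 => b2.
have := le_trans (P3 _ 0 Heh q3 I0) bnd; rewrite addr0 => b3.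
have wsc : ip (wderiv Z.1) (wderiv (eps *: H).1) = eps * ip (wderiv Z.1) (wderiv h).
  have [Lw _] := H1_wderiv Hh; have [Lz _] := H1_wderiv hH.1.
  rewrite ipC (ae_ip (wderivZ eps Hh)) //; last exact: L2Z.
    by rewrite ipC ipZr.
  by have [? _] := H1_wderiv Heh.1.
have zsc (z : F) : continuous z -> ip z (eps *: H).1 = eps * ip z h.
  by move=> cz; rewrite ipZr //; exact: continuous_L2.
rewrite wsc zsc // in b2; rewrite zsc // in b3.
have z2 : (Z + eps *: H).2 = Z.2 by rewrite /= scaler0 addr0.
have z0 : ip (fun t => fA Z * (2 / nsq Z.2 * (2 * Z.2 t ^+ 2 - qbar Z snd)) * Z.2 t) (eps *: H).2 = 0.
  by rewrite /= scaler0 ipC ip0l.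
rewrite z0 subr0 in b3; rewrite /Bfun z2 in b1.
have k1 : `|ip (fun t => k * Z.1 t) h| <= Mk * n := abs_itg_le ck ch kM.
have k2 : `|ip ka h| <= Ma * n := abs_itg_le cka ch kaM.
rewrite -/k in b2; rewrite -/ka in b3.
rewrite -/n in b4.
have ek1 : `|eps * ip (fun t => k * Z.1 t) h| <= eps * (Mk * n).
  by rewrite normrM epsE ler_wpM2l // ltW.
have ek2 : `|eps * ip ka h| <= eps * (Ma * n) by rewrite normrM epsE ler_wpM2l // ltW.
have := split_increment b1 b2 b4 b3 ek2 ek1.
rewrite (_ : 4 * nsq Z.1 * (eps * _) = eps * (4 * nsq Z.1 * ip (wderiv Z.1) (wderiv h))); last first.
  by rewrite mulrCA.
rewrite (_ : _ + eps * (Mk * n) = eps * ((Mk + `|r| * C + `|1 - r| * Ma) * n + e)); last first.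
  rewrite [in RHS](_ : e = e / L * L); last by rewrite mulfVK // gt_eqF.
  by rewrite /L; ring.
by rewrite (normrM eps) epsE ler_pM2l.
Qed.
End outer_regularity.

(** * Periodic functions and homeomorphisms of the circle *)

Section line.
Variable R : realType.
Local Notation F := (R -> R).
Implicit Types (f g h z u v w : R -> R) (a b c d e x y s t tau : R).

Lemma cst_of_der0R f : (forall x, der f x 0) -> forall x y, f x = f y.
Proof.
move=> df; have cf : continuous f by move=> x; exact: derivable_continuous (df x).
have key x y : x <= y -> f y = f x.
  by move=> xy; apply: cst_of_der0 => //; exact: continuous_subspaceT.
by move=> x y; have [/key|/ltW/key] := leP x y.
Qed.

Lemma fpartD1 x : fpart (x + 1) = fpart x :> R.
Proof. exact: (periodic_of_fpart id). Qed.

Lemma fpart01 x : 0 <= fpart x <= 1.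
Proof. by rewrite fpart_ge0 ltW // fpart_lt1. Qed.

Lemma periodize_continuous f : continuous f -> f 1 = f 0 -> continuous (fun x => f (fpart x)).
Proof.
move=> cf f01 x; pose g y := f (clip y) + f (clip (y + 1)) - f 0.
have cg : continuous g.
  by have cc := @clip_continuous R; rewrite /g; cont.
apply: (@near_continuous_eq _ (fun y => g (y - (Num.floor x)%:~R))); last first.
  have : continuous (fun y => g (y - (Num.floor x)%:~R)) by cont.
  exact.
have xn0 := fpart_ge0 x; have xn1 := fpart_lt1 x; rewrite /fpart in xn0 xn1.
near=> y.
have yn1 : (Num.floor x)%:~R - 1 < y by near: y; apply: near_gt; lra.
have yn2 : y < (Num.floor x)%:~R + 1 by near: y; apply: near_lt; lra.
have -> : fpart y = fpart (y - (Num.floor x)%:~R).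
  by rewrite -mulrNz (periodic_int _ _ (periodic_of_fpart id)).
have u1 : -1 < y - (Num.floor x)%:~R by lra.
have u2 : y - (Num.floor x)%:~R < 1 by lra.
move: (y - _) u1 u2 => u u1 u2; rewrite /g; case: (leP 0 u) => u0.
  rewrite fpart_id ?u0 // [clip (u + 1)]clip_ge1 ?lerDr // [clip u]clip_id ?f01 ?addrK //.
  by rewrite u0 ltW.
rewrite -fpartD1 fpart_id; last by apply/andP; split; lra.
rewrite [clip u]clip_le0 ?[clip (u + 1)]clip_id ?[_ + f (u + 1)]addrC ?addrK //; last exact: ltW.
by apply/andP; split; lra.
Unshelve. all: by end_near. Qed.

Lemma der_shift f a x l : der f (x + a) l -> der (fun y => f (y + a)) x l.
Proof.
move=> df; have d1 : der (fun y => y + a) x 1.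
  by apply: (der_eq (derD (is_derive_id _ _) (der_cst a x))); rewrite addr0.
by apply: (der_eq (der_comp (f := f) (g := fun y => y + a) df d1)); rewrite mulr1.
Qed.

Lemma prim_shift g x : continuous g -> periodic g 1 -> prim g (x + 1) = prim g x + itg 0 1 g.
Proof.
move=> cg pg; have -> : itg 0 1 g = prim g (0 + 1) - prim g 0 by rewrite itg_prim // add0r.
suff /(cst_of_der0R)/(_ x 0) : forall y, der (fun y => prim g (y + 1) - prim g y) y 0.
  by rewrite prim0 subr0 => <-; rewrite subrKC.
move=> y; apply: (der_eq (derB (der_shift (prim_der (y + 1) cg)) (prim_der y cg))).
by rewrite pg subrr.
Qed.

Lemma periodic_ext f g : periodic f 1 -> periodic g 1 ->
  (forall t, 0 <= t <= 1 -> f t = g t) -> forall x, f x = g x.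
Proof.
by move=> pf pg E x; rewrite -(periodic_fpart x pf) -(periodic_fpart x pg) E // fpart01.
Qed.

(** Periodicity of [f] forces [g] to have mean zero, so the primitive of [g] is periodic too,
    and its agreement with [f] on one period, up to a constant, extends to the line. *)
Lemma periodic_prim f g : continuous g -> periodic g 1 -> periodic f 1 ->
  (forall t, 0 <= t <= 1 -> f t = f 0 + itg 0 t g) -> forall x, der f x (g x).
Proof.
move=> cg pg pf fE; have I0 : itg 0 1 g = 0.
  have := fE 1; rewrite ler01 lexx -[in f 1](add0r 1) pf => /(_ isT)/eqP.
  by rewrite -subr_eq0 opprD addNKr oppr_eq0 => /eqP.
have pP : periodic (fun x => f 0 + prim g x) 1 by move=> x; rewrite /= prim_shift // I0 addr0.
have E := periodic_ext pf pP; move=> x.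
apply: (@der_ext _ (fun x => f 0 + prim g x)).
  by apply: E => t /andP[t0 t1]; rewrite fE ?t0 // itg_prim // prim0 subr0.
by apply: (der_eq (derD (der_cst _ _) (prim_der x cg))); rewrite add0r.
Qed.

(** A derivative that extends continuously over an isolated point is a derivative there as
    well, by the mean value theorem. Collisions are such points for the regularized quantities. *)
Lemma removable_der f g x : continuous f -> {for x, continuous g} ->
  (\forall y \near x, y != x -> der f y (g y)) -> der f x (g x).
Proof.
move=> cf cg df; have [d /= d0 dP] := df.
have mvt (h : R) : h != 0 -> `|h| < d -> exists c, `|x - c| <= `|h| /\ f (x + h) - f x = g c * h.
  move=> h0 hd; have hlt := normr_gt0 h; rewrite h0 in hlt.
  have sub a b : a < b -> `|x - a| <= `|h| -> `|x - b| <= `|h| -> (a = x \/ b = x) ->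
      exists2 c, `|x - c| <= `|h| & f b - f a = g c * (b - a).
    move=> ab /ler_normlP[a1 a2] /ler_normlP[b1 b2] axb.
    have df' y : y \in `]a, b[ -> der f y (g y).
      rewrite in_itv /= => /andP[ay yb]; apply: dP => /=.
        by apply: le_lt_trans hd; apply/ler_normlP; split; lra.
      by case: axb => E; [rewrite gt_eqF // -E|rewrite lt_eqF // -E].
    have [c] := MVT ab df' (continuous_subspaceT cf).
    rewrite in_itv /= => /andP[ac cb] E; exists c => //.
    by apply/ler_normlP; split; lra.
  have [hp|hn] := ltP 0 h.
    have l1 : x < x + h by lra.
    have l2 : `|x - x| <= `|h| by rewrite subrr normr0 ltW.
    have l3 : `|x - (x + h)| <= `|h| by rewrite opprD addNKr normrN.
    have [c cx E] := sub _ _ l1 l2 l3 (or_introl erefl).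
    by exists c; split=> //; rewrite E; ring.
  have hn' : h < 0 by rewrite lt_neqAle h0.
  have l1 : x + h < x by lra.
  have l2 : `|x - x| <= `|h| by rewrite subrr normr0 ltW.
  have l3 : `|x - (x + h)| <= `|h| by rewrite opprD addNKr normrN.
  have [c cx E] := sub _ _ l1 l3 l2 (or_intror erefl).
  by exists c; split=> //; rewrite -[LHS]opprB E; ring.
have lim : (h^-1 *: (f (h *: 1 + x) - f x)) @[h --> 0^'] --> g x.
  apply/cvgrPdist_le => e e0; have [d' d'0 gd] := continuous_at_dist cg e0.
  exists (Num.min d d'); first by rewrite /= lt_min d0.
  move=> h /=; rewrite sub0r normrN lt_min => /andP[h1 h2] h0.
  have [c [cx E]] := mvt h h0 h1.
  rewrite [h *: 1]mulr1 (addrC h) E [_ *: _]mulrC mulfK //.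
  by apply/ltW/gd/(le_lt_trans cx).
have lim' : (h^-1 *: ((f \o shift x) (h *: 1) - f x)) @[h --> 0^'] --> g x by exact: lim.
by split; [exact: cvgP lim'|exact: (cvg_lim _ lim')].
Qed.

(** A lift of a homeomorphism of the circle. Surjectivity comes from the translation property
    and the intermediate value theorem. *)
Lemma circle_homeo f : continuous f -> (forall x y, x < y -> f x < f y) ->
  (forall x, f (x + 1) = f x + 1) ->
  exists g, [/\ cancel f g, cancel g f, continuous g, forall x y, x < y -> g x < g y
     & forall x, g (x + 1) = g x + 1].
Proof.
move=> cf mf sf.
have sn n x : f (x + n%:R) = f x + n%:R.
  elim: n => [|n IH]; first by rewrite !addr0.
  by rewrite -natr1 !addrA sf IH.
have sz (n : int) x : f (x + n%:~R) = f x + n%:~R.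
  case: n => n; first by rewrite -pmulrn sn.
  rewrite NegzE mulrNz -pmulrn; apply/eqP; rewrite -subr_eq opprK -sn subrK //.
have inj x y : f x = f y -> x = y.
  by move=> E; apply/eqP; rewrite eq_le !leNgt; apply/andP; split; apply/negP => /mf;
     rewrite E ltxx.
have mono x y : (f x < f y) = (x < y).
  apply/idP/idP => [|/mf//]; rewrite !ltNge; apply: contra; rewrite le_eqVlt.
  by case/predU1P => [->//|/mf/ltW].
have surj t : exists x, f x = t.
  pose m := Num.floor (t - f 0).
  have l : m%:~R <= m%:~R + 1 :> R by rewrite lerDl.
  have rng : Num.min (f m%:~R) (f (m%:~R + 1)) <= t <= Num.max (f m%:~R) (f (m%:~R + 1)).
    have m1 : m%:~R <= t - f 0 by exact: ge_floor.
    have m2 : t - f 0 < m%:~R + 1 by have := lt_succ_floor (t - f 0); rewrite intrD.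
    rewrite sf -[m%:~R]add0r !sz ge_min le_max; apply/andP; split; apply/orP; [left|right]; lra.
  by have [x _ E] := IVT l (continuous_subspaceT cf) rng; exists x.
pose g (t : R) : R := xget (0 : R) [set x | f x = t].
have gK : cancel g f.
  by move=> t; have [x fx] := surj t; rewrite /g; case: xgetP => [y _ //|/(_ x)].
have fK : cancel f g by move=> x; apply: inj; rewrite gK.
have mg x y : x < y -> g x < g y by move=> xy; rewrite -mono !gK.
have sg x : g (x + 1) = g x + 1 by apply: inj; rewrite gK sf gK.
exists g; split=> // t; apply: continuous_atP => e e0.
pose x := g t; have fx : f x = t by exact: gK.
exists (Num.min (f (x + e) - f x) (f x - f (x - e))).
  rewrite lt_min !subr_gt0; apply/andP; split; apply: mf; lra.
move=> y; rewrite lt_min -fx fK => /andP[/ltr_normlP[l1 l2] /ltr_normlP[l3 l4]].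
have u1 : g y < x + e by rewrite -mono gK; lra.
have u2 : x - e < g y by rewrite -mono gK; lra.
by apply/ler_normlP; split; lra.
Qed.
End line.

Section time_line.
Variable R : realType.
Local Notation F := (R -> R).
Implicit Types (f g h u v w : R -> R) (a b c d e x y s t tau : R).
Variable z : F.
Hypotheses (cz : continuous z) (pz : periodic z 1) (nz : 0 < nsq z).
Local Notation q := (levi_civita1 z).
Local Notation T := (tline z).

Lemma tline0 : T 0 = 0.
Proof. by rewrite tline_tmap // tmap0. Qed.

Lemma tline_shift x : T (x + 1) = T x + 1.
Proof.
have c2 : continuous (fun s => z s ^+ 2) by cont.
rewrite /tline prim_shift //; last by move=> y; rewrite /= pz.
by rewrite mulrDr sqr_itg_nsq mulVf // gt_eqF.
Qed.

Lemma tline01 x : 0 <= x <= 1 -> 0 <= T x <= 1.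
Proof. by move=> /[dup] x01 /andP[x0 _]; rewrite tline_tmap // tmap01. Qed.

Lemma z01 : z 1 = z 0.
Proof. by rewrite -[in LHS](add0r 1) pz. Qed.

Lemma qclip10 : qclip z 1 = qclip z 0.
Proof.
have I0 : 0 <= (0:R) <= 1 by rewrite lexx ler01.
have I1 : 0 <= (1:R) <= 1 by rewrite lexx ler01.
rewrite !qclip_id // -{1}(tmap1 nz) -(tmap0 z) !(@qf_tmap R z) //.
by rewrite z01.
Qed.

Lemma levi_civitaE t : q t = qclip z (fpart t).
Proof. by rewrite qclip_id // fpart01. Qed.

Lemma levi_civita_periodic : periodic q 1.
Proof. by move=> x; rewrite !levi_civitaE fpartD1. Qed.

Lemma levi_civita_continuous : continuous q.
Proof.
have c := periodize_continuous (qclip_continuous cz nz) qclip10.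
rewrite (_ : q = (fun x => qclip z (fpart x))) //.
by apply: funext => t; exact: levi_civitaE.
Qed.

Lemma levi_civita_clip t : 0 <= t <= 1 -> q t = qclip z t.
Proof. by move=> t01; rewrite levi_civitaE (fpart_extend qclip10). Qed.

Lemma levi_civita_tline x : q (T x) = z x ^+ 2.
Proof.
have p1 : periodic (fun x => q (T x)) 1.
  by move=> y; rewrite /= tline_shift levi_civita_periodic.
have p2 : periodic (fun x => z x ^+ 2) 1 by move=> y; rewrite /= pz.
apply: (periodic_ext p1 p2) => t /[dup] t01 /andP[t0 _].
by rewrite levi_civita_clip ?tline01 // tline_tmap // qclip_id ?tmap01 // qf_tmap.
Qed.

Lemma avg_levi_civita : avg q = nsq (sqr z) / nsq z.
Proof. by rewrite -avg_q //; apply: itg_eq => t t01; rewrite levi_civita_clip. Qed.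

Hypothesis sep : forall a b, a < b -> exists2 c, a <= c <= b & z c != 0.

Lemma tline_lt x y : x < y -> T x < T y.
Proof.
move=> xy; have [c cxy zc] := sep xy.
have c2 : continuous (fun s => z s ^+ 2) by cont.
rewrite -subr_gt0 /tline -mulrBr mulr_gt0 ?invr_gt0 // -itg_prim ?ltW //.
apply: (itg_gt0 c2 _ cxy xy); first by move=> *; exact: sqr_ge0.
by rewrite exprn_even_gt0.
Qed.

(** The inverse of the time map on the whole line; it exists because [z] vanishes on no
    interval. *)
Definition tinv : F := xget (id : F) [set g | cancel T g /\ continuous g /\ cancel g T].

Lemma tinvP : [/\ cancel T tinv, cancel tinv T, continuous tinv &
  forall t, tinv (t + 1) = tinv t + 1].
Proof.
have [g [k1 k2 c _ s]] := circle_homeo (tline_continuous cz) tline_lt tline_shift.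
have [K1 [C K2]] : cancel T tinv /\ continuous tinv /\ cancel tinv T.
  by rewrite /tinv; case: xgetP => [h _ //|/(_ g)[]].
split=> // t; apply: (can_inj K1); rewrite K2 tline_shift K2 //.
Qed.

Lemma levi_civita_tinv t : q t = z (tinv t) ^+ 2.
Proof. by have [_ K _ _] := tinvP; rewrite -{1}(K t) levi_civita_tline. Qed.

Lemma tinv_der t : z (tinv t) != 0 -> der tinv t (nsq z / z (tinv t) ^+ 2).
Proof.
move=> z0; have [K1 K2 _ _] := tinvP; rewrite -{1}(K2 t).
have -> : nsq z / z (tinv t) ^+ 2 = (z (tinv t) ^+ 2 / nsq z)^-1 by rewrite invf_div.
apply: is_derive_inverse.
- by near=> y; exact: K1.
- by near=> y; exact: (tline_continuous cz).
- exact: tline_der.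
- by rewrite mulf_neq0 ?invr_eq0 ?sqrf_eq0 // gt_eqF.
Unshelve. all: by end_near. Qed.
End time_line.

(** * The regularized equations of motion *)

Section euler.
Variable R : realType.
Local Notation mu := (@lebesgue_measure R).
Local Notation F := (R -> R).
Implicit Types (f g h u v w : R -> R) (a b c d e x y s t tau : R).

Lemma der_uniq f x l m : der f x l -> der f x m -> l = m.
Proof. by move=> [_ <-] [_ <-]. Qed.

Lemma ftc f g a b : a <= b -> continuous f -> continuous g ->
  (forall x, a < x < b -> der g x (f x)) -> g b = g a + itg a b f.
Proof.
move=> ab cf cg dg; have E := itg_der ab cf (continuous_subspaceT cg) dg.
by rewrite E subrKC.
Qed.

Lemma der_periodic f g : periodic f 1 -> (forall x, der f x (g x)) -> periodic g 1.
Proof.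
move=> pf df x; apply: (der_uniq (der_shift (df (x + 1)))).
by apply: (der_ext (f := f)) => // y; rewrite pf.
Qed.

Lemma wderiv_nsq z v : H1 z -> is_wderiv z v -> nsq (wderiv z) = nsq v.
Proof.
move=> Hz zv; have zw := H1_wderiv Hz; apply: ae_nsq; first exact: wderiv_uniq zw zv.
- by case: zw.
- by case: zv.
Qed.

Lemma wderiv_ip z v h : H1 z -> is_wderiv z v -> L2 h -> ip (wderiv z) h = ip v h.
Proof.
move=> Hz zv Lh; have zw := H1_wderiv Hz; apply: ae_ip => //; first exact: wderiv_uniq zw zv.
- by case: zw.
- by case: zv.
Qed.

(** A weak solution of [c z'' = K z] has a weak derivative that is the primitive of [K z / c],
    hence a continuous derivative. *)
Lemma euler_lagrange (z K : F) c : H1 z -> continuous K -> 0 < c ->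
  (forall h, H1 h -> c * ip (wderiv z) (wderiv h) + ip (fun t => K t * z t) h = 0) ->
  exists v : F, [/\ continuous v, periodic v 1, forall x, der z x (v x) &
    forall t, 0 <= t <= 1 -> v t = v 0 + itg 0 t (fun s => K s * z s / c)].
Proof.
move=> Hz cK c0 E; have cz := H1_continuous Hz; have [Lw zE] := H1_wderiv Hz.
have ck : continuous (fun t => K t * z t) by cont.
have [|I0 [b wE]] := du_bois_reymond (L2Z c Lw) (continuous_L2 ck).
  by move=> h Hh; rewrite ipZl ?E //; case: (H1_wderiv Hh).
pose v0 t := b / c + prim (fun s => K s * z s / c) t.
have ckc : continuous (fun s => K s * z s / c) by cont.
have cv0 : continuous v0 by have := prim_continuous ckc; rewrite /v0 => cp; cont.
have pE t : 0 <= t -> prim (fun s => K s * z s / c) t = itg 0 t (fun s => K s * z s) / c.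
  move=> t0; have -> : prim (fun s => K s * z s / c) t = itg 0 t (fun s => K s * z s / c).
    by rewrite itg_prim // prim0 subr0.
  rewrite mulrC -itgZ; last exact: continuous_L1.
  by apply: itg_eq => x _; rewrite mulrC.
have v01 : v0 1 = v0 0 by rewrite /v0 pE // I0 mul0r prim0.
have cv := periodize_continuous cv0 v01; set v := fun x => v0 (fpart x) in cv.
have vE t : 0 <= t <= 1 -> v t = v0 t by move=> t01; rewrite /v fpart_extend.
have pv : periodic v 1 := periodic_of_fpart v0.
exists v; split=> //.
- apply: periodic_prim => //; first by case: Hz.
  move=> t /andP[t0 t1]; rewrite zE ?t0 //; congr (_ + _).
  apply: ae_int; [|exact: L1_01|exact: continuous_L1].
  apply: (@filterS _ _ (ae_filter_ringOfSetsType mu) _ _ _ wE) => x h /=.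
  rewrite in_itv /= => /andP[x0 xt]; have x1 := le_trans xt t1.
  rewrite vE ?x0 // /v0 pE // -mulrDl -h; last by rewrite /= in_itv /= x0.
  by rewrite [(c *: _) x]mulrC mulfK // gt_eqF.
- move=> t t01; have /andP[t0 _] := t01; rewrite !vE ?lexx ?ler01 // /v0 prim0 addr0.
  by rewrite itg_prim // prim0 subr0.
Qed.
End euler.

Section regular.
Variable R : realType.
Local Notation F := (R -> R).
Local Notation F2 := (F * F)%type.
Implicit Types (f g h u v w : R -> R) (a b c d e x y s t tau : R).

(** The Levi-Civita regularization of [q'' = - 2 / q^2 + s f] for [q (t_z) = z^2], with
    velocity [v = z'] and energy [e = q'^2 / 2 - 2 / q]: in the parameter [tau] with [dt = z^2
    / N dtau], [N = nsq z], it reads [2 N^2 z'' = (e + s f z^2) z], [e' = s f (z^2)'], and the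
    definition of the energy becomes the constraint [2 N^2 v^2 - 2 = z^2 e]. Nothing is
    singular at [z = 0]. *)
Definition kepler s (z v e f : F) : Prop :=
  [/\ forall x, der z x (v x),
      forall x, der v x ((e x + s * f (tline z x) * z x ^+ 2) * z x / (2 * nsq z ^+ 2)),
      forall x, der e x (s * f (tline z x) * (2 * z x * v x)),
      forall x, 2 * nsq z ^+ 2 * v x ^+ 2 - 2 = z x ^+ 2 * e x
    & periodic e 1].

(** The two sides differ by a first integral of the equations, a constant, which vanishes
    because its mean does. *)
Lemma constraint s (z v e f : F) : continuous z -> continuous v -> continuous e -> 0 < nsq z ->
  (forall x, 0 < x < 1 -> der z x (v x)) ->
  (forall x, 0 < x < 1 ->
    der v x ((e x + s * f (tline z x) * z x ^+ 2) * z x / (2 * nsq z ^+ 2))) ->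
  (forall x, 0 < x < 1 -> der e x (s * f (tline z x) * (2 * z x * v x))) ->
  itg 0 1 (fun x => z x ^+ 2 * e x) = 2 * nsq z ^+ 2 * nsq v - 2 ->
  forall t, 0 <= t <= 1 -> 2 * nsq z ^+ 2 * v t ^+ 2 - 2 = z t ^+ 2 * e t.
Proof.
move=> cz cv ce nz dz dv de mean; pose D t := 2 * nsq z ^+ 2 * v t ^+ 2 - 2 - z t ^+ 2 * e t.
have cD : continuous D by rewrite /D; cont.
have dD x : 0 < x < 1 -> der D x 0.
  move=> x01; have d1 := derZ (2 * nsq z ^+ 2) (der_sq (dv x x01)).
  have d2 := derM (der_sq (dz x x01)) (de x x01).
  have d3 := derB (derB d1 (der_cst 2 x)) d2.
  by apply: (der_eq d3); field; rewrite gt_eqF.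
have DE t : 0 <= t <= 1 -> D t = D 0.
  move=> /andP[t0 t1]; apply: (cst_of_der0 t0 (continuous_subspaceT cD)) => x.
  by move=> /andP[x0 xt]; apply: dD; rewrite x0 (lt_le_trans xt).
have : itg 0 1 D = D 0 by rewrite (itg_eq DE) itg_cst // subr0 mulr1.
have cv2 : continuous (fun t => 2 * nsq z ^+ 2 * v t ^+ 2) by cont.
have c2 : continuous (fun t : R => 2 : R) by exact: cont_cst.
have cze : continuous (fun t => z t ^+ 2 * e t) by cont.
rewrite /D itgB ?itgB ?mean ?itg_cst //; try exact: continuous_L1; last first.
  by apply: continuous_L1; cont.
rewrite itgZ; last by apply: continuous_L1; cont.
rewrite sqr_itg_nsq subr0 mulr1 subrr => /esym D0 t t01.
by apply/eqP; rewrite -subr_eq0 -[X in X == 0]/(D t) DE // /D D0.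
Qed.

(** The equations are known inside one period only; the matching of the values at its ends lets
    the periodic extensions satisfy them on the line. *)
Lemma kepler_periodize s (z v e f : F) : continuous z -> periodic z 1 -> 0 < nsq z ->
  continuous f -> periodic f 1 -> continuous v -> continuous e ->
  v 1 = v 0 -> e 1 = e 0 ->
  (forall x, 0 < x < 1 -> der z x (v x)) ->
  (forall x, 0 < x < 1 ->
    der v x ((e x + s * f (tline z x) * z x ^+ 2) * z x / (2 * nsq z ^+ 2))) ->
  (forall x, 0 < x < 1 -> der e x (s * f (tline z x) * (2 * z x * v x))) ->
  (forall t, 0 <= t <= 1 -> 2 * nsq z ^+ 2 * v t ^+ 2 - 2 = z t ^+ 2 * e t) ->
  kepler s z (fun x => v (fpart x)) (fun x => e (fpart x)) f.
Proof.
move=> cz pz nz cf pf cv ce v01 e01 dz dv de D.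
have c1 := periodize_continuous cv v01; have c2 := periodize_continuous ce e01.
have p1 := periodic_of_fpart v; have p2 := periodic_of_fpart e.
have ct := tline_continuous cz.
have cfT : continuous (fun x => f (tline z x)) by cont.
have pfT : periodic (fun x => f (tline z x)) 1.
  by move=> x; rewrite /= (tline_shift cz pz nz) pf.
have E1 x : 0 <= x <= 1 -> v (fpart x) = v x by move=> ?; rewrite fpart_extend.
have E2 x : 0 <= x <= 1 -> e (fpart x) = e x by move=> ?; rewrite fpart_extend.
have I0 : 0 <= (0:R) <= 1 by rewrite lexx ler01.
split.
- apply: periodic_prim => // t /andP[t0 t1].
  apply: ftc => // x /andP[x0 xt]; have x1 := lt_le_trans xt t1.
  by rewrite E1 ?(ltW x0) ?ltW //; apply: dz; rewrite x0.
- apply: periodic_prim => //.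
  + by cont.
  + by move=> x; rewrite /= (pfT x) pz p2.
  move=> t /andP[t0 t1]; rewrite !E1 ?t0 //.
  apply: ftc => //; first by cont.
  move=> x /andP[x0 xt]; have x1 := lt_le_trans xt t1.
  by rewrite E2 ?(ltW x0) ?ltW //; apply: dv; rewrite x0.
- apply: periodic_prim => //.
  + by cont.
  + by move=> x; rewrite /= (pfT x) pz p1.
  move=> t /andP[t0 t1]; rewrite !E2 ?t0 //.
  apply: ftc => //; first by cont.
  move=> x /andP[x0 xt]; have x1 := lt_le_trans xt t1.
  by rewrite E1 ?(ltW x0) ?ltW //; apply: de; rewrite x0.
- apply: periodic_ext => [x|x|x x01]; rewrite /= ?p1 ?p2 ?pz //.
  by rewrite E1 ?E2 ?D.
- exact: p2.
Qed.

Variable r : R.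

(** The force pushing the outer particle outwards and the inner one inwards. *)
Definition repulsion (q : F2) t :=
  r / (q.1 t - q.2 t) ^+ 2 + (1 - r) / (avg q.1 - avg q.2) ^+ 2.

(** The common form of critical points and of collision orbits: both sides of the
    correspondence are compared with it. *)
Definition regular (Z v e : F2) : Prop :=
  [/\ H1in Z, kepler 1 Z.1 v.1 e.1 (repulsion (levi_civita Z))
   & kepler (-1) Z.2 v.2 e.2 (repulsion (levi_civita Z))].

Variable Z : F2.
Hypothesis hZ : H1in Z.

Let hH : H1sq Z. Proof. by case: hZ. Qed.
Let sZ : apart Z. Proof. exact: H1in_apart. Qed.
Let pf : component (@fst F F). Proof. by left. Qed.
Let c1 : continuous Z.1. Proof. by case: sZ. Qed.
Let c2 : continuous Z.2. Proof. by case: sZ. Qed.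
Let n1 : 0 < nsq Z.1. Proof. by case: sZ. Qed.
Let n2 : 0 < nsq Z.2. Proof. by case: sZ. Qed.
Let p1 : periodic Z.1 1. Proof. by case: hH => -[]. Qed.
Let p2 : periodic Z.2 1. Proof. by case: hH => _ []. Qed.
Let I0 : 0 <= (0:R) <= 1. Proof. by rewrite lexx ler01. Qed.
Local Notation q1 := (levi_civita1 Z.1).
Local Notation q2 := (levi_civita1 Z.2).
Local Notation f := (repulsion (levi_civita Z)).

Lemma levi_civita_apart t : q2 t < q1 t.
Proof.
rewrite !(levi_civitaE, levi_civitaE) // -subr_gt0; exact: apart_clip.
Qed.

Lemma levi_civita_gap t : q1 t - q2 t != 0.
Proof. by rewrite gt_eqF // subr_gt0 levi_civita_apart. Qed.

Lemma repulsion_continuous : continuous f.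
Proof.
have k1 := levi_civita_continuous c1 p1 n1; have k2 := levi_civita_continuous c2 p2 n2.
have g : forall t, (q1 t - q2 t) ^+ 2 != 0 by move=> t; rewrite sqrf_eq0 levi_civita_gap.
have cg : continuous (fun t => ((q1 t - q2 t) ^+ 2)^-1) by apply: contV => //; cont.
by apply: contD; [apply: contM => //; exact: cont_cst|exact: cont_cst].
Qed.

Lemma repulsion_periodic : periodic f 1.
Proof.
by move=> x; rewrite /= /repulsion /= (levi_civita_periodic Z.1) (levi_civita_periodic Z.2).
Qed.

Lemma repulsion_force t : 0 <= t <= 1 -> f t = force r Z t.
Proof.
move=> t01; rewrite /repulsion /= !levi_civita_clip // !avg_levi_civita // /force /fPsi /Psi /fA.
by rewrite !exprVn.
Qed.

Variables v1 v2 : F.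
Hypotheses (cv1 : continuous v1) (cv2 : continuous v2) (pv1 : periodic v1 1).
Hypotheses (dz1 : forall x, der Z.1 x (v1 x)) (dz2 : forall x, der Z.2 x (v2 x)).

Let zv1 : is_wderiv Z.1 v1. Proof. exact: C1_wderiv. Qed.
Let zv2 : is_wderiv Z.2 v2. Proof. exact: C1_wderiv. Qed.
Local Notation T1 := (tline Z.1).
Local Notation T2 := (tline Z.2).

Lemma outer_sep a b : a < b -> exists2 c, a <= c <= b & Z.1 c != 0.
Proof. by move=> ab; exists a; rewrite ?lexx ?ltW // outer_neq0. Qed.

Lemma outer_tau_tinv t : 0 <= t <= 1 -> outer_tau Z t = tinv Z.1 t.
Proof.
move=> t01; have [/andP[s0 _] sE] := outer_tauP hZ t01.
have [K1' _ _ _] := tinvP c1 p1 n1 outer_sep.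
by rewrite -(K1' (outer_tau Z t)) tline_tmap // sE.
Qed.

Lemma outer_q_der t : der q1 t (slope1 Z v1 (tinv Z.1 t)).
Proof.
have nz := outer_neq0 hZ (tinv Z.1 t).
have dS := tinv_der c1 p1 n1 outer_sep nz.
have := der_sq (der_comp (f := Z.1) (g := tinv Z.1) (dz1 _) dS).
move=> d; apply: (der_ext (f := fun y => Z.1 (tinv Z.1 y) ^+ 2)).
  by move=> y; rewrite (levi_civita_tinv c1 p1 n1 outer_sep).
by apply: (der_eq d); rewrite /slope1; field; exact: nz.
Qed.

(** These are the energies of the two particles along an orbit: the mean is determined by the
    norms of [z] and [z'], the rest is the work of the force. *)
Definition energy1 x := 2 * nsq Z.1 * nsq v1 - 2 / nsq Z.1 +
  (r * Gam1 Z v1 (T1 x) + (1 - r) * fA Z * Z.1 x ^+ 2 - itg 0 1 (work1 r Z v1)).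
Definition energy2 x := 2 * nsq Z.2 * nsq v2 - 2 / nsq Z.2 -
  (r * (Gam1 Z v1 (T2 x) + (q1 (T2 x) - Z.2 x ^+ 2)^-1) + (1 - r) * fA Z * Z.2 x ^+ 2
   - itg 0 1 (work2 r Z v1)).

Lemma q1_T2_gap x : q1 (T2 x) - Z.2 x ^+ 2 != 0.
Proof. by rewrite -(levi_civita_tline c2 p2 n2) levi_civita_gap. Qed.

Lemma energy1_der x : 0 <= x <= 1 -> der energy1 x (1 * f (T1 x) * (2 * Z.1 x * v1 x)).
Proof.
move=> x01; have T01 := tline01 c1 n1 x01; have /andP[x0 x1] := x01.
have dG := der_comp (f := Gam1 Z v1) (g := T1) (Gam1_der hZ cv1 (T1 x)) (tline_der x c1).
have d := derD (derZ r dG) (derZ ((1 - r) * fA Z) (der_sq (dz1 x))).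
have d' := derD (der_cst (2 * nsq Z.1 * nsq v1 - 2 / nsq Z.1) x) (derB d (der_cst (itg 0 1 (work1 r Z v1)) x)).
apply: (der_eq d'); rewrite repulsion_force // /force outer_tau_tinv //.
have [K1' _ _ _] := tinvP c1 p1 n1 outer_sep; rewrite K1' /slope1.
by field; rewrite gt_eqF ?outer_neq0.
Qed.

Lemma energy2_der x : 0 <= x <= 1 -> der energy2 x (-1 * f (T2 x) * (2 * Z.2 x * v2 x)).
Proof.
move=> x01; have T01 := tline01 c2 n2 x01; have /andP[x0 x1] := x01.
have g0 := q1_T2_gap x.
have dT := tline_der x c2.
have dG := der_comp (f := Gam1 Z v1) (g := T2) (Gam1_der hZ cv1 (T2 x)) dT.
have dq := der_comp (f := q1) (g := T2) (outer_q_der (T2 x)) dT.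
have dI := der_recip (f := fun x => q1 (T2 x) - Z.2 x ^+ 2) g0 (derB dq (der_sq (dz2 x))).
have d := derD (derZ r (derD dG dI)) (derZ ((1 - r) * fA Z) (der_sq (dz2 x))).
have d' := derB (der_cst (2 * nsq Z.2 * nsq v2 - 2 / nsq Z.2) x) (derB d (der_cst (itg 0 1 (work2 r Z v1)) x)).
apply: (der_eq d'); rewrite repulsion_force // /force outer_tau_tinv //.
have -> : fPsi Z (T2 x) = (q1 (T2 x) - Z.2 x ^+ 2)^-1 ^+ 2.
  by rewrite /fPsi /Psi -!levi_civita_clip // (levi_civita_tline c2 p2 n2).
move: (slope1 _ _ _) (q1 _ - _) g0 (fA Z) => m g g0 A.
by field; rewrite g0 gt_eqF.
Qed.

Lemma energy1_continuous : continuous energy1.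
Proof.
have ct := tline_continuous c1; have cG := Gam1_continuous hZ cv1.
by rewrite /energy1; cont.
Qed.

Lemma energy2_continuous : continuous energy2.
Proof.
have ct := tline_continuous c2; have cG := Gam1_continuous hZ cv1.
have cq := levi_civita_continuous c1 p1 n1.
have cg : continuous (fun x => (q1 (T2 x) - Z.2 x ^+ 2)^-1).
  by apply: contV; [exact: q1_T2_gap|cont].
have cG2 : continuous (fun x => Gam1 Z v1 (T2 x)) by exact: (cont_comp cG).
have cs := contD (contM (@cont_cst R r) (contD cG2 cg)) (contM (@cont_cst R ((1 - r) * fA Z)) (contX (n:=2) c2)).
apply: contD; first exact: cont_cst.
by apply: contN; apply: contD => //; exact: cont_cst.
Qed.

Lemma work1_tline x : 0 <= x <= 1 -> work1 r Z v1 (T1 x) =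
  r * Gam1 Z v1 (T1 x) + (1 - r) * fA Z * Z.1 x ^+ 2.
Proof.
by move=> x01; rewrite /work1 -levi_civita_clip ?tline01 // (levi_civita_tline c1 p1 n1).
Qed.

Lemma work2_tline x : 0 <= x <= 1 -> work2 r Z v1 (T2 x) =
  r * (Gam1 Z v1 (T2 x) + (q1 (T2 x) - Z.2 x ^+ 2)^-1) + (1 - r) * fA Z * Z.2 x ^+ 2.
Proof.
move=> x01; have T01 := tline01 c2 n2 x01.
by rewrite /work2 /Gam2 /Psi -!levi_civita_clip // (levi_civita_tline c2 p2 n2).
Qed.

(** The coefficient of the Euler-Lagrange equation, a nonlocal expression in [Z], is the local
    coefficient of the regularized equation once the energy is introduced. *)
Lemma kernel1_energy x : 0 <= x <= 1 ->
  kernel1 r Z v1 x = 2 / nsq Z.1 * (energy1 x + 1 * f (T1 x) * Z.1 x ^+ 2).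
Proof.
move=> x01; rewrite /kernel1 (wderiv_nsq hH.1 zv1) /gdens work1_tline // repulsion_force ?tline01 //.
by rewrite /energy1; field; rewrite gt_eqF.
Qed.

Lemma kernel2_energy x : 0 <= x <= 1 ->
  kernel2 r Z v1 x = 2 / nsq Z.2 * (energy2 x + -1 * f (T2 x) * Z.2 x ^+ 2).
Proof.
move=> x01; rewrite /kernel2 (wderiv_nsq hH.2 zv2) /gdens work2_tline // repulsion_force ?tline01 //.
rewrite /energy2; move: (q1_T2_gap x); move: (q1 _ - _) => g g0.
by field; rewrite ?g0 ?gt_eqF.
Qed.

(** The part of the energy that is the work of the force has mean zero in the time [t]. *)
Lemma mean_work (z G : F) (E c : R) (e : F) : continuous z -> 0 < nsq z -> continuous G ->
  (forall x, 0 <= x <= 1 -> e x = E + c * (G (tmap z x) - itg 0 1 G)) ->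
  itg 0 1 (fun x => z x ^+ 2 * e x) = E * nsq z.
Proof.
move=> cz nz cG eE; have cl : continuous (fun t => E + c * (G t - itg 0 1 G)) by cont.
rewrite (itg_eq (g := fun x => nsq z * (z x ^+ 2 / nsq z *
    (fun t => E + c * (G t - itg 0 1 G)) (tmap z x)))); last first.
  by move=> x x01; rewrite eE //; field; rewrite gt_eqF.
have ct := tline_continuous cz.
have cm : continuous (fun x => z x ^+ 2 / nsq z *
    (fun t => E + c * (G t - itg 0 1 G)) (tline z x)).
  by apply: contM; [cont|exact: (cont_comp cl)].
have -> : itg 0 1 (fun x => nsq z * (z x ^+ 2 / nsq z *
    (fun t => E + c * (G t - itg 0 1 G)) (tmap z x))) =
   nsq z * itg 0 1 (fun x => z x ^+ 2 / nsq z *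
    (fun t => E + c * (G t - itg 0 1 G)) (tmap z x)).
  rewrite [RHS](_ : _ = nsq z * itg 0 1 (fun x => z x ^+ 2 / nsq z *
    (fun t => E + c * (G t - itg 0 1 G)) (tline z x))).
    rewrite -itgZ; last exact: continuous_L1.
    by apply: itg_eq => x /andP[x0 _]; rewrite tline_tmap.
  by congr (_ * _); apply: itg_eq => x /andP[x0 _]; rewrite tline_tmap.
rewrite (substitution cz nz cl) mulrC; congr (_ * _).
have cG' : continuous (fun t => G t - itg 0 1 G) by cont.
rewrite itgD ?itgZ ?itgB ?itg_cst //; try exact: continuous_L1;
  try exact/continuous_L1/cont_cst; last by apply: continuous_L1; cont.
by rewrite subr0 !mulr1 subrr mulr0 addr0.
Qed.

Lemma energy1_mean : itg 0 1 (fun x => Z.1 x ^+ 2 * energy1 x) = 2 * nsq Z.1 ^+ 2 * nsq v1 - 2.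
Proof.
rewrite (@mean_work _ (work1 r Z v1) (2 * nsq Z.1 * nsq v1 - 2 / nsq Z.1) 1) //.
- by field; rewrite gt_eqF.
- exact: work1_continuous.
- move=> x x01; have /andP[x0 _] := x01.
  by rewrite -(tline_tmap _ x0) work1_tline // /energy1 mul1r.
Qed.

Lemma energy2_mean : itg 0 1 (fun x => Z.2 x ^+ 2 * energy2 x) = 2 * nsq Z.2 ^+ 2 * nsq v2 - 2.
Proof.
rewrite (@mean_work _ (work2 r Z v1) (2 * nsq Z.2 * nsq v2 - 2 / nsq Z.2) (-1)) //.
- by field; rewrite gt_eqF.
- exact: work2_continuous.
- move=> x x01; have /andP[x0 _] := x01.
  by rewrite -(tline_tmap _ x0) work2_tline // /energy2 mulN1r.
Qed.

(** An energy satisfies the same differential equation as [E]; the constraint, integrated,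
    gives both the same weighted mean. *)
Lemma kepler_energyE s (z v e E : F) : continuous z -> 0 < nsq z ->
  kepler s z v e f -> continuous E ->
  (forall x, 0 <= x <= 1 -> der E x (s * f (tline z x) * (2 * z x * v x))) ->
  itg 0 1 (fun x => z x ^+ 2 * E x) = 2 * nsq z ^+ 2 * nsq v - 2 ->
  forall x, 0 <= x <= 1 -> e x = E x.
Proof.
move=> cz nz [dz dv de cons pe] cE dE mE.
have ce : continuous e by move=> x; exact: derivable_continuous (de x).
have cv : continuous v by move=> x; exact: derivable_continuous (dv x).
pose D x := e x - E x; have cD : continuous D by rewrite /D; cont.
have DE t : 0 <= t <= 1 -> D t = D 0.
  move=> /andP[t0 t1]; apply: (cst_of_der0 t0 (continuous_subspaceT cD)) => x /andP[x0 xt].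
  apply: (der_eq (derB (de x) (dE x _))); last by rewrite subrr.
  by rewrite (ltW x0) (le_trans (ltW xt)).
have D0 : D 0 = 0.
  have cze : continuous (fun x => z x ^+ 2 * e x) by cont.
  have czE : continuous (fun x => z x ^+ 2 * E x) by cont.
  have me : itg 0 1 (fun x => z x ^+ 2 * e x) = 2 * nsq z ^+ 2 * nsq v - 2.
    rewrite (itg_eq (g := fun x => 2 * nsq z ^+ 2 * v x ^+ 2 - 2)); last first.
      by move=> x _; rewrite cons.
    rewrite itgB; [|by apply: continuous_L1; cont|exact/continuous_L1/cont_cst].
    rewrite itgZ ?itg_cst ?subr0 ?mulr1 ?sqr_itg_nsq //; by apply: continuous_L1; cont.
  have : itg 0 1 (fun x => z x ^+ 2 * D x) = D 0 * nsq z.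
    rewrite -sqr_itg_nsq -itgZ; last by apply: continuous_L1; cont.
    by apply: itg_eq => x x01; rewrite DE // mulrC.
  rewrite (itg_eq (g := fun x => z x ^+ 2 * e x - z x ^+ 2 * E x)); last first.
    by move=> x _; rewrite mulrBr.
  rewrite itgB ?me ?mE ?subrr; [|exact: continuous_L1..].
  by move=> /esym/eqP; rewrite mulf_eq0 (gt_eqF nz) orbF => /eqP.
by move=> x x01; apply/eqP; rewrite -subr_eq0 -[X in X == 0]/(D x) DE // D0.
Qed.

(** Integration by parts of the equation for [v]. *)
Lemma kepler_weak s (z v e K h : F) : H1 z -> 0 < nsq z -> kepler s z v e f -> continuous f ->
  periodic v 1 ->
  (forall x, 0 <= x <= 1 -> K x = 2 / nsq z * (e x + s * f (tline z x) * z x ^+ 2)) ->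
  H1 h -> 4 * nsq z * ip (wderiv z) (wderiv h) + ip (fun t => K t * z t) h = 0.
Proof.
move=> Hz nz [dz dv de cons pe] cf pv KE Hh; have cz := H1_continuous Hz.
have ce : continuous e by move=> x; exact: derivable_continuous (de x).
have cv : continuous v by move=> x; exact: derivable_continuous (dv x).
have ct := tline_continuous cz.
have zv := C1_wderiv dz cv.
have cfT : continuous (fun x => f (tline z x)) by exact: (cont_comp cf).
have ca : continuous (fun x => (e x + s * f (tline z x) * z x ^+ 2) * z x / (2 * nsq z ^+ 2)).
  by cont.
have va := C1_wderiv dv ca.
have v10 : v 1 = v 0 by rewrite -[in LHS](add0r 1) pv.
have := H1_parts va cv v10 Hh.
have [Lwh _] := H1_wderiv Hh; have ch := H1_continuous Hh.
rewrite (wderiv_ip Hz zv Lwh) => /eqP; rewrite addr_eq0 => /eqP ->.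
rewrite mulrN addrC; apply/eqP; rewrite subr_eq0; apply/eqP.
rewrite /ip -itgZ; last by apply: continuous_L1; exact: contM.
by apply: itg_eq => x x01; rewrite KE //; field; rewrite gt_eqF.
Qed.
End regular.

Section equivalence.
Variable R : realType.
Local Notation F := (R -> R).
Local Notation F2 := (F * F)%type.
Implicit Types (f g h u w : R -> R) (a b c d x y s t tau : R) (v e Z : F2).

Lemma orbit_continuous s (z v e f : F) : kepler s z v e f -> continuous v /\ continuous e.
Proof.
by move=> [dz dv de _ _]; split=> x; [exact: derivable_continuous (dv x)|
  exact: derivable_continuous (de x)].
Qed.

Lemma regular_crit (r : R) Z v e : regular r Z v e -> crit_B r Z.
Proof.
move=> [hZ o1 o2]; split=> //; have [[z1 z2] _ _ _] := hZ.
have [c1 c2 n1 n2 _] := H1in_apart hZ.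
have [cv1 _] := orbit_continuous o1; have [cv2 _] := orbit_continuous o2.
have [dz1 _ _ _ _] := o1; have [dz2 _ _ _ _] := o2.
have pv1 := der_periodic z1.1 dz1; have pv2 := der_periodic z2.1 dz2.
have e1E := kepler_energyE c1 n1 o1 (energy1_continuous (r:=r) hZ cv1)
  (energy1_der r hZ cv1 dz1) (energy1_mean r hZ cv1).
have e2E := kepler_energyE c2 n2 o2 (energy2_continuous (r:=r) hZ cv1)
  (energy2_der r hZ cv1 dz1 dz2) (energy2_mean r hZ v.2 cv1).
have cf := repulsion_continuous (r:=r) hZ.
have zv1 := C1_wderiv dz1 cv1.
have [lin bd fr] := Bfun_frechet r hZ cv1 zv1.
suff E0 H : H1sq H -> dBfun r Z v.1 H = 0.
  split; first by move=> *; rewrite mulr0 addr0.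
    by exists 0 => h _; rewrite normr0 mul0r.
  move=> eps eps0; have [d d0 P] := fr _ eps0; exists d => // H HH Hd.
  by have := P H HH Hd; rewrite E0.
move=> [h1 h2]; rewrite /dBfun.
rewrite (kepler_weak z1 n1 o1 cf pv1 _ h1) ?(kepler_weak z2 n2 o2 cf pv2 _ h2) ?addr0 //.
- by move=> x x01; rewrite e2E //; exact: kernel2_energy.
- by move=> x x01; rewrite e1E //; exact: kernel1_energy.
Qed.

(** The regularity of the outer particle comes first; it makes the functional differentiable
    with the kernels of the previous part, so both particles satisfy weak Euler-Lagrange
    equations with continuous coefficients. The energy of the outer particle takes the same
    value at the two ends of the period by the constraint, as [z_1] has no zero; that of the
    inner one follows because both contain the same work integral. *)
Lemma crit_regular (r : R) Z : crit_B r Z -> exists v e, regular r Z v e.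
Proof.
move=> cB; have [hZ fr0] := cB; have [[z1 z2] _ _ _] := hZ.
have [c1 c2 n1 n2 _] := H1in_apart hZ; have [p1 p2] := (z1.1, z2.1).
have I0 : 0 <= (0:R) <= 1 by rewrite lexx ler01.
have I1 : 0 <= (1:R) <= 1 by rewrite lexx ler01.
have H0 : H1 (0 : F) by have [[]] := @zeroH1 R.
have ip00 (k : F) : ip k (0 : F) = 0 by rewrite ipC ip0l.
have w00 (k : F) : L2 k -> ip k (wderiv (0 : F)) = 0.
  move=> Lk; have [L0 _] := H1_wderiv H0; rewrite -(scale0r (0 : F)) ipC (ae_ip (wderivZ 0 H0)) //.
  - by rewrite scale0r ip0l.
  - by have [] := H1_wderiv (H1Z 0 H0).
  - exact: L2Z.
have weak w : continuous w -> is_wderiv Z.1 w ->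
    (forall h, H1 h -> 4 * nsq Z.1 * ip (wderiv Z.1) (wderiv h) + ip (fun t => kernel1 r Z w t * Z.1 t) h = 0)
    /\ (forall h, H1 h -> 4 * nsq Z.2 * ip (wderiv Z.2) (wderiv h) + ip (fun t => kernel2 r Z w t * Z.2 t) h = 0).
  move=> cw zw; have fr := Bfun_frechet r hZ cw zw.
  have N0 (H : F2) : 0 <= normH1 H by exact: normH1_ge0.
  have E (H : F2) (HH : H1sq H) := frechet_uniq N0 (@H1sq_scale R) fr fr0 HH.
  have [Lw1 _] := H1_wderiv z1; have [Lw2 _] := H1_wderiv z2.
  split=> h Hh.
    have := E (h, 0) (conj Hh H0); rewrite /dBfun /= w00 // ip00 mulr0 !addr0.
    exact.
  have := E (0, h) (conj H0 Hh); rewrite /dBfun /= w00 // ip00 mulr0 !add0r.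
  exact.
have [w cw zw] := crit_outer_C1 hZ cB.
have N1 : 0 < 4 * nsq Z.1 by rewrite mulr_gt0.
have N2 : 0 < 4 * nsq Z.2 by rewrite mulr_gt0.
have [v1 [cv1 pv1 dz1 _]] := euler_lagrange z1 (kernel1_continuous hZ cw) N1 (weak w cw zw).1.
have zv1 := C1_wderiv dz1 cv1.
have [v1' [cv1' _ dz1' v1E]] := euler_lagrange z1 (kernel1_continuous hZ cv1) N1 (weak v1 cv1 zv1).1.
have vv : v1' = v1 by apply: funext => x; exact: der_uniq (dz1' x) (dz1 x).
rewrite {}vv {cv1' dz1'} in v1E.
have [v2 [cv2 pv2 dz2 v2E]] := euler_lagrange z2 (kernel2_continuous hZ cv1) N2 (weak v1 cv1 zv1).2.
have cf := repulsion_continuous (r:=r) hZ; have pf := repulsion_periodic r Z.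
pose E1 := energy1 r Z v1; pose E2 := energy2 r Z v1 v2.
have cE1 : continuous E1 := energy1_continuous (r:=r) hZ cv1.
have cE2 : continuous E2 := energy2_continuous (r:=r) hZ cv1.
have dE1 := energy1_der r hZ cv1 dz1.
have dE2 := energy2_der r hZ cv1 dz1 dz2.
(* the integral equation for the velocity, differentiated inside the period *)
have second s (z v K E : F) : continuous z -> 0 < nsq z -> continuous E -> continuous v ->
    (forall t, 0 <= t <= 1 -> v t = v 0 + itg 0 t (fun s => K s * z s / (4 * nsq z))) ->
    (forall x, 0 <= x <= 1 -> K x = 2 / nsq z * (E x + s * repulsion r (levi_civita Z) (tline z x) * z x ^+ 2)) ->
    forall x, 0 < x < 1 -> der v x ((E x + s * repulsion r (levi_civita Z) (tline z x) * z x ^+ 2) * z x / (2 * nsq z ^+ 2)).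
  move=> cz nz cE cv vE KE x /andP[x0 x1]; have ct := tline_continuous cz.
  have cfT : continuous (fun x => repulsion r (levi_civita Z) (tline z x)) by exact: (cont_comp cf).
  pose a x := (E x + s * repulsion r (levi_civita Z) (tline z x) * z x ^+ 2) * z x / (2 * nsq z ^+ 2).
  have ca : continuous a by rewrite /a; cont.
  apply: (@near_eq_is_derive _ _ _ (fun y => v 0 + prim a y)).
    near=> y; have y0 : 0 < y by near: y; exact: near_gt.
    have y1 : y < 1 by near: y; exact: near_lt.
    rewrite (vE y) ?(ltW y0) ?ltW //; congr (_ + _).
    have -> : prim a y = itg 0 y a by rewrite itg_prim ?prim0 ?subr0 // ltW.
    apply: itg_eq => u /andP[u0 uy].
    by rewrite KE ?u0 ?(le_trans uy) ?ltW // /a; field; rewrite gt_eqF.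
  by apply: (der_eq (derD (der_cst _ _) (prim_der x ca))); rewrite add0r.
have K1E x : 0 <= x <= 1 -> kernel1 r Z v1 x = 2 / nsq Z.1 *
    (E1 x + 1 * repulsion r (levi_civita Z) (tline Z.1 x) * Z.1 x ^+ 2).
  by move=> x01; exact: kernel1_energy.
have K2E x : 0 <= x <= 1 -> kernel2 r Z v1 x = 2 / nsq Z.2 *
    (E2 x + -1 * repulsion r (levi_civita Z) (tline Z.2 x) * Z.2 x ^+ 2).
  by move=> x01; exact: kernel2_energy.
have dv1 := second _ _ _ _ _ c1 n1 cE1 cv1 v1E K1E.
have dv2 := second _ _ _ _ _ c2 n2 cE2 cv2 v2E K2E.
have oo x : 0 < x < 1 -> 0 <= x <= 1 by case/andP => ? ?; rewrite !ltW.
have cons1 := constraint c1 cv1 cE1 n1 (fun x _ => dz1 x) dv1 (fun x k01 => dE1 x (oo x k01))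
  (energy1_mean r hZ cv1).
have cons2 := constraint c2 cv2 cE2 n2 (fun x _ => dz2 x) dv2 (fun x k01 => dE2 x (oo x k01))
  (energy2_mean r hZ v2 cv1).
have v110 : v1 1 = v1 0 by rewrite -[in LHS](add0r 1) pv1.
have v210 : v2 1 = v2 0 by rewrite -[in LHS](add0r 1) pv2.
have zz (z : F) : periodic z 1 -> z 1 = z 0 by move=> pz; rewrite -[in LHS](add0r 1) pz.
have e110 : E1 1 = E1 0.
  have := cons1 1 I1; rewrite v110 (cons1 0 I0) (zz _ p1) => /esym/mulfI; apply.
  by rewrite sqrf_eq0 outer_neq0.
have e210 : E2 1 = E2 0.
  move: e110; rewrite /E1 /E2 /energy1 /energy2.
  rewrite !tline_tmap // !tmap0 !tmap1 // (zz _ p1) (zz _ p2).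
  have -> : levi_civita1 Z.1 1 = levi_civita1 Z.1 0.
    by have := levi_civita_periodic Z.1 0; rewrite /= add0r.
  move: (Gam1 Z v1 1) (Gam1 Z v1 0) => G G0 /addrI/addIr/addIr; rewrite !mulrDr => ->.
  by [].
exists (fun x => v1 (fpart x), fun x => v2 (fpart x)).
exists (fun x => E1 (fpart x), fun x => E2 (fpart x)).
split; first exact: hZ.
  exact: (kepler_periodize c1 p1 n1 cf pf cv1 cE1 v110 e110 (fun x _ => dz1 x) dv1
    (fun x k01 => dE1 x (oo x k01)) cons1).
exact: (kepler_periodize c2 p2 n2 cf pf cv2 cE2 v210 e210 (fun x _ => dz2 x) dv2
  (fun x k01 => dE2 x (oo x k01)) cons2).
Unshelve. all: by end_near. Qed.
End equivalence.

(** * From regularized orbits to collision orbits *)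

Section limits.
Variable R : realType.
Local Notation mu := (@lebesgue_measure R).
Local Notation F := (R -> R).
Implicit Types (f g h u v w : R -> R) (a b c d e x y s t tau : R).

(** Fatou for the squares and dominated convergence for the primitives. The velocity of [q] is
    unbounded at a collision but square integrable; it is approximated by continuous functions
    that vanish there. *)
Lemma wderiv_limit (q k : F) (kn : nat -> F) C : (forall n, continuous (kn n)) ->
  (forall t, 0 <= t <= 1 -> kn ^~ t @ \oo --> k t) ->
  (forall n t, 0 <= t <= 1 -> `|kn n t| <= `|k t|) ->
  (forall n, itg 0 1 (fun t => kn n t ^+ 2) <= C) ->
  (forall t, 0 <= t <= 1 -> (fun n => q 0 + itg 0 t (kn n)) @ \oo --> q t) ->
  is_wderiv q k.
Proof.
move=> ck lk dk bk lq.
have mD : measurable (`[(0:R), 1]%classic : set R) by exact: measurable_itv.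
have inI t : `[(0:R), 1]%classic t -> 0 <= t <= 1 by rewrite /= in_itv.
have mk : measurable_fun `[(0:R), 1]%classic k.
  apply: (@measurable_fun_cvg _ _ _ _ kn) => [n|t /inI]; last exact: lk.
  by apply: measurable_funTS; exact: continuous_measurable_fun.
have ck2 n : continuous (fun t => kn n t ^+ 2) by have := ck n => c; cont.
have mk2 n : measurable_fun `[(0:R), 1]%classic (fun t => (kn n t ^+ 2)%:E).
  apply/measurable_EFinP; apply: measurable_funTS; apply: continuous_measurable_fun.
  exact: ck2.
have Lk : L2 k.
  split=> //; apply/integrableP; split.
    by apply/measurable_EFinP; exact: measurable_funX.
  have F0 (n : nat) (t : R) : (0 <= (kn n t ^+ 2)%:E)%E by rewrite lee_fin sqr_ge0.
  have Ft := @fatou _ _ R mu _ mD (fun n t => (kn n t ^+ 2)%:E) mk2 (fun n t _ => F0 n t).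
  have E1 : (\int[mu]_(x in `[0%R, 1%R]) `|(k x ^+ 2)%:E| =
     \int[mu]_(x in `[0%R, 1%R]) limn_einf (fun n => (kn n x ^+ 2)%:E))%E.
    apply: eq_integral => t; rewrite inE => /inI t01.
    have l2 : (fun n => (kn n t ^+ 2)%:E) @ \oo --> (k t ^+ 2)%:E.
      by apply: cvg_EFin; [exact: nearW|apply: cvgM; exact: lk].
    by rewrite (cvg_limn_einf_sup l2).1 gee0_abs ?lee_fin ?sqr_ge0.
  rewrite E1; apply: le_lt_trans (ltry C); apply: (le_trans Ft).
  rewrite limn_einf_lim; apply: lime_le; first exact: is_cvg_einfs.
  apply: nearW => n; apply: (@le_trans _ _ (\int[mu]_(x in `[0%R, 1%R]) (kn n x ^+ 2)%:E)%E).
    by apply: ereal_inf_lbound; exists n => /=.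
  have := bk n; rewrite -lee_fin /Rintegral fineK //.
  by apply: integrable_fin_num => //; exact: continuous_L1.
split=> // t t01; have /andP[t0 t1] := t01.
have mt : measurable (`[(0:R), t]%classic : set R) by exact: measurable_itv.
have inT s : `[(0:R), t]%classic s -> 0 <= s <= 1.
  by rewrite /= in_itv /= => /andP[-> st]; rewrite (le_trans st).
have Lt : L1 0 t (fun x => `|k x|) by apply: L1_norm; apply: L1_01.
have cv := @dominated_cvg _ _ R mu _ mt (fun n s => (kn n s)%:E) (fun s => (k s)%:E)
  (fun s => `|k s|%:E) _ _ _ Lt _.
have {}cv : (fun n => (\int[mu]_(x in `[0%R, t]) (kn n x)%:E)%E) @ \oo -->
    (\int[mu]_(x in `[0%R, t]) (k x)%:E)%E.
  apply: cv => //.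
  - move=> n; apply/measurable_EFinP; apply: measurable_funTS.
    by apply: continuous_measurable_fun; exact: ck.
  - by move=> s /inT s01; apply: cvg_EFin; [exact: nearW|exact: lk].
  - by move=> n s /inT s01; rewrite lee_fin dk.
have fk : (\int[mu]_(x in `[0%R, t]) (k x)%:E)%E \is a fin_num.
  by apply: integrable_fin_num => //; exact: L1_01.
have cr : (fun n => q 0 + itg 0 t (kn n)) @ \oo --> q 0 + itg 0 t k.
  apply: cvgD; first exact: cvg_cst.
  have cv' : (fun n => (\int[mu]_(x in `[0%R, t]) (kn n x)%:E)%E) @ \oo --> (itg 0 t k)%:E.
    by rewrite /Rintegral fineK.
  exact: (fine_cvg cv').
by rewrite -(cvg_lim _ (lq t t01)) // (cvg_lim _ cr).
Qed.
End limits.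

Section smooth.
Variable R : realType.
Implicit Types (f g h u v w : R -> R) (a b c d e x y s t tau : R) (U : set R).

(** Iterated differentiability with the derivatives as witnesses: closure under the field
    operations is an easy induction in this form, and on an open set it implies [smooth_on]. *)
Fixpoint ndiff n U f : Prop :=
  if n is m.+1 then exists g, (forall t, U t -> der f t (g t)) /\ ndiff m U g
  else True.
Local Notation D := ndiff.

Lemma der_near U f g t l : open U -> U t -> (forall x, U x -> f x = g x) ->
  der f t l -> der g t l.
Proof.
move=> oU Ut E; apply: near_eq_is_derive; have := open_nbhs_nbhs (conj oU Ut).
by apply: filterS => x; exact: E.
Qed.

Lemma ndiff_ext n U f g : open U -> (forall x, U x -> f x = g x) ->
  D n U f -> D n U g.
Proof.
move=> oU; case: n => [//|n] E [h [fh Dh]]; exists h; split=> // t Ut.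
exact: (der_near oU Ut E (fh t Ut)).
Qed.

Lemma ndiff_le n U f : D n.+1 U f -> D n U f.
Proof. by elim: n f => [//|n IH] f [g [fg Dg]]; exists g; split=> //; exact: IH. Qed.

Lemma ndiff_cst n U c : D n U (fun=> c).
Proof.
by elim: n c => [//|n IH] c; exists (fun=> 0); split=> // t _; exact: der_cst.
Qed.

Lemma ndiffD n U f g : D n U f -> D n U g -> D n U (fun x => f x + g x).
Proof.
elim: n f g => [//|n IH] f g [f' [df Df]] [g' [dg Dg]].
exists (fun x => f' x + g' x); split; last exact: IH.
by move=> t Ut; apply: derD; [exact: df|exact: dg].
Qed.

Lemma ndiffM n U f g : D n U f -> D n U g -> D n U (fun x => f x * g x).
Proof.
elim: n f g => [//|n IH] f g Df0 Dg0; have [f' [df Df]] := Df0; have [g' [dg Dg]] := Dg0.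
exists (fun x => f' x * g x + f x * g' x); split.
  by move=> t Ut; apply: derM; [exact: df|exact: dg].
by apply: ndiffD; apply: IH => //; exact: ndiff_le.
Qed.

Lemma ndiffV n U f : (forall t, U t -> f t != 0) -> D n U f ->
  D n U (fun x => (f x)^-1).
Proof.
move=> f0; elim: n => [//|n IH] Df0; have [f' [df Df]] := Df0.
exists (fun x => (-1 * f' x) * ((f x)^-1 * (f x)^-1)); split.
  move=> t Ut; apply: (der_eq (der_recip (f0 t Ut) (df t Ut))).
  by rewrite expr2 invfM mulN1r.
have V := IH (ndiff_le Df0).
by apply: ndiffM; [apply: ndiffM => //; exact: ndiff_cst|
  exact: ndiffM].
Qed.

Lemma der_derive1 f x l : der f x l -> derive1 f x = l.
Proof. by move=> [_ <-]; rewrite derive1E. Qed.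

Lemma ndiff_smooth U f : open U -> (forall n, D n U f) -> smooth_on U f.
Proof.
move=> oU Df n t Ut; have := Df n.+1; elim: n f {Df} => [|n IH] f.
  by move=> [g [/(_ t Ut)[]]].
move=> [g [fg Dg]]; rewrite derive1Sn; apply: IH.
apply: (@ndiff_ext n.+1 U g _ oU _ Dg) => x Ux.
by rewrite (der_derive1 (fg x Ux)).
Qed.
End smooth.

Section orbit_time.
Variable R : realType.
Local Notation F := (R -> R).
Implicit Types (g h u w : R -> R) (a b c d x y t tau : R).

Lemma der_sign (f : F) x l : der f x l -> f x = 0 -> l != 0 -> exists2 d, 0 < d &
  forall y, y != x -> `|y - x| < d -> 0 < f y * l * (y - x).
Proof.
move=> [df dl] fx l0; have l2 : 0 < l ^+ 2 by rewrite exprn_even_gt0.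
have al : 0 < `|l| by rewrite normr_gt0.
have cv : (h^-1 *: ((f \o shift x) (h *: 1) - f x)) @[h --> 0^'] --> l.
  by rewrite -dl; exact: df.
clear dl df.
move/cvgrPdist_lt : cv => /(_ _ al)[d /= d0 P]; exists d => // y yx yd.
have h0 : y - x != 0 by rewrite subr_eq0.
have := P (y - x); rewrite /= sub0r normrN => /(_ yd h0).
rewrite [(y - x)%:A]mulr1 subrK fx subr0 [_ *: _]mulrC => lt.
have q0 : 0 < l * (f y / (y - x)).
  have [lp|ln] := ltP 0 l.
    move: lt; rewrite (gtr0_norm lp) => /ltr_normlP[_ lt].
    by rewrite mulr_gt0 //; move: lt; move: (f y / _) => k; lra.
  have {}ln : l < 0 by rewrite lt_neqAle l0.
  move: lt; rewrite (ltr0_norm ln) => /ltr_normlP[lt _].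
  by rewrite nmulr_rgt0 //; move: lt; move: (f y / _) => k; lra.
have -> : f y * l * (y - x) = l * (f y / (y - x)) * (y - x) ^+ 2 by field.
by rewrite mulr_gt0 // exprn_even_gt0.
Qed.

Variables (s : R) (z v e f : F).
Hypotheses (Hz : H1 z) (nz : 0 < nsq z) (o : kepler s z v e f).
Hypotheses (cf : continuous f) (pf : periodic f 1).
Local Notation N := (nsq z).
Local Notation T := (tline z).
Local Notation S := (tinv z).
Local Notation q := (levi_civita1 z).

Let cz : continuous z. Proof. exact: H1_continuous. Qed.
Let pz : periodic z 1. Proof. by case: Hz. Qed.
Let dz x : der z x (v x). Proof. by case: o. Qed.
Let dv x : der v x ((e x + s * f (T x) * z x ^+ 2) * z x / (2 * N ^+ 2)).
Proof. by case: o. Qed.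
Let cons x : 2 * N ^+ 2 * v x ^+ 2 - 2 = z x ^+ 2 * e x. Proof. by case: o. Qed.
Let pe : periodic e 1. Proof. by case: o. Qed.
Let cv : continuous v. Proof. by case: (orbit_continuous o). Qed.
Let ce : continuous e. Proof. by case: (orbit_continuous o). Qed.

(** At [z = 0] the constraint reads [N^2 v^2 = 1]: collisions are transversal in the
    regularized picture. *)
Lemma orbit_speed x : z x = 0 -> v x != 0.
Proof.
move=> z0; have := cons x; rewrite z0 expr0n mul0r; apply: contra_eqN => /eqP ->.
by rewrite expr0n mulr0 sub0r oppr_eq0 pnatr_eq0.
Qed.

Lemma orbit_sep a b : a < b -> exists2 c, a <= c <= b & z c != 0.
Proof.
move=> ab; have [z0|z0] := eqVneq (z a) 0; last by exists a => //; rewrite lexx ltW.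
have [d d0 P] := der_sign (dz a) z0 (orbit_speed z0).
pose c := a + Num.min d (b - a) / 2.
have m0 : 0 < Num.min d (b - a) by rewrite lt_min d0 subr_gt0.
have md : Num.min d (b - a) <= d by rewrite ge_min lexx.
have mb : Num.min d (b - a) <= b - a by rewrite ge_min lexx orbT.
have ca : a < c by rewrite /c; lra.
exists c; first by rewrite ltW //= /c; lra.
have := P c; rewrite gt_eqF // gtr0_norm ?subr_gt0 // => /(_ isT) H.
have /H : c - a < d by rewrite /c; lra.
by apply: contraTneq => ->; rewrite !mul0r ltxx.
Qed.

Let K1 : cancel T S. Proof. by have [] := tinvP cz pz nz orbit_sep. Qed.
Let K2 : cancel S T. Proof. by have [] := tinvP cz pz nz orbit_sep. Qed.
Let cS : continuous S. Proof. by have [] := tinvP cz pz nz orbit_sep. Qed.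
Let sS t : S (t + 1) = S t + 1. Proof. by have [] := tinvP cz pz nz orbit_sep. Qed.
Let qS t : q t = z (S t) ^+ 2. Proof. exact: levi_civita_tinv orbit_sep t. Qed.
Let cq : continuous q. Proof. exact: levi_civita_continuous. Qed.

Lemma orbit_q0 t : (q t != 0) = (z (S t) != 0).
Proof. by rewrite qS sqrf_eq0. Qed.

(** The velocity of [q] in the time [t]. *)
Definition speed t := 2 * N * v (S t) / z (S t).

Lemma orbit_q_der t : q t != 0 -> der q t (speed t).
Proof.
rewrite orbit_q0 => z0; have dS := tinv_der cz pz nz orbit_sep z0.
have := der_sq (der_comp (f := z) (g := S) (dz (S t)) dS) => d.
apply: (der_ext (f := fun y => z (S y) ^+ 2)) => //.
by apply: (der_eq d); rewrite /speed; field.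
Qed.

Lemma orbit_speed_der t : q t != 0 -> der speed t (- (2 / q t ^+ 2) + s * f t).
Proof.
rewrite orbit_q0 => z0; have dS := tinv_der cz pz nz orbit_sep z0.
have d1 := der_comp (f := v) (g := S) (dv (S t)) dS.
have d2 := der_comp (f := z) (g := S) (dz (S t)) dS.
have d3 := der_recip (f := fun t => z (S t)) z0 d2.
have := derM (derZ (2 * N) d1) d3 => d; apply: (der_eq d).
rewrite K2 qS; have := cons (S t).
move: (z (S t)) z0 (v (S t)) (e (S t)) (f t) => a a0 b c k E.
have Eb : 2 * N ^+ 2 * b ^+ 2 = a ^+ 2 * c + 2 by rewrite -E subrK.
rewrite (_ : - (2 / (a ^+ 2) ^+ 2) + s * k = (c + s * k * a ^+ 2) / a ^+ 2
   - (a ^+ 2 * c + 2) / a ^+ 4).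
  by rewrite -Eb; field; rewrite a0 gt_eqF.
by field.
Qed.

Lemma orbit_energy t : q t != 0 -> e (S t) = speed t ^+ 2 / 2 - 2 / q t.
Proof.
rewrite orbit_q0 qS /speed; have := cons (S t).
move: (z (S t)) (v (S t)) (e (S t)) => a b c E a0.
have Eb : c = (2 * N ^+ 2 * b ^+ 2 - 2) / a ^+ 2 by rewrite E mulrC mulKf // sqrf_eq0.
by rewrite Eb; field.
Qed.

Lemma orbit_energy_extends : energy_extends q.
Proof.
exists (fun t => e (S t)); split.
- exact: (cont_comp ce cS).
- by move=> t; rewrite /= sS pe.
- by move=> t q0; rewrite /energy (der_derive1 (orbit_q_der q0)) orbit_energy.
Qed.

Lemma nonzero_open : open [set t | q t != 0].
Proof.
have -> : [set t | q t != 0] = q @^-1` [set x | x != 0] by [].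
by apply: open_comp; [move=> *; exact: cq|exact: open_neq].
Qed.

Lemma orbit_derive2 t : q t != 0 -> derive1n 2 q t = - (2 / q t ^+ 2) + s * f t.
Proof.
move=> q0; rewrite /derive1n /=; apply: der_derive1.
apply: (der_near nonzero_open q0 _ (orbit_speed_der q0)) => x qx.
by rewrite (der_derive1 (orbit_q_der qx)).
Qed.

Lemma orbit_C2 : C2_on [set t | q t != 0] q.
Proof.
move=> t /= q0; have [d1 _] := orbit_q_der q0; split=> //.
  have [] // : der (derive1 q) t (- (2 / q t ^+ 2) + s * f t).
  apply: (der_near nonzero_open q0 _ (orbit_speed_der q0)) => x qx.
  by rewrite (der_derive1 (orbit_q_der qx)).
apply: (@near_continuous_eq _ (fun t => - (2 / q t ^+ 2) + s * f t)).
  have := open_nbhs_nbhs (conj nonzero_open q0); apply: filterS => x.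
  exact: orbit_derive2.
have q2 : q t ^+ 2 != 0 by rewrite sqrf_eq0.
apply: continuousD; last by apply: continuousM; [exact: cst_continuous|exact: cf].
apply: continuousN; apply: continuousM; first exact: cst_continuous.
by apply: continuousV => //; apply: (contX (n := 2) cq).
Qed.

Lemma speed_limit t (n : nat) : 2 * N * v (S t) * z (S t) / (z (S t) ^+ 2 + n.+1%:R^-1) =
  speed t * (z (S t) ^+ 2 / (z (S t) ^+ 2 + n.+1%:R^-1)).
Proof.
rewrite /speed; have [->|z0] := eqVneq (z (S t)) 0; first by rewrite invr0 expr0n !(mulr0, mul0r).
have p : z (S t) ^+ 2 + n.+1%:R^-1 != 0 by rewrite gt_eqF // ltr_wpDl ?sqr_ge0 // invr_gt0.
by move: (n.+1%:R^-1 : R) p => eps p; field; rewrite p z0.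
Qed.

Lemma regularization_error (a b V eps k : R) : 0 < k -> k < (eps / (V + 1)) ^+ 2 ->
  `|b| <= V -> 0 < eps -> `|2 * a * b - 2 * b * a * (a ^+ 2 / (a ^+ 2 + k))| <= eps.
Proof.
move=> k0 kh bV eps0; have p : 0 < a ^+ 2 + k by rewrite ltr_wpDl ?sqr_ge0.
have V1 : 0 < V + 1 by rewrite ltr_wpDl // (le_trans _ bV).
have m0 : 0 < eps / (V + 1) by rewrite divr_gt0.
have -> : 2 * a * b - 2 * b * a * (a ^+ 2 / (a ^+ 2 + k)) =
  b * (2 * a * k / (a ^+ 2 + k)) by field; rewrite gt_eqF.
rewrite normrM (_ : eps = (V + 1) * (eps / (V + 1))); last by rewrite mulrC divfK ?gt_eqF.
apply: ler_pM => //; first by apply: (le_trans bV); rewrite lerDl.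
rewrite normrM normfV (gtr0_norm p) ler_pdivrMr // !normrM ger0_norm // (gtr0_norm k0).
rewrite -[a ^+ 2]real_normK ?num_real //; move: (eps / _) (`|a|) (normr_ge0 a) m0 kh.
move=> h c c0 h0 kh; pose m := Num.sqrt k; have m0 : 0 < m by rewrite sqrtr_gt0.
have km : k = m ^+ 2 by rewrite sqr_sqrtr // ltW.
have mh : m <= h by rewrite -(ger0_norm (ltW h0)) -sqrtr_sqr ler_wsqrtr // ltW.
apply: (@le_trans _ _ (m * (c ^+ 2 + k))); last first.
  by rewrite ler_wpM2r // addr_ge0 ?sqr_ge0 // ltW.
rewrite (_ : 2 * c * k = m * (2 * c * m)); last by rewrite km; ring.
rewrite ler_wpM2l ?(ltW m0) // -subr_ge0 km.
by rewrite (_ : _ - _ = (c - m) ^+ 2) ?sqr_ge0 //; ring.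
Qed.

(** The energy bounds [q q'^2]; the square of [q'] itself is integrable in [t] because [q'^2 dt
    = 4 N v^2 d tau]. The continuous functions [2 N v z / (z^2 + 1 / n)] approximate [q'] from
    below in absolute value. *)
Lemma orbit_H1 : H1 q.
Proof.
split; first exact: levi_civita_periodic.
exists speed.
pose w (n : nat) x : R := z x ^+ 2 + n.+1%:R^-1.
have w0 n x : 0 < w n x by rewrite /w ltr_wpDl ?sqr_ge0 // invr_gt0.
have cw n : continuous (fun x => (w n x)^-1).
  by apply: contV; [move=> x; rewrite gt_eqF|rewrite /w; cont].
pose kn n t := 2 * N * v (S t) * z (S t) / w n (S t).
have ck n : continuous (kn n).
  have := cw n => c; have cwS := cont_comp c cS.
  by rewrite /kn; apply: contM; [cont|exact: cwS].
have kE n t : kn n t = speed t * (z (S t) ^+ 2 / w n (S t)) by exact: speed_limit.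
have ratio n x : 0 <= z x ^+ 2 / w n x <= 1.
  apply/andP; split; first by rewrite divr_ge0 ?sqr_ge0 ?ltW.
  by rewrite ler_pdivrMr // mul1r lerDl invr_ge0.
have [V vV] := continuous_bounded cv.
have V0 : 0 <= V by apply: le_trans (vV 0 _); rewrite ?lexx ?ler01.
apply: (@wderiv_limit _ _ _ kn (4 * N * nsq v)) => //.
- move=> t _; rewrite (_ : (fun n => kn n t) = (fun n => speed t * (z (S t) ^+ 2 / w n (S t)))).
    have [z0|z0] := eqVneq (z (S t)) 0.
      rewrite /speed z0 invr0 !mulr0; apply: cvg_near_cst; apply: nearW => n.
      by rewrite mul0r.
    rewrite -[X in _ --> X]mulr1; apply: cvgM; first exact: cvg_cst.
    rewrite -[X in _ --> X](@divff _ (z (S t) ^+ 2)) ?sqrf_eq0 //.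
    apply: cvgM; first exact: cvg_cst.
    apply: cvgV; first by rewrite sqrf_eq0.
    rewrite -[X in _ --> X]addr0; apply: cvgD; first exact: cvg_cst.
    exact: cvg_harmonic.
  by apply: funext => n; exact: kE.
- move=> n t _; rewrite kE normrM ler_piMr // ger0_norm //; by case/andP: (ratio n (S t)).
- move=> n; have ck2 : continuous (fun t => kn n t ^+ 2) by have := ck n => c; cont.
  rewrite -(substitution cz nz ck2).
  have cv2 : continuous (fun x => 4 * N * v x ^+ 2) by cont.
  rewrite /nsq /ip -/(nsq z) -itgZ; last by apply: continuous_L1; cont.
  have ct := tline_continuous cz.
  rewrite [leLHS](itg_eq (g := fun tau => z tau ^+ 2 / N * (fun t => kn n t ^+ 2) (T tau))); last first.
    by move=> x /andP[x0 _]; rewrite tline_tmap.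
  apply: itg_le.
  + by apply: continuous_L1; apply: contM; [cont|exact: (cont_comp ck2)].
  + by apply: continuous_L1; cont.
  move=> x /andP[x0 x1]; rewrite /kn K1.
  have -> : z x ^+ 2 / N * (2 * N * v x * z x / w n x) ^+ 2 =
     4 * N * (v x * v x) * (z x ^+ 2 / w n x) ^+ 2.
    by field; rewrite !gt_eqF.
  have /andP[r0 r1] := ratio n x; rewrite ler_piMr ?exprn_ile1 //.
  apply: mulr_ge0; [by rewrite mulr_ge0 // ltW|by rewrite -expr2 sqr_ge0].
- move=> t /andP[t0 t1].
  pose P n := prim (fun x => 2 * v x * z x * (z x ^+ 2 / w n x)).
  have cp n : continuous (fun x => 2 * v x * z x * (z x ^+ 2 / w n x)).
    by apply: contM; [cont|apply: contM; [cont|exact: cw]].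
  have S0 : S 0 = 0 by have := K1 0; rewrite tline0.
  have S1 : S 1 = 1 by have := K1 1; rewrite tline_tmap // tmap1.
  have S01 : 0 <= S t <= 1.
    have mS x y : x <= y -> S x <= S y.
      rewrite leNgt => xy; rewrite leNgt; apply: contra xy => /(tline_lt cz nz orbit_sep).
      by rewrite !K2.
    by apply/andP; split; [rewrite -S0|rewrite -[leRHS]S1]; exact: mS.
  have /andP[St0 St1] := S01.
  have IE n : itg 0 t (kn n) = itg 0 (S t) (fun x => 2 * v x * z x * (z x ^+ 2 / w n x)).
    rewrite [RHS]itg_prim // prim0 subr0.
    have cPS : continuous (fun x => P n (S x)) by exact: (cont_comp (prim_continuous (cp n)) cS).
    suff dP x : der (fun x => P n (S x)) x (kn n x).
      have FT := @ftc _ (kn n) (fun x => P n (S x)) 0 t t0 (ck n) cPS (fun x _ => dP x).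
      by rewrite -/(P n _) FT S0 /P prim0 add0r.
    apply: removable_der => //; first exact: ck.
    have off y : z (S y) != 0 -> der (fun x => P n (S x)) y (kn n y).
      move=> z0; have dS := tinv_der cz pz nz orbit_sep z0.
      have d := der_comp (f := P n) (g := S) (prim_der (S y) (cp n)) dS.
      by apply: (der_eq d); rewrite /kn; field; rewrite z0 gt_eqF.
    have [z0|z0] := eqVneq (z (S x)) 0.
      have [d d0 Pd] := der_sign (dz (S x)) z0 (orbit_speed z0).
      have [d' d'0 Pd'] := continuous_at_dist (@cS x) d0.
      exists d' => // y /= xy yx; apply: off; have := Pd (S y).
      rewrite (can_eq K2) distrC => /(_ yx (Pd' y xy)).
      by apply: contraTneq => ->; rewrite !mul0r ltxx.
    have := open_nbhs_nbhs (conj nonzero_open (_ : q x != 0)); rewrite orbit_q0 => /(_ z0).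
    by apply: filterS => y /=; rewrite orbit_q0 => zy _; exact: off.
  rewrite (qS t) (qS 0) S0; have -> : z (S t) ^+ 2 = z 0 ^+ 2 + itg 0 (S t) (fun x => 2 * z x * v x).
    by apply: (@ftc _ _ (fun x => z x ^+ 2)) => //; [cont|cont|move=> x _; exact: der_sq].
  apply/cvgrPdist_le => eps eps0.
  have V1 : 0 < V + 1 by lra.
  have h0 : 0 < eps / (V + 1) by rewrite divr_gt0.
  have /cvgrPdist_lt/(_ _ (exprn_gt0 2 h0)) := @cvg_harmonic R.
  apply: filterS => n; rewrite sub0r normrN ger0_norm ?invr_ge0 // => hn.
  rewrite IE opprD addrACA subrr add0r -itgB; last exact: continuous_L1; last first.
    by apply: continuous_L1; cont.
  have cd : continuous (fun x => 2 * z x * v x - 2 * v x * z x * (z x ^+ 2 / w n x)).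
    by apply: contD; [cont|exact: contN].
  apply: (@le_trans _ _ (eps * (S t - 0))); last by rewrite subr0 ler_piMr // ltW.
  apply: norm_itg_le => //; first exact: continuous_L1.
  move=> x /andP[x0 xt].
  have vx : `|v x| <= V by apply: vV; rewrite x0 (le_trans xt).
  by apply: regularization_error hn vx eps0; rewrite invr_gt0.
Qed.
End orbit_time.

(** * Sign changes of periodic functions *)

Section sign_pattern.
Variable R : realType.
Local Notation F := (R -> R).
Implicit Types (f g h u v w : R -> R) (a b c d e l m x y t : R) (X : seq R).

Lemma sin_pi_eq0 y : (sin (pi * y) == 0) = (fpart y == 0).
Proof.
have sh x : sin (pi * (x + 1)) = - sin (pi * x) by rewrite mulrDr mulr1 sinDpi.
have pg : periodic (fun x => sin (pi * x) ^+ 2) 1 by move=> x; rewrite /= sh sqrrN.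
rewrite -sqrf_eq0 -(periodic_fpart y pg) sqrf_eq0.
have := fpart_ge0 y; rewrite le_eqVlt => /predU1P[<-|f0]; first by rewrite mulr0 sin0 !eqxx.
rewrite !gt_eqF // sin_gt0_pi // mulr_gt0 ?pi_gt0 //= -[ltRHS]mulr1 ltr_pM2l ?pi_gt0 //.
exact: fpart_lt1.
Qed.

(** Vanishes exactly at the points of [X + Z]. Under the translation by 1 each factor changes
    its sign, so the parity of [size X] decides whether the product is periodic. *)
Definition alternator X t := \prod_(x <- X) sin (pi * (t - x)).

Lemma alternator_cons x X t : alternator (x :: X) t = sin (pi * (t - x)) * alternator X t.
Proof. by rewrite /alternator big_cons. Qed.

Lemma alternator_shift X t : alternator X (t + 1) = (-1) ^+ size X * alternator X t.
Proof.
elim: X => [|x X IH]; first by rewrite /alternator !big_nil mulr1.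
rewrite !alternator_cons IH exprS addrAC mulrDr mulr1 sinDpi; ring.
Qed.

Lemma fpart_int (n : int) x : fpart (x + n%:~R) = fpart x.
Proof. exact: (periodic_int n x (@fpartD1 R)). Qed.

Lemma fpart_sub x t : 0 <= x < 1 -> (fpart (t - x) == 0) = (fpart t == x).
Proof.
move=> x01; apply/eqP/eqP => [E|<-]; last first.
  have -> : t - fpart t = 0 + (Num.floor t)%:~R by rewrite /fpart; ring.
  by rewrite fpart_int; apply: fpart_id; rewrite lexx ltr01.
have -> : t = x + (Num.floor (t - x))%:~R by move/eqP: E; rewrite subr_eq0 => /eqP <-; ring.
by rewrite fpart_int fpart_id.
Qed.

Lemma alternator_eq0 X t : (forall x, x \in X -> 0 <= x < 1) ->
  (alternator X t == 0) = (fpart t \in X).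
Proof.
elim: X => [|x X IH] X01; first by rewrite /alternator big_nil oner_eq0.
rewrite alternator_cons mulf_eq0 sin_pi_eq0 fpart_sub ?X01 ?mem_head // inE IH //.
by move=> y yX; apply: X01; rewrite inE yX orbT.
Qed.

Lemma sin_shift_der x t : der (fun t => sin (pi * (t - x))) t (cos (pi * (t - x)) * pi).
Proof.
have d1 : der (fun t => pi * (t - x)) t pi.
  apply: (der_eq (derZ pi (derB (is_derive_id t 1) (der_cst x t)))).
  by rewrite subr0 mulr1.
exact: (der_comp (f := sin) (g := fun t => pi * (t - x)) (is_derive_sin _) d1).
Qed.

Lemma alternator_der X t : exists l, der (alternator X) t l.
Proof.
elim: X => [|x X [l IH]].
  by exists 0; apply: (der_ext (f := fun=> 1)) (der_cst _ _) => y; rewrite /alternator big_nil.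
exists (cos (pi * (t - x)) * pi * alternator X t + sin (pi * (t - x)) * l).
apply: (der_ext (f := fun y => sin (pi * (y - x)) * alternator X y)).
  by move=> y; rewrite alternator_cons.
exact: (derM (sin_shift_der x t) IH).
Qed.

Lemma alternator_continuous X : continuous (alternator X).
Proof. by move=> t; have [l] := alternator_der X t; exact: derivable_continuous. Qed.

Definition simple_zeros f := forall x, f x = 0 -> exists2 l, l != 0 & der f x l.

Lemma alternator_simple X : uniq X -> (forall x, x \in X -> 0 <= x < 1) ->
  simple_zeros (alternator X).
Proof.
move=> uX X01 t /eqP; rewrite alternator_eq0 // => tX.
have E y : alternator X y = sin (pi * (y - fpart t)) * alternator (rem (fpart t) X) y.
  by rewrite /alternator (big_rem _ tX).
have [l dl] := alternator_der (rem (fpart t) X) t.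
have s0 : sin (pi * (t - fpart t)) = 0.
  by apply/eqP; rewrite sin_pi_eq0 fpart_sub ?X01.
have A0 : alternator (rem (fpart t) X) t != 0.
  rewrite alternator_eq0; first by rewrite mem_rem_uniq // inE eqxx.
  by move=> x /mem_rem; exact: X01.
exists (cos (pi * (t - fpart t)) * pi * alternator (rem (fpart t) X) t).
  have pi0 : pi != 0 :> R by rewrite gt_eqF // pi_gt0.
  rewrite !mulf_neq0 //; apply/eqP => c0.
  have /eqP := cos2Dsin2 (pi * (t - fpart t)).
  by rewrite c0 s0 expr0n addr0 eq_sym oner_eq0.
apply: (der_ext E); apply: (der_eq (derM (sin_shift_der (fpart t) t) dl)).
by rewrite s0 mul0r addr0.
Qed.

Lemma locally_constant (c : F) :
  (forall x, exists2 d, 0 < d & forall y, `|y - x| < d -> c y = c x) -> forall x y, c x = c y.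
Proof.
move=> lc; apply: cst_of_der0R => x; have [d d0 P] := lc x.
apply: (@near_eq_is_derive _ _ _ (fun=> c x)).
by exists d => // y /= xy; rewrite P // distrC.
Qed.

Lemma simple_isolated f x : simple_zeros f -> f x = 0 -> exists2 d, 0 < d &
  forall y, y != x -> `|y - x| < d -> f y != 0.
Proof.
move=> sf fx; have [l l0 dl] := sf x fx; have [d d0 P] := der_sign dl fx l0.
exists d => // y yx yd; have := P y yx yd; apply: contraTneq => ->.
by rewrite !mul0r ltxx.
Qed.

Lemma sg_eq a b : 0 < a * b -> Num.sg a = Num.sg b.
Proof.
have [p|n|<-] := ltgtP 0 a; last by rewrite mul0r ltxx.
  by rewrite pmulr_rgt0 // => q; rewrite !gtr0_sg.
by rewrite nmulr_rgt0 // => q; rewrite !ltr0_sg.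
Qed.

(** At a common simple zero both functions change sign, so the sign of the product, completed
    at the zeros by the sign of the product of the derivatives, is locally constant. *)
Lemma sign_constant f g : continuous f -> continuous g -> simple_zeros f -> simple_zeros g ->
  (forall x, f x = 0 <-> g x = 0) ->
  forall x y, f x != 0 -> f y != 0 -> Num.sg (f x * g x) = Num.sg (f y * g y).
Proof.
move=> cf cg sf sg fg.
pose c x := if f x == 0 then Num.sg (derive1 f x * derive1 g x) else Num.sg (f x * g x).
suff lc : forall x y, c x = c y.
  by move=> x y fx fy; have := lc x y; rewrite /c (negbTE fx) (negbTE fy).
apply: locally_constant => x; rewrite /c; have [fx|fx] := eqVneq (f x) 0.
  have gx : g x = 0 by exact/fg.
  have [l l0 dl] := sf x fx; have [m m0 dm] := sg x gx.
  have [d1 d10 P1] := der_sign dl fx l0; have [d2 d20 P2] := der_sign dm gx m0.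
  exists (Num.min d1 d2); first by rewrite lt_min d10.
  move=> y; rewrite lt_min => /andP[y1 y2]; rewrite (der_derive1 dl) (der_derive1 dm).
  have [yx|yx] := eqVneq y x.
    by rewrite yx fx eqxx (der_derive1 dl) (der_derive1 dm).
  have p1 := P1 y yx y1; have p2 := P2 y yx y2.
  have -> : (f y == 0) = false by apply: contraTF p1 => /eqP ->; rewrite !mul0r ltxx.
  have yx0 : y - x != 0 by rewrite subr_eq0.
  have : 0 < (f y * g y) * (l * m).
    have := mulr_gt0 p1 p2; rewrite (_ : f y * l * (y - x) * (g y * m * (y - x)) =
      (f y * g y) * (l * m) * (y - x) ^+ 2); last by ring.
    by rewrite pmulr_lgt0 // exprn_even_gt0.
  exact: sg_eq.
have gx : g x != 0 by apply: contra_neq fx => /fg.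
have cfg : continuous (fun y => f y * g y) by cont.
have fg0 : 0 < `|f x * g x| by rewrite normr_gt0 mulf_neq0.
have [d d0 P] := continuous_at_dist (@cfg x) fg0; exists d => // y yx.
have := P y; rewrite distrC => /(_ yx) lt.
have : 0 < (f y * g y) * (f x * g x).
  have [p|n|E] := ltgtP 0 (f x * g x).
  - by move: lt; rewrite (gtr0_norm p) => /ltr_normlP[_ lt]; rewrite mulr_gt0 //; lra.
  - by move: lt; rewrite (ltr0_norm n) => /ltr_normlP[lt _]; rewrite nmulr_lgt0 //; lra.
  - by move: fg0; rewrite -E normr0 ltxx.
move=> fgfg; have -> : (f y == 0) = false.
  by apply: contraTF fgfg => /eqP ->; rewrite !mul0r ltxx.
exact: sg_eq.
Qed.

(** Isolated zeros of a continuous function: a compact period is covered by finitely many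
    intervals with at most one zero each. *)
Lemma finite_zeros f : (forall x, f x = 0 -> exists2 d, 0 < d &
  forall y, y != x -> `|y - x| < d -> f y != 0) -> continuous f -> finite_set (zeros f).
Proof.
move=> iso cf.
have ex x : exists d, 0 < d /\ forall y, y != x -> `|y - x| < d -> f y != 0.
  have [fx|fx] := eqVneq (f x) 0; first by have [d d0 P] := iso x fx; exists d.
  have n0 : 0 < `|f x| by rewrite normr_gt0.
  have [d d0 P] := continuous_at_dist (@cf x) n0; exists d; split=> // y _ yx.
  have := P y; rewrite distrC => /(_ yx); apply: contraTneq => ->.
  by rewrite subr0 ltxx.
have [d dP] := choice ex.
have cK : cover_compact `[(0:R), 1]%classic.
  by have := @segment_compact R 0 1; rewrite compact_cover.
have [|x|D _ cD] := cK R setT (fun x => ball x (d x)).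
- by move=> x _; exact: ball_open.
- by move=> _; exists x => //; apply: ballxx; case: (dP x).
apply: (sub_finite_set _ (finite_fset D)) => t [/andP[t0 t1] ft].
have [|x xD /= tx] := cD t; first by rewrite /= in_itv /= t0 ltW.
have [_ P] := dP x; have [->//|tx'] := eqVneq t x.
have := P t tx'; rewrite ft eqxx => H; exfalso.
by have := H _; rewrite -(distrC x) => /(_ tx).
Qed.

(** Compare [f], which is periodic, with the alternator of its zeros: their product has
    constant sign, so the alternator keeps its sign under the translation by 1. *)
Lemma simple_even_zeros f : continuous f -> periodic f 1 -> simple_zeros f -> even_zeros f.
Proof.
move=> cf pf sf; have fin := finite_zeros (fun x => @simple_isolated f x sf) cf.
have [X XE] := finite_fsetP.1 fin; exists (half (size (finmap.enum_fset X))).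
suff ev : ~~ odd (size (finmap.enum_fset X)).
  rewrite XE; apply/card_eq_fsetP.
  by rewrite -[LHS]odd_double_half (negbTE ev) add0n.
have X01 x : x \in (finmap.enum_fset X) -> 0 <= x < 1.
  by move=> xX; have [] : zeros f x by rewrite XE.
have zE x : f x = 0 <-> alternator (finmap.enum_fset X) x = 0.
  have -> : alternator (finmap.enum_fset X) x = 0 <-> fpart x \in (finmap.enum_fset X).
    by rewrite -alternator_eq0 //; split => /eqP.
  have -> : fpart x \in (finmap.enum_fset X) <-> zeros f (fpart x) by rewrite XE.
  rewrite /zeros /= periodic_fpart // fpart_ge0 fpart_lt1.
  by split=> [->|[]].
have sa := alternator_simple (finmap.fset_uniq X) X01.
have ca := @alternator_continuous (finmap.enum_fset X).
have [t ft] : exists t, f t != 0.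
  have [f0|] := eqVneq (f 0) 0; last by exists 0.
  have [d d0 P] := simple_isolated sf f0; exists (d / 2); apply: P.
    by rewrite gt_eqF // divr_gt0.
  by rewrite subr0 gtr0_norm ?divr_gt0 //; lra.
have ft1 : f (t + 1) != 0 by rewrite pf.
have := sign_constant cf ca sf sa zE ft ft1; rewrite pf alternator_shift.
have p0 : f t * alternator (finmap.enum_fset X) t != 0.
  by rewrite mulf_neq0 //; apply: contra_neq ft => /zE.
rewrite mulrCA -signr_odd; case: odd => //; rewrite expr1 mulN1r sgrN => /eqP.
by rewrite -subr_eq0 opprK -mulr2n mulrn_eq0 /= sgr_eq0 (negbTE p0).
Qed.
End sign_pattern.

Section generalized.
Variable R : realType.
Local Notation F := (R -> R).
Local Notation F2 := (F * F)%type.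
Implicit Types (Z v e q : F2) (t : R).

(** The zeros of [q] correspond under the time map to those of [z], which are simple. *)
Lemma kepler_even_zeros (s : R) (z v e f : F) : H1 z -> 0 < nsq z ->
  kepler s z v e f -> even_zeros (levi_civita1 z).
Proof.
move=> Hz nz o; have cz := H1_continuous Hz; have pz := Hz.1.
have sz : simple_zeros z.
  by move=> x zx; exists (v x); [exact: (orbit_speed o)|case: o].
have [n nE] := simple_even_zeros cz pz sz; exists n; apply: card_eq_trans nE.
have sep := orbit_sep o.
have [K1 K2 _ _] := tinvP cz pz nz sep.
have -> : zeros (levi_civita1 z) = tline z @` zeros z.
  apply/seteqP; split=> t /=.
    move=> [/andP[t0 t1] q0]; exists (tinv z t); last exact: K2.
    have lt x y : (tline z x < tline z y) = (x < y).
      apply/idP/idP => [|/(tline_lt cz nz sep)//]; rewrite !ltNge; apply: contra.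
      by rewrite le_eqVlt => /predU1P[->//|/(tline_lt cz nz sep)/ltW].
    split; last first.
      by apply/eqP; rewrite -sqrf_eq0 -(levi_civita_tinv cz pz nz sep) q0.
    rewrite -lt K2 tline_tmap // tmap1 // t1 andbT leNgt -lt K2 tline_tmap // tmap0.
    by rewrite -leNgt.
  move=> [x [/andP[x0 x1] zx] <-]; split; last first.
    by rewrite levi_civita_tline // zx expr0n.
  have := tline_lt cz nz sep x1; rewrite [in ltRHS]tline_tmap // tmap1 // => ->.
  by have /andP[-> _] : 0 <= tline z x <= 1 by apply: tline01 => //; rewrite x0 ltW.
apply: inj_card_eq => x y _ _; exact: (can_inj K1).
Qed.

(** Smoothness off all collisions is a bootstrap: the velocities and accelerations are rational
    expressions in the positions and velocities with denominators that do not vanish there. *)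
Lemma regular_generalized (r : R) Z v e : regular r Z v e ->
  generalized_solution r (levi_civita Z).
Proof.
move=> [hZ o1 o2]; have [[z1 z2] _ _ _] := hZ.
have [c1 c2 n1 n2 _] := H1in_apart hZ; have [p1 p2] := (z1.1, z2.1).
have cf := repulsion_continuous (r:=r) hZ.
set q1 := levi_civita1 Z.1; set q2 := levi_civita1 Z.2.
have gap t : q1 t - q2 t != 0 by exact: levi_civita_gap.
split.
- by split; [split; [exact: orbit_H1 o1|exact: orbit_H1 o2]|move=> t; rewrite !sqr_ge0].
- by move=> t; exact: levi_civita_apart.
- by split; [exact: kepler_even_zeros o1|exact: kepler_even_zeros o2].
- set U := [set t | q1 t != 0 /\ q2 t != 0].
  have oU : open U.
    have -> : U = [set t | q1 t != 0] `&` [set t | q2 t != 0] by [].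
    by apply: openI; exact: nonzero_open.
  pose k := (1 - r) / (avg q1 - avg q2) ^+ 2.
  have sm n : [/\ ndiff n U q1, ndiff n U q2,
      ndiff n U (speed Z.1 v.1) & ndiff n U (speed Z.2 v.2)].
    elim: n => [//|n [D1 D2 S1 S2]].
    have Dm (g : F) : ndiff n U g -> ndiff n U (fun t => -1 * g t).
      by move=> Dg; apply: ndiffM => //; exact: ndiff_cst.
    have Dd : ndiff n U (fun t => q1 t + -1 * q2 t).
      by apply: ndiffD => //; exact: Dm.
    have Di : ndiff n U (fun t => (q1 t + -1 * q2 t)^-1).
      by apply: ndiffV => // t _; rewrite mulN1r.
    have Df (s : R) : ndiff n U
        (fun t => s * (r * ((q1 t + -1 * q2 t)^-1 * (q1 t + -1 * q2 t)^-1) + k)).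
      apply: ndiffM; first exact: ndiff_cst.
      apply: ndiffD; last exact: ndiff_cst.
      by apply: ndiffM; [exact: ndiff_cst|exact: ndiffM].
    have Dv (q : F) : (forall t, U t -> q t != 0) -> ndiff n U q ->
        ndiff n U (fun t => -2 * ((q t)^-1 * (q t)^-1)).
      move=> q0 Dq; have V := ndiffV q0 Dq.
      by apply: ndiffM; [exact: ndiff_cst|exact: ndiffM].
    split.
    - by exists (speed Z.1 v.1); split=> // t [t1 _]; exact: (orbit_q_der _ _ o1).
    - by exists (speed Z.2 v.2); split=> // t [_ t2]; exact: (orbit_q_der _ _ o2).
    - exists (fun t => -2 * ((q1 t)^-1 * (q1 t)^-1)
         + 1 * (r * ((q1 t + -1 * q2 t)^-1 * (q1 t + -1 * q2 t)^-1) + k)); split.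
        move=> t [t1 _]; apply: (der_eq (orbit_speed_der z1 n1 o1 t1)).
        rewrite /repulsion /= -/q1 -/q2 -/k; have g0 := gap t.
        by rewrite mulN1r; field; rewrite t1 g0.
      by apply: ndiffD => //; apply: Dv => // t [].
    - exists (fun t => -2 * ((q2 t)^-1 * (q2 t)^-1)
         + -1 * (r * ((q1 t + -1 * q2 t)^-1 * (q1 t + -1 * q2 t)^-1) + k)); split.
        move=> t [_ t2]; apply: (der_eq (orbit_speed_der z2 n2 o2 t2)).
        rewrite /repulsion /= -/q1 -/q2 -/k; have g0 := gap t.
        by rewrite !mulN1r; field; rewrite t2 g0.
      by apply: ndiffD => //; apply: Dv => // t [].
  split.
  + exact: (orbit_C2 z1 n1 o1 cf).
  + exact: (orbit_C2 z2 n2 o2 cf).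
  + by apply: ndiff_smooth => // n; case: (sm n).
  + by apply: ndiff_smooth => // n; case: (sm n).
  + split=> t t0.
      rewrite (orbit_derive2 z1 n1 o1) // /repulsion /= mul1r addrA.
      by [].
    rewrite (orbit_derive2 z2 n2 o2) // /repulsion /= mulN1r opprD addrA.
    by [].
- by split; [exact: orbit_energy_extends o1|exact: orbit_energy_extends o2].
Qed.
End generalized.

(** * From collision orbits to regularized orbits *)

Section increasing.
Variable R : realType.
Implicit Types (f g : R -> R) (x y : R).

(** The maximum of [f] over [[x, y]] can only be attained at [y]. *)
Lemma increasing_of_local f : continuous f -> (forall x, exists2 d, 0 < d &
    forall y, y != x -> `|y - x| < d -> 0 < (f y - f x) * (y - x)) ->
  forall x y, x < y -> f x < f y.
Proof.
move=> cf loc.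
have weak x y : x <= y -> f x <= f y.
  move=> xy; have [c] := EVT_max xy (continuous_subspaceT cf).
  rewrite in_itv /= => /andP[xc cy] P; move: cy; rewrite le_eqVlt => /predU1P[<-|cy].
    by apply: P; rewrite in_itv /= lexx xy.
  have [d d0 L] := loc c; pose u := c + Num.min d (y - c) / 2.
  have m0 : 0 < Num.min d (y - c) by rewrite lt_min d0 subr_gt0.
  have md : Num.min d (y - c) <= d by rewrite ge_min lexx.
  have my : Num.min d (y - c) <= y - c by rewrite ge_min lexx orbT.
  have cu : c < u by rewrite /u; lra.
  have uy : u <= y by rewrite /u; lra.
  have := L u; rewrite gt_eqF // gtr0_norm ?subr_gt0 // => /(_ isT) Lu.
  have : 0 < (f u - f c) * (u - c) by apply: Lu; rewrite /u; lra.
  rewrite pmulr_lgt0 ?subr_gt0 // ltNge P //.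
  by rewrite in_itv /= uy (le_trans xc) // ltW.
move=> x y xy; have [d d0 L] := loc x; pose u := x + Num.min d (y - x) / 2.
have m0 : 0 < Num.min d (y - x) by rewrite lt_min d0 subr_gt0.
have md : Num.min d (y - x) <= d by rewrite ge_min lexx.
have my : Num.min d (y - x) <= y - x by rewrite ge_min lexx orbT.
have xu : x < u by rewrite /u; lra.
have uy : u <= y by rewrite /u; lra.
have := L u; rewrite gt_eqF // gtr0_norm ?subr_gt0 // => /(_ isT) Lu.
have : 0 < (f u - f x) * (u - x) by apply: Lu; rewrite /u; lra.
rewrite pmulr_lgt0 ?subr_gt0 // => fxu; exact: lt_le_trans (weak _ _ uy).
Qed.

Lemma mvt_punctured f g x d y : continuous f ->
  (forall c, c != x -> `|c - x| < d -> der f c (g c)) -> y != x -> `|y - x| < d ->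
  exists c, [/\ c != x, `|c - x| < d & f y - f x = g c * (y - x)].
Proof.
move=> cf df yx yd; have [xy|xy|E] := ltgtP x y; last by rewrite E eqxx in yx.
  have sub c : c \in `]x, y[ -> c != x /\ `|c - x| < d.
    rewrite in_itv /= => /andP[xc cy]; rewrite gt_eqF //; split=> //.
    by move: yd; rewrite !gtr0_norm ?subr_gt0 //; lra.
  have [|c cI E] := MVT (df := g) xy _ (continuous_subspaceT cf).
    by move=> c /sub[? ?]; exact: df.
  by exists c; have [] := sub c cI.
have sub c : c \in `]y, x[ -> c != x /\ `|c - x| < d.
  rewrite in_itv /= => /andP[yc cx]; rewrite lt_eqF //; split=> //.
  by move: yd; rewrite !ltr0_norm ?subr_lt0 //; lra.
have [|c cI E] := MVT (df := g) xy _ (continuous_subspaceT cf).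
  by move=> c /sub[? ?]; exact: df.
exists c; have [? ?] := sub c cI; split=> //.
by rewrite -opprB E; ring.
Qed.

Lemma sg_near g x : {for x, continuous g} -> g x != 0 ->
  \forall y \near x, Num.sg (g y) = Num.sg (g x).
Proof.
move=> cg gx; have n0 : 0 < `|g x| by rewrite normr_gt0.
have [d d0 P] := continuous_at_dist cg n0; exists d => // y /= /P lt.
apply: sg_eq; have [p|n|E] := ltgtP 0 (g x); last by rewrite -E eqxx in gx.
  by move: lt; rewrite (gtr0_norm p) => /ltr_normlP[_ lt]; rewrite mulr_gt0 //; lra.
by move: lt; rewrite (ltr0_norm n) => /ltr_normlP[lt _]; rewrite nmulr_lgt0 //; lra.
Qed.
End increasing.

Section inverse.
Variable R : realType.
Local Notation F := (R -> R).
Implicit Types (x y t tau : R).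
Variables (s : R) (q w f e : F) (X : seq R).
Hypotheses (cq : continuous q) (pq : periodic q 1) (q0 : forall t, 0 <= q t).
Hypotheses (cf : continuous f) (pf : periodic f 1) (ce : continuous e) (pe : periodic e 1).
Hypothesis dq : forall t, q t != 0 -> der q t (w t).
Hypothesis dw : forall t, q t != 0 -> der w t (- (2 / q t ^+ 2) + s * f t).
Hypothesis en : forall t, q t != 0 -> e t = w t ^+ 2 / 2 - 2 / q t.
Hypotheses (uX : uniq X) (X01 : forall x, x \in X -> 0 <= x < 1) (eX : ~~ odd (size X)).
Hypothesis qX : forall t, q t = 0 <-> alternator X t = 0.

Local Notation al := (alternator X).

Let sX : simple_zeros al. Proof. exact: alternator_simple. Qed.
Let cX : continuous al. Proof. exact: alternator_continuous. Qed.
Let pX : periodic al 1.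
Proof.
by move=> t; rewrite /= alternator_shift -signr_odd (negbTE eX) mul1r.
Qed.
Let qgt t : q t != 0 -> 0 < q t. Proof. by move=> qt; rewrite lt_neqAle eq_sym qt q0. Qed.
Let al0 t : q t != 0 -> al t != 0.
Proof. by apply: contra_neq => /qX. Qed.

Lemma q_isolated x : exists2 d, 0 < d & forall y, y != x -> `|y - x| < d -> q y != 0.
Proof.
have [qx|qx] := eqVneq (q x) 0.
  have [d d0 P] := simple_isolated sX ((qX x).1 qx); exists d => // y yx yd.
  by apply: contra_neq (P y yx yd) => /qX.
have n0 : 0 < `|q x| by rewrite normr_gt0.
have [d d0 P] := continuous_at_dist (@cq x) n0; exists d => // y _ yx.
have := P y; rewrite distrC => /(_ yx); apply: contraTneq => ->.
by rewrite subr0 ltxx.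
Qed.

(** The product [q q'], continued by 0: its square [2 e q^2 + 4 q] shows that it is continuous
    at collisions, where [q'] is not bounded. *)
Let moment t := if q t == 0 then 0 else q t * w t.

Let momentE t : q t != 0 -> moment t = q t * w t.
Proof. by rewrite /moment => /negbTE ->. Qed.

Let moment_sq t : moment t ^+ 2 = 2 * e t * q t ^+ 2 + 4 * q t.
Proof.
rewrite /moment; have [->|qt] := eqVneq (q t) 0; first by rewrite expr0n !mulr0 addr0.
by rewrite en //; field.
Qed.

Let near_q t : q t != 0 -> \forall y \near t, q y != 0.
Proof.
move=> qt; have oq : open (q @^-1` [set x | x != 0]).
  by apply: open_comp; [move=> *; exact: cq|exact: open_neq].
exact: (open_nbhs_nbhs (conj oq qt)).
Qed.

Let moment_continuous : continuous moment.
Proof.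
move=> t; have [qt|qt] := eqVneq (q t) 0; last first.
  apply: (@near_continuous_eq _ (fun y => q y * w y)).
    by apply: filterS (near_q qt) => y; exact: momentE.
  by apply: continuousM; [exact: cq|exact: derivable_continuous (dw qt)].
have ck : continuous (fun y => Num.sqrt (2 * e y * q y ^+ 2 + 4 * q y)).
  by apply: (@cont_comp _ Num.sqrt); [exact: sqrt_continuous|cont].
have E y : `|moment y| = Num.sqrt (2 * e y * q y ^+ 2 + 4 * q y).
  by rewrite -moment_sq sqrtr_sqr.
have m0 : moment t = 0 by rewrite /moment qt eqxx.
apply: continuous_atP => eps eps0; have [d d0 P] := continuous_at_dist (@ck t) eps0.
exists d => // y /P; rewrite -!E m0 normr0 !sub0r !normrN normr_id; exact: ltW.
Qed.

Let moment_der t : q t != 0 -> der moment t (w t ^+ 2 + (- (2 / q t) + s * f t * q t)).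
Proof.
move=> qt; apply: (@near_eq_is_derive _ _ _ (fun y => q y * w y)).
  by apply: filterS (near_q qt) => y /momentE.
by apply: (der_eq (derM (dq qt) (dw qt))); field.
Qed.

Let moment_periodic : periodic moment 1.
Proof.
move=> t; rewrite /moment pq; case: eqVneq => // qt; congr (_ * _).
have qt1 : q (t + 1) != 0 by rewrite pq.
apply: (der_uniq (der_shift (dq qt1))).
by apply: (der_ext (f := q)) (dq qt) => y; rewrite pq.
Qed.

(** The regularized time up to scale. *)
Let T t := moment t / 2 - prim (fun t => e t + s * f t * q t / 2) t.

Let cI : continuous (fun t => e t + s * f t * q t / 2). Proof. by cont. Qed.

Let T_continuous : continuous T.
Proof. by have cp := prim_continuous cI; have cm := moment_continuous; rewrite /T; cont. Qed.

Let T_der t : q t != 0 -> der T t (q t)^-1.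
Proof.
move=> qt; have d := derB (derM (moment_der qt) (der_cst 2^-1 t)) (prim_der t cI).
by apply: (der_eq d); rewrite en //; field.
Qed.

Let T_lt x y : x < y -> T x < T y.
Proof.
apply: increasing_of_local => // {}x; have [d d0 P] := q_isolated x; exists d => // {}y yx yd.
have [|c [cx cd ->]] := mvt_punctured (g := fun t => (q t)^-1) (d := d) T_continuous _ yx yd.
  by move=> c cx cd; apply: T_der; exact: P.
rewrite -mulrA mulr_gt0 ?invr_gt0 ?qgt ?P // -expr2 exprn_even_gt0 //=.
by rewrite subr_eq0.
Qed.

Let kappa := T 1 - T 0.

Let kappa_gt0 : 0 < kappa. Proof. by rewrite subr_gt0 T_lt. Qed.

Let T_shift t : T (t + 1) = T t + kappa.
Proof.
have pI : periodic (fun t => e t + s * f t * q t / 2) 1 by move=> x; rewrite /= pe pf pq.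
have E x : T (x + 1) = T x - itg 0 1 (fun t => e t + s * f t * q t / 2).
  by rewrite /T moment_periodic prim_shift //; ring.
by rewrite E /kappa -[in T 1](add0r 1) E; ring.
Qed.

Let clock_ex : exists th : F, [/\ continuous th, injective th, th 0 = 0,
  forall x, th (x + 1) = th x + 1 & forall x, q (th x) != 0 -> der th x (kappa * q (th x))].
Proof.
pose U t := (T t - T 0) / kappa.
have k0 : kappa != 0 by rewrite gt_eqF.
have cU : continuous U by have cT := T_continuous; rewrite /U; cont.
have mU x y : x < y -> U x < U y.
  by move=> xy; rewrite /U ltr_pM2r ?invr_gt0 // ltrD2r T_lt.
have sU x : U (x + 1) = U x + 1 by rewrite /U T_shift; field.
have [th [K1 K2 cth _ sth]] := circle_homeo cU mU sU; exists th; split=> //.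
- exact: (can_inj K2).
- by rewrite -{1}(_ : U 0 = 0) ?K1 // /U subrr mul0r.
move=> x qx; suff : der th (U (th x)) (kappa * q (th x)) by rewrite K2.
have -> : kappa * q (th x) = ((q (th x))^-1 / kappa)^-1 by rewrite invfM !invrK mulrC.
apply: is_derive_inverse.
- by near=> y; exact: K1.
- by near=> y; exact: cU.
- apply: (der_eq (derM (derB (T_der qx) (der_cst (T 0) _)) (der_cst kappa^-1 _))).
  by rewrite subr0 mulr0 addr0.
- by rewrite mulf_neq0 ?invr_eq0.
Unshelve. all: by end_near. Qed.

(** The square root of [q] with alternating sign. Half of [kappa b] is its derivative in the
    regularized time, continued through the collisions by the sign of the slope of the
    alternator. *)
Let a t := Num.sg (al t) * Num.sqrt (q t).
Let b t := if q t == 0 then 2 * Num.sg (derive1 al t) else Num.sg (al t) * (w t * Num.sqrt (q t)).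

Let sg_sq t : q t != 0 -> Num.sg (al t) * Num.sg (al t) = 1.
Proof. by move=> qt; rewrite -expr2 sqr_sg al0. Qed.

Let a_sq t : a t ^+ 2 = q t.
Proof.
rewrite /a; have [->|qt] := eqVneq (q t) 0; first by rewrite sqrtr0 mulr0 expr0n.
by rewrite exprMn sqr_sqrtr // expr2 sg_sq // mul1r.
Qed.

Let ab t : q t != 0 -> a t * b t = q t * w t.
Proof.
move=> qt; rewrite /a /b (negbTE qt) -[in RHS](sqr_sqrtr (q0 t)).
rewrite (_ : _ * _ = (Num.sg (al t) * Num.sg (al t)) * (Num.sqrt (q t) ^+ 2 * w t)); last by ring.
by rewrite sg_sq // mul1r.
Qed.

Let b_sq t : b t ^+ 2 = 2 * e t * q t + 4.
Proof.
rewrite /b; have [qt|qt] := eqVneq (q t) 0.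
  rewrite qt mulr0 add0r exprMn; have [l l0 dl] := sX ((qX t).1 qt).
  by rewrite (der_derive1 dl) sqr_sg l0 mulr1 -natrX.
rewrite !exprMn expr2 sg_sq // mul1r sqr_sqrtr // en //; by field.
Qed.

Let a_continuous : continuous a.
Proof.
have csq : continuous (fun y => Num.sqrt (q y)).
  by apply: (@cont_comp _ Num.sqrt) => //; exact: sqrt_continuous.
move=> t; have [qt|qt] := eqVneq (q t) 0; last first.
  apply: (@near_continuous_eq _ (fun y => Num.sg (al t) * Num.sqrt (q y))).
    by apply: filterS (sg_near (@cX t) (al0 qt)) => y E; rewrite /a E.
  by apply: continuousM; [exact: cst_continuous|exact: csq].
have E y : `|a y| = Num.sqrt (q y) by rewrite -a_sq sqrtr_sqr.
have a0 : a t = 0 by rewrite /a qt sqrtr0 mulr0.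
apply: continuous_atP => eps eps0; have [d d0 P] := continuous_at_dist (@csq t) eps0.
exists d => // y /P; rewrite -!E a0 normr0 !sub0r !normrN normr_id; exact: ltW.
Qed.

(** The derivative of [moment] is [(2 e q + 2 + s f q^2) / q], positive near a collision. *)
Let moment_sign t : q t = 0 -> exists2 d, 0 < d & forall y, y != t -> `|y - t| < d ->
  0 < moment y * (y - t).
Proof.
move=> qt; have [d d0 P] := q_isolated t.
pose k y := 2 * e y * q y + 2 + s * f y * q y ^+ 2.
have ck : continuous k by rewrite /k; cont.
have k0 : 0 < k t by rewrite /k qt expr0n !mulr0 add0r addr0.
have [d' d'0 P'] := continuous_at_dist (@ck t) k0.
exists (Num.min d d'); first by rewrite lt_min d0.
move=> y yt yd.
have [|c [ct cd]] := mvt_punctured (g := fun t => k t / q t) (d := Num.min d d') moment_continuous _ yt yd.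
  move=> c ct; rewrite lt_min => /andP[cd _]; have qc := P c ct cd.
  by apply: (der_eq (moment_der qc)); rewrite /k en //; field.
rewrite {2}/moment qt eqxx subr0 => ->; move: cd; rewrite lt_min => /andP[c1 c2].
have kc : 0 < k c.
  by rewrite distrC in c2; have /ltr_normlP[_] := P' c c2; lra.
rewrite -mulrA mulr_gt0 ?divr_gt0 ?qgt ?P // -expr2 exprn_even_gt0 //=.
by rewrite subr_eq0.
Qed.

(** The square of [b] is [2 e q + 4] throughout, so only the sign is at stake: near a collision
    [w] changes its sign together with the alternator. *)
Let b_continuous : continuous b.
Proof.
have ck : continuous (fun y => Num.sqrt (2 * e y * q y + 4)).
  by apply: (@cont_comp _ Num.sqrt); [exact: sqrt_continuous|cont].
move=> t; have [qt|qt] := eqVneq (q t) 0; last first.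
  apply: (@near_continuous_eq _ (fun y => Num.sg (al t) * (w y * Num.sqrt (q y)))).
    apply: filterS2 (sg_near (@cX t) (al0 qt)) (near_q qt) => y E qy.
    by rewrite /b (negbTE qy) E.
  apply: continuousM; first exact: cst_continuous.
  apply: continuousM; first exact: derivable_continuous (dw qt).
  by apply: (@cont_comp _ Num.sqrt) => //; exact: sqrt_continuous.
have [l l0 dl] := sX ((qX t).1 qt); have [d1 d10 P1] := der_sign dl ((qX t).1 qt) l0.
have [d2 d20 P2] := moment_sign qt; have [d3 d30 P3] := q_isolated t.
apply: (@near_continuous_eq _ (fun y => Num.sg l * Num.sqrt (2 * e y * q y + 4))); last first.
  by apply: continuousM; [exact: cst_continuous|exact: ck].
exists (Num.min d1 (Num.min d2 d3)); first by rewrite /= !lt_min d10 d20.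
move=> y /=; rewrite distrC !lt_min => /and3P[y1 y2 y3].
rewrite -b_sq sqrtr_sqr; have [->|yt] := eqVneq y t.
  rewrite /b qt eqxx (der_derive1 dl) normrM normr_sg l0 mulr1 mulrC.
  by rewrite ger0_norm.
have qy := P3 y yt y3; have p1 := P1 y yt y1; have p2 := P2 y yt y2.
have pw : 0 < w y * (y - t).
  by move: p2; rewrite momentE // -mulrA pmulr_rgt0 // qgt.
have pb : 0 < l * b y.
  rewrite /b (negbTE qy) (_ : l * _ = Num.sqrt (q y) * ((Num.sg (al y) * l) * w y)); last by ring.
  rewrite mulr_gt0 ?sqrtr_gt0 ?qgt //.
  have E : Num.sg (al y) * l = `|l| * Num.sg (y - t).
    have -> : Num.sg (al y) = Num.sg (l * (y - t)) by apply: sg_eq; rewrite mulrA.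
    by rewrite sgrM [X in _ = X * _]normrEsg; ring.
  rewrite E -mulrA mulr_gt0 ?normr_gt0 //.
  have -> : Num.sg (y - t) = Num.sg (w y) by apply: sg_eq; rewrite mulrC.
  by rewrite -normrEsg normr_gt0; apply: contraTneq pw => ->; rewrite mul0r ltxx.
by rewrite {1}[b y]numEsg -(sg_eq pb).
Qed.

Let sqrt_der t : q t != 0 -> der (fun y => Num.sqrt (q y)) t (w t / (2 * Num.sqrt (q t))).
Proof.
move=> qt; have d := der_comp (f := Num.sqrt) (g := q) (is_derive1_sqrt (qgt qt)) (dq qt).
by apply: (der_eq d); rewrite mulrC.
Qed.

Let a_der t : q t != 0 -> der a t (b t / (2 * q t)).
Proof.
move=> qt; have s0 : Num.sqrt (q t) != 0 by rewrite gt_eqF // sqrtr_gt0 qgt.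
apply: (@near_eq_is_derive _ _ _ (fun y => Num.sg (al t) * Num.sqrt (q y))).
  by apply: filterS (sg_near (@cX t) (al0 qt)) => y E; rewrite /a E.
apply: (der_eq (derZ (Num.sg (al t)) (sqrt_der qt))).
rewrite /b (negbTE qt); move: (w t) (Num.sg _) => k g.
have E := sqr_sqrtr (q0 t); move: (Num.sqrt (q t)) s0 E => u u0 <-.
by field.
Qed.

Let b_der t : q t != 0 -> der b t ((e t + s * f t * q t) * a t / q t).
Proof.
move=> qt; have s0 : Num.sqrt (q t) != 0 by rewrite gt_eqF // sqrtr_gt0 qgt.
apply: (@near_eq_is_derive _ _ _ (fun y => Num.sg (al t) * (w y * Num.sqrt (q y)))).
  apply: filterS2 (sg_near (@cX t) (al0 qt)) (near_q qt) => y E qy.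
  by rewrite /b (negbTE qy) E.
apply: (der_eq (derZ (Num.sg (al t)) (derM (dw qt) (sqrt_der qt)))).
rewrite en // /a; move: (w t) (f t) (Num.sg _) => k m g.
have E := sqr_sqrtr (q0 t); move: (Num.sqrt (q t)) s0 E => u u0 <-.
by field.
Qed.

Let e_der t : q t != 0 -> der e t (s * f t * w t).
Proof.
move=> qt; apply: (@near_eq_is_derive _ _ _ (fun y => w y ^+ 2 * 2^-1 - 2 * (q y)^-1)).
  by apply: filterS (near_q qt) => y qy; rewrite en.
apply: (der_eq (derB (derM (der_sq (dw qt)) (der_cst 2^-1 t)) (derZ 2 (der_recip qt (dq qt))))).
by field.
Qed.

(** The function [T = q q' / 2 - int (e + s f q / 2)] satisfies [T' = 1 / q] off the
    collisions: it is the regularized time, obtained without integrating the unbounded function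
    [1 / q]. It is continuous and strictly increasing, and its inverse [th], rescaled to period
    1, has [th' = kappa q (th)]. Then [z] is the square root of [q (th)] with a sign that
    alternates at each collision; the even number of collisions makes it periodic, and the
    transversality of the collisions makes it differentiable. *)
Lemma levi_civita_inverse : exists z v e' : F,
  [/\ H1 z, 0 < nsq z, levi_civita1 z = q & kepler s z v e' f].
Proof.
have [th [cth ith th0 sth dth]] := clock_ex.
have cqt : continuous (fun x => q (th x)) by exact: (cont_comp cq).
have remov (G g : F) : continuous G -> continuous g ->
    (forall x, q (th x) != 0 -> der G x (g x)) -> forall x, der G x (g x).
  move=> cG cg dG x; have [qx|qx] := eqVneq (q (th x)) 0; last exact: dG.
  apply: removable_der => //; first exact: cg.
  have [d d0 P] := q_isolated (th x); have [d' d'0 P'] := continuous_at_dist (@cth x) d0.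
  exists d' => // y /= xy yx; apply/dG/P; first by rewrite (inj_eq ith).
  by rewrite distrC P'.
have dth' : forall x, der th x (kappa * q (th x)) by apply: remov => //; cont.
pose z x := a (th x); pose v x := kappa / 2 * b (th x); pose e' x := e (th x).
have cz : continuous z by exact: (cont_comp a_continuous).
have cv : continuous v.
  by apply: contM; [exact: cont_cst|exact: (cont_comp b_continuous)].
have ce' : continuous e' by exact: (cont_comp ce).
have cft : continuous (fun x => f (th x)) by exact: (cont_comp cf).
have zq x : z x ^+ 2 = q (th x) by exact: a_sq.
have dz : forall x, der z x (v x).
  apply: (remov z v cz cv) => x qx; apply: (der_eq (der_comp (f := a) (g := th) (a_der qx) (dth x qx))).
  by rewrite /v; field.
have dv : forall x, der v x (kappa ^+ 2 / 2 * ((e' x + s * f (th x) * z x ^+ 2) * z x)).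
  apply: (remov v _ cv); first by apply: contM; [exact: cont_cst|apply: contM => //; cont].
  move=> x qx; have := derZ (kappa / 2) (der_comp (f := b) (g := th) (b_der qx) (dth x qx)).
  by move=> d; apply: (der_eq d); rewrite zq /e' /z; field.
have de' : forall x, der e' x (s * f (th x) * (2 * z x * v x)).
  apply: (remov e' _ ce'); first by cont.
  move=> x qx; apply: (der_eq (der_comp (f := e) (g := th) (e_der qx) (dth x qx))).
  rewrite /z /v (_ : 2 * _ * _ = kappa * (a (th x) * b (th x))); last by field.
  by rewrite ab //; ring.
have pz : periodic z 1.
  by move=> x; rewrite /z sth /a pq pX.
have Hz : H1 z by split=> //; exists v; exact: C1_wderiv.
have kN : kappa * nsq z = 1.
  have cz2 : continuous (fun x => kappa * z x ^+ 2) by cont.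
  have dz2 x : 0 < x < 1 -> der th x (kappa * z x ^+ 2) by move=> _; rewrite zq; exact: dth'.
  have := ftc ler01 cz2 cth dz2; rewrite th0 add0r.
  have -> : th 1 = 1 by rewrite -(add0r 1) sth th0.
  by rewrite itgZ ?sqr_itg_nsq //; apply: continuous_L1; cont.
have nz : 0 < nsq z by rewrite -(pmulr_rgt0 _ kappa_gt0) kN.
have kE : kappa = (nsq z)^-1 by rewrite -[LHS](mulfK (lt0r_neq0 nz)) kN mul1r.
have tlE x : tline z x = th x.
  apply/eqP; rewrite -subr_eq0; apply/eqP.
  rewrite (@cst_of_der0R _ (fun x => tline z x - th x) _ x 0); last first.
    move=> y; apply: (der_eq (derB (tline_der y cz) (dth' y))).
    by rewrite -zq kE mulrC subrr.
  by rewrite tline0 th0 subrr.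
exists z, v, e'; split=> //.
- apply: funext => t.
  have [x <-] : exists x, th x = t.
    have k0 : kappa != 0 by rewrite gt_eqF.
    have sh (n : nat) x : th (x + n%:R) = th x + n%:R.
      by elim: n => [|n IH]; rewrite ?addr0 // -natr1 !addrA sth IH.
    have shz (n : int) x : th (x + n%:~R) = th x + n%:~R.
      case: n => n; first by rewrite -pmulrn sh.
      by rewrite NegzE mulrNz -pmulrn; apply/eqP; rewrite -subr_eq opprK -sh subrK.
    have l : (Num.floor t)%:~R <= (Num.floor t)%:~R + 1 :> R by rewrite lerDl.
    have := IVT l (continuous_subspaceT cth) (v := t).
    rewrite sth -[(Num.floor t)%:~R]add0r !shz th0 !add0r min_l // max_r //.
    rewrite ge_floor ltW; first by move=> /(_ isT)[x _ E]; exists x.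
    by have := lt_succ_floor t; rewrite intrD.
  by rewrite -tlE levi_civita_tline // tlE zq.
- split=> //.
  + move=> x; apply: (der_eq (dv x)); rewrite tlE kE; field; rewrite gt_eqF //.
  + by move=> x; rewrite tlE; exact: de'.
  + move=> x; rewrite zq /v /e' exprMn b_sq kE; field; rewrite gt_eqF //.
  + by move=> x; rewrite /e' sth pe.
Qed.
End inverse.

(** * The four regularized orbits over a solution *)

Section realization.
Variable R : realType.
Local Notation F := (R -> R).
Local Notation F2 := (F * F)%type.
Implicit Types (r s t : R).

Lemma even_zeros_pattern (q : F) : periodic q 1 -> even_zeros q -> exists X : seq R,
  [/\ uniq X, forall x, x \in X -> 0 <= x < 1, ~~ odd (size X)
    & forall t, q t = 0 <-> alternator X t = 0].
Proof.
move=> pq [n nE]; have fin : finite_set (zeros q) by exists n.*2.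
have [X XE] := finite_fsetP.1 fin; exists (finmap.enum_fset X).
have X01 x : x \in finmap.enum_fset X -> 0 <= x < 1.
  by move=> xX; have [] : zeros q x by rewrite XE.
split=> //; first exact: finmap.fset_uniq.
  by move: nE; rewrite XE => /card_eq_fsetP ->; rewrite odd_double.
move=> x; have -> : alternator (finmap.enum_fset X) x = 0 <-> fpart x \in finmap.enum_fset X.
  by rewrite -alternator_eq0 //; split => /eqP.
have -> : fpart x \in finmap.enum_fset X <-> zeros q (fpart x) by rewrite XE.
rewrite /zeros /= periodic_fpart // fpart_ge0 fpart_lt1.
by split=> [->|[]].
Qed.

Lemma generalized_kepler s (q f : F) : H1 q -> (forall t, 0 <= q t) -> continuous f -> periodic f 1 ->
  even_zeros q -> C2_on [set t | q t != 0] q -> energy_extends q ->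
  (forall t, q t != 0 -> derive1n 2 q t = - (2 / q t ^+ 2) + s * f t) ->
  exists z v e : F, [/\ H1 z, 0 < nsq z, levi_civita1 z = q & kepler s z v e f].
Proof.
move=> Hq q0 cf pf evq C2 [e [ce pe eE]] ode.
have [X [uX X01 eX qX]] := even_zeros_pattern Hq.1 evq.
apply: (@levi_civita_inverse _ s q (derive1 q) f e X) => //.
- exact: H1_continuous.
- exact: Hq.1.
- by move=> t qt; have [d _ _] := C2 t qt; rewrite derive1E; exact: derivableP.
move=> t qt; have [_ d _] := C2 t qt; rewrite -(ode t qt).
have := derivableP d; rewrite -derive1E; exact.
Qed.

Lemma generalized_regular r (q : F2) : generalized_solution r q ->
  exists Z v e, regular r Z v e /\ levi_civita Z = q.
Proof.
case: q => q1 q2 [[[/= H1q H2q] q0] lt [ev1 ev2] [C1 C2 _ _ [ ode1 ode2]] [en1 en2]].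
have c1 := H1_continuous H1q; have c2 := H1_continuous H2q.
have gap t : (q1 t - q2 t) ^+ 2 != 0 by rewrite sqrf_eq0 gt_eqF // subr_gt0.
pose f := repulsion r (q1, q2).
have cf : continuous f.
  have cg : continuous (fun t => ((q1 t - q2 t) ^+ 2)^-1) by apply: contV => //; cont.
  by apply: contD; [apply: contM => //; exact: cont_cst|exact: cont_cst].
have pf : periodic f 1 by move=> t; have [p1 p2] := (H1q.1, H2q.1); rewrite /f /repulsion /= p1 p2.
have [t qt|z1 [v1 [e1 [Hz1 n1 L1 k1]]]] := @generalized_kepler 1 q1 f H1q (fun t => (q0 t).1) cf pf ev1 C1 en1.
  by rewrite derive1nS derive1n1 ode1 // /f /repulsion mul1r addrA.
have [t qt|z2 [v2 [e2 [Hz2 n2 L2 k2]]]] := @generalized_kepler (-1) q2 f H2q (fun t => (q0 t).2) cf pf ev2 C2 en2.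
  by rewrite derive1nS derive1n1 ode2 // /f /repulsion mulN1r opprD addrA.
have LE : levi_civita (z1, z2) = (q1, q2) by rewrite /levi_civita L1 L2.
exists (z1, z2), (v1, v2), (e1, e2); split=> //; split; rewrite ?LE //=.
have cz1 := H1_continuous Hz1; have cz2 := H1_continuous Hz2.
apply: apart_H1in => //; split=> //= t t01.
rewrite -!qclip_id // -(levi_civita_clip cz1 Hz1.1 n1 t01) -(levi_civita_clip cz2 Hz2.1 n2 t01).
by rewrite L1 L2.
Qed.
End realization.

Section uniqueness.
Variable R : realType.
Local Notation F := (R -> R).
Implicit Types (z v e f : F) (s t x y eps : R).

Section pair.
Variables (s : R) (z v e z' v' e' f : F).
Hypotheses (Hz : H1 z) (nz : 0 < nsq z) (Hz' : H1 z') (nz' : 0 < nsq z').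
Hypotheses (o : kepler s z v e f) (o' : kepler s z' v' e' f).
Hypothesis Lq : levi_civita1 z = levi_civita1 z'.

Let cz : continuous z. Proof. exact: H1_continuous. Qed.
Let cz' : continuous z'. Proof. exact: H1_continuous. Qed.

(** The composition of one time map with the inverse of the other has the constant derivative
    [nsq z' / nsq z] off the isolated zeros of [z], hence everywhere; mapping a period to a
    period it is the identity. *)
Lemma kepler_time : nsq z' = nsq z /\ forall x, tline z' x = tline z x.
Proof.
have [pz pz'] := (Hz.1, Hz'.1); have sep' := orbit_sep o'.
have [K1 K2 cS shS] := tinvP cz' pz' nz' sep'.
have [dz _ _ _ _] := o.
have N0 : nsq z != 0 by rewrite gt_eqF.
have N0' : nsq z' != 0 by rewrite gt_eqF.
pose phi x := tinv z' (tline z x).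
have cT := tline_continuous cz.
have cphi : continuous phi by exact: (cont_comp cS).
have zphi x : z' (phi x) ^+ 2 = z x ^+ 2.
  by rewrite -(levi_civita_tinv cz' pz' nz' sep') -Lq levi_civita_tline.
have dphi0 x : z x != 0 -> der phi x (nsq z' / nsq z).
  move=> zx; have z'x : z' (phi x) != 0 by rewrite -sqrf_eq0 zphi sqrf_eq0.
  have dS := tinv_der cz' pz' nz' sep' z'x.
  apply: (der_eq (der_comp (f := tinv z') (g := tline z) dS (tline_der x cz))).
  by rewrite zphi; field; rewrite zx N0.
have dphi x : der phi x (nsq z' / nsq z).
  have [zx|zx] := eqVneq (z x) 0; last exact: dphi0.
  apply: (@removable_der _ _ (fun=> nsq z' / nsq z)) => //; first exact: cst_continuous.
  have [d d0 P] := der_sign (dz x) zx (orbit_speed o zx).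
  exists d => // y /= xy yx; apply: dphi0; rewrite distrC in xy.
  by have := P y yx xy; apply: contraTneq => ->; rewrite !mul0r ltxx.
have phiE x : phi x = nsq z' / nsq z * x.
  have dD y : der (fun y => phi y - nsq z' / nsq z * y) y 0.
    apply: (der_eq (derB (dphi y) (derZ (nsq z' / nsq z) (is_derive_id y 1)))).
    by rewrite mulr1 subrr.
  apply/eqP; rewrite -subr_eq0; apply/eqP; rewrite (cst_of_der0R dD x 0).
  by rewrite /phi (tline0 z) mulr0 subr0 -{1}(tline0 z') K1.
have E1 : nsq z' / nsq z = 1.
  rewrite -[LHS]mulr1 -phiE /phi -[X in tline z X]add0r (tline_shift cz pz nz) shS.
  by rewrite (tline0 z) -{1}(tline0 z') K1 add0r.
split; first by rewrite -[LHS](divfK N0) E1 mul1r.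
by move=> x; rewrite -{1}[x]mul1r -E1 -phiE K2.
Qed.

Lemma kepler_sq x : z' x ^+ 2 = z x ^+ 2.
Proof.
rewrite -(levi_civita_tline cz Hz.1 nz) -(levi_civita_tline cz' Hz'.1 nz').
by have [_ ->] := kepler_time; rewrite Lq.
Qed.

Lemma kepler_prod x : z' x * v' x = z x * v x.
Proof.
have [dz _ _ _ _] := o; have [dz' _ _ _ _] := o'.
have d : der (fun y => z y ^+ 2) x (2 * z' x * v' x).
  by apply: (der_ext _ (der_sq (dz' x))) => y; rewrite kepler_sq.
have := der_uniq d (der_sq (dz x)); rewrite -!mulrA => /(mulfI _); apply.
by rewrite pnatr_eq0.
Qed.

(** Both energies satisfy the same differential equation, and the constraint at a point with [z
    != 0] identifies the constant. *)
Lemma kepler_energy x : e' x = e x.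
Proof.
have [dz dv de cons _] := o; have [dz' dv' de' cons' _] := o'.
have [NE TE] := kepler_time.
have dD y : der (fun y => e' y - e y) y 0.
  apply: (der_eq (derB (de' y) (de y))); rewrite TE -!mulrA kepler_prod; ring.
have D0 y := cst_of_der0R dD y.
have [c _ zc] := orbit_sep o (@ltr01 R).
have : v' c ^+ 2 = v c ^+ 2.
  apply: (mulfI (_ : z c ^+ 2 != 0)); first by rewrite sqrf_eq0.
  by rewrite -[in LHS]kepler_sq -!exprMn kepler_prod.
move=> vE; have := cons' c; rewrite NE vE cons kepler_sq => /mulfI E.
apply/eqP; rewrite -subr_eq0 (D0 x c); rewrite E ?subrr //.
by rewrite sqrf_eq0.
Qed.

Lemma kepler_speed x : v' x ^+ 2 = v x ^+ 2.
Proof.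
have [_ _ _ cons _] := o; have [_ _ _ cons' _] := o'; have [NE _] := kepler_time.
have := cons' x; rewrite NE kepler_sq kepler_energy -cons => /addIr /mulfI; apply.
by rewrite mulf_neq0 ?pnatr_eq0 // sqrf_eq0 gt_eqF.
Qed.

Lemma kepler_sign_at x : exists2 eps, eps ^+ 2 = 1 & z' x = eps * z x /\ v' x = eps * v x.
Proof.
have sq1 (a b : R) : a ^+ 2 = b ^+ 2 -> b != 0 -> exists2 eps, eps ^+ 2 = 1 & a = eps * b.
  by move=> ab b0; exists (a / b); rewrite ?divfK // expr_div_n ab divff // sqrf_eq0.
have [zx|zx] := eqVneq (z x) 0.
  have [eps e1 ->] := sq1 _ _ (kepler_speed x) (orbit_speed o zx); exists eps => //; split=> //.
  by rewrite zx mulr0; apply/eqP; rewrite -sqrf_eq0 kepler_sq zx expr0n.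
have [eps e1 zE] := sq1 _ _ (kepler_sq x) zx; exists eps => //; split=> //.
have P := kepler_prod x; rewrite zE in P.
by apply: (mulfI zx); rewrite mulrCA -P -[LHS]mul1r -e1; ring.
Qed.

(** At each parameter [(z', v')] is [(z, v)] or its opposite, because the squares and the
    product [z v] agree. The pair never vanishes, so the sign is the sign of the nonvanishing
    continuous function [z' z + v' v]. *)
Lemma kepler_uniq : exists2 eps, eps = 1 \/ eps = -1 &
  z' = (fun x => eps * z x) /\ v' = (fun x => eps * v x).
Proof.
pose d x := z' x * z x + v' x * v x.
have [cv _] := orbit_continuous o; have [cv' _] := orbit_continuous o'.
have cd : continuous d by rewrite /d; cont.
have zv x : 0 < z x ^+ 2 + v x ^+ 2.
  have [zx|zx] := eqVneq (z x) 0.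
    by rewrite zx expr0n add0r exprn_even_gt0 //= (orbit_speed o).
  by rewrite ltr_wpDr ?sqr_ge0 // exprn_even_gt0.
have sgd x : z' x = Num.sg (d x) * z x /\ v' x = Num.sg (d x) * v x.
  have [eps e1 [E1 E2]] := kepler_sign_at x.
  have -> : Num.sg (d x) = eps.
    rewrite /d E1 E2 (_ : _ + _ = eps * (z x ^+ 2 + v x ^+ 2)); last by ring.
    rewrite sgrM (gtr0_sg (zv x)) mulr1.
    by move/eqP: e1; rewrite sqrf_eq1 => /orP[]/eqP ->; rewrite ?sgr1 ?sgrN1.
  by [].
have d0 x : d x != 0.
  apply/eqP => dx; have [] := sgd x; rewrite dx sgr0 !mul0r => z0 v0.
  by have := zv x; rewrite -kepler_sq -kepler_speed z0 v0 expr0n addr0 ltxx.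
have sgE : forall x y, Num.sg (d x) = Num.sg (d y).
  apply: locally_constant => x; have [del /= del0 P] := sg_near (@cd x) (d0 x).
  by exists del => // y; rewrite distrC => /P.
exists (Num.sg (d 0)).
  by have := sqr_sg (d 0); rewrite d0 => /eqP; rewrite sqrf_eq1 => /orP[]/eqP ->; [left|right].
by split; apply: funext => x; rewrite (sgE 0 x); case: (sgd x).
Qed.
End pair.

Lemma kepler_scl s z v e f eps : eps ^+ 2 = 1 ->
  [/\ nsq (scl eps z) = nsq z, tmap (scl eps z) = tmap z,
      levi_civita1 (scl eps z) = levi_civita1 z
    & kepler s z v e f -> kepler s (scl eps z) (scl eps v) e f].
Proof.
move=> e1; have sq (g : F) x : scl eps g x ^+ 2 = g x ^+ 2 by rewrite /scl exprMn e1 mul1r.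
have nE : nsq (scl eps z) = nsq z.
  by rewrite /nsq /ip; congr Rintegral; apply: funext => x; rewrite -!expr2 sq.
have tE : tmap (scl eps z) = tmap z.
  apply: funext => t; rewrite /tmap nE; congr (_ * Rintegral _ _ _).
  by apply: funext => x; rewrite sq.
have lE : tline (scl eps z) = tline z.
  apply: funext => t; rewrite /tline nE; congr (_ * prim _ _).
  by apply: funext => x; rewrite sq.
have LE : levi_civita1 (scl eps z) = levi_civita1 z.
  by apply: funext => t; rewrite /levi_civita1 sq /taumap tE.
split=> // -[dz dv de cons pe]; split=> //.
- by move=> x; exact: derZ.
- by move=> x; apply: (der_eq (derZ eps (dv x))); rewrite nE lE sq /scl; ring.
- move=> x; apply: (der_eq (de x)); rewrite lE /scl.
  rewrite (_ : 2 * (eps * z x) * _ = eps ^+ 2 * (2 * z x * v x)); last by ring.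
  by rewrite e1 mul1r.
- by move=> x; rewrite nE !sq.
Qed.

Lemma continuous_aeeq (f g : F) : continuous f -> continuous g -> periodic f 1 -> periodic g 1 ->
  aeeq f g -> f = g.
Proof.
move=> cf cg pf pg /(aeeq_nsqB (continuous_L2 cf) (continuous_L2 cg)) n0.
apply: funext; apply: periodic_ext => // t t01; apply/eqP; rewrite -subr_eq0.
apply/negPn/negP => ft; have cd : continuous (fun x => (f x - g x) ^+ 2) by cont.
have := itg_gt0 cd _ t01 ltr01; rewrite exprn_even_gt0 //= => /(_ _ ft).
have -> : itg 0 1 (fun x => (f x - g x) ^+ 2) = 0 by rewrite sqr_itg_nsq -n0.
by rewrite ltxx => H; apply: notF; apply: H => x _; exact: sqr_ge0.
Qed.
End uniqueness.

Section count.
Variable R : realType.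
Local Notation F := (R -> R).
Local Notation F2 := (F * F)%type.
Implicit Types (Z v e eta q : F2) (r : R).

Lemma momentum_H1 r Z v e : regular r Z v e -> H1sq (momentum Z v).
Proof.
move=> [hZ o1 o2]; have [[z1 z2] _ _ _] := hZ.
have cf := repulsion_continuous (r := r) hZ.
have H s (z v' e' : F) : H1 z -> kepler s z v' e' (repulsion r (levi_civita Z)) -> H1 v'.
  move=> Hz o; have [dz dv _ _ _] := o; have cz := H1_continuous Hz.
  have [cv ce] := orbit_continuous o; split; first exact: der_periodic Hz.1 dz.
  eexists; apply: (C1_wderiv dv).
  have cfT : continuous (fun x => repulsion r (levi_civita Z) (tline z x)).
    by apply: (cont_comp cf); exact: tline_continuous.
  by cont.
split; [exact: (H1Z (4 * nrm Z.1 ^+ 2) (H _ _ _ _ z1 o1))|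
        exact: (H1Z (4 * nrm Z.2 ^+ 2) (H _ _ _ _ z2 o2))].
Qed.

Lemma momentum_wderiv2 r Z v e : regular r Z v e ->
  aeeq2 (momentum Z v) (momentum Z (wderiv2 Z)).
Proof.
move=> [[[z1 z2] _ _ _] o1 o2]; have [dz1 _ _ _ _] := o1; have [dz2 _ _ _ _] := o2.
have a1 := wderiv_uniq (C1_wderiv dz1 (orbit_continuous o1).1) (H1_wderiv z1).
have a2 := wderiv_uniq (C1_wderiv dz2 (orbit_continuous o2).1) (H1_wderiv z2).
by split; [apply: filterS a1|apply: filterS a2] => x E Dx; rewrite /= /scl E.
Qed.

Lemma regular_hamilton r Z v e : regular r Z v e -> hamilton_solution r (Z, momentum Z v).
Proof.
move=> o; have He := momentum_H1 o; apply/hamilton_critE => //.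
apply/crit_actionE; first exact: H1sq_L2sq.
by split; [exact: regular_crit o|exact: momentum_wderiv2 o].
Qed.

(** The momentum and [4 nsq z z'] agree almost everywhere; both being continuous, they are
    equal. *)
Lemma hamilton_regular r Z eta : hamilton_solution r (Z, eta) ->
  exists v e, regular r Z v e /\ eta = momentum Z v.
Proof.
move=> hs; have [_ He _] := hs; have /hamilton_critE := hs => /(_ He).
move=> /(crit_actionE _ _ (H1sq_L2sq He))[cB ae]; have [v [e o]] := crit_regular cB.
exists v, e; split=> //; have [m1 m2] := momentum_H1 o; have [b1 b2] := momentum_wderiv2 o.
have [a1 a2] := ae; have [h1 h2] := He; rewrite [eta]surjective_pairing.
congr pair; apply: continuous_aeeq.
- exact: H1_continuous h1.
- exact: H1_continuous m1.
- exact: h1.1.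
- exact: m1.1.
- exact: aeeq_trans a1 (aeeq_sym b1).
- exact: H1_continuous h2.
- exact: H1_continuous m2.
- exact: h2.1.
- exact: m2.1.
- exact: aeeq_trans a2 (aeeq_sym b2).
Qed.

Definition scl2 (c d : R) (Z : F2) : F2 := (scl c Z.1, scl d Z.2).

Lemma regular_scl2 r c d Z v e : c ^+ 2 = 1 -> d ^+ 2 = 1 -> regular r Z v e ->
  regular r (scl2 c d Z) (scl2 c d v) e /\ levi_civita (scl2 c d Z) = levi_civita Z.
Proof.
move=> c1 d1 [hZ o1 o2].
have [n1 t1 l1 k1] := kepler_scl 1 Z.1 v.1 e.1 (repulsion r (levi_civita Z)) c1.
have [n2 t2 l2 k2] := kepler_scl (-1) Z.2 v.2 e.2 (repulsion r (levi_civita Z)) d1.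
have LE : levi_civita (scl2 c d Z) = levi_civita Z by rewrite /levi_civita l1 l2.
split=> //; split; rewrite ?LE; [|exact: k1|exact: k2].
have [[z1 z2] g1 g2 g] := hZ; split; rewrite ?nrm_gt0 /= ?n1 ?n2 -?nrm_gt0 //.
  by split; exact: H1Z.
by move=> t t01; have := g t t01; rewrite /gap /= /taumap t1 t2 /scl !exprMn c1 d1 !mul1r.
Qed.

(** The orbits over the same solution differ by a sign for each particle. The four choices are
    different since no [z_i] vanishes identically; they are numbered by two binary digits. *)
Lemma four_orbits r Z v e : regular r Z v e ->
  ([set x | hamilton_solution r x /\ levi_civita x.1 = levi_civita Z] #= `I_4)%card.
Proof.
move=> o; have [hZ o1 o2] := o; have [[z1 z2] _ _ _] := hZ.
have [c1 c2 n1 n2 _] := H1in_apart hZ.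
pose sg (b : bool) : R := (-1) ^+ b.
have sg1 b : sg b ^+ 2 = 1 by rewrite /sg sqrr_sign.
pose Zn (n : nat) := scl2 (sg (odd n)) (sg (1 < n)%N) Z.
pose vn (n : nat) := scl2 (sg (odd n)) (sg (1 < n)%N) v.
rewrite (_ : [set x | _] = (fun n => (Zn n, momentum (Zn n) (vn n))) @` `I_4).
  apply: inj_card_eq => i j; rewrite !in_setE /= => i4 j4 [E1 E2 _ _].
  have [a _ za] := orbit_sep o1 (@ltr01 R); have [b _ zb] := orbit_sep o2 (@ltr01 R).
  have s1 : odd i = odd j.
    apply: (@signr_inj R); apply: (mulIf za); exact: (congr1 (fun g : F => g a) E1).
  have s2 : (1 < i)%N = (1 < j)%N.
    apply: (@signr_inj R); apply: (mulIf zb); exact: (congr1 (fun g : F => g b) E2).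
  by move: i j i4 j4 s1 s2 {E1 E2} => [|[|[|[|i]]]] [|[|[|[|j]]]].
apply/seteqP; split=> x /=; last first.
  move=> [n _ <-] /=; have [on LE] := regular_scl2 (sg1 (odd n)) (sg1 (1 < n)%N) o.
  by split=> //; exact: regular_hamilton on.
case: x => Z' eta' /= [hs LE].
have [v' [e' [reg' etaE]]] := hamilton_regular hs; rewrite {}etaE; have [hZ' o1' o2'] := reg'.
have [[z1' z2'] _ _ _] := hZ'; have [_ _ n1' n2' _] := H1in_apart hZ'.
rewrite LE in o1' o2'; have [E1 E2] : levi_civita1 Z'.1 = levi_civita1 Z.1 /\
  levi_civita1 Z'.2 = levi_civita1 Z.2 by case: LE.
have [eps1 s1 [zE1 vE1]] := kepler_uniq z1 n1 z1' n1' o1 o1' (esym E1).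
have [eps2 s2 [zE2 vE2]] := kepler_uniq z2 n2 z2' n2' o2 o2' (esym E2).
have sgE (c : R) : c = 1 \/ c = -1 -> exists b, c = sg b.
  by case=> ->; [exists false; rewrite /sg expr0|exists true; rewrite /sg expr1].
have [b1 b1E] := sgE _ s1; have [b2 b2E] := sgE _ s2.
pose n : nat := (b1 + b2.*2)%N.
have n4 : (n < 4)%N by rewrite /n; case: (b1); case: (b2).
have nb1 : odd n = b1 by rewrite /n; case: (b1); case: (b2).
have nb2 : (1 < n)%N = b2 by rewrite /n; case: (b1); case: (b2).
have ZE : Zn n = Z' by rewrite /Zn /scl2 nb1 nb2 -b1E -b2E [RHS]surjective_pairing zE1 zE2.
have vE : vn n = v' by rewrite /vn /scl2 nb1 nb2 -b1E -b2E [RHS]surjective_pairing vE1 vE2.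
by exists n => //; rewrite ZE vE.
Qed.
End count.

(** * Hamilton equations and collision orbits *)

Theorem theoremD (R : realType) (r : R) (r0 : 0 <= r) (r1 : r <= 1) :
  (forall z eta : (R -> R) * (R -> R), H1in z -> L2sq eta ->
    [/\ forall w, L2sq w ->
          (is_grad (Lagr r z) w eta <-> aeeq2 w (velocity z eta)),
        Ham r (z, eta) =
          (nrm eta.1 ^+ 2 / (8 * nrm z.1 ^+ 2) - 2 / nrm z.1 ^+ 2)
          + (nrm eta.2 ^+ 2 / (8 * nrm z.2 ^+ 2) - 2 / nrm z.2 ^+ 2)
          - r * Ifun z - (1 - r) * Afun z
      & is_grad (fun eta' => Ham r (z, eta')) eta (velocity z eta)]) /\
  (forall z eta : (R -> R) * (R -> R), H1in z -> L2sq eta ->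
    (crit_action r (z, eta) <->
     exists2 eta', aeeq2 eta eta' & hamilton_solution r (z, eta'))) /\
  [/\ forall z eta, crit_action r (z, eta) -> crit_B r z,
      forall z, crit_B r z -> crit_action r (z, momentum z (wderiv2 z))
    & forall z eta, crit_action r (z, eta) ->
        aeeq2 eta (momentum z (wderiv2 z))] /\
  (forall z eta, hamilton_solution r (z, eta) ->
    generalized_solution r (levi_civita z)) /\
  (forall q, generalized_solution r q ->
    ([set x | hamilton_solution r x /\ levi_civita x.1 = q] #= `I_4)%card).

Proof.
have tr (a b c : (R -> R) * (R -> R)) : aeeq2 a b -> aeeq2 b c -> aeeq2 a c.
  by move=> [h1 h2] [k1 k2]; split; [exact: aeeq_trans h1 k1|exact: aeeq_trans h2 k2].
have sym (a b : (R -> R) * (R -> R)) : aeeq2 a b -> aeeq2 b a.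
  by move=> [h1 h2]; split; exact: aeeq_sym.
have L2eta z eta : crit_action r (z, eta) -> L2sq eta by case=> [[]].
split; [|split; [|split; [split|split]]].
- move=> z eta hz Le; have [_ _ n1 n2 _] := H1in_apart hz; split.
  + by move=> w Lw; exact: Lagr_grad.
  + by rewrite HamE // !nrm_sq.
  + exact: Ham_grad.
- move=> z eta hz Le; split.
    move=> /(crit_actionE _ _ Le)[cB ae]; have [v [e reg]] := crit_regular cB.
    exists (momentum z v); last exact: regular_hamilton reg.
    exact: tr ae (sym _ _ (momentum_wderiv2 reg)).
  move=> [eta' ae hs]; have [_ He' _] := hs.
  have /(hamilton_critE _ _ He')/(crit_actionE _ _ (H1sq_L2sq He'))[cB ae'] := hs.
  by apply/crit_actionE => //; split=> //; exact: tr ae ae'.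
- by move=> z eta c; have /crit_actionE := c => /(_ (L2eta _ _ c))[].
- move=> z cB; have [[hz _ _ _] _] := cB.
  apply/crit_actionE; first exact/L2sq_momentum/L2sq_wderiv.
  by split=> //; split; exact: aeeq_refl.
- by move=> z eta c; have /crit_actionE := c => /(_ (L2eta _ _ c))[].
- by move=> z eta /hamilton_regular[v [e [reg _]]]; exact: regular_generalized reg.
- by move=> q /generalized_regular[Z [v [e [reg <-]]]]; exact: four_orbits reg.
Qed.
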